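(* Assume that $\rho^f$, $\psi^{\rm D}$ and $\psi^{\rm N}$ are bounded and smooth functions. Then both Scheme I and Scheme II preserve the steady state in the following sense: for a given mesh, the numerical solution satisfies $$(c^{1,n}_i,\dots,c^{M,n}_i,\psi^n_i)_{1\le i\le N}\longrightarrow(c^{1,\infty}_i,\dots,c^{M,\infty}_i,\psi^\infty_i)_{1\le i\le N}\qquad\text{as } n\to\infty,$$ where $(c^{1,\infty},\dots,c^{M,\infty},\psi^\infty)$ is the solution on the same mesh of the discrete Poisson--Boltzmann system $$\left\{\begin{aligned}&-\kappa\sum_{\sigma\in\mathcal{E}_i}\tau_\sigma\varepsilon_\sigma D\psi^\infty_{i,\sigma}=\mathrm{m}(V_i)\left(\sum_{\ell=1}^Mz^\ell c^{\ell,\infty}_i+\rho^f_i\right),\quad i=1,\dots,N,\\&\mu^{\ell,\infty}=\log(a_\ell^3c^{\ell,\infty}_i)-\left(\frac{a_\ell}{a_0}\right)^3\log\left(1-\sum_{k=1}^Ma_k^3c^{k,\infty}_i\right)+z^\ell\psi^\infty_i+\frac{\chi(z^\ell)^2}{a_\ell}\left(\frac1{\varepsilon_i}-1\right),\quad i=1,\dots,N,\ \ell=1,\dots,M,\\&\sum_{i=1}^N\mathrm{m}(V_i)c^{\ell,\infty}_i=\sum_{i=1}^N\mathrm{m}(V_i)c^{\ell,0}_i,\quad\ell=1,\dots,M,\end{aligned}\right.$$ in which each $\mu^{\ell,\infty}$ is a constant independent of $i$ (determined together with the solution).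
   Context: Mesh: $\Omega\subset\mathbb{R}^d$ ($d=2,3$) is a bounded polygonal/polyhedral domain, $\partial\Omega=\Gamma_{\rm D}\cup\Gamma_{\rm N}$ (disjoint union). $\mathbf{x}_1,\dots,\mathbf{x}_N$ are the vertices of a Delaunay mesh (triangles/tetrahedra), and $V_i=\{\mathbf{y}\in\Omega: |\mathbf{x}_i-\mathbf{y}|<|\mathbf{x}_j-\mathbf{y}|\ \forall j\ne i\}$ are the dual Voronoi control volumes. $\mathrm{m}(\cdot)$ is Lebesgue measure in $\mathbb{R}^d$ or $\mathbb{R}^{d-1}$. Edges (faces): interior ones $\mathcal{E}_{int}$ are $\sigma=\partial V_i\cap\partial V_j$; exterior ones are $\mathcal{E}^{\rm D}_{ext}$ ($\sigma=\partial V_i\cap\Gamma_{\rm D}$), assumed nonempty so that the discrete Poisson matrix is symmetric positive definite, and $\mathcal{E}^{\rm N}_{ext}$ ($\sigma=\partial V_i\cap\Gamma_{\rm N}$). $\mathcal{E}_i$ is the set of edges of $V_i$. $d_\sigma=|\mathbf{x}_i-\mathbf{x}_j|$ for $\sigma=\partial V_i\cap\partial V_j$ interior, $d_\sigma=\mathrm{dist}(\mathbf{x}_i,\sigma)$ for $\sigma\in\mathcal{E}_i$ exterior, and there is $\xi>0$ with $\mathrm{dist}(\mathbf{x}_i,\sigma)\ge\xi\,\mathrm{diam}(V_i)$ for all $\sigma\in\mathcal{E}_i$. $\tau_\sigma=\mathrm{m}(\sigma)/d_\sigma$. For interior $\sigma=\partial V_i\cap\partial V_j$, $Du_{i,\sigma}=u_j-u_i$.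 Parameters: real valences $z^\ell$, sizes $a_\ell>0$ ($\ell=1,\dots,M$), solvent size $a_0>0$, $\kappa,\chi,\gamma_\ell>0$, dielectric values $\varepsilon_i,\varepsilon_\sigma\in[\varepsilon_{\min},\varepsilon_{\max}]$ with $\varepsilon_{\min}>0$, time step $\Delta t>0$. The fixed charge is $\rho^f:\Omega\to\mathbb{R}$ (time independent) with cell averages $\rho^f_i=\frac1{\mathrm{m}(V_i)}\int_{V_i}\rho^f$. Write $S^n_i=1-\sum_{k=1}^M a_k^3c^{k,n}_i$ and $c^{0,n}_i=a_0^{-3}S^n_i$ (solvent concentration). Boundary data (time independent): functions $\psi^{\rm D}$ on $\Gamma_{\rm D}$ and $\psi^{\rm N}$ on $\Gamma_{\rm N}$ with edge values $\psi^{\rm D}_\sigma=\frac1{\mathrm{m}(\sigma)}\int_\sigma\psi^{\rm D}$ and $\psi^{\rm N}_\sigma$; $D\psi_{i,\sigma}=\psi^{\rm D}_\sigma-\psi_i$ for $\sigma\in\mathcal{E}_i\cap\mathcal{E}^{\rm D}_{ext}$, and $\kappa\varepsilon_\sigma D\psi_{i,\sigma}/d_\sigma=\psi^{\rm N}_\sigma$ for $\sigma\in\mathcal{E}_i\cap\mathcal{E}^{\rm N}_{ext}$ (also for $\psi=\psi^\infty$). Zero-flux condition: on every exterior edge, the product (mobility)$\times D\mu^\ell_{i,\sigma}$ appearing in the schemes is $0$. Nodal chemical potential: $\mu^{\ell,n}_i=z^\ell\psi^n_i+\log(a_\ell^3c^{\ell,n}_i)-\frac{a_\ell^3}{a_0^3}\log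 S^n_i+\frac{\chi(z^\ell)^2}{a_\ell}\left(\frac1{\varepsilon_i}-1\right)$. Discrete Poisson equation: $-\kappa\sum_{\sigma\in\mathcal{E}_i}\tau_\sigma\varepsilon_\sigma D\psi^{n}_{i,\sigma}=\mathrm{m}(V_i)\left(\sum_{\ell=1}^M z^\ell c^{\ell,n}_i+\rho^f_i\right)$ for all $i$; it holds at every step $n\ge0$. Scheme I: discrete Poisson equation at step $n+1$ together with $$\mathrm{m}(V_i)\frac{c^{\ell,n+1}_i-c^{\ell,n}_i}{\Delta t}=\gamma_\ell\sum_{\sigma\in\mathcal{E}_i}\tau_\sigma\tilde c^{\ell,n}_\sigma D\mu^{\ell,n+1}_{i,\sigma},\quad \ell=1,\dots,M,\ i=1,\dots,N,$$ with $\mu^{\ell,n+1}_i$ the nodal chemical potential at step $n+1$. The mobility is $\tilde c^{\ell,n}_\sigma=c^{\ell,n}_{i\to j}$ if $D\mu^{\ell,n}_{i,\sigma}<0$ and $c^{\ell,n}_{j\to i}$ if $D\mu^{\ell,n}_{i,\sigma}\ge0$. Scheme II: discrete Poisson equation at step $n+1$ together with $$\mathrm{m}(V_i)\frac{c^{\ell,n+1}_i-c^{\ell,n}_i}{\Delta t}=\gamma_\ell\sum_{\sigma\in\mathcal{E}_i}\tau_\sigma\check c^{\ell,n+\frac12}_\sigma D\mu^{\ell,n+\frac12}_{i,\sigma},$$ $$\mu^{\ell,n+\frac12}_i=\mu^{\ell,n+\frac12}_{e1,i}+\mu^{\ell,n+\frac12}_{e2,i}+\frac{z^\ell}{2}(\psi^n_i+\psi^{n+1}_i)+\frac{\chi(z^\ell)^2}{a_\ell}\left(\frac1{\varepsilon_i}-1\right),$$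 $$\mu^{\ell,n+\frac12}_{e1,i}=\log(a_\ell^3c^{\ell,n+1}_i)-\frac{c^{\ell,n+1}_i-c^{\ell,n}_i}{2c^{\ell,n+1}_i}-\frac{(c^{\ell,n+1}_i-c^{\ell,n}_i)^2}{6(c^{\ell,n+1}_i)^2},$$ $$\mu^{\ell,n+\frac12}_{e2,i}=-\frac{a_\ell^3}{a_0^3}\log S^{n+1}_i-\frac{a_\ell^3\sum_{k=1}^M a_k^3(c^{k,n+1}_i-c^{k,n}_i)}{2a_0^3S^{n+1}_i}+\frac{a_\ell^3\left[\sum_{k=1}^M a_k^3(c^{k,n+1}_i-c^{k,n}_i)\right]^2}{6a_0^3(S^{n+1}_i)^2}.$$ The mobility is $\check c^{\ell,n+\frac12}_\sigma=\hat c^{\ell,n+\frac12}_{i\to j}$ if $D\mu^{\ell,n}_{i,\sigma}<0$ and $\hat c^{\ell,n+\frac12}_{j\to i}$ if $D\mu^{\ell,n}_{i,\sigma}\ge0$, where $\hat c^{\ell,n+\frac12}_i=\frac12(3c^{\ell,n}_i-c^{\ell,n-1}_i)$ if $3c^{\ell,n}_i>c^{\ell,n-1}_i$ and $\hat c^{\ell,n+\frac12}_i=(c^{\ell,n}_i)^{3/2}/(c^{\ell,n-1}_i)^{1/2}$ otherwise; at $n=0$ an arbitrary real array $c^{\ell,-1}_i$ is prescribed for this extrapolation. The initial concentrations (cell averages of the initial data) satisfy $c^{\ell,0}_i>0$ for all $i$ and $\ell=0,1,\dots,M$, and the numerical solution of a scheme is the solution with $c^{\ell,n}_i>0$ for all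 $n\ge0$, all $i$ and $\ell=0,\dots,M$. For each interior edge $\sigma=\partial V_i\cap\partial V_j$ the mobility is a single number attached to $\sigma$ (a fixed ordering $(i,j)$ of the two volumes is used in its definition). Multislope reconstruction $u\mapsto u_{i\to j}$ (used for $u=c^{\ell,n}$ or $u=\hat c^{\ell,n+\frac12}$): choose the neighbour $\mathbf{x}_{k_1}$ of $\mathbf{x}_i$ (vertex whose Voronoi cell touches $V_i$) maximizing the cosine of the angle between $\overrightarrow{\mathbf{x}_q\mathbf{x}_i}$ and $\overrightarrow{\mathbf{x}_i\mathbf{x}_j}$ over neighbours $\mathbf{x}_q$; for $r=0,1,2,\dots$ let $\mathbf{x}^{\rm ext}_{ij}=\frac{(2^r+1)\mathbf{x}_i-\mathbf{x}_j}{2^r}$ and take the first $r$ for which it lies in a Delaunay triangle (tetrahedron) having $\mathbf{x}_{k_1}\mathbf{x}_i$ as an edge; let $u^{\rm ext}_{ij}$ be the interpolated value there from the vertex values. Put $s^+_{ij}=\frac{u_j-u_i}{|\mathbf{x}_i\mathbf{x}_j|}$, $s^-_{ij}=\frac{u_i-u^{\rm ext}_{ij}}{|\mathbf{x}_i\mathbf{x}^{\rm ext}_{ij}|}$ and $u_{i\to j}=u_i+\frac{|\mathbf{x}_i\mathbf{x}_j|}2\,\mathrm{minmod}\left(\beta s^+_{ij},\beta s^-_{ij},\frac{s^+_{ij}+s^-_{ij}}2\right)$ with fixed $\beta\in[1,2]$; $\mathrm{minmod}(q_1,q_2,q_3)=k\min_r|q_r|$ if all $q_r$ have the same sign $k$,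 and $0$ otherwise. $u_{j\to i}$ is defined by exchanging $i$ and $j$. *)

(* Defs.v *)
From HB Require Import structures.
From mathcomp Require Import all_boot all_order all_algebra.
From mathcomp Require Import all_classical all_reals all_analysis.

Set Implicit Arguments.
Unset Strict Implicit.
Unset Printing Implicit Defensive.

Import Order.TTheory GRing.Theory Num.Theory.
Import numFieldNormedType.Exports.

Local Open Scope classical_set_scope.
Local Open Scope ring_scope.

(** * Euclidean geometry and measures in R^d *)

Section Euclidean.
Variables (R : realType) (d : nat).
Local Notation E := 'rV[R]_d.

(* The library norm on row vectors is the sup norm; it induces the usual
   topology, but lengths and angles need the Euclidean structure. *)
Definition eudot (u v : E) : R := \sum_(k < d) u 0 k * v 0 k.
Definition eunorm (u : E) : R := Num.sqrt (eudot u u).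
Definition eudist (u v : E) : R := eunorm (u - v).
Definition eucos (u v : E) : R := eudot u v / (eunorm u * eunorm v).

Definition boundary (A : set E) : set E := closure A `\` interior A.

Definition eudiam (A : set E) : R :=
  sup [set eudist p.1 p.2 | p in A `*` A].

Definition eudist_set (y : E) (A : set E) : R := inf [set eudist y u | u in A].

(* m(.) in R^d for d = 2, 3: the library's product Lebesgue measures,
   transported to row vectors. *)
Definition row2 (p : R * R) : E := \row_(k < d) nth 0 [:: p.1; p.2] k.
Definition row3 (p : R * R * R) : E :=
  \row_(k < d) nth 0 [:: p.1.1; p.1.2; p.2] k.

Definition leb2 : set (measurableTypeR R * measurableTypeR R) -> \bar R :=
  (@lebesgue_measure R \x @lebesgue_measure R)%E.
Definition leb3 :
    set (measurableTypeR R * measurableTypeR R * measurableTypeR R) -> \bar R :=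
  ((@lebesgue_measure R \x @lebesgue_measure R) \x @lebesgue_measure R)%E.

Definition vol (A : set E) : R :=
  fine (if d == 2 then leb2 (row2 @^-1` A) else leb3 (row3 @^-1` A)).

Definition vol_integral (A : set E) (f : E -> R) : R :=
  fine (if d == 2 then (\int[leb2]_(p in row2 @^-1` A) (f (row2 p))%:E)%E
        else (\int[leb3]_(p in row3 @^-1` A) (f (row3 p))%:E)%E).

Definition vol_avg (A : set E) (f : E -> R) : R :=
  vol_integral A f / vol A.

(* m(.) in R^{d-1} on subsets of boundaries: the (d-1)-dimensional Hausdorff
   measure, which on a flat piece is its (d-1)-dimensional Lebesgue measure.
   [hausdorff_const k] is the volume of the k-ball of diameter 1 for k = 1, 2,
   the only values of d - 1 that occur. *)
Definition hausdorff_const (k : nat) : R := if k == 2 then pi / 4 else 1.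

Definition hausdorff_pre (k : nat) (delta : R) (A : set E) : \bar R :=
  ereal_inf [set (\sum_(j <oo) (hausdorff_const k * eudiam (B j) ^+ k)%:E)%E
    | B in [set B : nat -> set E | A `<=` \bigcup_j B j /\
             forall j y y', B j y -> B j y' -> eudist y y' <= delta]].

Definition hausdorff (k : nat) (A : set E) : \bar R :=
  ereal_sup [set hausdorff_pre k delta A | delta in [set delta : R | 0 < delta]].

Definition borelE := g_sigma_algebraType (@open E).

Definition surf_measure : set borelE -> \bar R := hausdorff d.-1.

Definition area (A : set E) : R := fine (surf_measure A).

Definition surf_avg (A : set E) (f : E -> R) : R :=
  fine (\int[surf_measure]_(y in A) (f y)%:E)%E / area A.

(** * Smooth data *)

Definition iter_partial (s : seq 'I_d) (f : E -> R) : E -> R :=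
  foldr (fun k (g : E -> R) => (fun y => 'D_(delta_mx 0 k) g y)) f s.

Definition smooth_on (U : set E) (f : E -> R) : Prop :=
  forall (s : seq 'I_d) (y : E), U y -> differentiable (iter_partial s f) y.

Definition smooth_on_subset (A : set E) (f : E -> R) : Prop :=
  exists (W : set E) (g : E -> R),
    [/\ open W, A `<=` W, smooth_on W g & forall y, A y -> g y = f y].

Definition bounded_on (A : set E) (f : E -> R) : Prop :=
  exists B : R, forall y, A y -> `|f y| <= B.

(** * Polygonal and polyhedral domains *)

Definition simplex_hull (p : 'I_d.+1 -> E) : set E :=
  [set y | exists w : 'I_d.+1 -> R,
    [/\ forall k, 0 <= w k, \sum_k w k = 1 & y = \sum_k w k *: p k]].

(* Interior of a finite union of closed triangles (tetrahedra); in particular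
   open and bounded, and without slits. *)
Definition polytopal_domain (Om : set E) : Prop :=
  [/\ Om !=set0, connected Om &
      exists (n : nat) (p : 'I_n -> 'I_d.+1 -> E),
        Om = interior (\bigcup_k simplex_hull (p k))].

End Euclidean.

(** * Meshes *)

Record mesh (R : realType) (d N : nat) := Mesh {
  Omega : set 'rV[R]_d ;
  GammaD : set 'rV[R]_d ;
  GammaN : set 'rV[R]_d ;
  vtx : 'I_N -> 'rV[R]_d ;
  (* a triangle (tetrahedron) is the set of the indices of its vertices *)
  simplices : {set {set 'I_N}}
}.

Section Mesh.
Variables (R : realType) (d N : nat) (G : mesh R d N).
Local Notation E := 'rV[R]_d.
Local Notation x := (vtx G).

Definition barycentric (t : {set 'I_N}) (w : 'I_N -> R) (y : E) : Prop :=
  [/\ forall q, 0 <= w q, forall q, q \notin t -> w q = 0,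
      \sum_q w q = 1 & y = \sum_q w q *: x q].

Definition hull (t : {set 'I_N}) : set E := [set y | exists w, barycentric t w y].

Definition affinely_independent (t : {set 'I_N}) : Prop :=
  forall w : 'I_N -> R, (forall q, q \notin t -> w q = 0) ->
    \sum_q w q = 0 -> \sum_q w q *: x q = 0 -> forall q, w q = 0.

(* The simplices are not required to fill Omega: if they did, some vertices
   would lie on the boundary of Omega, hence on exterior edges of their own
   cells, against [shape_regular]. *)
Definition delaunay_mesh : Prop :=
  [/\ forall t, t \in simplices G -> #|t| = d.+1 /\ affinely_independent t,
      forall t t', t \in simplices G -> t' \in simplices G ->
        hull t `&` hull t' = hull (t :&: t'),
      forall i, exists2 t, t \in simplices G & i \in t &
      forall t, t \in simplices G -> exists (o : E) (r : R),
        (forall q, q \in t -> eudist o (x q) = r) /\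
        (forall q, r <= eudist o (x q))].

Definition voronoi (i : 'I_N) : set E :=
  [set y | Omega G y /\ forall j, j != i -> eudist (x i) y < eudist (x j) y].

Definition sigmaI (i j : 'I_N) : set E :=
  boundary (voronoi i) `&` boundary (voronoi j).
Definition sigmaD (i : 'I_N) : set E := boundary (voronoi i) `&` GammaD G.
Definition sigmaN (i : 'I_N) : set E := boundary (voronoi i) `&` GammaN G.

Definition mV (i : 'I_N) : R := vol (voronoi i).

Definition dD (i : 'I_N) : R := eudist_set (x i) (sigmaD i).
Definition dN (i : 'I_N) : R := eudist_set (x i) (sigmaN i).

(* An edge is a set [sigma] of positive (d-1)-measure. Coefficients are defined
   for all indices and vanish where there is no edge, so that a sum over the
   edges of a cell can be written as a sum over all indices. *)
Definition tauI (i j : 'I_N) : R := area (sigmaI i j) / eudist (x i) (x j).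
Definition tauD (i : 'I_N) : R := area (sigmaD i) / dD i.
Definition tauN (i : 'I_N) : R := area (sigmaN i) / dN i.

Definition shape_regular (xi : R) : Prop :=
  forall (i : 'I_N) (sg : set E),
    (exists2 j, j != i & sg = sigmaI i j) \/ sg = sigmaD i \/ sg = sigmaN i ->
    0 < area sg -> xi * eudiam (voronoi i) <= eudist_set (x i) sg.

Definition admissible_mesh : Prop :=
  [/\ polytopal_domain (Omega G),
      boundary (Omega G) = GammaD G `|` GammaN G /\
        GammaD G `&` GammaN G = set0,
      injective x /\ (forall i, closure (Omega G) (x i)),
      delaunay_mesh &
      (exists2 xi : R, 0 < xi & shape_regular xi) /\
        (exists i, 0 < area (sigmaD i))].

(** ** Multislope reconstruction *)

Definition touching (i q : 'I_N) : Prop :=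
  q != i /\ closure (voronoi q) `&` closure (voronoi i) !=set0.

Definition opposite_neighbour (i j k : 'I_N) : Prop :=
  touching i k /\ forall q, touching i q ->
    eucos (x i - x q) (x j - x i) <= eucos (x i - x k) (x j - x i).

Definition xext (i j : 'I_N) (r : nat) : E :=
  (2 ^+ r)^-1 *: ((2 ^+ r + 1) *: x i - x j).

Definition minmod (p q r : R) : R :=
  if (Num.sg p == Num.sg q) && (Num.sg q == Num.sg r)
  then Num.sg p * Num.min `|p| (Num.min `|q| `|r|) else 0.

(* Free choices in the reconstruction and in the schemes:
   - [kopp i j] is the chosen neighbour x_{k_1} for the pair (i, j);
   - [fallback u i j] stands for s^-_{ij} when no x^ext_{ij} lies in a suitable
     simplex, which always happens when x_i is an extreme point of the
     triangulated region;
   - [oriented i j] means that the edge {i, j} is ordered as (i, j). *)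
Record recon := Recon {
  beta : R ;
  kopp : 'I_N -> 'I_N -> 'I_N ;
  fallback : ('I_N -> R) -> 'I_N -> 'I_N -> R ;
  oriented : 'I_N -> 'I_N -> bool
}.

Definition admissible_recon (K : recon) : Prop :=
  [/\ 1 <= beta K <= 2,
      forall i j, touching i j -> opposite_neighbour i j (kopp K i j) &
      forall i j, i != j -> oriented K i j = ~~ oriented K j i].

Section Recon.
Variable K : recon.

Definition ext_value (u : 'I_N -> R) (i j : 'I_N) (r : nat) (v : R) : Prop :=
  exists t w, [/\ t \in simplices G, i \in t, kopp K i j \in t,
                  barycentric t w (xext i j r) & v = \sum_q w q * u q].

Definition sminus_set (u : 'I_N -> R) (i j : 'I_N) : set R :=
  [set s | exists r v,
    [/\ ext_value u i j r v,
        forall r' v', (r' < r)%N -> ~ ext_value u i j r' v' &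
        s = (u i - v) / eudist (x i) (xext i j r)]].

Definition sminus (u : 'I_N -> R) (i j : 'I_N) : R :=
  xget (fallback K u i j) (sminus_set u i j).

Definition splus (u : 'I_N -> R) (i j : 'I_N) : R :=
  (u j - u i) / eudist (x i) (x j).

Definition reconstruct (u : 'I_N -> R) (i j : 'I_N) : R :=
  u i + eudist (x i) (x j) / 2 *
    minmod (beta K * splus u i j) (beta K * sminus u i j)
           ((splus u i j + sminus u i j) / 2).

Definition mobility_ord (u mu : 'I_N -> R) (i j : 'I_N) : R :=
  if mu j - mu i < 0 then reconstruct u i j else reconstruct u j i.

Definition mobility (u mu : 'I_N -> R) (i j : 'I_N) : R :=
  if oriented K i j then mobility_ord u mu i j else mobility_ord u mu j i.

End Recon.

End Mesh.

(** * Model data and schemes *)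

(* 'I_M indexes the ions; the solvent is not among them: [solsize] is its size
   and its concentration is [(solsize P ^+ 3)^-1 * solvent c i] below. *)
Record model (R : realType) (d N M : nat) := Model {
  valence : 'I_M -> R ;
  ionsize : 'I_M -> R ;
  solsize : R ;
  gamma : 'I_M -> R ;
  kappa : R ;
  chi : R ;
  eps : 'I_N -> R ;
  epsI : 'I_N -> 'I_N -> R ;
  epsD : 'I_N -> R ;
  epsN : 'I_N -> R ;
  dt : R ;
  rhof : 'rV[R]_d -> R ;
  psiD : 'rV[R]_d -> R ;
  psiN : 'rV[R]_d -> R
}.

Section Schemes.
Variables (R : realType) (d N M : nat).
Variables (G : mesh R d N) (P : model R d N M) (K : recon R N).

Local Notation conc := ('I_M -> 'I_N -> R).
Local Notation pot := ('I_N -> R).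

Definition admissible_model : Prop :=
  [/\ [/\ forall l, 0 < ionsize P l, 0 < solsize P, forall l, 0 < gamma P l,
          0 < kappa P & 0 < chi P],
      0 < dt P,
      (exists emin emax : R, 0 < emin /\
        [/\ forall i, emin <= eps P i <= emax,
            forall i j, emin <= epsI P i j <= emax,
            forall i, emin <= epsD P i <= emax &
            forall i, emin <= epsN P i <= emax]) &
      forall i j, epsI P i j = epsI P j i].

Definition smooth_bounded_data : Prop :=
  [/\ smooth_on (Omega G) (rhof P) /\ bounded_on (Omega G) (rhof P),
      smooth_on_subset (GammaD G) (psiD P) /\ bounded_on (GammaD G) (psiD P) &
      smooth_on_subset (GammaN G) (psiN P) /\ bounded_on (GammaN G) (psiN P)].

Definition solvent (c : conc) (i : 'I_N) : R :=
  1 - \sum_(k < M) ionsize P k ^+ 3 * c k i.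

Definition positive_conc (c : conc) : Prop :=
  (forall l i, 0 < c l i) /\ (forall i, 0 < (solsize P ^+ 3)^-1 * solvent c i).

Definition born (l : 'I_M) (i : 'I_N) : R :=
  chi P * valence P l ^+ 2 / ionsize P l * ((eps P i)^-1 - 1).

Definition chem_pot (c : conc) (psi : pot) (l : 'I_M) (i : 'I_N) : R :=
  valence P l * psi i + ln (ionsize P l ^+ 3 * c l i)
  - ionsize P l ^+ 3 / solsize P ^+ 3 * ln (solvent c i) + born l i.

Definition DpsiD (psi : pot) (i : 'I_N) : R :=
  surf_avg (sigmaD G i) (psiD P) - psi i.

(* from kappa * eps_sigma * Dpsi / d_sigma = psi^N_sigma *)
Definition DpsiN (i : 'I_N) : R :=
  surf_avg (sigmaN G i) (psiN P) * dN G i / (kappa P * epsN P i).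

Definition poisson (c : conc) (psi : pot) : Prop :=
  forall i,
    - kappa P * (\sum_(j | j != i) tauI G i j * epsI P i j * (psi j - psi i)
                 + tauD G i * epsD P i * DpsiD psi i
                 + tauN G i * epsN P i * DpsiN i)
    = mV G i * (\sum_(l < M) valence P l * c l i + vol_avg (voronoi G i) (rhof P)).

(* The zero-flux condition removes the exterior edges from the sum. *)
Definition transport_step (l : 'I_M) (cl cl' mob_u mob_mu mu : pot) : Prop :=
  forall i, mV G i * ((cl' i - cl i) / dt P) =
    gamma P l * \sum_(j | j != i)
      tauI G i j * mobility G K mob_u mob_mu i j * (mu j - mu i).

Definition schemeI (c : nat -> conc) (psi : nat -> pot) : Prop :=
  forall n l, transport_step l (c n l) (c n.+1 l)
    (c n l) (chem_pot (c n) (psi n) l) (chem_pot (c n.+1) (psi n.+1) l).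

Definition mu_e1 (c c' : conc) (l : 'I_M) (i : 'I_N) : R :=
  ln (ionsize P l ^+ 3 * c' l i) - (c' l i - c l i) / (2 * c' l i)
  - (c' l i - c l i) ^+ 2 / (6 * c' l i ^+ 2).

Definition mu_e2 (c c' : conc) (l : 'I_M) (i : 'I_N) : R :=
  let D := \sum_(k < M) ionsize P k ^+ 3 * (c' k i - c k i) in
  - (ionsize P l ^+ 3 / solsize P ^+ 3) * ln (solvent c' i)
  - ionsize P l ^+ 3 * D / (2 * solsize P ^+ 3 * solvent c' i)
  + ionsize P l ^+ 3 * D ^+ 2 / (6 * solsize P ^+ 3 * solvent c' i ^+ 2).

Definition mu_half (c c' : conc) (psi psi' : pot) (l : 'I_M) (i : 'I_N) : R :=
  mu_e1 c c' l i + mu_e2 c c' l i + valence P l / 2 * (psi i + psi' i) + born l i.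

Definition c_hat (cprev c : conc) (l : 'I_M) (i : 'I_N) : R :=
  if 3 * c l i > cprev l i then (3 * c l i - cprev l i) / 2
  else c l i `^ (3 / 2) / cprev l i `^ (1 / 2).

(* [cm1] is the array prescribed at step -1 *)
Definition prev_conc (cm1 : conc) (c : nat -> conc) (n : nat) : conc :=
  if n is n'.+1 then c n' else cm1.

Definition schemeII (cm1 : conc) (c : nat -> conc) (psi : nat -> pot) : Prop :=
  forall n l, transport_step l (c n l) (c n.+1 l)
    (c_hat (prev_conc cm1 c n) (c n) l) (chem_pot (c n) (psi n) l)
    (mu_half (c n) (c n.+1) (psi n) (psi n.+1) l).

Definition solutionI (c : nat -> conc) (psi : nat -> pot) : Prop :=
  [/\ forall n, positive_conc (c n), forall n, poisson (c n) (psi n)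
    & schemeI c psi].

Definition solutionII (cm1 : conc) (c : nat -> conc) (psi : nat -> pot) : Prop :=
  [/\ forall n, positive_conc (c n), forall n, poisson (c n) (psi n)
    & schemeII cm1 c psi].

Definition poisson_boltzmann (c0 : conc) (s : conc * pot) : Prop :=
  [/\ positive_conc s.1,
      poisson s.1 s.2,
      exists mu_inf : 'I_M -> R, forall l i, mu_inf l = chem_pot s.1 s.2 l i &
      forall l, \sum_i mV G i * s.1 l i = \sum_i mV G i * c0 l i].

Definition converges_to_steady_state (c : nat -> conc) (psi : nat -> pot) :
    Prop :=
  exists s : conc * pot,
    [/\ unique (poisson_boltzmann (c 0%N)) s,
        forall l i, c n l i @[n --> \oo] --> s.1 l i &
        forall i, psi n i @[n --> \oo] --> s.2 i].

End Schemes.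

(* Main.v *)
Require Import Defs.
From HB Require Import structures.
From mathcomp Require Import all_boot all_order all_algebra.
From mathcomp Require Import all_classical all_reals all_analysis.
From mathcomp Require Import ring lra zify.

(** Both schemes are implicit discretizations of a gradient flow.  Let C_o be
    the concentrations of the ions and of the solvent.  The free energy, the
    sum over the cells and the species of m(V_i) (C_o ln C_o - C_o) plus a
    linear term plus half of the electric energy, decreases at every step by
    at least the dissipation, a sum of (mobility) * (difference of chemical
    potentials)^2 over the edges, plus an entropy produced by the time step
    ([energy_step]).  It is bounded below, so the decrements are summable.
    Two difficulties remain.  Compactness only gives limit points, and a
    limit point might lack a species in some cell: a mobility is bounded
    below by the smaller of the two nodal values only, so it may tend to 0,
    and then the dissipation controls nothing.

    Convergence of the concentrations.  The amounts form a trajectory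
    x_(n+1) = x_n + sum_e J_e r_e in which the flux J_e times the driving
    force of the channel e is at most the energy decrement, and the driving
    force is a slowly varying term plus a combination of ln x_z.  For such
    trajectories a component cannot change its logarithm by a fixed amount
    unless the energy decreases by a fixed fraction of that component
    ([all_sets]).  The proof is an induction on the set of components.
    Components of comparable size form a cluster.  If the energy spent is
    small compared with the cluster, its displacements stay close to one of
    finitely many linear subspaces on which the driving force almost
    vanishes, that is, on which ln x almost takes prescribed values; since
    ln is strictly monotone, the cluster can hardly move along any of them,
    and a colouring argument bounds its total motion ([rigid_path],
    [cluster_rigid]).  Much smaller components are handled by the induction
    hypothesis, with the logarithms of the cluster frozen.  The electric
    potential enters as a Lipschitz monotone perturbation of the logarithms.
    As the energy is finite, all amounts converge ([run_cvg], [C_cvg]).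

    Positivity of the limit.  Suppose that a species stays in the cell p and
    disappears in the neighbouring cell o, while the solvent stays in o.  The
    potential difference between p and o tends to infinity, so the nodal
    value at o that enters the mobility is eventually much smaller than the
    new concentration in o; by the way that value is built from the past,
    the concentration in o then drops at least by a factor 2/5 at each step.
    But the set of cells to which the content of o can spread loses mass at
    most by a factor 2/3 per step, up to constants: a contradiction
    ([no_depletion]).  If the solvent disappears in p but not in o, the same
    potential difference appears.  Since the cells are connected by edges of
    positive measure, everything is positive in the limit
    ([Cinf_positive]).

    Identification.  Now the mobilities are bounded below, so the differences
    of potentials tend to 0 and the limit solves the Poisson-Boltzmann
    system.  Two solutions with the same total amounts coincide, because ln
    is strictly monotone and the discrete Poisson operator is positive
    definite ([equilibrium_unique]).

    Geometry.  The Voronoi cells have positive finite volume, and the graph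
    of edges of positive (d-1)-dimensional measure is connected: otherwise a
    bundle of parallel segments joining the two sides of a partition of the
    cells would cross only edges of measure zero, whose projection along the
    segments cannot cover a (d-1)-dimensional cube ([voronoi_connected]). *)

Set Implicit Arguments.
Unset Strict Implicit.
Unset Printing Implicit Defensive.

Import Order.TTheory GRing.Theory Num.Theory.
Import numFieldNormedType.Exports.

Local Open Scope ring_scope.

(** * Distances to subspaces in the l1 norm *)

(** The inequalities between reals are cleared because [lia] would try to read all
    of them. *)
Ltac nlia := repeat match goal with
  | H : forall _, _ |- _ => clear H
  | H : is_true (Order.le _ _) |- _ => clear H
  | H : is_true (Order.lt _ _) |- _ => clear H
  | H := _ |- _ => clear H
  end; lia.

Section L1norm.
Variables (R : realType) (T : finType).
Implicit Types (f g h : T -> R).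

Definition dot f g : R := \sum_t f t * g t.
Definition norm1 f : R := \sum_t `|f t|.

Lemma norm1_ge0 f : 0 <= norm1 f. Proof. exact: sumr_ge0. Qed.

Lemma norm1_triangle f g h : norm1 (fun t => f t - h t) <= norm1 (fun t => f t - g t) + norm1 (fun t => g t - h t).
Proof. by rewrite -big_split; apply: ler_sum => t _; exact: ler_distD. Qed.

Lemma norm1D f g : norm1 (fun t => f t + g t) <= norm1 f + norm1 g.
Proof. by rewrite -big_split; apply: ler_sum => t _; exact: ler_normD. Qed.

Lemma norm1Z a f : norm1 (fun t => a * f t) = `|a| * norm1 f.
Proof. by rewrite /norm1 mulr_sumr; apply: eq_bigr => t _; rewrite normrM. Qed.

Lemma norm1_distC f g : norm1 (fun t => f t - g t) = norm1 (fun t => g t - f t).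
Proof. by apply: eq_bigr => t _; rewrite distrC. Qed.

Lemma norm1_eq f g : f =1 g -> norm1 f = norm1 g.
Proof. by move=> fg; apply: eq_bigr => t _; rewrite fg. Qed.

Lemma norm1_coord f t : `|f t| <= norm1 f.
Proof. by rewrite /norm1 (bigD1 t) //= lerDl sumr_ge0. Qed.

Lemma norm1_sum (I : Type) (s : seq I) (P : pred I) (F : I -> T -> R) :
  norm1 (fun t => \sum_(i <- s | P i) F i t) <= \sum_(i <- s | P i) norm1 (F i).
Proof.
rewrite /norm1 exchange_big /=; apply: ler_sum => t _; exact: ler_norm_sum.
Qed.

Lemma dotDl f g h : dot (fun t => f t + g t) h = dot f h + dot g h.
Proof. by rewrite -big_split; apply: eq_bigr => t _; rewrite mulrDl. Qed.
Lemma dotBl f g h : dot (fun t => f t - g t) h = dot f h - dot g h.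
Proof. by rewrite /dot -sumrB; apply: eq_bigr => t _; rewrite mulrBl. Qed.
Lemma dotDr f g h : dot h (fun t => f t + g t) = dot h f + dot h g.
Proof. by rewrite -big_split; apply: eq_bigr => t _; rewrite mulrDr. Qed.
Lemma dotC f g : dot f g = dot g f.
Proof. by apply: eq_bigr => t _; rewrite mulrC. Qed.
Lemma dot_eq f f' g g' : f =1 f' -> g =1 g' -> dot f g = dot f' g'.
Proof. by move=> ff gg; apply: eq_bigr => t _; rewrite ff gg. Qed.

Lemma dot_sumr (I : Type) (s : seq I) (P : pred I) (F : I -> T -> R) f :
  dot f (fun t => \sum_(i <- s | P i) F i t) = \sum_(i <- s | P i) dot f (F i).
Proof.
rewrite /dot exchange_big /=; apply: eq_bigr => t _; by rewrite mulr_sumr.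
Qed.

Lemma dot_bound f g M : (forall t, `|f t| <= M) -> `|dot f g| <= M * norm1 g.
Proof.
move=> fM; apply: (le_trans (ler_norm_sum _ _ _)).
rewrite /norm1 mulr_sumr; apply: ler_sum => t _; rewrite normrM.
by apply: ler_wpM2r.
Qed.

End L1norm.

Section Linear.
Variables (R : realType).

(** Expand the argument in the canonical basis. *)
Lemma lin_bound (E E' : finType) (f : 'Hom({ffun E -> R^o}, {ffun E' -> R^o})) :
  exists2 K : R, 0 < K & forall v, norm1 (f v) <= K * norm1 v.
Proof.
pose d e : {ffun E -> R^o} := [ffun e' => (e == e')%:R].
exists (1 + \sum_e norm1 (f (d e))); first by rewrite ltr_pwDl // sumr_ge0 // => e _; exact: norm1_ge0.
move=> v.
have -> : v = \sum_e (v e : R) *: d e.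
  apply/ffunP => e; rewrite sum_ffunE (bigD1 e) //= !ffunE eqxx big1 ?addr0; first by rewrite [RHS]mulr1.
  by move=> e' ne; rewrite !ffunE (negbTE ne) [LHS]mulr0.
set w := \sum_e _ *: _.
have wv e : w e = v e.
  rewrite /w sum_ffunE (bigD1 e) //= !ffunE eqxx big1 ?addr0; first by rewrite [LHS]mulr1.
  by move=> e' ne; rewrite !ffunE (negbTE ne) [LHS]mulr0.
have -> : norm1 w = norm1 v by apply: eq_bigr => e _; rewrite wv.
rewrite /w linear_sum.
have -> : norm1 (\sum_e f ((v e : R) *: d e)) = norm1 (fun t => \sum_e (v e : R) * f (d e) t).
  apply: eq_bigr => t _; rewrite sum_ffunE; congr (`| _ |); apply: eq_bigr => e _.
  by rewrite linearZ ffunE.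
apply: (le_trans (norm1_sum _ _ _)).
rewrite mulrDl mul1r.
apply: (@le_trans _ _ ((\sum_e norm1 (f (d e))) * norm1 v)); last by rewrite lerDr norm1_ge0.
rewrite mulr_suml; apply: ler_sum => e _; rewrite norm1Z mulrC.
by apply: ler_wpM2l; [exact: norm1_ge0 | exact: norm1_coord].
Qed.

Variable E : finType.
Local Notation F := {ffun E -> R^o}.

(** [V] will be a space of displacements that cost almost no energy. *)
Definition Near (V : {vspace F}) (j : E -> R) (delta : R) :=
  exists2 v, v \in V & norm1 (fun e => j e - v e) <= delta.

Lemma Near_le V W j d d' : (V <= W)%VS -> d <= d' -> Near V j d -> Near W j d'.
Proof. by move=> VW dd [v /(subvP VW) vW h]; exists v => //; apply: le_trans dd. Qed.

Lemma Near_eq V j j' d : j =1 j' -> Near V j d -> Near V j' d.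
Proof. by move=> jj [v vV h]; exists v => //; rewrite -(norm1_eq (f := fun e => j e - v e)) // => e; rewrite jj. Qed.

Lemma NearD V j j' d d' : Near V j d -> Near V j' d' -> Near V (fun e => j e + j' e) (d + d').
Proof.
move=> [v vV hv] [w wV hw]; exists (v + w); first exact: rpredD.
apply: le_trans (lerD hv hw); rewrite -big_split; apply: ler_sum => e _ /=.
rewrite ffunE opprD addrACA; exact: ler_normD.
Qed.

Lemma Near0 V d : 0 <= d -> Near V (fun=> 0) d.
Proof.
move=> d0; exists 0; first exact: mem0v.
by rewrite /norm1 big1 // => e _; rewrite ffunE subrr normr0.
Qed.
Definition dot_form (r : E -> R) (v : F) : R^o := dot v r.
Lemma dot_form_linear r : linear (dot_form r).
Proof.
move=> a u v; rewrite /dot_form /dot /= scaler_sumr -big_split; apply: eq_bigr => e _ /=.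
by rewrite !ffunE mulrDl -mulrA.
Qed.
HB.instance Definition _ r := GRing.isLinear.Build R F R^o _ (dot_form r) (dot_form_linear r).

Definition kerf (r : E -> R) : {vspace F} := lker (linfun (dot_form r)).
Lemma mem_kerf r v : (v \in kerf r) = (dot v r == 0).
Proof. by rewrite memv_ker lfunE. Qed.

(** Either [r] vanishes on [V], or some [v0] in [V] is not killed by [r] and subtracting
    a multiple of it puts an approximating vector into the kernel. *)
Lemma Near_ker (V : {vspace F}) (r : E -> R) : exists2 K : R, 0 < K &
  forall j d, Near V j d -> `|dot j r| <= d -> Near (V :&: kerf r) j (K * d).
Proof.
have [/subvP Vr|/subvPn[v0 v0V]] := boolP (V <= kerf r)%VS.
  exists 1 => // j d [v vV h] _; exists v; rewrite ?mul1r //.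
  by rewrite memv_cap vV Vr.
rewrite mem_kerf => v0r.
pose M := 1 + \sum_e `|r e|.
have M0 : 0 < M by rewrite ltr_pwDl // sumr_ge0.
exists (1 + (M + 1) * norm1 v0 / `|dot v0 r|).
  by rewrite ltr_pwDl // divr_ge0 // mulr_ge0 ?norm1_ge0 // addr_ge0 // ltW.
move=> j d [v vV h] jr.
exists (v - (dot v r / dot v0 r) *: v0).
  rewrite memv_cap rpredB ?rpredZ //= mem_kerf.
  have -> : dot (v - (dot v r / dot v0 r) *: v0) r = dot_form r (v - (dot v r / dot v0 r) *: v0) by [].
  by rewrite linearB linearZ /= /dot_form [_ *: _]divfK ?subrr.
apply: le_trans (norm1_triangle _ v _) _.
rewrite mulrDl mul1r; apply: lerD => //.
have -> : norm1 (fun t => v t - (v - (dot v r / dot v0 r) *: v0) t) = `|dot v r / dot v0 r| * norm1 v0.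
  by rewrite -norm1Z; apply: norm1_eq => e; rewrite !ffunE opprB addrCA subrr addr0.
rewrite normf_div.
have vr : `|dot v r| <= (M + 1) * d.
  rewrite -[X in `|X|](subrK (dot j r)) mulrDl mul1r; apply: le_trans (ler_normD _ _) (lerD _ jr).
  rewrite -dotBl dotC; apply: (le_trans (dot_bound (M := M) _ _)).
    by move=> e; apply: (le_trans (norm1_coord r e)); rewrite lerDr.
  by rewrite norm1_distC; apply: ler_wpM2l => //; exact: ltW.
have := ler_wpM2r (_ : 0 <= norm1 v0 / `|dot v0 r|) vr.
rewrite divr_ge0 ?norm1_ge0 // => /(_ isT).
set A := `|dot v r|; set B := `|dot v0 r|; move=> H.
have -> : A * B^-1 * norm1 v0 = A * (norm1 v0 / B) by ring.
by have -> : (M + 1) * norm1 v0 / B * d = (M + 1) * d * (norm1 v0 / B) by ring.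
Qed.

(** A force [g] with small [th] does almost no work along [V]. *)
Definition resid (V : {vspace F}) (g : E -> R) (th : R) := forall v, v \in V -> `|dot g v| <= th * norm1 v.

(** A vector of the sum splits into two components of comparable norm. *)
Lemma resid_add (V W : {vspace F}) : exists2 K : R, 0 < K &
  forall g th, 0 <= th -> resid V g th -> resid W g th -> resid (V + W) g (K * th).
Proof.
have [K1 K10 h1] := lin_bound (addv_pi1 V W).
have [K2 K20 h2] := lin_bound (addv_pi2 V W).
exists (K1 + K2); first exact: addr_gt0.
move=> g th th0 gV gW v /addv_pi1_pi2 e.
have -> : dot g v = dot g (addv_pi1 V W v) + dot g (addv_pi2 V W v).
  by rewrite -dotDr; apply: dot_eq => // t; rewrite -[in LHS]e ffunE.
apply: le_trans (ler_normD _ _) _; rewrite mulrDl mulrDl.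
have -> : K1 * th * norm1 v = th * (K1 * norm1 v) by ring.
have -> : K2 * th * norm1 v = th * (K2 * norm1 v) by ring.
apply: lerD.
  by apply: le_trans (gV _ (memv_pi1 _ _ _)) _; apply: ler_wpM2l.
by apply: le_trans (gW _ (memv_pi2 _ _ _)) _; apply: ler_wpM2l.
Qed.

Lemma resid_sum (I : eqType) (W : I -> {vspace F}) (s : seq I) : exists2 K : R, 1 <= K &
  forall g th, 0 <= th -> (forall i, i \in s -> resid (W i) g th) -> resid (\sum_(i <- s) W i)%VS g (K * th).
Proof.
elim: s => [|i s [K K1 IH]].
  exists 1 => // g th th0 _ v; rewrite big_nil memv0 => /eqP ->.
  have e : dot g (0 : F) = 0 by rewrite /dot big1 // => e _; rewrite ffunE mulr0.
  by rewrite e normr0 !mulr_ge0 ?norm1_ge0.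
have [K' K'0 h] := resid_add (W i) (\sum_(i <- s) W i)%VS.
exists (1 + K' * K); first by rewrite lerDl mulr_ge0 // ltW // (lt_le_trans _ K1).
move=> g th th0 Hs v; rewrite big_cons => vV.
have K0 : 0 <= K by apply: le_trans K1.
apply: (le_trans (h g (K * th) _ _ _ v vV)).
- by rewrite mulr_ge0.
- move=> w wV; apply: (le_trans (Hs i _ w wV)); first by rewrite mem_head.
  by rewrite ler_wpM2r ?norm1_ge0 // ler_peMl.
- by apply: IH => // k ks; apply: Hs; rewrite inE ks orbT.
by rewrite ler_wpM2r ?norm1_ge0 // mulrA ler_wpM2r // lerDr.
Qed.

(** The linear map from [v] to the values <v, r_z>, z in [C], has a linear right inverse on its
    image, composed here with the projection onto [V]; its norm is the constant. *)
Lemma bounded_lift (L : finType) (r : L -> E -> R) (C : {set L}) (V : {vspace F}) :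
  exists2 K : R, 0 < K & forall v, v \in V -> exists2 w, w \in V &
    (forall z, z \in C -> dot w (r z) = dot v (r z)) /\ norm1 w <= K * \sum_(z in C) `|dot v (r z)|.
Proof.
pose f (v : F) : {ffun L -> R^o} := [ffun z => if z \in C then dot_form (r z) v else 0].
have flin : linear f.
  move=> a u v; apply/ffunP => z; rewrite !ffunE; case: ifP => _; first by rewrite linearP.
  by rewrite scaler0 addr0.
pose fL := GRing.isLinear.Build R _ _ _ f flin.
pose f' : {linear F -> {ffun L -> R^o}} := HB.pack f fL.
pose g := (linfun f' \o projv V)%VF.
have [K K0 hK] := lin_bound (projv V \o g^-1)%VF.
exists K => // v vV; exists (projv V (g^-1%VF (g v))); first exact: memv_proj.
have gv : g v = f v by rewrite comp_lfunE projv_id // lfunE.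
have e : f (projv V (g^-1%VF (g v))) = f v.
  have : g (g^-1%VF (g v)) = g v by rewrite limg_lfunVK // memv_img // memvf.
  by rewrite gv comp_lfunE lfunE.
split=> [z zC|]; first by move/ffunP/(_ z): e; rewrite !ffunE zC.
have := hK (g v); rewrite comp_lfunE => /le_trans; apply; apply: ler_wpM2l; first exact: ltW.
rewrite gv /norm1 [leRHS]big_mkcond /=; apply: ler_sum => z _; rewrite ffunE; case: ifP => //.
by rewrite normr0.
Qed.

End Linear.

(** * Rigidity of paths under a monotone force *)

Section Rigid.
Variables (R : realType).

Lemma last_time (Q : nat -> Prop) (s n : nat) : (s < n)%N -> Q s ->
  exists t, [/\ (s <= t < n)%N, Q t & forall t', (t < t' < n)%N -> ~ Q t'].
Proof.
move=> sn Qs; pose P t := (s <= t < n)%N && `[< Q t >].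
have exP : exists t, P t by exists s; rewrite /P leqnn sn; apply/asboolP.
have ubP t : P t -> (t <= n)%N by case/andP => /andP[_ /ltnW].
case: (ex_maxnP exP ubP) => t /andP[st /asboolP Qt] tmax.
exists t; split=> // t' /andP[tt' t'n] Qt'.
have : P t' by rewrite /P t'n (leq_trans _ (ltnW tt')) ?(andP st).1 //=; apply/asboolP.
by move/tmax; rewrite leqNgt tt'.
Qed.

(** Follow the trajectory from a time of colour [i] to the last time of colour [i]: this moves
    it by at most [d] by the hypothesis on equal colours.  Then make one step of length [h] and
    continue with the remaining colours; each colour is used once. *)
Lemma colour_chain (I : finType) (T : {set I}) (b : nat) (D : nat -> nat -> R)
    (col : nat -> I -> Prop) (d h : R) (a : nat) :
  0 <= d -> 0 <= h ->
  (forall s t u, D s u <= D s t + D t u) ->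
  (forall s, (a <= s <= b)%N -> (forall n, (s <= n <= b)%N -> D s n <= h) \/
     exists i t, [/\ i \in T, col s i, (s < t)%N & forall n, (s <= n <= t)%N -> D s n <= h]) ->
  (forall i s s', i \in T -> (a <= s <= s')%N -> (s' <= b)%N -> col s i -> col s' i -> D s s' <= d) ->
  forall s n, (a <= s <= n)%N -> (n <= b)%N -> D s n <= #|T|%:R * (d + h) + h.
Proof.
move=> d0 h0 tri step same s n asn nb.
have dh0 : 0 <= d + h by exact: addr_ge0.
suff H : forall k (T' : {set I}) s, #|T'| = k -> (a <= s <= n)%N -> T' \subset T ->
   (forall s' i, (s <= s' < n)%N -> i \in T -> col s' i -> i \in T') -> D s n <= k%:R * (d + h) + h.
  by apply: (H _ T).
elim=> [|k IH] T' {asn}s cT' /andP[as_ sn] T'T Hc.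
  have sab : (a <= s <= b)%N by rewrite as_ (leq_trans sn).
  have [/(_ n)|[i [t [iT ci st ht]]]] := step s sab; first by rewrite sn nb mul0r add0r; apply.
  move: sn; rewrite leq_eqVlt => /predU1P[e|sn].
    by subst n; rewrite mul0r add0r; apply: ht; rewrite leqnn ltnW.
  have := Hc s i; rewrite leqnn sn => /(_ isT iT ci).
  by move/eqP: cT'; rewrite cards_eq0 => /eqP ->; rewrite inE.
have k0 : 0 <= k.+1%:R * (d + h) by rewrite mulr_ge0.
have sab : (a <= s <= b)%N by rewrite as_ (leq_trans sn).
have [/(_ n)|[i [t [iT ci st ht]]]] := step s sab.
  by rewrite sn nb => /(_ isT) H; apply: le_trans H _; rewrite lerDr.
have [nt|tn] := leqP n t.
  have := ht n; rewrite sn nt => /(_ isT) H; apply: le_trans H _; by rewrite lerDr.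
have [s' [/andP[ss' s'n] cs' s'max]] := last_time (Q := fun u => col u i) (ltn_trans st tn) ci.
have as' := leq_trans as_ ss'.
have s'ab : (a <= s' <= b)%N by rewrite as' (leq_trans (ltnW s'n)).
have Dss' : D s s' <= d by apply: (same i) => //; rewrite ?as_ ?ss' //; case/andP: s'ab.
have one : D s s' + h <= k.+1%:R * (d + h) + h.
  by rewrite lerD2r; apply: le_trans Dss' _; rewrite -natr1 mulrDl mul1r; have : 0 <= k%:R * (d + h) by [rewrite mulr_ge0|]; lra.
have [/(_ n)|[i' [t' [_ _ st' ht']]]] := step s' s'ab.
  rewrite (ltnW s'n) nb => /(_ isT) H; apply: le_trans (tri s s' n) _.
  by apply: le_trans one; rewrite lerD2l.
have [nt'|t'n] := leqP n t'.
  apply: le_trans (tri s s' n) _; apply: le_trans one; rewrite lerD2l.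
  by apply: ht'; rewrite nt' ltnW.
have h1 : D s' t' <= h by apply: ht'; rewrite leqnn ltnW.
have h2 : D t' n <= k%:R * (d + h) + h.
  apply: (IH (T' :\ i)).
  - have iT' : i \in T' by apply: (Hc s i) => //; rewrite leqnn (ltn_trans st tn).
    by move: cT'; rewrite (cardsD1 i) iT' add1n => -[].
  - by rewrite (ltnW t'n) (leq_trans as') // ltnW.
  - by apply: (fintype.subset_trans _ T'T); exact: subsetDl.
  - move=> u j /andP[t'u un] jT cj; rewrite !inE (Hc u) // ?andbT; last first.
      by rewrite un (leq_trans ss') // (leq_trans (ltnW st')).
    apply/eqP => ji; subst j; apply: (s'max u) => //.
    by rewrite un (leq_trans st').
have := tri s s' n; have := tri s' t' n; rewrite -natr1 mulrDl mul1r; lra.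
Qed.
(** All small constants of the convergence proof are chosen through [small]: it commutes with
    finite conjunctions, so that finitely many smallness conditions can be met together. *)
Definition small (P : R -> Prop) := exists2 d0 : R, 0 < d0 & forall d, 0 < d -> d <= d0 -> P d.

Lemma small_and (P Q : R -> Prop) : small P -> small Q -> small (fun d => P d /\ Q d).
Proof.
move=> [p p0 Hp] [q q0 Hq]; exists (Num.min p q); first by rewrite lt_min p0.
by move=> d d0; rewrite le_min => /andP[dp dq]; split; [exact: Hp|exact: Hq].
Qed.

Lemma small_imp (P Q : R -> Prop) : (forall d, 0 < d -> P d -> Q d) -> small P -> small Q.
Proof. by move=> PQ [p p0 Hp]; exists p => // d d0 dp; apply: PQ => //; exact: Hp. Qed.

Lemma small_all (I : finType) (P : I -> R -> Prop) : (forall i, small (P i)) -> small (fun d => forall i, P i d).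
Proof.
move=> H; suff : forall s : seq I, small (fun d => forall i, i \in s -> P i d).
  by move=> /(_ (enum I)); apply: small_imp => d _ h i; apply: h; rewrite mem_enum.
elim=> [|i s IH]; first by exists 1.
apply: small_imp (small_and (H i) IH) => d _ [h1 h2] j; rewrite inE => /predU1P[->|] //; exact: h2.
Qed.

Lemma small_scale (K : R) (P : R -> Prop) : 0 < K -> small P -> small (fun d => P (K * d)).
Proof.
move=> K0 [p p0 Hp]; exists (p / K); first exact: divr_gt0.
move=> d d0; rewrite ler_pdivlMr // mulrC => dp; apply: Hp => //; exact: mulr_gt0.
Qed.

Lemma small_le (K c : R) : 0 < c -> small (fun d => K * d <= c).
Proof.
move=> c0; exists (c / (`|K| + 1)); first by rewrite divr_gt0 // ltr_wpDl.
move=> d d0; rewrite ler_pdivlMr ?ltr_wpDl // mulrDr mulr1 => H.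
have := ler_norm K; move=> HK; have : K * d <= `|K| * d by rewrite ler_pM2r.
by have := ltW d0; lra.
Qed.

Variables (T I : finType) (U : I -> (T -> R) -> Prop) (c Lm : R) (e : R -> R).
Implicit Types (p mu : nat -> T -> R).

Definition dist p s n := norm1 (fun t => p n t - p s t).
(** Like [Near], for sets of functions that need not be subspaces. *)
Definition nearS (V : (T -> R) -> Prop) u (delta : R) := exists2 v, V v & norm1 (fun t => u t - v t) <= delta.

Lemma dist_tri p s t u : dist p s u <= dist p s t + dist p t u.
Proof. by rewrite addrC; exact: norm1_triangle. Qed.
Lemma distC' p s t : dist p s t = dist p t s.
Proof. exact: norm1_distC. Qed.
Lemma dist0 p s : dist p s s = 0.
Proof. by rewrite /dist /norm1 big1 // => t _; rewrite subrr normr0. Qed.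

(** A path [p] between the times [a] and [b] with a force [mu] that is bounded and, up
    to [delta], strongly monotone along it.  The last clause says that a stretch with small motion
    has all its displacements close to some [U i], on which the force almost has the prescribed
    value [phi i].  Only finitely many [U i] are available. *)
Definition path_hyp (delta : R) (phi : I -> (T -> R) -> R) p mu (a b : nat) :=
  [/\ forall n, (a <= n < b)%N -> dist p n n.+1 <= delta,
      forall m n, (a <= m < b)%N -> (a <= n < b)%N ->
        c * dist p m n ^+ 2 <= dot (fun t => mu n t - mu m t) (fun t => p n t - p m t) + delta,
      forall n t, (a <= n < b)%N -> `|mu n t| <= Lm &
      forall th s t, 0 < th -> delta <= e th -> (a <= s < t)%N -> (t <= b)%N ->
        (forall m n, (s <= m <= t)%N -> (s <= n <= t)%N -> dist p m n <= e th) ->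
        exists i, (forall m n, (s <= m <= t)%N -> (s <= n <= t)%N ->
                     nearS (U i) (fun z => p n z - p m z) (delta / e th)) /\
          forall u, U i u -> `|dot (mu s) u - phi i u| <= th * norm1 u].

Hypotheses (c0 : 0 < c) (Lm0 : 0 <= Lm) (e0 : forall th, 0 < th -> 0 < e th).

Lemma nearS_le V u d d' : d <= d' -> nearS V u d -> nearS V u d'.
Proof. by move=> dd [v vV h]; exists v => //; apply: le_trans dd. Qed.

Lemma path_hyp_sub delta delta' phi p mu a b a' b' : delta <= delta' -> (a <= a')%N -> (b' <= b)%N ->
  path_hyp delta phi p mu a b -> path_hyp delta' phi p mu a' b'.
Proof.
move=> dd aa bb [h1 h2 h3 h4]; split.
- by move=> n /andP[an nb]; apply: le_trans dd; apply: h1; rewrite (leq_trans aa) //= (leq_trans nb).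
- move=> m n /andP[am mb] /andP[an nb]; apply: le_trans (h2 m n _ _) _; rewrite ?lerD2l //.
    by rewrite (leq_trans aa) //= (leq_trans mb).
  by rewrite (leq_trans aa) //= (leq_trans nb).
- by move=> n t /andP[an nb]; apply: h3; rewrite (leq_trans aa) //= (leq_trans nb).
move=> th s t th0 dth /andP[as_ st] tb H.
have [|i [hi1 hi2]] := h4 th s t th0 (le_trans dd dth) _ (leq_trans tb bb) H; first by rewrite (leq_trans aa).
exists i; split=> // m n hm hn; apply: nearS_le (hi1 m n hm hn).
by rewrite ler_pM2r // invr_gt0 e0.
Qed.

(** Two times at which the force has the same prescribed values on a set [U i] close to the
    displacement: strong monotonicity bounds the square of the displacement by the small work of
    the difference of the forces. *)
Lemma same_colour delta phi p mu a b d i s s' : 0 < delta -> 0 < d ->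
  path_hyp delta phi p mu a b -> (c * d / 4 + 2 * Lm + 1) * delta <= c * d ^+ 2 / 4 ->
  (a <= s < b)%N -> (a <= s' < b)%N ->
  nearS (U i) (fun z => p s' z - p s z) delta ->
  (forall u, U i u -> `|dot (mu s) u - phi i u| <= c * d / 8 * norm1 u) ->
  (forall u, U i u -> `|dot (mu s') u - phi i u| <= c * d / 8 * norm1 u) ->
  dist p s s' <= d.
Proof.
move=> delta0 d0 [_ h2 h3 _] small_d hs hs' [u Uu hu] r1 r2.
rewrite leNgt; apply/negP => dD.
have := h2 s s' hs hs'; set D := dist p s s' in dD *.
set dm := fun t => mu s' t - mu s t.
have -> : dot dm (fun t => p s' t - p s t) = dot dm u + dot dm (fun t => (p s' t - p s t) - u t).
  by rewrite -dotDr; apply: dot_eq => // t; ring.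
have D1 : `|dot dm (fun t => (p s' t - p s t) - u t)| <= (2 * Lm) * delta.
  apply: le_trans (dot_bound (M := 2 * Lm) _ _) _; last by rewrite ler_wpM2l // mulr_ge0.
  move=> t; have := h3 s t hs; have := h3 s' t hs'; rewrite /dm; have := ler_normB (mu s' t) (mu s t); lra.
have nu : norm1 u <= D + delta.
  have -> : norm1 u = norm1 (fun t => (p s' t - p s t) - ((p s' t - p s t) - u t)).
    by apply: norm1_eq => t; ring.
  apply: le_trans (_ : _ <= norm1 (fun t => p s' t - p s t) + norm1 (fun t => - ((p s' t - p s t) - u t))) _.
    exact: norm1D.
  rewrite lerD2l; apply: le_trans hu; rewrite le_eqVlt; apply/orP; left; apply/eqP.
  by apply: eq_bigr => t _; rewrite normrN.
have D2 : `|dot dm u| <= (c * d / 4) * (D + delta).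
  have -> : dot dm u = (dot (mu s') u - phi i u) - (dot (mu s) u - phi i u) by rewrite /dm dotBl; ring.
  apply: le_trans (ler_normB _ _) _; apply: le_trans (lerD (r2 u Uu) (r1 u Uu)) _.
  have : c * d / 8 * norm1 u <= c * d / 8 * (D + delta) by rewrite ler_pM2l // divr_gt0 // mulr_gt0.
  lra.
have := ler_norm (dot dm u); have := ler_norm (dot dm (fun t => (p s' t - p s t) - u t)).
have dDD : c * d * D <= c * D ^+ 2 by rewrite expr2 -!mulrA ler_pM2l // ler_pM2r ?(ltW dD) // (lt_trans d0).
have ddDD : c * d ^+ 2 < c * D ^+ 2 by rewrite ltr_pM2l // ltr_pXn2r // ?nnegrE ltW // (lt_trans d0).
have : 0 < c * d ^+ 2 by rewrite mulr_gt0 // exprn_gt0.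
move: small_d D1 D2; nra.
Qed.

(** Rigidity of the paths whose displacements are known to be close to [U i] for all [i] in [S].
    With [S] empty this is full rigidity; it is proved by decreasing induction on [S]. *)
Definition rigid_near (S : {set I}) (w delta : R) := forall phi p mu a b,
  path_hyp delta phi p mu a b ->
  (forall i m n, i \in S -> (a <= m <= b)%N -> (a <= n <= b)%N -> nearS (U i) (fun z => p n z - p m z) delta) ->
  forall m n, (a <= m <= b)%N -> (a <= n <= b)%N -> dist p m n <= w.

(** Extend a time [s] to a maximal stretch whose displacements are close to one more set [U i];
    the induction hypothesis makes its motion small.  One step beyond the stretch the motion is
    still small, so the hypothesis on the path provides an index, and by maximality this index lies
    in [S].  It is the colour of [s]; [same_colour] and [colour_chain] conclude. *)
Lemma rigid_near_step (S : {set I}) :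
  (forall i w, i \notin S -> 0 < w -> small (rigid_near (i |: S) w)) ->
  forall w, 0 < w -> small (rigid_near S w).
Proof.
move=> IH w w0.
(* the colour chain of [#|S|] links moves the path by at most [(2 * #|S| + 1) * d] *)
pose d := w / (4 * #|S|%:R + 4).
have d0 : 0 < d by rewrite divr_gt0 // ltr_wpDl // mulr_ge0.
pose e1 := e (c * d / 8); have e10 : 0 < e1 by rewrite e0 // divr_gt0 // mulr_gt0.
pose w' := Num.min d e1 / 4; have w'0 : 0 < w' by rewrite divr_gt0 // lt_min d0.
pose K := 1 + e1^-1; have K0 : 0 < K by rewrite addr_gt0 // invr_gt0.
have {}IH : small (fun delta => forall i, i \notin S -> rigid_near (i |: S) w' delta).
  apply: small_all => i; have [iS|iS] := boolP (i \in S); first by exists 1.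
  by apply: small_imp (IH i w' iS w'0) => dl _ H _.
have cd0 : 0 < c * d ^+ 2 / 4 by rewrite divr_gt0 // mulr_gt0 // exprn_gt0.
apply: small_imp (small_and (small_scale K0 IH) (small_and (small_le 1 w'0) (small_and (small_le 1 e10) (small_le (c * d / 4 + 2 * Lm + 1) cd0)))).
move=> delta delta0 [{}IH [dsw [dse dsmall]]] phi p mu a b Hp HS; rewrite mul1r in dsw; rewrite mul1r in dse.
have dK : delta <= K * delta by rewrite ler_peMl ?(ltW delta0) // lerDl invr_ge0 ltW.
have dK' : delta / e1 <= K * delta by rewrite mulrC ler_pM2r // lerDr.
have w'd : w' + w' <= d by have := ge_min d d e1; rewrite lexx /= => ?; rewrite /w'; lra.
have w'e : w' + w' <= e1 by have := ge_min e1 d e1; rewrite lexx orbT => ?; rewrite /w'; lra.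
suff H : forall n, (a <= n <= b)%N -> dist p a n <= w / 2.
  by move=> m n hm hn; apply: le_trans (dist_tri p m a n) _; rewrite distC'; have := H m hm; have := H n hn; lra.
pose col (s : nat) (i : I) := (s < b)%N /\ forall u, U i u -> `|dot (mu s) u - phi i u| <= c * d / 8 * norm1 u.
move=> n /andP[an nb].
suff /(_ a n) : forall s n, (a <= s <= n)%N -> (n <= b)%N -> dist p s n <= #|S|%:R * (d + d) + d.
  rewrite leqnn an nb => /(_ isT isT) /le_trans; apply.
  rewrite (_ : w / 2 = (2 * #|S|%:R + 2) * d); last by rewrite /d; field; apply/lt0r_neq0; rewrite ltr_wpDl // mulr_ge0.
  by have := ltW d0; have : 0 <= #|S|%:R * d by [rewrite mulr_ge0 // ltW|]; lra.
apply: (@colour_chain I S b (dist p) col d d a (ltW d0) (ltW d0) (dist_tri p)); last first.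
  move=> i s s' iS /andP[as_ ss'] s'b [sb c1] [s'b' c2].
  have hs : (a <= s <= b)%N by rewrite as_ ltnW.
  have hs' : (a <= s' <= b)%N by rewrite (leq_trans as_).
  apply: (same_colour delta0 d0 Hp dsmall _ _ (HS i s s' iS hs hs') c1 c2).
    by rewrite as_.
  by rewrite (leq_trans as_).
move=> s /andP[as_ sb].
(* stretches whose displacements are close to one further set *)
pose good t := t = s \/ exists2 i, i \notin S & forall m n, (s <= m <= t)%N -> (s <= n <= t)%N ->
   nearS (U i) (fun z => p n z - p m z) (K * delta).
have [|t [/andP[st tb1] gt tmax]] := @last_time good s b.+1 _ (or_introl erefl); first by rewrite ltnS.
have Hst : forall m n, (s <= m <= t)%N -> (s <= n <= t)%N -> dist p m n <= w'.
  case: gt => [ts|[i iS Hi]].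
    by subst t => m' n'; rewrite -!eqn_leq => /eqP <- /eqP <-; rewrite dist0 ltW.
  apply: (IH i iS phi p mu s t); first exact: path_hyp_sub Hp.
  move=> i' m' n'; rewrite in_setU1 => /predU1P[->|i'S] hm hn; first exact: Hi.
  by apply: nearS_le dK _; apply: HS => //; nlia.
move: tb1; rewrite ltnS leq_eqVlt => /predU1P[tb|tb].
  left => n' hn; rewrite -tb in hn; have := Hst s n'; rewrite leqnn st hn => /(_ isT isT); lra.
have Hs1 : dist p t t.+1 <= w' by case: Hp => h1 _ _ _; apply: le_trans (h1 t _) dsw; nlia.
have Ht1 : forall m, (s <= m <= t)%N -> dist p m t.+1 <= w' + w'.
  by move=> m hm; apply: le_trans (dist_tri p m t t.+1) (lerD (Hst _ _ hm _) Hs1); nlia.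
have Hst1 : forall m n, (s <= m <= t.+1)%N -> (s <= n <= t.+1)%N -> dist p m n <= w' + w'.
  move=> m' n' hm hn; have [em|nm] := eqVneq m' t.+1; [subst m'|]; (have [en|nn] := eqVneq n' t.+1; [subst n'|]).
  - by rewrite dist0; lra.
  - by rewrite distC'; apply: Ht1; nlia.
  - by apply: Ht1; nlia.
  - have : dist p m' n' <= w' by (apply: Hst; nlia).
    lra.
right; have [_ _ _ h4] := Hp.
have [||||m' n' hm hn|i [near res]] := h4 (c * d / 8) s t.+1.
- by rewrite divr_gt0 // mulr_gt0.
- by [].
- nlia.
- nlia.
- by apply: le_trans w'e; exact: Hst1.
have iS : i \in S.
  apply/negPn/negP => iS; apply: (tmax t.+1); first nlia.
  right; exists i => // m' n' hm hn; exact: nearS_le dK' (near _ _ hm hn).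
exists i, t.+1; split=> //; first by split=> //; nlia.
by move=> n' hn; have := Hst1 s n'; rewrite leqnn hn (leqW st) => /(_ isT isT); lra.
Qed.

Lemma rigid_path w : 0 < w -> small (fun delta =>
  forall phi p mu a b, path_hyp delta phi p mu a b ->
    forall m n, (a <= m <= b)%N -> (a <= n <= b)%N -> dist p m n <= w).
Proof.
suff H : forall k (S : {set I}), (#|I| - #|S|)%N = k -> forall w, 0 < w -> small (rigid_near S w).
  move=> w0; have := H _ finset.set0 erefl w w0; apply: small_imp => d _ {}H phi p mu a b Hp.
  by apply: (H _ _ _ _ _ Hp) => i m n; rewrite inE.
elim=> [|k IH] S cS {}w w0; apply: rigid_near_step => // i w' iS w'0.
  by have := max_card (mem (i |: S)); rewrite cardsU1 iS; nlia.
by apply: IH => //; rewrite cardsU1 iS; nlia.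
Qed.

End Rigid.

(** * Dissipative trajectories *)

Section Run.
Variables (R : realType) (L E : finType) (r : L -> E -> R) (kap : R -> R).
Hypothesis kap0 : forall th, 0 < th -> 0 < kap th.
Local Notation F := {ffun E -> R^o}.

Implicit Types (Z C : {set L}).

(** Amounts [tx], log-activities [ty] (close to [ln (tx _ _)]), fluxes [tJ] through the channels,
    external part [tg] of the driving force, and energy decrements [tk]. *)
Record traj := Traj { tx : nat -> L -> R ; ty : nat -> L -> R ; tJ : nat -> E -> R ;
  tg : nat -> E -> R ; tk : nat -> R }.

(** The third clause bounds the flux times the driving force by the energy decrement; the last one
    says that a large logarithmic jump of [z], or a log-activity far from the logarithm, costs a
    fixed fraction of the amount of [z]. *)
Definition step_ok (Z : {set L}) (x x' y : L -> R) (J g : E -> R) (k : R) : Prop :=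
  [/\ 0 <= k,
      forall z, z \in Z -> [/\ 0 < x z, 0 < x' z & x' z = x z + dot J (r z)],
      forall e, `|J e| * `|g e + \sum_(z in Z) y z * r z e| <= k &
      forall z th, z \in Z -> 0 < th -> kap th * Num.max (x z) (x' z) <= k \/
        `|ln (x' z) - ln (x z)| <= th /\ `|y z - ln (x z)| <= th].

Definition run Z (X : traj) (a b : nat) := forall n, (a <= n < b)%N ->
  step_ok Z (tx X n) (tx X n.+1) (ty X n) (tJ X n) (tg X n) (tk X n).

Definition osc (X : traj) a b eps := forall n m e, (a <= n < b)%N -> (a <= m < b)%N ->
  `|tg X n e - tg X m e| <= eps.

Definition cost (X : traj) a b : R := \sum_(a <= n < b) tk X n.
Definition disp (X : traj) a b e : R := \sum_(a <= n < b) tJ X n e.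

(** The components of [C] are moved into the external force.  As long as their log-activities
    hardly vary, the rest is again a run with slowly varying external force. *)
Definition freeze (C : {set L}) (X : traj) :=
  Traj (tx X) (ty X) (tJ X) (fun n e => tg X n e + \sum_(z in C) ty X n z * r z e) (tk X).

Implicit Types (X : traj).

Lemma run_sub Z X a b a' b' : (a <= a')%N -> (b' <= b)%N -> run Z X a b -> run Z X a' b'.
Proof. by move=> aa bb H n /andP[h1 h2]; apply: H; rewrite (leq_trans aa) // (leq_trans h2). Qed.

Lemma osc_sub X a b a' b' eps eps' : (a <= a')%N -> (b' <= b)%N -> eps <= eps' ->
  osc X a b eps -> osc X a' b' eps'.
Proof. by move=> aa bb ee H n m e hn hm; apply: le_trans ee; apply: H; nlia. Qed.

Lemma run_freeze Z C X a b : C \subset Z -> run Z X a b -> run (Z :\: C) (freeze C X) a b.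
Proof.
move=> CZ H n /H [h1 h2 h3 h4]; split=> //=.
- by move=> z /finset.setDP[zZ _]; exact: h2.
- move=> e; rewrite -addrA; have -> : \sum_(z in C) ty X n z * r z e + \sum_(z in Z :\: C) ty X n z * r z e = \sum_(z in Z) ty X n z * r z e.
    rewrite [RHS](bigID (mem C)) /=; congr (_ + _); apply: eq_bigl => z.
      by rewrite andb_idl // => /(fintype.subsetP CZ).
    by rewrite inE andbC.
  exact: h3.
by move=> z th /finset.setDP[zZ _]; exact: h4.
Qed.

Lemma cost_cat X a m b : (a <= m <= b)%N -> cost X a b = cost X a m + cost X m b.
Proof. by case/andP=> am mb; rewrite /cost (big_cat_nat am). Qed.
Lemma disp_cat X a m b e : (a <= m <= b)%N -> disp X a b e = disp X a m e + disp X m b e.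
Proof. by case/andP=> am mb; rewrite /disp (big_cat_nat am). Qed.

Lemma cost_ge0 Z X a b m n : run Z X a b -> (a <= m)%N -> (n <= b)%N -> 0 <= cost X m n.
Proof.
move=> H am nb; rewrite /cost big_nat; apply: sumr_ge0 => i /andP[mi in_].
have hi : (a <= i < b)%N by nlia.
by have [] := H i hi.
Qed.

Lemma cost_mono Z X a b m n m' n' : run Z X a b -> (a <= m')%N -> (n' <= b)%N -> (m' <= m)%N -> (n <= n')%N ->
  cost X m n <= cost X m' n'.
Proof.
move=> H am nb mm nn; have [mn|nm] := leqP m n; last first.
  by rewrite {1}/cost big_geq ?(ltnW nm) //; exact: (cost_ge0 H am nb).
have h1 := cost_ge0 H (leq_trans am mm) nb.
rewrite (@cost_cat _ m' m n'); last by nlia.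
rewrite (@cost_cat _ m n n'); last by nlia.
have h2 : (n <= b)%N by rewrite (leq_trans nn).
have h3 : (m <= b)%N by rewrite (leq_trans mn).
have := cost_ge0 H am h3; have := cost_ge0 H (leq_trans am (leq_trans mm mn)) nb; lra.
Qed.

Lemma cost_step Z X a b n : run Z X a b -> (a <= n < b)%N -> tk X n <= cost X a b.
Proof.
move=> H /andP[an nb]; have -> : tk X n = cost X n n.+1 by rewrite /cost big_nat1.
exact: (cost_mono H).
Qed.

Lemma run_pos Z X a b n z : run Z X a b -> (a < b)%N -> (a <= n <= b)%N -> z \in Z -> 0 < tx X n z.
Proof.
move=> H ab /andP[an nb] zZ; move: nb; rewrite leq_eqVlt => /predU1P[->|nb].
  have hb : (a <= b.-1 < b)%N by nlia.
  have [_ /(_ z zZ) [_ h _] _ _] := H _ hb; rewrite prednK in h => //; nlia.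
have hn : (a <= n < b)%N by rewrite an.
by have [_ /(_ z zZ) []] := H n hn.
Qed.

Lemma run_disp Z X a b m n z : run Z X a b -> (a <= m <= n)%N -> (n <= b)%N -> z \in Z ->
  dot (disp X m n) (r z) = tx X n z - tx X m z.
Proof.
move=> H /andP[am mn] nb zZ; elim: n mn nb => [|n IH].
  by rewrite leqn0 => /eqP-> _; rewrite subrr /dot big1 // => e _; rewrite /disp big_geq // mul0r.
rewrite leq_eqVlt => /predU1P[<- _|mn nb].
  by rewrite subrr /dot big1 // => e _; rewrite /disp big_geq // mul0r.
have hn : (a <= n < b)%N by nlia.
have [_ /(_ z zZ) [_ _ ->] _ _] := H n hn.
have -> : dot (disp X m n.+1) (r z) = dot (disp X m n) (r z) + dot (tJ X n) (r z).
  by rewrite -dotDl; apply: dot_eq => // e; rewrite /disp big_nat_recr.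
by rewrite IH ?(ltnW nb) //; ring.
Qed.

Definition N_move (Z : {set L}) := forall th, 0 < th -> small (fun eps =>
  forall X a b, run Z X a b -> osc X a b eps -> forall n z, (a <= n <= b)%N -> z \in Z ->
    `|ln (tx X n z) - ln (tx X a z)| <= th \/ eps * tx X a z <= cost X a b).

(** The displacements are close to one of finitely many spaces along which the external force does
    almost no work.  The error is controlled by the cost and the initial amounts, but not by the
    size of the displacement. *)
Definition N_disp (Z : {set L}) := exists s : seq {vspace F}, forall th, 0 < th -> small (fun eps =>
  forall X a b, (a < b)%N -> run Z X a b -> osc X a b eps ->
    exists2 V, V \in s &
      (forall m n, (a <= m <= n)%N -> (n <= b)%N ->
         Near V (disp X m n) ((cost X a b + \sum_(z in Z) tx X a z) / eps)) /\
      forall n, (a <= n < b)%N -> resid V (tg X n) th).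

Lemma ln_le_exp (s t th : R) : 0 < s -> 0 < t -> ln s - ln t <= th -> s <= expR th * t.
Proof.
move=> s0 t0 H; rewrite -[s]lnK ?posrE // -[X in _ * X]lnK ?posrE // -expRD ler_expR; lra.
Qed.

Definition Msup : R := \sum_z norm1 (r z).
Lemma r_le z e : `|r z e| <= Msup.
Proof.
apply: le_trans (norm1_coord _ e) _; rewrite /Msup (bigD1 z) //= lerDl.
by apply: sumr_ge0 => *; exact: norm1_ge0.
Qed.
Lemma Msup_ge0 : 0 <= Msup. Proof. by apply: sumr_ge0 => *; exact: norm1_ge0. Qed.

Definition growth_cst (e0 : R) : R := expR 1 + e0^-1 + expR 1 / kap 1 + expR 1 * expR 1 / e0.

(** Let [m] be the last time with [e0 * tx X m z] at most the cost.  After [m] the amount moves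
    by a bounded factor only, and the step following [m] multiplies it by a bounded factor unless
    the cost already dominates the new amount. *)
Lemma growth_core Z X a b e0 n z : 0 < e0 -> run Z X a b -> (a < b)%N -> (a <= n <= b)%N -> z \in Z ->
  (forall m, (a <= m <= n)%N -> `|ln (tx X n z) - ln (tx X m z)| <= 1 \/ e0 * tx X m z <= cost X a b) ->
  tx X n z <= growth_cst e0 * (tx X a z + cost X a b).
Proof.
move=> e00 HX ab /andP[an nb] zZ H; rewrite /growth_cst.
set k1 := kap 1; have k10 : 0 < k1 by exact: kap0.
set e : R := expR 1; have e1 : 1 <= e by rewrite /e -[X in X <= _]expR0 ler_expR.
set K := cost X a b in H *; have K0 : 0 <= K by exact: (cost_ge0 HX).
have pos m : (a <= m <= b)%N -> 0 < tx X m z by move=> hm; apply: (run_pos HX).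
have xa0 : 0 < tx X a z by apply: pos; rewrite leqnn ltnW.
have t1 : 0 <= e0^-1 * (tx X a z + K) by rewrite mulr_ge0 ?invr_ge0 ?(ltW e00) ?addr_ge0 // ltW.
have t2 : 0 <= e / k1 * (tx X a z + K) by rewrite mulr_ge0 ?divr_ge0 ?expR_ge0 ?(ltW k10) ?addr_ge0 // ltW.
have t3 : 0 <= e * e / e0 * (tx X a z + K) by rewrite mulr_ge0 ?divr_ge0 ?mulr_ge0 ?expR_ge0 ?(ltW e00) ?addr_ge0 // ltW.
have t4 : 0 <= e * (tx X a z + K) by rewrite mulr_ge0 ?expR_ge0 ?addr_ge0 // ltW.
rewrite !mulrDl.
have move m : (a <= m <= n)%N -> K < e0 * tx X m z -> tx X n z <= e * tx X m z.
  move=> /andP[am mn] Km; have [|h'|h'] := H m; first by rewrite am mn.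
    by move: h'; rewrite ler_norml => /andP[_]; apply: ln_le_exp; apply: pos; nlia.
  by move: Km; rewrite ltNge h'.
have [xaK|xaK] := ltP K (e0 * tx X a z).
  have := move a; rewrite leqnn an => /(_ isT xaK).
  have : e * tx X a z <= e * (tx X a z + K) by rewrite ler_pM2l ?expR_gt0 //; lra.
  lra.
have [|m [/andP[am mn] Qm mmax]] := @last_time (fun m => e0 * tx X m z <= K) a n.+1 _ xaK.
  by rewrite ltnS.
have Qm' : tx X m z <= e0^-1 * K by rewrite mulrC ler_pdivlMr // mulrC.
have t1' : e0^-1 * K <= e0^-1 * (tx X a z + K) by rewrite ler_pM2l ?invr_gt0 //; lra.
move: mn; rewrite ltnS leq_eqVlt => /predU1P[mn|mn]; first by subst m; lra.
have Km1 : K < e0 * tx X m.+1 z by rewrite ltNge; apply/negP; apply: mmax; nlia.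
have mv : tx X n z <= e * tx X m.+1 z by apply: move => //; nlia.
have hm : (a <= m < b)%N by nlia.
have [_ _ _ /(_ z 1 zZ ltr01)] := HX m hm.
have kK := cost_step HX hm; rewrite -/K in kK.
case=> [k1x|[h' _]].
  have : tx X m.+1 z <= K / k1.
    rewrite ler_pdivlMr // mulrC; apply: le_trans kK; apply: le_trans k1x.
    by rewrite ler_pM2l // le_max lexx orbT.
  rewrite -(ler_pM2l (expR_gt0 1)) -/e mulrA => h.
  have : e / k1 * K <= e / k1 * (tx X a z + K) by rewrite ler_pM2l ?divr_gt0 ?expR_gt0 //; lra.
  have -> : e / k1 * K = e * K / k1 by ring.
  lra.
have : tx X m.+1 z <= e * tx X m z.
  by move: h'; rewrite ler_norml => /andP[_]; apply: ln_le_exp; apply: pos; nlia.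
rewrite -(ler_pM2l (expR_gt0 1)) -/e.
have : e * (e * tx X m z) <= e * (e * (e0^-1 * (tx X a z + K))).
  by rewrite !ler_pM2l ?expR_gt0 //; lra.
have -> : e * (e * (e0^-1 * (tx X a z + K))) = e * e / e0 * (tx X a z + K) by ring.
lra.
Qed.

Lemma growth_bound Z : N_move Z -> exists2 e0 : R, 0 < e0 & exists2 C : R, 1 <= C &
  forall X a b, run Z X a b -> osc X a b e0 -> (a < b)%N -> forall n z, (a <= n <= b)%N -> z \in Z ->
    tx X n z <= C * (tx X a z + cost X a b).
Proof.
move=> /(_ 1 ltr01) [e0 e00 H]; exists e0 => //; exists (growth_cst e0).
  have k10 : 0 < kap 1 by exact: kap0.
  have e1 : 1 <= expR 1 :> R by rewrite -[X in X <= _]expR0 ler_expR.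
  have p1 : 0 < e0^-1 by rewrite invr_gt0.
  have p2 : 0 < expR 1 / kap 1 by rewrite divr_gt0 // expR_gt0.
  have p3 : 0 < expR 1 * expR 1 / e0 by rewrite divr_gt0 // mulr_gt0 // expR_gt0.
  by rewrite /growth_cst; lra.
move=> X a b HX Hosc ab n z hn zZ; have /andP[an nb] := hn.
apply: (growth_core e00 HX ab hn zZ) => m /andP[am mn].
have Hr : run Z X m n by exact: run_sub HX.
have Ho : osc X m n e0 by exact: osc_sub Hosc.
have [|h'|h'] := H e0 e00 (lexx _) X m n Hr Ho n z _ zZ; first by rewrite leqnn mn.
  by left.
by right; apply: le_trans h' _; exact: (cost_mono HX).
Qed.

(** Without components, the channels whose external force is not small carry a total flux bounded by
    the cost.  The spaces are spanned by the other channels. *)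
Lemma N_disp0 : N_disp finset.set0.
Proof.
pose W (T : {set E}) : {vspace F} := (\bigcap_(e in ~: T) kerf (fun e' => (e' == e)%:R))%VS.
have WP (T : {set E}) (v : F) : reflect (forall e, e \notin T -> v e = 0) (v \in W T).
  rewrite memvE; apply: (iffP subv_bigcapP) => H e eT.
    have := H e; rewrite inE -memvE mem_kerf => /(_ eT) /eqP <-.
    rewrite /dot (bigD1 e) //= eqxx mulr1 big1 ?addr0 // => e' /negbTE ->; by rewrite mulr0.
  rewrite -memvE mem_kerf /dot (bigD1 e) //= eqxx mulr1 H ?add0r; last by rewrite inE in eT.
  by rewrite big1 // => e' /negbTE ->; rewrite mulr0.
exists [seq W T | T <- enum {set E}] => th th0.
have th40 : 0 < th / 4 by lra.
have h1 := @small_le R 1 _ th40.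
have h2 := @small_le R (#|E|%:R * (4 / th)) 1 ltr01.
apply: small_imp (small_and h1 h2) => eps eps0 [{}h1 {}h2] X a b ab HX Hosc.
rewrite mul1r in h1.
pose T := [set e | `|tg X a e| <= th / 2].
exists (W T); first by apply: map_f; rewrite mem_enum.
have K0 : 0 <= cost X a b by exact: (cost_ge0 HX).
have close n e : (a <= n < b)%N -> `|tg X n e - tg X a e| <= th / 4.
  by move=> hn; apply: le_trans h1; apply: Hosc => //; nlia.
split=> [m n /andP[am mn] nb|n hn v /WP vW]; last first.
  rewrite /dot; apply: le_trans (ler_norm_sum _ _ _) _; rewrite /norm1 mulr_sumr; apply: ler_sum => e _.
  have [eT|eT] := boolP (e \in T); last by rewrite vW // mulr0 normr0 mulr0.
  rewrite normrM ler_wpM2r //; have := close n e hn; move: eT; rewrite inE.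
  by have := ler_normD (tg X a e) (tg X n e - tg X a e); rewrite addrC subrK; lra.
exists [ffun e => if e \in T then disp X m n e : R^o else 0].
  by apply/WP => e /negbTE eT; rewrite ffunE eT.
apply: (@le_trans _ _ (#|E|%:R * (4 / th * cost X a b))); last first.
  rewrite big_set0 addr0 ler_pdivlMr //; set c := _%:R in h2 *; set K := cost X a b in K0 *.
  have -> : c * (4 / th * K) * eps = c * (4 / th) * eps * K by ring.
  by rewrite -[leRHS]mul1r ler_wpM2r.
rewrite /norm1 -sum1_card natr_sum mulr_suml; apply: ler_sum => e _; rewrite mul1r ffunE.
case: ifPn => eT; first by rewrite subrr normr0 mulr_ge0 // divr_ge0 // ltW.
rewrite subr0; apply: le_trans (ler_norm_sum _ _ _) _.
have C1 := cost_mono HX (leqnn a) (leqnn b) am nb.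
apply: (@le_trans _ _ (4 / th * cost X m n)); last by rewrite ler_pM2l // divr_gt0.
rewrite /cost mulr_sumr big_nat [leRHS]big_nat; apply: ler_sum => i hi.
have hi' : (a <= i < b)%N by nlia.
have [_ _ /(_ e)] := HX i hi'; rewrite big_set0 addr0 => Jg _.
have gi : th / 4 <= `|tg X i e|.
  have := close i e hi'; move: eT; rewrite inE -ltNge.
  by have := ler_normD (tg X i e) (tg X a e - tg X i e); rewrite distrC addrC subrK distrC; lra.
rewrite -[4 / th]invrK invf_div mulrC ler_pdivlMr //.
by apply: le_trans Jg; apply: ler_wpM2l.
Qed.

End Run.

(** * Displacements at small cost *)

Lemma small_seq (R : realType) (T : eqType) (s : seq T) (P : T -> R -> Prop) :
  (forall i, i \in s -> small (P i)) -> small (fun d => forall i, i \in s -> P i d).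
Proof.
elim: s => [|i s IH] H; first by exists 1.
have h1 := H i (mem_head _ _).
have h2 : small (fun d => forall i, i \in s -> P i d) by apply: IH => j js; apply: H; rewrite inE js orbT.
apply: small_imp (small_and h1 h2) => d _ [k1 k2] j; rewrite inE => /predU1P[->|] //; exact: k2.
Qed.

Lemma first_time (Q : nat -> Prop) (a b : nat) : (exists2 n, (a < n <= b)%N & Q n) ->
  exists n, [/\ (a < n <= b)%N, Q n & forall m, (a < m < n)%N -> ~ Q m].
Proof.
case=> n0 h0 Q0; pose P t := (a < t <= b)%N && `[< Q t >].
have exP : exists t, P t by exists n0; rewrite /P h0; apply/asboolP.
case: (ex_minnP exP) => n /andP[hn /asboolP Qn] nmin; exists n; split=> // m hm Qm.
have : P m by rewrite /P; apply/andP; split; [nlia|apply/asboolP].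
by move/nmin; nlia.
Qed.

Section Disp.
Variables (R : realType) (L E : finType) (r : L -> E -> R) (kap : R -> R).
Hypothesis kap0 : forall th, 0 < th -> 0 < kap th.
Local Notation F := {ffun E -> R^o}.
Local Notation run := (run r kap).
Implicit Types (Z C : {set L}) (X : traj R L E).
Local Notation N_move := (N_move r kap).
Local Notation N_disp := (N_disp r kap).
Local Notation Msup := (Msup r).
Local Notation freeze := (freeze r).

Lemma sum_subv (T T' : seq {vspace F}) : {subset T <= T'} -> (\sum_(V <- T) V <= \sum_(V <- T') V)%VS.
Proof.
have mem (W : {vspace F}) (S : seq {vspace F}) : W \in S -> (W <= \sum_(V <- S) V)%VS.
  elim: S => // V S IH; rewrite inE big_cons => /predU1P[->|/IH h]; first exact: addvSl.
  by apply: subv_trans h _; exact: addvSr.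
elim: T => [|V T IH] sT; first by rewrite big_nil sub0v.
rewrite big_cons subv_add mem ?sT ?mem_head //=; apply: IH => W WT; apply: sT.
by rewrite inE WT orbT.
Qed.

(** A displacement across [c] is the sum of one before and one after. *)
Lemma near_cut X (V : {vspace F}) a c b d1 d2 : (a <= c <= b)%N -> 0 <= d1 -> 0 <= d2 ->
  (forall m n, (a <= m <= n)%N -> (n <= c)%N -> Near V (disp X m n) d1) ->
  (forall m n, (c <= m <= n)%N -> (n <= b)%N -> Near V (disp X m n) d2) ->
  forall m n, (a <= m <= n)%N -> (n <= b)%N -> Near V (disp X m n) (d1 + d2).
Proof.
move=> acb d10 d20 h1 h2 m n amn nb.
have [nc|cn] := leqP n c; first by apply: Near_le (h1 m n amn nc) => //; rewrite lerDl.
have [cm|mc] := leqP c m; first by apply: Near_le (h2 m n _ nb) => //; [rewrite lerDr | nlia].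
have e : (fun e => disp X m c e + disp X c n e) =1 disp X m n.
  by move=> e; rewrite -disp_cat //; nlia.
by apply: Near_eq e _; apply: NearD; [apply: h1 | apply: h2]; nlia.
Qed.

Lemma osc_freeze C X a b eps eps' : osc X a b eps ->
  (forall n m, (a <= n < b)%N -> (a <= m < b)%N -> \sum_(z in C) `|ty X n z - ty X m z| * Msup <= eps') ->
  osc (freeze C X) a b (eps + eps').
Proof.
move=> H1 H2 n m e hn hm /=.
have -> : tg X n e + \sum_(z in C) ty X n z * r z e - (tg X m e + \sum_(z in C) ty X m z * r z e) =
  (tg X n e - tg X m e) + \sum_(z in C) (ty X n z - ty X m z) * r z e.
  by under [X in _ = _ + X]eq_bigr do rewrite mulrBl; rewrite sumrB; ring.
apply: le_trans (ler_normD _ _) (lerD (H1 n m e hn hm) _); apply: le_trans (H2 n m hn hm).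
apply: le_trans (ler_norm_sum _ _ _) _; apply: ler_sum => z _; rewrite normrM ler_wpM2l //; exact: r_le.
Qed.

Section Step.
Variables (Z : {set L}) (s : L -> seq {vspace F}) (th2 e1 dk e0 C th' : R).
Hypotheses (e10 : 0 < e1) (dk0 : 0 < dk) (e00 : 0 < e0) (C1 : 1 <= C) (th'0 : 0 < th') (th'1 : th' <= 1).
Hypothesis thM : 4 * th' * Msup <= e1 / 2.
Hypothesis e0e1 : e0 <= e1 / 2.
Hypothesis Hdisp : forall z, z \in Z -> forall X a b, (a < b)%N -> run (Z :\ z) X a b -> osc X a b e1 ->
  exists2 V, V \in s z &
      (forall m n, (a <= m <= n)%N -> (n <= b)%N ->
         Near V (disp X m n) ((cost X a b + \sum_(i in Z :\ z) tx X a i) / e1)) /\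
      forall n, (a <= n < b)%N -> resid V (tg X n) th2.
Hypothesis Hker : forall z V, z \in Z -> V \in s z -> forall j d, Near V j d -> `|dot j (r z)| <= d ->
  Near (V :&: kerf (r z)) j (d / dk).
Hypothesis Hgrow : forall X a b, run Z X a b -> osc X a b e0 -> (a < b)%N -> forall n z, (a <= n <= b)%N -> z \in Z ->
    tx X n z <= C * (tx X a z + cost X a b).
Hypothesis Hmove : forall X a b, run Z X a b -> osc X a b e0 -> forall n z, (a <= n <= b)%N -> z \in Z ->
    `|ln (tx X n z) - ln (tx X a z)| <= th' \/ e0 * tx X a z <= cost X a b.

Definition spaces : seq {vspace F} := flatten [seq [seq (V :&: kerf (r z))%VS | V <- s z] | z <- enum Z].

Lemma tx_sum X a b z : run Z X a b -> (a < b)%N -> z \in Z -> tx X a z <= \sum_(i in Z) tx X a i.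
Proof.
move=> HX ab zZ; rewrite (bigD1 z) //= lerDl; apply: sumr_ge0 => i /andP[iZ _].
by apply/ltW/(run_pos HX ab) => //; rewrite leqnn ltnW.
Qed.

(** While [z] hardly moves it can be frozen, and the displacements almost preserve its amount: they
    are close to the intersection of a space for [Z :\ z] with the kernel of [r z]. *)
Lemma good_window X a b z D : z \in Z -> (a < b)%N -> run Z X a b -> osc X a b e0 ->
  (forall n, (a <= n <= b)%N -> tx X n z <= D) ->
  (forall n m, (a <= n < b)%N -> (a <= m < b)%N -> `|ty X n z - ty X m z| <= 4 * th') ->
  exists2 V, V \in spaces &
    (forall m n, (a <= m <= n)%N -> (n <= b)%N ->
      Near V (disp X m n) (((cost X a b + \sum_(i in Z) tx X a i) / e1 + D) / dk)) /\
    forall n, (a <= n < b)%N -> resid V (tg X n) th2.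
Proof.
move=> zZ ab HX Hosc HD Hy.
have Hf : run (Z :\ z) (freeze [set z] X) a b by apply: run_freeze => //; rewrite finset.sub1set.
have Ho : osc (freeze [set z] X) a b e1.
  apply: (@osc_sub _ _ _ _ a b a b (e0 + e1 / 2)) => //; first by rewrite [leRHS]splitr lerD2r.
  apply: osc_freeze => // n m hn hm; rewrite big_set1; apply: le_trans thM.
  by apply: ler_wpM2r; [exact: Msup_ge0 | exact: Hy].
have [V Vs [near res]] := Hdisp zZ ab Hf Ho.
exists (V :&: kerf (r z))%VS.
  by apply/flatten_mapP; exists z; rewrite ?mem_enum //; exact: map_f.
have xa0 i : i \in Z -> 0 <= tx X a i by move=> iZ; apply/ltW/(run_pos HX ab) => //; rewrite leqnn ltnW.
have K0 : 0 <= cost X a b by exact: (cost_ge0 HX).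
have D0 : 0 <= D by apply: le_trans (xa0 z zZ) (HD a _); rewrite leqnn ltnW.
have S0 : 0 <= \sum_(i in Z) tx X a i by apply: sumr_ge0.
split=> [m n amn nb|n hn v]; last first.
  rewrite memv_cap mem_kerf => /andP[vV /eqP vr]; have := res n hn v vV.
  have -> // : dot (tg (freeze [set z] X) n) v = dot (tg X n) v.
  rewrite /= dotDl -[RHS]addr0; congr (_ + _).
  rewrite /dot; under eq_bigr do rewrite big_set1 -mulrA.
  rewrite -mulr_sumr; have -> : \sum_e r z e * v e = dot v (r z) by apply: eq_bigr => e _; rewrite mulrC.
  by rewrite vr mulr0.
apply: Hker => //.
  apply: Near_le (near m n amn nb) => //; apply: le_trans (_ : _ <= (cost X a b + \sum_(i in Z) tx X a i) / e1) _; last by rewrite lerDl.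
  rewrite ler_pM2r ?invr_gt0 // lerD2l [leRHS](bigD1 z) //=.
  rewrite (eq_bigl (fun i => (i \in Z) && (i != z))) ?lerDr ?xa0 // => i.
  by rewrite !inE andbC.
rewrite (run_disp HX) //.
have pos i : (a <= i <= b)%N -> 0 < tx X i z by move=> hi; apply: (run_pos HX).
have h1 := HD n; have h2 := HD m; have p1 := pos n; have p2 := pos m.
have h : 0 <= (cost X a b + \sum_(i in Z) tx X a i) / e1 by rewrite divr_ge0 ?addr_ge0 // ltW.
have hn : (a <= n <= b)%N by nlia.
have hm : (a <= m <= b)%N by nlia.
move: (h1 hn) (h2 hm) (p1 hn) (p2 hm) => *; rewrite ler_norml; apply/andP; split; lra.
Qed.

Let N : R := #|L|%:R.
Let ee : R := expR 1.
Let eta := Num.min e0 (kap th' / ee).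
Let A := ((1 + C * (N + 1)) / e1 + C + ee) / dk.
Definition dispK1 := 2 * A.
Definition dispK2 := 2 * A + dispK1 * (C * N * (eta^-1 + 1)).

(** Let [z] have the largest amount.  Up to the first time at which [z] moves, [good_window] applies,
    and the step of that time is a window of its own.  Moving [z] costs a fraction of its amount,
    hence a fraction of all amounts; this pays for the growth of the amounts in the remaining time
    interval, which is treated by induction.  Only finitely many spaces occur, so the sum of the
    spaces of all windows does not depend on the number of windows. *)
Lemma windows k X a b : (b - a <= k)%N -> (a < b)%N -> run Z X a b -> osc X a b e0 -> Z != finset.set0 ->
  exists T : seq {vspace F}, [/\ {subset T <= spaces},
    forall V, V \in T -> exists2 n, (a <= n < b)%N & resid V (tg X n) th2 &
    forall m n, (a <= m <= n)%N -> (n <= b)%N ->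
      Near (\sum_(V <- T) V)%VS (disp X m n) (dispK2 * cost X a b + dispK1 * \sum_(i in Z) tx X a i)].
Proof.
elim: k X a b => [|k IH] X a b; first by nlia.
move=> bak ab HX Hosc Z0.
have C1_ := C1; have th'0_ := th'0; have th'1_ := th'1; have e00_ := e00.
have ee1 : 1 <= ee by rewrite /ee -[X in X <= _]expR0 ler_expR.
have eeth : expR th' <= ee by rewrite ler_expR.
have N0 : 0 <= N by exact: ler0n.
have eta0 : 0 < eta by rewrite lt_min e00 divr_gt0 // ?kap0 // expR_gt0.
have A0 : 0 <= A.
  rewrite divr_ge0 ?(ltW dk0) // !addr_ge0 ?divr_ge0 ?(ltW e10) ?addr_ge0 ?mulr_ge0 ?addr_ge0 //; lra.
have xpos n i : (a <= n <= b)%N -> i \in Z -> 0 < tx X n i by move=> *; apply: (run_pos HX).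
have haa : (a <= a <= b)%N by rewrite leqnn ltnW.
set c := cost X a b; have c0 : 0 <= c by exact: (cost_ge0 HX).
set S := \sum_(i in Z) tx X a i.
have S0 : 0 <= S by apply: sumr_ge0 => i iZ; exact/ltW/xpos.
have [z zZ zmax] : exists2 z, z \in Z & forall i, i \in Z -> tx X a i <= tx X a z.
  case/finset.set0Pn: Z0 => z0 z0Z; case: (@arg_maxP _ _ _ z0 (mem Z) (tx X a) z0Z) => z zZ zm.
  by exists z.
have xzS : tx X a z <= S by exact: tx_sum HX ab zZ.
have SN : S <= N * tx X a z.
  rewrite /S /N -sum1_card natr_sum mulr_suml big_mkcond /=; apply: ler_sum => i _; rewrite mul1r.
  by case: ifP => iZ; [exact: zmax | exact/ltW/xpos].
pose bad n := (th' < `|ln (tx X n z) - ln (tx X a z)|) || (2 * th' < `|ty X n.-1 z - ln (tx X a z)|).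
have goodx n : (a <= n <= b)%N -> ~~ bad n -> tx X n z <= ee * tx X a z /\ tx X a z <= ee * tx X n z.
  move=> hn; rewrite /bad negb_or -!leNgt => /andP[h _].
  have [h1 h2] : ln (tx X n z) - ln (tx X a z) <= th' /\ ln (tx X a z) - ln (tx X n z) <= th'.
    by move: h; rewrite ler_norml => /andP[]; split; lra.
  have x1 := xpos n z hn zZ; have x2 := xpos a z haa zZ.
  split; [apply: le_trans (ln_le_exp x1 x2 h1) _ | apply: le_trans (ln_le_exp x2 x1 h2) _].
    by apply: ler_wpM2r eeth; exact: ltW.
  by apply: ler_wpM2r eeth; exact: ltW.
have AA (c1 S1 D1 : R) : 0 <= c1 -> S1 <= C * (S + N * c1) -> D1 <= C * (S + c1) + ee * S ->
   ((c1 + S1) / e1 + D1) / dk <= A * (c1 + S).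
  move=> c10 hS1 hD1; rewrite /A mulrAC ler_pM2r ?invr_gt0 //.
  have h1 : (c1 + S1) / e1 <= (1 + C * (N + 1)) / e1 * (c1 + S).
    rewrite mulrAC ler_pM2r ?invr_gt0 //.
    have : 0 <= C * N * S by rewrite !mulr_ge0 //; lra.
    have : 0 <= C * c1 by rewrite mulr_ge0 //; lra.
    lra.
  have : 0 <= ee * c1 by rewrite mulr_ge0 // expR_ge0.
  lra.
have p1 : 0 <= A * c by rewrite mulr_ge0.
have p2 : 0 <= A * S by rewrite mulr_ge0.
have p3 : 0 <= dispK1 * (C * N * (eta^-1 + 1)).
  have h1 : 0 <= C * N by rewrite mulr_ge0 // (le_trans ler01 C1).
  have h2 : 0 <= dispK1 by rewrite mulr_ge0.
  have h3 : 0 <= eta^-1 + 1 by rewrite addr_ge0 // invr_ge0 ltW.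
  exact: mulr_ge0 h2 (mulr_ge0 h1 h3).
have [ex|nex] := pselect (exists2 n, (a < n <= b)%N & bad n); last first.
  have nobad n : (a < n <= b)%N -> ~~ bad n by move=> h; apply/negP => h'; apply: nex; exists n.
  have [||V Vsp [near res]] := @good_window X a b z (ee * tx X a z) zZ ab HX Hosc.
  - move=> n /andP[]; rewrite leq_eqVlt => /predU1P[<-|an] nb; first by rewrite ler_peMl // ltW // xpos.
    have hn : (a < n <= b)%N by rewrite an.
    by apply: (goodx n _ (nobad n hn)).1; rewrite (ltnW an).
  - have hy i : (a <= i < b)%N -> `|ty X i z - ln (tx X a z)| <= 2 * th'.
      by move=> hi; have := nobad i.+1 hi; rewrite /bad negb_or -!leNgt /= => /andP[].
    move=> n m /hy h1 /hy h2; rewrite (_ : _ - _ = (ty X n z - ln (tx X a z)) - (ty X m z - ln (tx X a z))); last by ring.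
    by apply: le_trans (ler_normB _ _) _; rewrite (_ : 4 * th' = 2 * th' + 2 * th') ?lerD //; ring.
  exists [:: V]; split.
  - by move=> V'; rewrite inE => /eqP ->.
  - by move=> V'; rewrite inE => /eqP ->; exists a; rewrite ?leqnn ?ab //; apply: res; rewrite leqnn ab.
  move=> m n amn nb; rewrite big_seq1; apply: Near_le (near m n amn nb) => //.
  apply: le_trans (AA c S (ee * tx X a z) c0 _ _) _.
  - rewrite mulrDr; apply: le_trans (_ : C * S <= _); first by rewrite ler_peMl.
    by rewrite lerDl !mulr_ge0 // (le_trans ler01 C1).
  - apply: (@le_trans _ _ (ee * S)); first by rewrite ler_pM2l // expR_gt0.
    by rewrite lerDr mulr_ge0 ?addr_ge0 // (le_trans ler01 C1).
  have p4 : 0 <= dispK1 * (C * N * (eta^-1 + 1)) * c by rewrite mulr_ge0.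
  rewrite /dispK2 mulrDl; rewrite {2}/dispK1; move: p1 p2 p4; set q := _ * (_ * _ * _) * c; lra.
have [a1 [/andP[aa1 a1b] bad1 a1min]] := first_time ex.
have good1 n : (a < n < a1)%N -> ~~ bad n by move=> h; apply/negP; exact: a1min.
set c1 := cost X a a1; set c2 := cost X a1 b.
have cc : c = c1 + c2 by rewrite /c (@cost_cat _ _ _ _ _ a1) // ltnW.
have HX1 : run Z X a a1 by exact: run_sub HX.
have Ho1 : osc X a a1 e0 by exact: osc_sub Hosc.
have c10 : 0 <= c1 by exact: (cost_ge0 HX1).
have c20 : 0 <= c2 by apply: (cost_ge0 HX) => //; exact: ltnW.
have ap : (a <= a1.-1 < a1)%N by nlia.
have lnp : `|ln (tx X a1.-1 z) - ln (tx X a z)| <= th'.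
  have [<-|nap] := eqVneq a a1.-1; first by rewrite subrr normr0 ltW.
  by have := good1 a1.-1; rewrite /bad negb_or -!leNgt => h; have /h/andP[] : (a < a1.-1 < a1)%N by nlia.
have eta_le : eta * tx X a z <= c1.
  have xa0 := xpos a z haa zZ.
  move: bad1; rewrite /bad => /orP[b1|b1].
    have [|h|h] := Hmove HX1 Ho1 (n := a1) _ zZ; first by rewrite leqnn ltnW.
      by move: b1; rewrite ltNge h.
    by apply: le_trans h; rewrite ler_pM2r // ge_min lexx.
  have [_ _ _ /(_ z th' zZ th'0)] := HX1 a1.-1 ap; case=> [h|[_ h]].
    have kc := cost_step HX1 ap.
    have hp : (a <= a1.-1 <= b)%N by nlia.
    have xp0 := xpos a1.-1 z hp zZ.
    have h1 : tx X a z <= ee * tx X a1.-1 z.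
      apply: (@le_trans _ _ (expR th' * tx X a1.-1 z)).
        by apply: ln_le_exp => //; move: lnp; rewrite ler_norml => /andP[? ?]; lra.
      by apply: ler_wpM2r eeth; exact: ltW.
    apply: le_trans kc; apply: le_trans h.
    apply: (@le_trans _ _ (kap th' / ee * tx X a z)).
      by rewrite ler_pM2r // ge_min lexx orbT.
    rewrite -mulrA ler_pM2l ?kap0 // ler_pdivrMl ?expR_gt0 //.
    by apply: le_trans h1 _; rewrite ler_pM2l ?expR_gt0 // le_max lexx.
  exfalso; move: b1; rewrite ltNge => /negP; apply.
  rewrite (_ : _ - _ = (ty X a1.-1 z - ln (tx X a1.-1 z)) + (ln (tx X a1.-1 z) - ln (tx X a z))); last by ring.
  by apply: le_trans (ler_normD _ _) _; rewrite (_ : 2 * th' = th' + th') ?lerD //; ring.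
have grow n i : (a <= n <= a1)%N -> i \in Z -> tx X n i <= C * (tx X a i + c1).
  by move=> hn iZ; exact: (Hgrow HX1 Ho1).
have growS n : (a <= n <= a1)%N -> \sum_(i in Z) tx X n i <= C * (S + N * c1).
  move=> hn; apply: le_trans (ler_sum _ (fun i iZ => grow n i hn iZ)) _.
  rewrite -mulr_sumr ler_pM2l ?(lt_le_trans _ C1) // big_split /= lerD2l.
  rewrite sumr_const -[_ *+ _]mulr_natl ler_wpM2r // ler_nat; exact: max_card.
have xaS : tx X a z + c1 <= S + c1 by rewrite lerD2r.
have C0 : 0 < C by exact: lt_le_trans C1.
have [T1 [sT1 rT1 nT1]] : exists T : seq {vspace F}, [/\ {subset T <= spaces},
    forall V, V \in T -> exists2 n, (a <= n < b)%N & resid V (tg X n) th2 &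
    forall m n, (a <= m <= n)%N -> (n <= a1.-1)%N -> Near (\sum_(V <- T) V)%VS (disp X m n) (A * (c1 + S))].
  have [aa|naa] := eqVneq a a1.-1.
    exists [::]; split=> // m n amn nb.
    have -> : n = m by nlia.
    have e : (fun=> 0) =1 disp X m m by move=> e; rewrite /disp big_geq.
    by apply: Near_eq e _; apply: Near0; rewrite mulr_ge0 ?addr_ge0.
  have ap' : (a < a1.-1)%N by nlia.
  have pb : (a1.-1 <= b)%N by nlia.
  have HXp : run Z X a a1.-1 by exact: run_sub HX.
  have Hop : osc X a a1.-1 e0 by exact: osc_sub Hosc.
  have [||V Vsp [near res]] := @good_window X a a1.-1 z (ee * tx X a z) zZ ap' HXp Hop.
  - move=> n /andP[]; rewrite leq_eqVlt => /predU1P[<-|an] nb; first by rewrite ler_peMl // ltW // xpos.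
    have hn : (a < n < a1)%N by nlia.
    by apply: (goodx n _ (good1 n hn)).1; nlia.
  - have hy i : (a <= i < a1.-1)%N -> `|ty X i z - ln (tx X a z)| <= 2 * th'.
      move=> hi; have hi1 : (a < i.+1 < a1)%N by nlia.
      by have := good1 i.+1 hi1; rewrite /bad negb_or -!leNgt /= => /andP[].
    move=> n m /hy h1 /hy h2; rewrite (_ : _ - _ = (ty X n z - ln (tx X a z)) - (ty X m z - ln (tx X a z))); last by ring.
    by apply: le_trans (ler_normB _ _) _; rewrite (_ : 4 * th' = 2 * th' + 2 * th') ?lerD //; ring.
  exists [:: V]; split.
  - by move=> V'; rewrite inE => /eqP ->.
  - move=> V'; rewrite inE => /eqP ->; exists a; rewrite ?leqnn ?ab //; apply: res; rewrite leqnn //.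
  move=> m n amn nb; rewrite big_seq1; apply: Near_le (near m n amn nb) => //.
  apply: le_trans (AA (cost X a a1.-1) S (ee * tx X a z) _ _ _) _.
  - exact: (cost_ge0 HXp).
  - rewrite mulrDr; apply: le_trans (_ : C * S <= _); first by rewrite ler_peMl.
    by rewrite lerDl !mulr_ge0 ?(ltW C0) //; exact: (cost_ge0 HXp).
  - apply: (@le_trans _ _ (ee * S)); first by rewrite ler_pM2l // expR_gt0.
    by rewrite lerDr mulr_ge0 ?addr_ge0 ?(ltW C0) //; exact: (cost_ge0 HXp).
  rewrite ler_wpM2l // lerD2r; apply: (cost_mono HX) => //; nlia.
have [V2 V2s [n2 r2]] : exists2 V, V \in spaces &
    (forall m n, (a1.-1 <= m <= n)%N -> (n <= a1)%N -> Near V (disp X m n) (A * (c1 + S))) /\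
    forall n, (a1.-1 <= n < a1)%N -> resid V (tg X n) th2.
  have pa : (a1.-1 < a1)%N by nlia.
  have HXp : run Z X a1.-1 a1 by apply: run_sub HX => //; nlia.
  have Hop : osc X a1.-1 a1 e0 by apply: osc_sub Hosc => //; nlia.
  have [||V Vsp [near res]] := @good_window X a1.-1 a1 z (C * (S + c1)) zZ pa HXp Hop.
  - move=> n hn; apply: le_trans (grow n z _ zZ) _; first by nlia.
    by rewrite ler_pM2l.
  - move=> n m hn hm; have -> : n = m by nlia.
    by rewrite subrr normr0 mulr_ge0 // ltW.
  exists V => //; split=> // m n amn nb; apply: Near_le (near m n amn nb) => //.
  apply: le_trans (_ : ((c1 + \sum_(i in Z) tx X a1.-1 i) / e1 + C * (S + c1)) / dk <= _).
    rewrite ler_pM2r ?invr_gt0 // lerD2r ler_pM2r ?invr_gt0 // lerD2r.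
    by apply: (cost_mono HX1) => //; nlia.
  apply: AA => //; first by apply: growS; nlia.
  by rewrite lerDl mulr_ge0 // expR_ge0.
have [T3 [sT3 rT3 nT3]] : exists T : seq {vspace F}, [/\ {subset T <= spaces},
    forall V, V \in T -> exists2 n, (a <= n < b)%N & resid V (tg X n) th2 &
    forall m n, (a1 <= m <= n)%N -> (n <= b)%N ->
      Near (\sum_(V <- T) V)%VS (disp X m n) (dispK2 * c2 + dispK1 * (C * N * (eta^-1 + 1)) * c1)].
  have dK20 : 0 <= dispK2 by rewrite addr_ge0 // mulr_ge0.
  have [a1b'|a1b'] := eqVneq a1 b.
    exists [::]; split=> // m n amn nb.
    have -> : n = m by nlia.
    have e : (fun=> 0) =1 disp X m m by move=> e; rewrite /disp big_geq.
    by apply: Near_eq e _; apply: Near0; rewrite addr_ge0 // mulr_ge0.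
  have a1lb : (a1 < b)%N by nlia.
  have HX3 : run Z X a1 b by apply: run_sub HX => //; nlia.
  have Ho3 : osc X a1 b e0 by apply: osc_sub Hosc => //; nlia.
  have bk : (b - a1 <= k)%N by nlia.
  have [T [sT rT nT]] := IH X a1 b bk a1lb HX3 Ho3 Z0.
  exists T; split=> // [V /rT[n hn rn]|m n amn nb]; first by exists n => //; nlia.
  apply: Near_le (nT m n amn nb) => //; rewrite lerD2l -[leRHS]mulrA; apply: ler_wpM2l; first by rewrite mulr_ge0.
  have ha1 : (a <= a1 <= a1)%N by nlia.
  apply: le_trans (growS a1 ha1) _.
  rewrite -!mulrA ler_pM2l // mulrDl mul1r mulrDr lerD2r.
  apply: le_trans SN _; rewrite ler_wpM2l // mulrC ler_pdivlMr // mulrC.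
  exact: eta_le.
exists (T1 ++ V2 :: T3); split.
- move=> V; rewrite mem_cat inE => /or3P[/sT1|/eqP ->|/sT3] //.
- move=> V; rewrite mem_cat inE => /or3P[/rT1|/eqP ->|/rT3] //.
  by exists a1.-1; [nlia | apply: r2; nlia].
set W := (\sum_(V <- _) V)%VS.
have s1 : (\sum_(V <- T1) V <= W)%VS by apply: sum_subv => V VT; rewrite mem_cat VT.
have s2 : (V2 <= W)%VS.
  have -> : V2 = (\sum_(V <- [:: V2]) V)%VS by rewrite big_seq1.
  by apply: sum_subv => V; rewrite inE => /eqP ->; rewrite mem_cat mem_head orbT.
have s3 : (\sum_(V <- T3) V <= W)%VS by apply: sum_subv => V VT; rewrite mem_cat inE VT !orbT.
have n12 : forall m n, (a <= m <= n)%N -> (n <= a1)%N -> Near W (disp X m n) (A * (c1 + S) + A * (c1 + S)).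
  apply: (@near_cut _ _ _ a1.-1); first by nlia.
  - by rewrite mulr_ge0 // addr_ge0.
  - by rewrite mulr_ge0 // addr_ge0.
  - by move=> m n amn nb; apply: Near_le (nT1 m n amn nb).
  - by move=> m n amn nb; apply: Near_le (n2 m n amn nb).
have dK20 : 0 <= dispK2 by rewrite addr_ge0 // mulr_ge0.
have n123 : forall m n, (a <= m <= n)%N -> (n <= b)%N -> Near W (disp X m n) ((A * (c1 + S) + A * (c1 + S)) + (dispK2 * c2 + dispK1 * (C * N * (eta^-1 + 1)) * c1)).
  apply: (@near_cut _ _ _ a1); first by nlia.
  - by rewrite addr_ge0 // mulr_ge0 // addr_ge0.
  - by rewrite addr_ge0 // mulr_ge0.
  - exact: n12.
  - by move=> m n amn nb; apply: Near_le (nT3 m n amn nb).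
move=> m n amn nb; apply: Near_le (n123 m n amn nb) => //.
rewrite cc; set dk2 := dispK2; rewrite (_ : dk2 * (c1 + c2) = dk2 * c2 + dk2 * c1); last by ring.
rewrite {3}/dk2 /dispK2 /dispK1 le_eqVlt; apply/orP; left; apply/eqP; ring.
Qed.

End Step.

Lemma near_small (z : L) (V : {vspace F}) : small (fun dk => forall j d, Near V j d -> `|dot j (r z)| <= d ->
  Near (V :&: kerf (r z)) j (d / dk)).
Proof.
have [K K0 H] := Near_ker V (r z); exists K^-1; first by rewrite invr_gt0.
move=> d0 d00 dK j d h1 h2.
have d_ge : 0 <= d by apply: le_trans h2.
apply: Near_le (H j d h1 h2) => //; rewrite mulrC ler_wpM2l //.
by rewrite -[K]invrK lef_pV2 ?posrE // invr_gt0.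
Qed.

(** The spaces are the sums of the subsets of the finite list [spaces]. *)
Lemma disp_step Z : Z != finset.set0 -> N_move Z -> (forall z, z \in Z -> N_disp (Z :\ z)) -> N_disp Z.
Proof.
move=> Z0 HM HD.
have /choice[s Hs] : forall z, exists sz : seq {vspace F}, z \in Z -> forall th, 0 < th -> small (fun eps =>
  forall X a b, (a < b)%N -> run (Z :\ z) X a b -> osc X a b eps ->
    exists2 V, V \in sz &
      (forall m n, (a <= m <= n)%N -> (n <= b)%N ->
         Near V (disp X m n) ((cost X a b + \sum_(i in Z :\ z) tx X a i) / eps)) /\
      forall n, (a <= n < b)%N -> resid V (tg X n) th).
  move=> z; have [zZ|zZ] := boolP (z \in Z); last by exists [::].
  by have [sz Hz] := HD z zZ; exists sz.
pose sp := spaces Z s.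
exists [seq (\sum_(V <- mask m sp) V)%VS | m : (size sp).-tuple bool] => th th0.
have [Kr [Kr1 HKr]] : exists Kr : R, 1 <= Kr /\ forall (m : (size sp).-tuple bool) g t, 0 <= t ->
    (forall V, V \in mask m sp -> resid V g t) -> resid (\sum_(V <- mask m sp) V)%VS g (Kr * t).
  have [d d0 Hd] : small (fun d : R => forall m : (size sp).-tuple bool, forall g t, 0 <= t ->
    (forall V, V \in mask m sp -> resid V g t) -> resid (\sum_(V <- mask m sp) V)%VS g (d^-1 * t)).
    apply: small_all => m; have [K K1 H] := resid_sum (fun V : {vspace F} => V) (mask m sp).
    have K0 : 0 < K by exact: lt_le_trans K1.
    exists K^-1; first by rewrite invr_gt0.
    move=> d d0 dK g t t0 h v vV; apply: le_trans (H g t t0 h v vV) _.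
    rewrite ler_wpM2r ?norm1_ge0 // ler_wpM2r // -[K]invrK lef_pV2 ?posrE // invr_gt0 //.
  have m0 : 0 < Num.min d 1 by rewrite lt_min d0 ltr01.
  have [md m1] : Num.min d 1 <= d /\ Num.min d 1 <= 1 by rewrite !ge_min !lexx orbT.
  exists ((Num.min d 1)^-1); split; first by rewrite invf_ge1.
  exact: Hd.
have Kr0 : 0 < Kr by exact: lt_le_trans Kr1.
pose th2 := th / (2 * Kr); have th20 : 0 < th2 by rewrite divr_gt0 // mulr_gt0.
have [e1 e10 He1] : small (fun eps => forall z, z \in Z ->
  forall X a b, (a < b)%N -> run (Z :\ z) X a b -> osc X a b eps ->
    exists2 V, V \in s z &
      (forall m n, (a <= m <= n)%N -> (n <= b)%N ->
         Near V (disp X m n) ((cost X a b + \sum_(i in Z :\ z) tx X a i) / eps)) /\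
      forall n, (a <= n < b)%N -> resid V (tg X n) th2).
  apply: small_all => z; have [zZ|zZ] := boolP (z \in Z); last by exists 1.
  by apply: small_imp (Hs z zZ th2 th20) => d _ h _.
have [dk dk0 Hdk] : small (fun dk => forall z, z \in Z -> forall V, V \in s z ->
   forall j d, Near V j d -> `|dot j (r z)| <= d -> Near (V :&: kerf (r z)) j (d / dk)).
  apply: small_all => z; have [zZ|zZ] := boolP (z \in Z); last by exists 1.
  have : small (fun dk => forall V, V \in s z ->
   forall j d, Near V j d -> `|dot j (r z)| <= d -> Near (V :&: kerf (r z)) j (d / dk)).
    by apply: small_seq => V _; exact: near_small.
  by apply: small_imp => d _ h _.
have M0 : 0 <= Msup by exact: Msup_ge0.
pose th' := Num.min 1 (e1 / (8 * (Msup + 1))).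
have th'0 : 0 < th' by rewrite lt_min ltr01 divr_gt0 // mulr_gt0 // ltr_wpDl.
have th'1 : th' <= 1 by rewrite ge_min lexx.
have thM : 4 * th' * Msup <= e1 / 2.
  have h : th' * (8 * (Msup + 1)) <= e1.
    by rewrite -ler_pdivlMr ?mulr_gt0 ?ltr_wpDl // ge_min lexx orbT.
  by have := ltW th'0; lra.
have [e0 e00 [C C1 Hgrow]] := growth_bound kap0 HM.
have [e2 e20 Hmove] := HM th' th'0.
pose e3 := Num.min e0 (Num.min e2 (Num.min (e1 / 2) th2)).
have e30 : 0 < e3 by rewrite !lt_min e00 e20 th20 divr_gt0.
have [e3e0 e3e2 e3e1 e3t] : [/\ e3 <= e0, e3 <= e2, e3 <= e1 / 2 & e3 <= th2].
  by split; rewrite !ge_min lexx ?orbT.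
have W := @windows Z s th2 e1 dk e3 C th' e10 dk0 e30 C1 th'0 th'1 thM e3e1
  (He1 e1 e10 (lexx _)) (fun z V zZ => Hdk dk dk0 (lexx _) z zZ V).
have {}W := W (fun X a b hX ho => Hgrow X a b hX (osc_sub (leqnn a) (leqnn b) e3e0 ho)).
have {}W := W (fun X a b hX ho => Hmove e3 e30 e3e2 X a b hX ho).
set K1 := dispK1 _ _ _ in W; set K2 := dispK2 _ _ _ _ _ in W.
have h1 := small_le 1 e30; have h2 := small_le K1 ltr01; have h3 := small_le K2 ltr01.
apply: small_imp (small_and h1 (small_and h2 h3)) => eps eps0 [{}h1 [{}h2 {}h3]] X a b ab HX Hosc.
rewrite mul1r in h1.
have Ho3 : osc X a b e3 by exact: osc_sub Hosc.
have [T [sT rT nT]] := W (b - a)%N X a b (leqnn _) ab HX Ho3 Z0.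
pose m := map_tuple (fun V => V \in T) (in_tuple sp).
have mE : mask m sp = [seq V <- sp | V \in T] by rewrite filter_mask.
exists (\sum_(V <- mask m sp) V)%VS; first by apply/fintype.imageP; exists m.
split=> [i j aij jb|n hn].
  apply: Near_le (nT i j aij jb).
    by apply: sum_subv => V VT; rewrite mE mem_filter VT sT.
  have K0 : 0 <= cost X a b by exact: (cost_ge0 HX).
  have S0 : 0 <= \sum_(z in Z) tx X a z.
    by apply: sumr_ge0 => z zZ; apply/ltW/(run_pos HX ab) => //; rewrite leqnn ltnW.
  rewrite ler_pdivlMr // mulrDl lerD //.
    by rewrite mulrAC -[leRHS]mul1r ler_wpM2r.
  by rewrite mulrAC -[leRHS]mul1r ler_wpM2r.
have -> : th = Kr * (2 * th2) by rewrite /th2; field; exact: lt0r_neq0.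
apply: HKr; first by rewrite mulr_ge0 // ltW.
move=> V; rewrite mE mem_filter => /andP[VT _].
have [n' hn' rV] := rT V VT; move=> v vV.
have -> : dot (tg X n) v = dot (tg X n') v + dot (fun e => tg X n e - tg X n' e) v.
  by rewrite -dotDl; apply: dot_eq => // t; rewrite addrC subrK.
apply: le_trans (ler_normD _ _) _; rewrite (_ : 2 * th2 = th2 + th2); last by ring.
rewrite mulrDl lerD ?rV //; apply: dot_bound => t.
by apply: le_trans e3t; exact: Ho3.
Qed.
End Disp.

(** * Clusters of comparable components *)

Section LnLemmas.
Variable R : realType.
Implicit Types s t th m : R.

Lemma ln_sub_le s t : 0 < s -> 0 < t -> ln s - ln t <= (s - t) / t.
Proof.
move=> s0 t0; rewrite -ln_div ?posrE //.
have -> : s / t = 1 + (s - t) / t by field; exact: lt0r_neq0.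
apply: le_ln1Dx; rewrite ltr_pdivlMr // ; lra.
Qed.

Lemma ln_lip s t m : 0 < m -> m <= s -> m <= t -> `|ln s - ln t| <= `|s - t| / m.
Proof.
move=> m0; wlog st : s t / s <= t => [H ms mt|ms mt].
  by have /orP[h|h] := le_total s t; [exact: H | rewrite distrC [X in X / _]distrC; exact: H].
have s0 : 0 < s by exact: lt_le_trans ms.
have t0 : 0 < t by exact: lt_le_trans mt.
rewrite distrC ger0_norm ?subr_ge0 ?ler_ln // distrC ger0_norm ?subr_ge0 //.
apply: le_trans (ln_sub_le t0 s0) _; rewrite ler_wpM2l ?subr_ge0 // lef_pV2 ?posrE //.
Qed.

(** The derivative of [ln] is at least 1/2 on (0, 2]. *)
Lemma ln_strong_mono s t : 0 < s <= 2 -> 0 < t <= 2 -> (s - t) ^+ 2 / 2 <= (ln s - ln t) * (s - t).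
Proof.
wlog st : s t / t <= s => [H hs ht|/andP[s0 s2] /andP[t0 t2]].
  have /orP[h|h] := le_total t s; first exact: H.
  have := H t s h ht hs.
  have -> : (ln s - ln t) * (s - t) = (ln t - ln s) * (t - s) by ring.
  by have -> : (s - t) ^+ 2 = (t - s) ^+ 2 by ring.
have := ln_sub_le t0 s0; rewrite ler_pdivlMr // => h.
have h1 : (s - t) / 2 <= ln s - ln t.
  have l0 : 0 <= ln s - ln t by rewrite subr_ge0 ler_ln.
  rewrite ler_pdivrMr //; nra.
by rewrite expr2 mulrAC; apply: ler_wpM2r h1; rewrite subr_ge0.
Qed.

Lemma close_of_ln s t th : 0 < s -> 0 < t -> th <= 2^-1 -> `|ln s - ln t| <= th -> `|s - t| <= 2 * th * t.
Proof.
move=> s0 t0 th2; rewrite ler_norml => /andP[h1 h2].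
have th0 : 0 <= th by lra.
have e1 := ln_le_exp s0 t0 h2.
have e2 : t <= expR th * s by apply: ln_le_exp => //; lra.
have e3 : expR th <= 1 + 2 * th.
  have := expR_ge1Dx (- th); rewrite expRN => h.
  have : expR th * (1 - th) <= 1.
    by rewrite -[leRHS](@divff _ (expR th)) ?gt_eqF ?expR_gt0 // ler_pM2l ?expR_gt0.
  have := expR_gt0 th; nra.
have e4 : expR th * s <= (1 + 2 * th) * s by rewrite ler_pM2r.
have e5 : expR th * t <= (1 + 2 * th) * t by rewrite ler_pM2r.
rewrite ler_norml; apply/andP; split; nra.
Qed.

Lemma ln_of_close s t th : 0 < s -> 0 < t -> th <= 2^-1 -> `|s - t| <= th * t -> `|ln s - ln t| <= 2 * th.
Proof.
move=> s0 t0 th2 h; have h' := h; move: h'; rewrite ler_norml => /andP[h1 h2].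
have t2 : 0 < t / 2 by rewrite divr_gt0.
have ht : th * t <= t / 2 by rewrite mulrC ler_pM2l.
apply: le_trans (ln_lip (m := t / 2) t2 _ _) _; [lra|lra|].
by rewrite ler_pdivrMr // (_ : 2 * th * (t / 2) = th * t) //; field.
Qed.

Lemma abs_sub_le s t m : 0 < s -> 0 < t -> s <= m -> t <= m -> `|s - t| <= m.
Proof. by move=> *; rewrite ler_norml; apply/andP; split; lra. Qed.

Lemma abs_tri3 s t u a b c : `|s| <= a -> `|t| <= b -> `|u| <= c -> `|s + t - u| <= a + b + c.
Proof.
move=> h1 h2 h3; apply: le_trans (ler_normB _ _) (lerD _ h3).
exact: le_trans (ler_normD _ _) (lerD h1 h2).
Qed.

End LnLemmas.

Section Cluster.
Variables (R : realType) (L E : finType) (r : L -> E -> R) (kap : R -> R).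
Hypothesis kap0 : forall th, 0 < th -> 0 < kap th.
Local Notation F := {ffun E -> R^o}.
Local Notation run := (run r kap).
Implicit Types (Z C : {set L}) (X : traj R L E).
Local Notation N_move := (N_move r kap).
Local Notation N_disp := (N_disp r kap).
Local Notation Msup := (Msup r).
Local Notation freeze := (freeze r).
Let Nn : R := #|L|%:R.
Ltac clra := clear -kap0 r Nn; lra.

Definition kers (V : {vspace F}) (zs : seq L) := foldr (fun z W => (W :&: kerf (r z))%VS) V zs.

Lemma mem_kers V zs v : v \in kers V zs -> v \in V /\ forall z, z \in zs -> dot v (r z) = 0.
Proof.
elim: zs => [|z zs IH] //=; rewrite memv_cap mem_kerf => /andP[/IH[vV h] /eqP vz]; split=> // i.
by rewrite inE => /predU1P[->|/h].
Qed.

Lemma near_kers (s : seq {vspace F}) (zs : seq L) : small (fun dk => forall V, V \in s -> forall j d,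
  Near V j d -> (forall z, z \in zs -> `|dot j (r z)| <= d) -> Near (kers V zs) j (d / dk)).
Proof.
have mono (V : {vspace F}) (j : E -> R) (d p q : R) : 0 < p -> p <= q -> Near V j (d / q) -> 0 <= d -> Near V j (d / p).
  move=> p0 pq h d0; apply: Near_le h => //; rewrite ler_wpM2l // lef_pV2 ?posrE //; exact: lt_le_trans pq.
have nd (V : {vspace F}) (j : E -> R) (d : R) : Near V j d -> 0 <= d by case=> v _; apply: le_trans; exact: norm1_ge0.
elim: zs => [|z zs [p p0 IH]].
  exists 1 => // d d0 d1 V Vs j e /= h _; by apply: (mono V j e d 1 d0 d1); rewrite ?divr1 //; exact: nd h.
have [q q0 Hq] : small (fun dk => forall V, V \in s -> forall j d, Near (kers V zs) j d -> `|dot j (r z)| <= d ->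
   Near (kers V zs :&: kerf (r z)) j (d / dk)).
  by apply: small_seq => V _; exact: near_small.
pose p1 := Num.min p 1; have p10 : 0 < p1 by rewrite lt_min p0 ltr01.
have [p1p p11] : p1 <= p /\ p1 <= 1 by rewrite !ge_min !lexx orbT.
exists (p1 * q); first exact: mulr_gt0.
move=> d d0 dpq V Vs j e h hz; have e0 := nd _ _ _ h.
apply: (mono _ j e d (p1 * q) d0 dpq _ e0); rewrite invfM mulrA.
apply: (Hq q q0 (lexx _) V Vs); first by apply: (IH p1 p10 p1p) => // i izs; apply: hz; rewrite inE izs orbT.
by apply: le_trans (hz z (mem_head _ _)) _; rewrite ler_peMr // invf_ge1.
Qed.

Lemma sum_card_le (A : {set L}) (G : L -> R) D : 0 <= D -> (forall z, z \in A -> G z <= D) -> \sum_(z in A) G z <= Nn * D.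
Proof.
move=> D0 hG; rewrite /Nn -sum1_card natr_sum mulr_suml big_mkcond /=; apply: ler_sum => i _; rewrite mul1r.
by case: ifP => // iA; exact: hG.
Qed.

(** The components of [C] lie between [Lv * X0] and [X0], while the other components of [Z] and
    the cost are negligible compared with [X0].  The external force is an almost constant [bt] plus
    a coupling [q] (the electric potential) that depends on the amounts in a Lipschitz and monotone way. *)
Record cluster_data Z C (B Lv eps : R) X (a b : nat) (bt : nat -> E -> R) (q : nat -> L -> R) (Q X0 : R) : Prop :=
 ClusterData {
  cd_ab : (a < b)%N;
  cd_run : run Z X a b;
  cd_dec : forall n e, (a <= n < b)%N -> tg X n e = bt n e + \sum_(z in Z) q n z * r z e;
  cd_osc : forall n m e, (a <= n < b)%N -> (a <= m < b)%N -> `|bt n e - bt m e| <= eps;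
  cd_Q : 0 <= Q;
  cd_QB : Q * X0 <= B;
  cd_X0 : 0 < X0;
  cd_lip : forall n m z, (a <= n < b)%N -> (a <= m < b)%N -> z \in Z ->
    `|q n z - q m z| <= Q * \sum_(i in Z) `|tx X n i - tx X m i|;
  cd_mono : forall n m, (a <= n < b)%N -> (a <= m < b)%N ->
    0 <= \sum_(z in Z) (q n z - q m z) * (tx X n z - tx X m z);
  cd_C : forall z, z \in C -> Lv * X0 <= tx X a z <= X0;
  cd_Z' : forall z, z \in Z :\: C -> tx X a z <= eps * X0;
  cd_cost : cost X a b <= eps * X0 }.
Definition confined Z C X (X0 : R) (a N : nat) (th1 : R) := forall n, (a <= n <= N)%N ->
  (forall z, z \in C -> `|ln (tx X n z) - ln (tx X a z)| <= th1) /\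
  (forall z, z \in Z :\: C -> tx X n z <= th1 * X0).

Section Confined.
Variables (Z C : {set L}) (B Lv eps : R) (X : traj R L E) (a b : nat) (bt : nat -> E -> R) (q : nat -> L -> R) (Q X0 : R).
Variables (N : nat) (th1 : R).
Hypotheses (CZ : C \subset Z) (HD : cluster_data Z C B Lv eps X a b bt q Q X0).
Hypotheses (Nb : (N < b)%N) (th10 : 0 < th1) (th12 : th1 <= 2^-1) (Lv0 : 0 < Lv).
Hypothesis conf : confined Z C X X0 a N th1.

Let pos n z : (a <= n <= N)%N -> z \in Z -> 0 < tx X n z.
Proof. by move=> hn zZ; apply: (run_pos (cd_run HD) (cd_ab HD)) => //; nlia. Qed.

Lemma conf_near_a n z : (a <= n <= N)%N -> z \in C -> `|tx X n z - tx X a z| <= 2 * th1 * tx X a z.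
Proof.
move=> hn zC; have zZ := fintype.subsetP CZ z zC.
apply: close_of_ln => //; [exact: pos | apply: pos => //; nlia |].
by have [h _] := conf hn; exact: h.
Qed.

Lemma conf_C n z : (a <= n <= N)%N -> z \in C -> Lv / 2 * X0 <= tx X n z <= 2 * X0.
Proof.
move=> hn zC; have zZ := fintype.subsetP CZ z zC.
have x1 := pos hn zZ; have haa : (a <= a <= N)%N by nlia.
have x2 := pos haa zZ; have [/(_ z zC) h _] := conf hn.
have e1 : expR th1 <= 2.
  apply: (@le_trans _ _ (expR (2^-1))); first by rewrite ler_expR.
  have h2 := expR_ge1Dx (- 2^-1 : R); rewrite expRN in h2.
  rewrite -[leLHS]invrK -[leRHS]invrK lef_pV2 ?posrE ?invr_gt0 ?expR_gt0 //.
  apply: le_trans h2; lra.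
move: h; rewrite ler_norml => /andP[h1 h2].
have h3 := ln_le_exp x1 x2 h2.
have h4 : tx X a z <= expR th1 * tx X n z by apply: ln_le_exp => //; lra.
have h5 : expR th1 * tx X a z <= 2 * tx X a z by rewrite ler_pM2r.
have h6 : expR th1 * tx X n z <= 2 * tx X n z by rewrite ler_pM2r.
have /andP[c1 c2] := cd_C HD zC.
have e : Lv / 2 * X0 = (Lv * X0) / 2 by ring.
by apply/andP; split; rewrite ?e; lra.
Qed.

Lemma conf_sum n m : (a <= n <= N)%N -> (a <= m <= N)%N -> \sum_(i in Z) `|tx X n i - tx X m i| <= Nn * (5 * th1 * X0).
Proof.
move=> hn hm; rewrite /Nn -sum1_card natr_sum mulr_suml big_mkcond /=; apply: ler_sum => i _; rewrite mul1r.
have X00 := cd_X0 HD; have t0 := th10.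
have h0 : 0 <= th1 * X0 by rewrite mulr_ge0 // ltW.
case: ifP => iZ; last by rewrite !mulr_ge0 // ltW.
have [iC|iC] := boolP (i \in C); last first.
  have iD : i \in Z :\: C by rewrite inE iC iZ.
  have [_ /(_ i iD) h1] := conf hn; have [_ /(_ i iD) h2] := conf hm.
  have := pos hn iZ; have := pos hm iZ; move=> *.
  rewrite (_ : 5 * th1 * X0 = 5 * (th1 * X0)); last by ring.
  rewrite ler_norml; apply/andP; split; lra.
have h1 := conf_near_a hn iC; have h2 := conf_near_a hm iC.
have /andP[_ c2] := cd_C HD iC.
have h3 : 2 * th1 * tx X a i <= 2 * th1 * X0 by rewrite ler_pM2l // mulr_gt0.
rewrite (_ : _ - _ = (tx X n i - tx X a i) - (tx X m i - tx X a i)); last by ring.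
apply: le_trans (ler_normB _ _) _; rewrite (_ : 5 * th1 * X0 = 2 * th1 * X0 + 2 * th1 * X0 + th1 * X0); last by ring.
lra.
Qed.

Lemma conf_R3 th n z : 0 < th -> eps < kap th * (Lv / 2) -> (a <= n <= N)%N -> z \in C ->
  `|ln (tx X n.+1 z) - ln (tx X n z)| <= th /\ `|ty X n z - ln (tx X n z)| <= th.
Proof.
move=> th0 he hn zC; have zZ := fintype.subsetP CZ z zC.
have hn' : (a <= n < b)%N by nlia.
have [_ _ _ /(_ z th zZ th0)] := cd_run HD hn'; case=> // h; exfalso.
have := cost_step (cd_run HD) hn'; have := cd_cost HD; move=> h1 h2.
have /andP[c1 _] := conf_C hn zC.
have : kap th * (Lv / 2) * X0 <= eps * X0.
  rewrite -mulrA; apply: le_trans (le_trans h2 h1); apply: le_trans h.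
  by rewrite ler_pM2l ?kap0 // le_max c1.
by rewrite ler_pM2r ?(cd_X0 HD) // leNgt he.
Qed.

(** The variations of the frozen force come from [bt], from the coupling and from the
    log-activities of the cluster. *)
Lemma osc_frozen s t D1 D2 : (a <= s)%N -> (t <= N.+1)%N -> 0 <= D2 ->
  (forall n m, (s <= n < t)%N -> (s <= m < t)%N -> Q * \sum_(i in Z) `|tx X n i - tx X m i| <= D1) ->
  (forall n m z, (s <= n < t)%N -> (s <= m < t)%N -> z \in C -> `|ty X n z - ty X m z| <= D2) ->
  osc (freeze C X) s t (eps + Nn * (D1 + D2) * Msup).
Proof.
move=> as_ tN D20 h1 h2; rewrite mulrDr mulrDl addrA.
have M0 : 0 <= Msup by exact: Msup_ge0.
apply: osc_freeze => [n m e hn hm|n m hn hm]; last first.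
  by rewrite -mulr_suml ler_wpM2r //; apply: sum_card_le => // z zC; exact: h2.
have hn' : (a <= n < b)%N by nlia.
have hm' : (a <= m < b)%N by nlia.
rewrite !(cd_dec HD) //.
have -> : bt n e + \sum_(z in Z) q n z * r z e - (bt m e + \sum_(z in Z) q m z * r z e) =
  (bt n e - bt m e) + \sum_(z in Z) (q n z - q m z) * r z e.
  by under [X in _ = _ + X]eq_bigr do rewrite mulrBl; rewrite sumrB; ring.
apply: le_trans (ler_normD _ _) (lerD (cd_osc HD e hn' hm') _).
apply: le_trans (ler_norm_sum _ _ _) _.
apply: (@le_trans _ _ (\sum_(z in Z) `|q n z - q m z| * Msup)).
  by apply: ler_sum => z _; rewrite normrM ler_wpM2l //; exact: r_le.
rewrite -mulr_suml ler_wpM2r //; apply: sum_card_le => [|z zZ].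
  by apply: le_trans (h1 n m hn hm); rewrite mulr_ge0 ?(cd_Q HD) // sumr_ge0.
by apply: le_trans (h1 n m hn hm); exact: (cd_lip HD).
Qed.

End Confined.

Lemma norm1_sq (T : finType) (u : T -> R) : norm1 u ^+ 2 <= #|T|%:R ^+ 2 * \sum_t u t ^+ 2.
Proof.
set S := \sum_t _; have S0 : 0 <= S by apply: sumr_ge0 => t _; exact: sqr_ge0.
have h : norm1 u <= #|T|%:R * Num.sqrt S.
  rewrite /norm1 -sum1_card natr_sum mulr_suml; apply: ler_sum => t _; rewrite mul1r.
  by rewrite -sqrtr_sqr ler_wsqrtr // /S (bigD1 t) //= lerDl; apply: sumr_ge0 => i _; exact: sqr_ge0.
rewrite -[X in _ * X]sqr_sqrtr // -exprMn ler_pXn2r ?nnegrE ?norm1_ge0 //.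
Qed.

Lemma norm1_on C (u : L -> R) : (forall z, z \notin C -> u z = 0) -> norm1 u = \sum_(z in C) `|u z|.
Proof.
move=> h; rewrite /norm1 [RHS]big_mkcond /=; apply: eq_bigr => z _; case: ifPn => // /h ->.
by rewrite normr0.
Qed.

(** Induction on the final time.  While the trajectory is confined, the small components form a run
    with the cluster frozen, and stay small by [growth_bound].  On a stretch where the cluster moves
    little, [N_disp] of the small components provides a space [V] along which the frozen force does
    almost no work.  The displacements almost preserve the small components, so [V] may be
    intersected with their kernels; on the images of that intersection in the space of the
    amounts of [C] the force, here ln x plus the coupling, has almost prescribed values.  Thus the
    rescaled amounts of [C] form a path as in [rigid_path]. *)
Lemma cluster_rigid Z C : C \subset Z -> N_move (Z :\: C) -> N_disp (Z :\: C) ->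
  forall B Lv th : R, 0 <= B -> 0 < Lv -> 0 < th -> small (fun eps =>
    forall X a b bt q (Q X0 : R), cluster_data Z C B Lv eps X a b bt q Q X0 -> confined Z C X X0 a b th).
Proof.
move=> CZ HM [s Hs] B Lv th B0 Lv0 th0.
have [es es0 [Cs Cs1 Hg]] := growth_bound kap0 HM.
pose zs := enum (Z :\: C).
have [dk dk0 Hdk] := near_kers s zs.
have [kl kl0 Hl] : small (fun d => forall V, V \in s -> forall v, v \in kers V zs -> exists2 w, w \in kers V zs &
    (forall z, z \in C -> dot w (r z) = dot v (r z)) /\ norm1 w <= d^-1 * \sum_(z in C) `|dot v (r z)|).
  apply: small_seq => V _; have [K K0 H] := bounded_lift r C (kers V zs).
  exists K^-1; first by rewrite invr_gt0.
  move=> d d0 dK v vV; have [w wV [h1 h2]] := H v vV; exists w => //; split=> //.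
  apply: le_trans h2 _; rewrite ler_wpM2r ?sumr_ge0 //.
  by rewrite -[K]invrK lef_pV2 ?posrE ?invr_gt0.
have {Hl} := Hl kl kl0 (lexx _); set Kl := kl^-1 => Hl.
have Kl0 : 0 < Kl by rewrite invr_gt0.
have /choice[ed Hed] : forall t : R, exists d : R, 0 < t -> 0 < d /\
  forall X a b, (a < b)%N -> run (Z :\: C) X a b -> osc X a b d ->
    exists2 V, V \in s &
      (forall m n, (a <= m <= n)%N -> (n <= b)%N ->
         Near V (disp X m n) ((cost X a b + \sum_(z in Z :\: C) tx X a z) / d)) /\
      forall n, (a <= n < b)%N -> resid V (tg X n) t.
  move=> t; have [t0|t0] := ltP 0 t; last by exists 1 => ?; exfalso; lra.
  by have [d d0 Hd] := Hs t t0; exists d => _; split=> //; exact: Hd.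
have M0 : 0 <= Msup by exact: Msup_ge0.
have N0 : 0 <= Nn by exact: ler0n.
pose A := Nn * Msup; have A0 : 0 <= A by exact: mulr_ge0.
have AB0 : 0 <= A * (5 * B * Nn + 4) by rewrite mulr_ge0 // addr_ge0 // !mulr_ge0.
(* within [th1] the frozen force oscillates less than [growth_bound] allows *)
pose th1 := Num.min (Num.min th 2^-1) (es / (2 * (A * (5 * B * Nn + 4) + 1))).
have th10 : 0 < th1.
  by rewrite !lt_min th0 /= invr_gt0 ltr0n /= divr_gt0 // mulr_gt0 // ltr_wpDl.
have [th1th th12 th1es] : [/\ th1 <= th, th1 <= 2^-1 & th1 * (A * (5 * B * Nn + 4) + 1) <= es / 2].
  split.
  - by rewrite /th1 !ge_min lexx.
  - by rewrite /th1 !ge_min lexx orbT.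
  rewrite -ler_pdivlMr ?ltr_wpDl // [leRHS](_ : _ = es / (2 * (A * (5 * B * Nn + 4) + 1))); last by rewrite invfM mulrA.
  by rewrite /th1 ge_min lexx orbT.
have CB0 : 0 <= A * (B + 2 / Lv) by rewrite mulr_ge0 // addr_ge0 // divr_ge0 // ltW.
pose e2 t := ed (t / (3 * Kl)).
(* tolerances for the oscillation of the frozen force on a stretch with motion at most [e t] *)
pose ty_ t := Num.min (e2 t / (8 * (A + 1))) (t / 3).
pose e t := Num.min (((e2 t)^-1 + 1)^-1) (Num.min (e2 t / (8 * (A * (B + 2 / Lv) + 1)))
   (Num.min (e2 t / 8) (Num.min (kap (ty_ t) * (Lv / 4)) (t / (3 * Kl))))).
have e20 t : 0 < t -> 0 < e2 t by move=> t0; have [] := Hed (t / (3 * Kl)) _; rewrite ?divr_gt0 ?mulr_gt0.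
have ty0 t : 0 < t -> 0 < ty_ t.
  by move=> t0; rewrite lt_min !divr_gt0 ?e20 // mulr_gt0 // ltr_wpDl.
have e0 t : 0 < t -> 0 < e t.
  move=> t0; rewrite !lt_min; apply/and5P; split.
  - by rewrite invr_gt0 addr_gt0 // invr_gt0 e20.
  - by rewrite divr_gt0 ?e20 // mulr_gt0 // ltr_wpDl.
  - by rewrite divr_gt0 ?e20.
  - by rewrite mulr_gt0 ?kap0 ?ty0 ?divr_gt0.
  - by rewrite divr_gt0 // mulr_gt0.
(* the possible directions of motion of the cluster: images of spaces of displacements that
   preserve the small components *)
pose U (i : 'I_(size s)) (u : L -> R) := exists2 v, v \in kers (nth 0%VS s i) zs &
  forall z, u z = if z \in C then dot v (r z) else 0.
pose c := (2 * (Nn ^+ 2 + 1))^-1.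
have c0 : 0 < c by rewrite invr_gt0 mulr_gt0 // ltr_wpDl // sqr_ge0.
pose Lm := `|ln (Lv / 2)| + ln 2 + 5 * B * Nn.
have ln20 : 0 <= ln (2 : R) by rewrite ln_ge0 // ler1n.
have Lm0 : 0 <= Lm by rewrite !addr_ge0 // !mulr_ge0.
(* each amount of the cluster is at least [Lv] on the scale [X0], so a path motion of [w] is a
   logarithmic motion of at most [th1] *)
pose w := Lv * th1 / 2; have w0 : 0 < w by rewrite !divr_gt0 // mulr_gt0.
have [dl dl0 /(_ dl dl0 (lexx _)) Hpath] := rigid_path U c0 Lm0 e0 w0.
pose ths := Num.min 2^-1 (dl / (4 * (Nn + 1))).
have ths0 : 0 < ths by rewrite lt_min invr_gt0 ltr0n divr_gt0 // mulr_gt0 // ltr_wpDl.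
have [ths1 ths2] : ths <= 2^-1 /\ ths * (4 * (Nn + 1)) <= dl.
  split; first by rewrite ge_min lexx.
  by rewrite -ler_pdivlMr ?mulr_gt0 ?ltr_wpDl // ge_min lexx orbT.
have k1 : 0 < kap ths * (Lv / 4) by rewrite mulr_gt0 ?kap0 ?divr_gt0.
have k2 : 0 < kap th1 * (Lv / 4) by rewrite mulr_gt0 ?kap0 ?divr_gt0.
have es20 : 0 < es / 2 by rewrite divr_gt0.
pose K0 := A / dk * (1 + 2 * Cs * Nn + 2 * Cs).
have S := small_and (small_le (1 + 2 * A * B * Cs * Nn) dl0) (small_and (small_le K0 dl0)
  (small_and (small_le (Nn * (5 * B * Nn) * (2 * Cs)) dl0) (small_and (small_le 1 k1) (small_and (small_le 1 k2)
  (small_and (small_le 1 es20) (small_and (small_le 1 th10) (small_le (2 * Cs) th10))))))).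
apply: small_imp S => eps eps0 [E1 [E2 [E3 [E4 [E5 [E6 [E7 E8]]]]]]] X a b bt q Q X0 HD.
rewrite !mul1r in E4 E5 E6 E7.
have Cs0 : 0 < Cs by exact: lt_le_trans Cs1.
have X00 := cd_X0 HD; have ab := cd_ab HD; have HX := cd_run HD.
have eps_dl : eps <= dl.
  by apply: le_trans E1; rewrite ler_peMl ?(ltW eps0) // lerDl !mulr_ge0 // ltW.
suff H : forall N, (a <= N <= b)%N -> confined Z C X X0 a N th1.
  have hb : (a <= b <= b)%N by rewrite leqnn ltnW.
  move=> n hn; have [h1 h2] := H b hb n hn.
  split=> z zC; first by apply: le_trans (h1 z zC) th1th.
  by apply: le_trans (h2 z zC) _; rewrite ler_pM2r.
have base : confined Z C X X0 a a th1.
  move=> n hn; have -> : n = a by nlia.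
  split=> z zC; first by rewrite subrr normr0 ltW.
  by apply: le_trans (cd_Z' HD zC) _; rewrite ler_pM2r.
elim=> [|N IH] hN; first by have -> : 0%N = a by nlia.
have [aN|aN] := eqVneq a N.+1; first by rewrite -aN.
have hN' : (a <= N <= b)%N by nlia.
have Nb : (N < b)%N by nlia.
have {IH base} conf := IH hN'.
have eps_k2 : eps < kap th1 * (Lv / 2).
  apply: le_lt_trans E5 _; rewrite ltr_pM2l ?kap0 // ltr_pM2l // ltf_pV2 ?posrE // ltr_nat //.
have eps_k1 : eps < kap ths * (Lv / 2).
  apply: le_lt_trans E4 _; rewrite ltr_pM2l ?kap0 // ltr_pM2l // ltf_pV2 ?posrE // ltr_nat //.
have R3 t n z t0 ht hn zC := @conf_R3 _ _ _ _ _ _ _ _ _ _ _ _ _ _ CZ HD Nb th12 conf t n z t0 ht hn zC.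
have R3a n z hn zC := R3 th1 n z th10 eps_k2 hn zC.
have Qs n m : (a <= n <= N)%N -> (a <= m <= N)%N -> Q * \sum_(i in Z) `|tx X n i - tx X m i| <= 5 * B * Nn * th1.
  move=> hn hm; apply: le_trans (ler_wpM2l (cd_Q HD) (conf_sum CZ HD Nb th10 th12 conf hn hm)) _.
  rewrite (_ : Q * (Nn * (5 * th1 * X0)) = (Q * X0) * (5 * Nn * th1)); last by ring.
  rewrite (_ : 5 * B * Nn * th1 = B * (5 * Nn * th1)); last by ring.
  by rewrite ler_wpM2r ?(cd_QB HD) // !mulr_ge0 // ltW.
have HX1 : run Z X a N.+1 by apply: run_sub HX.
have Hf : run (Z :\: C) (freeze C X) a N.+1 by exact: run_freeze.
have Hes : osc (freeze C X) a N.+1 es.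
  have th10' : 0 <= 4 * th1 by rewrite mulr_ge0 // ltW.
  have := osc_frozen CZ HD Nb (s := a) (t := N.+1) (D1 := 5 * B * Nn * th1) (D2 := 4 * th1) (leqnn _) (leqnn _) th10'.
  move=> h; apply: (osc_sub (leqnn _) (leqnn _) _ (h _ _)).
  - have -> : Nn * (5 * B * Nn * th1 + 4 * th1) * Msup = th1 * (A * (5 * B * Nn + 4)) by rewrite /A; ring.
    by move: th1es E6 (ltW th10); rewrite mulrDr mulr1; clra.
  - by move=> n m hn hm; apply: Qs; nlia.
  move=> n m z hn hm zC.
  have hn' : (a <= n <= N)%N by nlia.
  have hm' : (a <= m <= N)%N by nlia.
  have [_ y1] := R3a n z hn' zC; have [_ y2] := R3a m z hm' zC.
  have [/(_ z zC) l1 _] := conf n hn'; have [/(_ z zC) l2 _] := conf m hm'.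
  rewrite (_ : ty X n z - ty X m z = (ty X n z - ln (tx X n z)) + (ln (tx X n z) - ln (tx X a z)) -
    (ln (tx X m z) - ln (tx X a z)) - (ty X m z - ln (tx X m z))); last by ring.
  apply: le_trans (ler_normB _ _) _; apply: le_trans (lerD (ler_normB _ _) (lexx _)) _.
  apply: le_trans (lerD (lerD (ler_normD _ _) (lexx _)) (lexx _)) _.
  by move: y1 y2 l1 l2; clra.
have aN1 : (a < N.+1)%N by nlia.
have small' n z : (a <= n <= N.+1)%N -> z \in Z :\: C -> tx X n z <= 2 * Cs * eps * X0.
  move=> hn zD; apply: le_trans (Hg _ a N.+1 Hf Hes aN1 n z hn zD) _.
  rewrite (_ : 2 * Cs * eps * X0 = Cs * (eps * X0 + eps * X0)); last by ring.
  rewrite ler_pM2l //; apply: lerD; first exact: (cd_Z' HD).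
  by apply: le_trans (cd_cost HD); apply: (cost_mono HX).
have pos n z : (a <= n <= N.+1)%N -> z \in Z -> 0 < tx X n z.
  by move=> hn zZ; apply: (run_pos HX1 aN1).
pose p n z := if z \in C then tx X n z / X0 else 0.
pose mu n z := if z \in C then ln (tx X n z) - ln X0 + (q n z - q a z) else 0.
(* a preimage of bounded norm; it turns the condition on the force along [V] into one on [U i] *)
pose lift i u := xget (0 : F) [set v | v \in kers (nth 0%VS s i) zs /\
  (forall z, z \in C -> dot v (r z) = u z) /\ norm1 v <= Kl * norm1 u].
pose phi (i : 'I_(size s)) u := - dot (bt a) (lift i u) - \sum_(z in C) (ln X0 + q a z) * u z.
have p_out n m z : z \notin C -> p n z - p m z = 0 by move=> /negbTE zC; rewrite /p zC subrr.
have p_in n m z : z \in C -> p n z - p m z = (tx X n z - tx X m z) / X0 by move=> zC; rewrite /p zC mulrBl.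
have X0V : 0 < X0^-1 by rewrite invr_gt0.
have distE n m : dist p m n = \sum_(z in C) `|tx X n z - tx X m z| / X0.
  rewrite /dist (norm1_on (C := C)); last by move=> z; exact: p_out.
  by apply: eq_bigr => z zC; rewrite p_in // normrM (gtr0_norm X0V).
have confC n z : (a <= n <= N)%N -> z \in C -> Lv / 2 * X0 <= tx X n z <= 2 * X0.
  by move=> hn zC; exact: (conf_C CZ HD Nb th12 conf).
have posC n z : (a <= n <= N.+1)%N -> z \in C -> 0 < tx X n z.
  by move=> hn zC; apply: pos => //; exact: (fintype.subsetP CZ).
have Hp1 : forall n, (a <= n < N.+1)%N -> dist p n n.+1 <= dl.
  move=> n hn; rewrite distE; apply: le_trans ths2.
  rewrite (_ : ths * (4 * (Nn + 1)) = Nn * (4 * ths) + 4 * ths); last by ring.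
  apply: le_trans (_ : Nn * (4 * ths) <= _); last by rewrite lerDl mulr_ge0 // ltW.
  apply: sum_card_le => [|z zC]; first by rewrite mulr_ge0 // ltW.
  have hn' : (a <= n <= N)%N by nlia.
  have [h _] := R3 ths n z ths0 eps_k1 hn' zC.
  rewrite ler_pdivrMr //.
  have k1' : 0 < tx X n.+1 z by apply: posC => //; nlia.
  have k2' : 0 < tx X n z by apply: posC => //; nlia.
  apply: le_trans (close_of_ln k1' k2' ths1 h) _.
  have /andP[_ c2] := confC n z hn' zC.
  rewrite (_ : 4 * ths * X0 = 2 * ths * (2 * X0)); last by ring.
  by rewrite ler_pM2l // mulr_gt0.
have Hp2 : forall m n, (a <= m < N.+1)%N -> (a <= n < N.+1)%N ->
    c * dist p m n ^+ 2 <= dot (fun t => mu n t - mu m t) (fun t => p n t - p m t) + dl.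
  move=> m n hm hn.
  have hm' : (a <= m <= N)%N by nlia.
  have hn' : (a <= n <= N)%N by nlia.
  have hmb : (a <= m < b)%N by nlia.
  have hnb : (a <= n < b)%N by nlia.
  have -> : dot (fun t => mu n t - mu m t) (fun t => p n t - p m t) =
    \sum_(z in C) (ln (tx X n z) - ln (tx X m z)) * (p n z - p m z) +
    (\sum_(z in C) (q n z - q m z) * (tx X n z - tx X m z)) / X0.
    rewrite /dot [RHS](_ : _ = \sum_(z in C) (mu n z - mu m z) * (p n z - p m z)); last first.
      rewrite mulr_suml -big_split /=; apply: eq_bigr => z zC; rewrite /mu zC p_in //; ring.
    by rewrite [RHS]big_mkcond /=; apply: eq_bigr => z _; case: ifPn => // zC; rewrite p_out // mulr0.
  have l1 : c * dist p m n ^+ 2 <= \sum_(z in C) (ln (tx X n z) - ln (tx X m z)) * (p n z - p m z).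
    apply: (@le_trans _ _ (\sum_z (p n z - p m z) ^+ 2 / 2)).
      apply: le_trans (ler_wpM2l (ltW c0) (norm1_sq _)) _; rewrite mulrA -mulr_suml mulrC.
      apply: ler_wpM2l; first by apply: sumr_ge0 => z _; exact: sqr_ge0.
      rewrite /c -/Nn invfM -mulrA ger_pMr ?invr_gt0 // mulrC ler_pdivrMr ?ltr_wpDl ?sqr_ge0 // mul1r lerDl //.
    rewrite [leRHS]big_mkcond /=; apply: ler_sum => z _; case: ifPn => zC; last first.
      by rewrite p_out // expr0n /= mul0r.
    have /andP[a1 a2] := confC n z hn' zC; have /andP[a3 a4] := confC m z hm' zC.
    have x1 := posC n z; have x2 := posC m z.
    have lnp k : 0 < tx X k z -> ln (tx X k z / X0) = ln (tx X k z) - ln X0 by move=> h; rewrite ln_div ?posrE.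
    have h1 : 0 < tx X n z by apply: x1 => //; nlia.
    have h2 : 0 < tx X m z by apply: x2 => //; nlia.
    rewrite (_ : ln (tx X n z) - ln (tx X m z) = ln (tx X n z / X0) - ln (tx X m z / X0)); last by rewrite !lnp //; ring.
    by rewrite /p zC; apply: ln_strong_mono; rewrite divr_gt0 //= ler_pdivrMr.
  have l2 : - dl <= (\sum_(z in C) (q n z - q m z) * (tx X n z - tx X m z)) / X0.
    rewrite ler_pdivlMr //.
    have := cd_mono HD hnb hmb; rewrite (bigID (mem C)) /=.
    rewrite (eq_bigl (mem C)); last by move=> z /=; rewrite andb_idl // => /(fintype.subsetP CZ).
    set s1 := \sum_(i in mem C) _; set s2 := \sum_(i in Z | _) _ => s12.
    have : s2 <= dl * X0.
      apply: le_trans (_ : Nn * ((5 * B * Nn) * (2 * Cs * eps * X0)) <= _); last first.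
        rewrite (_ : Nn * (5 * B * Nn * (2 * Cs * eps * X0)) = Nn * (5 * B * Nn) * (2 * Cs) * eps * X0); last by ring.
        by rewrite ler_pM2r.
      rewrite /s2 (eq_bigl (fun z => z \in Z :\: C)); last by move=> z; rewrite inE andbC.
      have D1 : 0 <= 5 * B * Nn by rewrite !mulr_ge0.
      have D2 : 0 <= 2 * Cs * eps * X0 by rewrite !mulr_ge0 // ltW.
      apply: sum_card_le => [|z zD]; first by rewrite mulr_ge0.
      have zZ : z \in Z by move: zD; rewrite inE => /andP[].
      apply: le_trans (ler_norm _) _; rewrite normrM; apply: ler_pM => //.
        apply: le_trans (cd_lip HD hnb hmb zZ) _; apply: le_trans (Qs n m hn' hm') _.
        by rewrite ler_piMr //; move: th12; clra.
      have k3 : (a <= n <= N.+1)%N by nlia.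
      have k4 : (a <= m <= N.+1)%N by nlia.
      exact: abs_sub_le (pos n z k3 zZ) (pos m z k4 zZ) (small' n z k3 zD) (small' m z k4 zD).
    by move: s12; clra.
  by move: l1 l2; clra.
have Hp3 : forall n t, (a <= n < N.+1)%N -> `|mu n t| <= Lm.
  move=> n z hn; rewrite /mu; case: ifPn => zC; last by rewrite normr0.
  have hn' : (a <= n <= N)%N by nlia.
  have haa : (a <= a <= N)%N by nlia.
  have hab : (a <= a < b)%N by nlia.
  have hnb : (a <= n < b)%N by nlia.
  have zZ := fintype.subsetP CZ z zC.
  apply: le_trans (ler_normD _ _) _; apply: lerD; last first.
    apply: le_trans (cd_lip HD hnb hab zZ) _; apply: le_trans (Qs n a hn' haa) _.
    have : 0 <= 5 * B * Nn by rewrite !mulr_ge0.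
    by move=> ?; rewrite ler_piMr //; move: th12; clra.
  have /andP[a1 a2] := confC n z hn' zC.
  have x1 : 0 < tx X n z by apply: posC => //; nlia.
  rewrite -ln_div ?posrE //.
  have b1 : ln (Lv / 2) <= ln (tx X n z / X0) by rewrite ler_ln ?posrE ?divr_gt0 // ler_pdivlMr.
  have b2 : ln (tx X n z / X0) <= ln 2 by rewrite ler_ln ?posrE ?divr_gt0 // ler_pdivrMr.
  have := ler_norm (- ln (Lv / 2)); rewrite normrN => b3.
  have b4 : 0 <= `|ln (Lv / 2)| by [].
  by move: b1 b2 b3 b4 ln20; clear -kap0 r Nn => *; rewrite ler_norml; apply/andP; split; lra.
have Hp : path_hyp U c Lm e dl phi p mu a N.+1.
  split=> // t s1 t1 t0 dle /andP[as1 st1] tN1 motion.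
  have [m1 m2 m3 m4 m5] : [/\ e t <= ((e2 t)^-1 + 1)^-1, e t <= e2 t / (8 * (A * (B + 2 / Lv) + 1)),
    e t <= e2 t / 8, e t <= kap (ty_ t) * (Lv / 4) & e t <= t / (3 * Kl)].
    by split; rewrite /e !ge_min lexx ?orbT.
  have [y1 y2] : ty_ t <= e2 t / (8 * (A + 1)) /\ ty_ t <= t / 3 by rewrite /ty_ !ge_min !lexx orbT.
  have [[et0 ty0'] e2t0] := (e0 t t0, ty0 t t0, e20 t t0).
  have [|_ Hd] := Hed (t / (3 * Kl)); first by rewrite divr_gt0 // mulr_gt0.
  rewrite -/(e2 t) in Hd.
  have epse : eps <= e t by exact: le_trans dle.
  have eps_y : eps < kap (ty_ t) * (Lv / 2).
    apply: le_lt_trans (le_trans epse m4) _; rewrite ltr_pM2l ?kap0 // ltr_pM2l // ltf_pV2 ?posrE // ltr_nat //.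
  have inN n : (s1 <= n < t1)%N -> (a <= n <= N)%N by move=> h; nlia.
  have inN1 n : (s1 <= n <= t1)%N -> (a <= n <= N.+1)%N by move=> h; nlia.
  have y_ln n z : (s1 <= n < t1)%N -> z \in C -> `|ty X n z - ln (tx X n z)| <= ty_ t.
    by move=> hn zC; have [] := R3 (ty_ t) n z ty0' eps_y (inN n hn) zC.
  have dC n m z : (s1 <= n <= t1)%N -> (s1 <= m <= t1)%N -> z \in C -> `|tx X n z - tx X m z| <= e t * X0.
    move=> hn hm zC; rewrite -ler_pdivrMr //; apply: le_trans (motion m n hm hn); rewrite distE (bigD1 z) //= lerDl.
    by apply: sumr_ge0 => i _; rewrite divr_ge0 // ltW.
  have sumZ' n : (s1 <= n <= t1)%N -> \sum_(z in Z :\: C) tx X n z <= Nn * (2 * Cs * eps * X0).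
    move=> hn; apply: sum_card_le => [|z zD]; first by rewrite !mulr_ge0 // ltW.
    by apply: small' => //; exact: inN1.
  have D1 : forall n m, (s1 <= n < t1)%N -> (s1 <= m < t1)%N ->
    Q * \sum_(i in Z) `|tx X n i - tx X m i| <= B * (e t + 2 * Cs * Nn * eps).
    move=> n m hn hm; apply: le_trans (_ : Q * ((e t + 2 * Cs * Nn * eps) * X0) <= _); last first.
      rewrite mulrCA mulrC; apply: ler_wpM2r; last exact: (cd_QB HD).
      by rewrite addr_ge0 ?(ltW et0) // !mulr_ge0 // ltW.
    apply: ler_wpM2l; first exact: (cd_Q HD).
    have hn' : (s1 <= n <= t1)%N by nlia.
    have hm' : (s1 <= m <= t1)%N by nlia.
    rewrite (bigID (mem C)) /= mulrDl; apply: lerD.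
      rewrite (eq_bigl (mem C)); last by move=> z /=; rewrite andb_idl // => /(fintype.subsetP CZ).
      have := motion m n hm' hn'; rewrite distE -mulr_suml ler_pdivrMr //.
    rewrite (eq_bigl (fun z => z \in Z :\: C)); last by move=> z; rewrite inE andbC.
    rewrite (_ : 2 * Cs * Nn * eps * X0 = Nn * (2 * Cs * eps * X0)); last by ring.
    apply: sum_card_le => [|z zD]; first by rewrite !mulr_ge0 // ltW.
    have zZ : z \in Z by move: zD; rewrite inE => /andP[].
    have q1 := small' n z (inN1 n hn') zD; have q2 := small' m z (inN1 m hm') zD.
    have q3 := pos n z (inN1 n hn') zZ; have q4 := pos m z (inN1 m hm') zZ.
    exact: abs_sub_le q3 q4 q1 q2.
  have D2 : forall n m z, (s1 <= n < t1)%N -> (s1 <= m < t1)%N -> z \in C ->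
     `|ty X n z - ty X m z| <= 2 * ty_ t + e t * (2 / Lv).
    move=> n m z hn hm zC.
    have hn' : (s1 <= n <= t1)%N by nlia.
    have hm' : (s1 <= m <= t1)%N by nlia.
    have q1 := y_ln n z hn zC; have q2 := y_ln m z hm zC.
    have /andP[a1 _] := confC n z (inN n hn) zC; have /andP[a2 _] := confC m z (inN m hm) zC.
    have L0 : 0 < Lv / 2 * X0 by rewrite mulr_gt0 // divr_gt0.
    have q3 := ln_lip L0 a1 a2.
    have q4 : `|tx X n z - tx X m z| / (Lv / 2 * X0) <= e t * (2 / Lv).
      rewrite ler_pdivrMr // (_ : e t * (2 / Lv) * (Lv / 2 * X0) = e t * X0); first exact: dC.
      by field; exact: lt0r_neq0.
    rewrite (_ : _ - _ = (ty X n z - ln (tx X n z)) + (ln (tx X n z) - ln (tx X m z)) - (ty X m z - ln (tx X m z))); last by ring.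
    apply: le_trans (abs_tri3 q1 (le_trans q3 q4) q2) _; rewrite le_eqVlt; apply/orP; left; apply/eqP; ring.
  have osc1 : osc (freeze C X) s1 t1 (e2 t).
    have D20 : 0 <= 2 * ty_ t + e t * (2 / Lv) by rewrite addr_ge0 // mulr_ge0 ?divr_ge0 ?(ltW Lv0) ?(ltW et0) ?(ltW ty0').
    have := osc_frozen CZ HD Nb as1 tN1 D20 D1 D2; apply: osc_sub => //.
    rewrite (_ : eps + _ = eps * (1 + 2 * A * B * Cs * Nn) + A * (B + 2 / Lv) * e t + 2 * (A * ty_ t)); last by rewrite /A; ring.
    have u1 : eps * (1 + 2 * A * B * Cs * Nn) <= e2 t / 8 by rewrite mulrC; apply: le_trans (le_trans E1 dle) m3.
    have u2 : e t * (8 * (A * (B + 2 / Lv) + 1)) <= e2 t by rewrite -ler_pdivlMr // mulr_gt0 // ltr_wpDl.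
    have u3 : ty_ t * (8 * (A + 1)) <= e2 t by rewrite -ler_pdivlMr // mulr_gt0 // ltr_wpDl.
    have u4 : A * (B + 2 / Lv) * e t <= e2 t / 8.
      by move: u2; set Y := A * (B + 2 / Lv); rewrite (_ : e t * (8 * (Y + 1)) = 8 * (Y * e t) + 8 * e t); [move: (ltW et0); clra | ring].
    have u5 : A * ty_ t <= e2 t / 8.
      by move: u3; rewrite (_ : ty_ t * (8 * (A + 1)) = 8 * (A * ty_ t) + 8 * ty_ t); [move: (ltW ty0'); clra | ring].
    by move: u1 u4 u5 (ltW e2t0); clra.
  have run1 : run (Z :\: C) (freeze C X) s1 t1 by exact: run_sub Hf.
  have [V Vs [near res]] := Hd (freeze C X) s1 t1 st1 run1 osc1.
  have iV : (index V s < size s)%N by rewrite index_mem.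
  exists (Ordinal iV).
  have nV : nth 0%VS s (Ordinal iV) = V by rewrite /= nth_index.
  split=> [m n|].
    have Uneg u : U (Ordinal iV) u -> U (Ordinal iV) (fun z => - u z).
      case=> v vV hu; exists (- v); first by rewrite rpredN.
      move=> z; rewrite hu; case: ifP => _; last by rewrite oppr0.
      by rewrite /dot -sumrN; apply: eq_bigr => x _; rewrite ffunE mulNr.
    wlog mn : m n / (m <= n)%N => [H hm hn|hm hn].
      have /orP[h|h] := leq_total m n; first exact: H.
      have [u Uu hu] := H n m h hn hm; exists (fun z => - u z); first exact: Uneg.
      apply: le_trans hu; rewrite le_eqVlt; apply/orP; left; apply/eqP.
      by apply: eq_bigr => z _; rewrite -normrN; congr (`| _ |); ring.
    pose D := (cost X s1 t1 + \sum_(z in Z :\: C) tx X s1 z) / e2 t + 2 * Cs * eps * X0.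
    have hs1 : (s1 <= s1 <= t1)%N by nlia.
    have c1 : cost X s1 t1 <= eps * X0 by apply: le_trans (cd_cost HD); apply: (cost_mono HX) => //; nlia.
    have c2 : 0 <= cost X s1 t1 by apply: (cost_ge0 HX) => //; nlia.
    have S2 := sumZ' s1 hs1.
    have S0 : 0 <= \sum_(z in Z :\: C) tx X s1 z.
      by apply: sumr_ge0 => z zD; apply/ltW/pos; [exact: inN1 | move: zD; rewrite inE => /andP[]].
    have X2 : 0 <= 2 * Cs * eps * X0 by rewrite !mulr_ge0 // ltW.
    have Dle : D <= eps * X0 * (1 + 2 * Cs * Nn + 2 * Cs) * ((e2 t)^-1 + 1).
      have v0 : 0 <= (e2 t)^-1 by rewrite invr_ge0 ltW.
      have : (cost X s1 t1 + \sum_(z in Z :\: C) tx X s1 z) / e2 t <= (eps * X0 + Nn * (2 * Cs * eps * X0)) / e2 t.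
        by apply: ler_wpM2r => //; exact: lerD.
      have : 0 <= (2 * Cs * eps * X0) / e2 t by rewrite divr_ge0 // ltW.
      have : 0 <= Nn * (2 * Cs * eps * X0) by rewrite mulr_ge0.
      have : 0 <= eps * X0 by rewrite mulr_ge0 // ltW.
      have -> : eps * X0 * (1 + 2 * Cs * Nn + 2 * Cs) * ((e2 t)^-1 + 1) = (eps * X0 + Nn * (2 * Cs * eps * X0)) / e2 t +
        (2 * Cs * eps * X0) / e2 t + eps * X0 + Nn * (2 * Cs * eps * X0) + 2 * Cs * eps * X0 by ring.
      by rewrite /D; clra.
    have nk : Near (kers V zs) (disp X m n) (D / dk).
      apply: (Hdk dk dk0 (lexx _) V Vs).
        apply: Near_le (near m n _ _) => //; rewrite /D ?lerDl //; nlia.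
      move=> z; rewrite mem_enum => zD.
      have zZ : z \in Z by move: zD; rewrite inE => /andP[].
      rewrite (run_disp HX1) //; [|nlia|nlia].
      have q1 := small' n z (inN1 n hn) zD; have q2 := small' m z (inN1 m hm) zD.
      have q3 := pos n z (inN1 n hn) zZ; have q4 := pos m z (inN1 m hm) zZ.
      have : 0 <= (cost X s1 t1 + \sum_(z in Z :\: C) tx X s1 z) / e2 t by rewrite divr_ge0 ?addr_ge0 // ltW.
      by rewrite /D => dd; apply: le_trans (abs_sub_le q3 q4 q1 q2) _; rewrite lerDr.
    case: nk => v vV hv.
    have dsc z : dot ((X0^-1 : R) *: v) (r z) = dot v (r z) / X0.
      rewrite /dot mulr_suml; apply: eq_bigr => x _; rewrite ffunE [LHS](_ : _ = X0^-1 * v x * r z x) //; ring.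
    exists (fun z => if z \in C then dot v (r z) / X0 else 0).
      exists ((X0^-1 : R) *: v); first by rewrite nV rpredZ.
      by move=> z; rewrite dsc.
    rewrite (norm1_on (C := C)); last by move=> z zC; rewrite p_out // (negbTE zC) subr0.
    apply: (@le_trans _ _ (Nn * (Msup * (D / dk) / X0))).
      have D0 : 0 <= D / dk by apply: le_trans hv; exact: norm1_ge0.
      apply: sum_card_le => [|z zC]; first by rewrite divr_ge0 ?(ltW X00) // mulr_ge0.
      rewrite zC p_in // -mulrBl normrM (gtr0_norm X0V); apply: ler_wpM2r; first exact: ltW.
      rewrite -(run_disp HX1) //; [|nlia|nlia|exact: (fintype.subsetP CZ)].
      rewrite -dotBl dotC; apply: le_trans (dot_bound (M := Msup) _ _) _; first by move=> x; exact: r_le.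
      exact: ler_wpM2l.
    rewrite ler_pdivlMr //.
    apply: (@le_trans _ _ (K0 * eps * ((e2 t)^-1 + 1) * e t)).
      apply: ler_wpM2r; first exact: ltW.
      rewrite /K0 /A (_ : Nn * (Msup * (D / dk) / X0) = Nn * Msup / dk / X0 * D); last by ring.
      have P0 : 0 <= Nn * Msup / dk / X0 by rewrite !divr_ge0 ?mulr_ge0 // ltW.
      apply: le_trans (ler_wpM2l P0 Dle) _; rewrite le_eqVlt; apply/orP; left; apply/eqP.
      by field; rewrite !lt0r_neq0.
    have v1 : 0 < (e2 t)^-1 + 1 by rewrite addr_gt0 // invr_gt0.
    rewrite -mulrA -[leRHS]mulr1; apply: ler_pM => //.
    - by rewrite mulr_ge0 ?(ltW eps0) // /K0 mulr_ge0 ?divr_ge0 ?(ltW dk0) // !addr_ge0 ?mulr_ge0 // ltW.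
    - by rewrite mulr_ge0 // ltW.
    by rewrite mulrC -ler_pdivlMr // mul1r.
  move=> u [v vV hu].
  have liftP : lift (Ordinal iV) u \in kers V zs /\
     (forall z, z \in C -> dot (lift (Ordinal iV) u) (r z) = u z) /\ norm1 (lift (Ordinal iV) u) <= Kl * norm1 u.
    rewrite -{2}nV; apply: (@xgetPex _ (0 : F) [set v | v \in kers (nth 0%VS s (Ordinal iV)) zs /\
      (forall z, z \in C -> dot v (r z) = u z) /\ norm1 v <= Kl * norm1 u]).
    rewrite nV in vV *; have [w' w'V [h1 h2]] := Hl V Vs v vV.
    exists w'; split=> //; split=> [z zC|]; first by rewrite h1 // hu zC.
    apply: le_trans h2 _; rewrite (norm1_on (C := C)); last by move=> z /negbTE zC; rewrite hu zC.
    rewrite le_eqVlt; apply/orP; left; apply/eqP; congr (_ * _); apply: eq_bigr => z zC.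
    by rewrite hu zC.
  case: liftP; set w' := lift _ u => w'V [w'C w'n].
  have [w'V' w'Z] := mem_kers w'V.
  have hs1 : (s1 <= s1 < t1)%N by nlia.
  have hsb : (a <= s1 < b)%N by nlia.
  have hab : (a <= a < b)%N by nlia.
  have u0 : 0 <= norm1 u by exact: norm1_ge0.
  have r1 := res s1 hs1 w' w'V'.
  have eq1 : dot (tg (freeze C X) s1) w' = dot (bt s1) w' + \sum_(z in C) (q s1 z + ty X s1 z) * u z.
    have sw (A1 : {set L}) (g : L -> R) : dot (fun x => \sum_(z in A1) g z * r z x) w' = \sum_(z in A1) g z * dot w' (r z).
      rewrite dotC dot_sumr; apply: eq_bigr => z _; rewrite /dot mulr_sumr; apply: eq_bigr => x _; ring.
    rewrite /= dotDl (dot_eq (f' := fun x => bt s1 x + \sum_(z in Z) q s1 z * r z x) (g' := w')) //; last by move=> x; exact: (cd_dec HD).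
    rewrite dotDl !sw -addrA; congr (_ + _).
    rewrite (bigID (mem C)) /= [X in _ + X + _]big1 ?addr0; last first.
      move=> z zD; rewrite w'Z ?mulr0 // mem_enum inE andbC //.
    rewrite (eq_bigl (mem C)); last by move=> z /=; rewrite andb_idl // => /(fintype.subsetP CZ).
    by rewrite -big_split /=; apply: eq_bigr => z zC; rewrite w'C //; ring.
  have -> : dot (mu s1) u - phi (Ordinal iV) u = dot (tg (freeze C X) s1) w' + dot (fun x => bt a x - bt s1 x) w' -
     \sum_(z in C) (ty X s1 z - ln (tx X s1 z)) * u z.
    rewrite eq1 dotBl /phi -/w'.
    have -> : dot (mu s1) u = \sum_(z in C) (ln (tx X s1 z) - ln X0 + (q s1 z - q a z)) * u z.
      rewrite /dot [RHS]big_mkcond /=; apply: eq_bigr => z _; rewrite /mu; case: ifP => //; by rewrite mul0r.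
    apply/eqP; rewrite -subr_eq0; apply/eqP.
    set a1 := dot (bt s1) w'; set a2 := dot (bt a) w'.
    set b1 := \sum_(z in C) (ln (tx X s1 z) - ln X0 + (q s1 z - q a z)) * u z.
    set b2 := \sum_(z in C) (ln X0 + q a z) * u z.
    set b3 := \sum_(z in C) (q s1 z + ty X s1 z) * u z.
    set b4 := \sum_(z in C) (ty X s1 z - ln (tx X s1 z)) * u z.
    have : b1 + b2 - b3 + b4 = 0.
      rewrite /b1 /b2 /b3 /b4 -big_split -sumrB -big_split /= big1 // => z _; ring.
    move=> h; apply: etrans h; ring.
  apply: le_trans (ler_normB _ _) _; apply: le_trans (lerD (ler_normD _ _) (lexx _)) _.
  have r2 : `|dot (fun x => bt a x - bt s1 x) w'| <= eps * norm1 w' by apply: dot_bound => x; exact: (cd_osc HD).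
  have r3 : `|\sum_(z in C) (ty X s1 z - ln (tx X s1 z)) * u z| <= ty_ t * norm1 u.
    apply: le_trans (ler_norm_sum _ _ _) _; rewrite (norm1_on (C := C)); last by move=> z /negbTE zC; rewrite hu zC.
    rewrite mulr_sumr; apply: ler_sum => z zC; rewrite normrM ler_wpM2r //; exact: y_ln.
  have r4 : t / (3 * Kl) * norm1 w' <= t / 3 * norm1 u.
    have t3 : 0 <= t / (3 * Kl) by rewrite divr_ge0 ?mulr_ge0 // ltW.
    apply: le_trans (ler_wpM2l t3 w'n) _; rewrite le_eqVlt; apply/orP; left; apply/eqP.
    by field; exact: lt0r_neq0.
  have r5 : eps * norm1 w' <= t / 3 * norm1 u.
    by apply: le_trans r4; rewrite ler_wpM2r ?norm1_ge0 // (le_trans epse).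
  have r6 : ty_ t * norm1 u <= t / 3 * norm1 u by rewrite ler_wpM2r.
  rewrite (_ : t * norm1 u = t / 3 * norm1 u + t / 3 * norm1 u + t / 3 * norm1 u); last by field.
  by move: r1 r2 r3 r4 r5 r6; clra.
have dist_a : dist p a N.+1 <= w by apply: (Hpath _ _ _ _ _ Hp); nlia.
move=> n; have [->|nN] := eqVneq n N.+1; last by move=> hn; apply: conf; nlia.
move=> hn; split=> z zC; last first.
  by apply: le_trans (small' _ _ hn zC) _; rewrite ler_pM2r // (le_trans E8).
have zZ := fintype.subsetP CZ z zC.
have h1 : `|p N.+1 z - p a z| <= w by apply: le_trans dist_a; exact: (norm1_coord (fun z => p N.+1 z - p a z)).
have haa : (a <= a <= N.+1)%N by nlia.
rewrite (_ : th1 = 2 * (th1 / 2)); last by field.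
apply: ln_of_close; [exact: pos | exact: pos | by move: th12 th10; clra |].
move: h1; rewrite /p zC -mulrBl normrM (gtr0_norm (_ : 0 < X0^-1)) ?invr_gt0 // ler_pdivrMr // => h1.
apply: le_trans h1 _; rewrite /w.
have /andP[c1 _] := cd_C HD zC.
rewrite (_ : Lv * th1 / 2 * X0 = th1 / 2 * (Lv * X0)); last by ring.
by rewrite ler_pM2l // divr_gt0.
Qed.

End Cluster.

(** * Convergence of dissipative trajectories *)

Section Main.
Variables (R : realType) (L E : finType) (r : L -> E -> R) (kap : R -> R).
Hypothesis kap0 : forall th, 0 < th -> 0 < kap th.
Local Notation run := (run r kap).
Implicit Types (Z C : {set L}) (X : traj R L E).
Local Notation N_move := (N_move r kap).
Local Notation N_disp := (N_disp r kap).
Local Notation Msup := (Msup r).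
Local Notation freeze := (freeze r).
Let Nn : R := #|L|%:R.

(** A run in which the external force contains the coupling [q], which varies with the amounts
    and is not small.  Its Lipschitz constant is relative to the scale of the amounts. *)
Record coupled_run Z (B eps : R) X (a b : nat) (bt : nat -> E -> R) (q : nat -> L -> R) (Q : R) : Prop := CoupledRun {
  cr_run : run Z X a b;
  cr_dec : forall n e, (a <= n < b)%N -> tg X n e = bt n e + \sum_(z in Z) q n z * r z e;
  cr_osc : forall n m e, (a <= n < b)%N -> (a <= m < b)%N -> `|bt n e - bt m e| <= eps;
  cr_Q : 0 <= Q;
  cr_QB : forall z, z \in Z -> Q * tx X a z <= B;
  cr_lip : forall n m z, (a <= n < b)%N -> (a <= m < b)%N -> z \in Z ->
    `|q n z - q m z| <= Q * \sum_(i in Z) `|tx X n i - tx X m i|;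
  cr_mono : forall n m, (a <= n < b)%N -> (a <= m < b)%N ->
    0 <= \sum_(z in Z) (q n z - q m z) * (tx X n z - tx X m z) }.

(** The version of [N_move] with a monotone coupling. *)
Definition N_moveQ Z := forall B th : R, 0 <= B -> 0 < th -> small (fun eps =>
  forall X a b bt q Q, coupled_run Z B eps X a b bt q Q -> forall n z, (a <= n <= b)%N -> z \in Z ->
    `|ln (tx X n z) - ln (tx X a z)| <= th \/ eps * tx X a z <= cost X a b).

Lemma N_moveQ_move Z : N_moveQ Z -> N_move Z.
Proof.
move=> H th th0; apply: small_imp (H 0 th (lexx _) th0) => eps eps0 {}H X a b HX Ho.
apply: (H X a b (tg X) (fun _ _ => 0) 0); split=> //.
- by move=> n e _; rewrite big1 ?addr0 // => z _; rewrite mul0r.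
- by move=> z _; rewrite mul0r.
- by move=> *; rewrite subrr normr0 mul0r.
by move=> *; rewrite big1 // => z _; rewrite subrr mul0r.
Qed.

Lemma increasing_stops (Cs : nat -> {set L}) : (forall k, Cs k \subset Cs k.+1) -> Cs 0 != finset.set0 ->
  exists2 k, (k <= #|L|)%N & Cs k.+1 \subset Cs k.
Proof.
move=> inc C0; apply/not_exists2P => H.
suff h k : (k <= #|L|.+1)%N -> (k < #|Cs k|)%N.
  have h1 := h #|L|.+1 (leqnn _); have h2 := max_card (mem (Cs #|L|.+1)).
  by rewrite ltnNge (leq_trans h2 (leqnSn _)) in h1.
elim: k => [|k IH] hk; first by rewrite card_gt0.
have := IH (ltnW hk); move=> /leq_ltn_trans; apply; apply: proper_card.
rewrite properE inc /=; apply/negP => h; case: (H k) => [|/(_ h)//].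
by move/negP; rewrite -ltnNge; nlia.
Qed.

(** Choose a decreasing sequence of levels, each negligible compared with the previous one in the
    sense needed by [cluster_rigid].  By [increasing_stops] two consecutive levels select the same
    set [C], so there is a gap below [C].  If the cost is small compared with the largest amount, the
    cluster is rigid, its frozen log-activities and the coupling vary little, and [N_move] applies
    to the components below the gap. *)
Lemma moveQ_step Z : (forall C, C \subset Z -> C != finset.set0 -> N_move (Z :\: C) /\ N_disp (Z :\: C)) -> N_moveQ Z.
Proof.
move=> HC B th B0 th0.
have M0 : 0 <= Msup by exact: Msup_ge0.
have N0 : 0 <= Nn by exact: ler0n.
have [em em0 Hem] : small (fun eps => forall C, C \subset Z -> C != finset.set0 ->
  forall X a b, run (Z :\: C) X a b -> osc X a b eps -> forall n z, (a <= n <= b)%N -> z \in Z :\: C ->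
    `|ln (tx X n z) - ln (tx X a z)| <= th \/ eps * tx X a z <= cost X a b).
  apply: small_all => C; have [[CZ C0]|h] := pselect (C \subset Z /\ C != finset.set0); last first.
    by exists 1 => // d _ _ CZ C0; case: h.
  by have [h _] := HC C CZ C0; apply: small_imp (h th th0) => d _ h' _ _.
have {Hem} Hem := Hem em em0 (lexx _).
have P0 : 0 <= Nn * Msup * (5 * B * Nn + 4) by rewrite !mulr_ge0 ?addr_ge0 ?mulr_ge0.
pose th' := Num.min (Num.min th 2^-1) (em / 2 / (Nn * Msup * (5 * B * Nn + 4) + 1)).
have th'0 : 0 < th' by rewrite !lt_min th0 invr_gt0 ltr0n /= !divr_gt0 // ltr_wpDl.
have [th'1 th'2 th'3] : [/\ th' <= th, th' <= 2^-1 & th' * (Nn * Msup * (5 * B * Nn + 4) + 1) <= em / 2].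
  split; first by rewrite /th' !ge_min lexx.
    by rewrite /th' !ge_min lexx orbT.
  by rewrite -ler_pdivlMr ?ltr_wpDl // /th' ge_min lexx orbT.
have /choice[f Hf] : forall Lv : R, exists d, 0 < Lv -> 0 < d /\ forall C, C \subset Z -> C != finset.set0 ->
   forall X a b bt q (Q X0 : R), cluster_data r kap Z C B Lv d X a b bt q Q X0 -> confined Z C X X0 a b th'.
  move=> Lv; have [Lv0|Lv0] := ltP 0 Lv; last by exists 1 => ?; exfalso; lra.
  have [d d0 Hd] : small (fun d => forall C, C \subset Z -> C != finset.set0 ->
    forall X a b bt q (Q X0 : R), cluster_data r kap Z C B Lv d X a b bt q Q X0 -> confined Z C X X0 a b th').
    apply: small_all => C; have [[CZ C0]|h] := pselect (C \subset Z /\ C != finset.set0); last first.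
      by exists 1 => // d _ _ CZ C0; case: h.
    have [h1 h2] := HC C CZ C0.
    by apply: small_imp (cluster_rigid kap0 CZ h1 h2 B0 Lv0 th'0) => d _ h' _ _.
  by exists d => _; split=> //; apply: Hd.
(* each level is small enough for [cluster_rigid] with the previous one as lower bound *)
pose lev := fix lev k : R := if k is k'.+1 then Num.min (lev k') (Num.min (f (lev k')) (kap th' * (lev k' / 4))) else Num.min 1 (em / 2).
have [lev01 lev0e] : lev 0%N <= 1 /\ lev 0%N <= em / 2 by rewrite /= !ge_min !lexx orbT.
have lev0 k : 0 < lev k.
  elim: k => [|k IH]; first by rewrite /= lt_min ltr01 divr_gt0.
  rewrite /= !lt_min IH /= (Hf _ IH).1 /= mulr_gt0 ?kap0 ?divr_gt0 //.
have levS k : [/\ lev k.+1 <= lev k, lev k.+1 <= f (lev k) & lev k.+1 <= kap th' * (lev k / 4)].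
  by split; rewrite /= !ge_min lexx ?orbT.
have levm k j : lev (k + j)%N <= lev k.
  by elim: j => [|j IH]; rewrite ?addn0 // addnS; apply: le_trans IH; have [] := levS (k + j)%N.
exists (Num.min (lev #|L|.+1) (em / 2)); first by rewrite lt_min lev0 divr_gt0.
move=> eps eps0; rewrite le_min => /andP[eps_lev eps_em] X a b bt q Q HR n z hn zZ.
have [ab|ba] := ltnP a b; last first.
  have e : n = a by nlia.
  by left; rewrite e subrr normr0 ltW.
have HX := cr_run HR.
have haa : (a <= a <= b)%N by nlia.
have pos i k : (a <= k <= b)%N -> i \in Z -> 0 < tx X k i by move=> *; apply: (run_pos HX).
have [z1 z1Z z1max] : exists2 z1, z1 \in Z & forall i, i \in Z -> tx X a i <= tx X a z1.
  by case: (@arg_maxP _ _ _ z (mem Z) (tx X a) zZ) => z1 z1Z zm; exists z1.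
set X0 := tx X a z1 in z1max; have X00 : 0 < X0 by exact: pos.
have [K|K] := leP (eps * X0) (cost X a b).
  by right; apply: le_trans K; rewrite ler_pM2l // z1max.
pose Ck k := [set i in Z | lev k * X0 <= tx X a i].
have [||k kL Ckk] := @increasing_stops Ck.
- move=> k; apply/fintype.subsetP => i; rewrite !inE => /andP[-> h] /=; apply: le_trans h.
  by rewrite ler_pM2r //; have [] := levS k.
- by apply/finset.set0Pn; exists z1; rewrite inE z1Z /= -[leRHS]mul1r ler_pM2r.
set C := Ck k in Ckk.
have CZ : C \subset Z by apply/fintype.subsetP => i; rewrite inE => /andP[].
have C0 : C != finset.set0.
  by apply/finset.set0Pn; exists z1; rewrite inE z1Z /= -[leRHS]mul1r ler_pM2r //; exact: le_trans (levm 0%N k) lev01.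
have eps_k : eps <= lev k.+1.
  by apply: le_trans eps_lev _; have := levm k.+1 (#|L| - k)%N; rewrite addSn subnKC.
have [l1 l2 l3] := levS k.
have HD : cluster_data r kap Z C B (lev k) (lev k.+1) X a b bt q Q X0.
  split=> //.
  - exact: (cr_dec HR).
  - by move=> *; apply: le_trans eps_k; exact: (cr_osc HR).
  - exact: (cr_Q HR).
  - exact: (cr_QB HR).
  - exact: (cr_lip HR).
  - exact: (cr_mono HR).
  - by move=> i; rewrite inE => /andP[iZ ->]; rewrite z1max.
  - move=> i; rewrite inE => /andP[iC iZ]; rewrite leNgt; apply/negP => h.
    by move/negP: iC; apply; apply: (fintype.subsetP Ckk); rewrite inE iZ ltW.
  by apply/ltW/(lt_le_trans K); rewrite ler_pM2r.
have HDf : cluster_data r kap Z C B (lev k) (f (lev k)) X a b bt q Q X0.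
  case: HD => d1 d2 d3 d4 d5 d6 d7 d8 d9 d10 d11 d12; split=> //.
  - by move=> norm1 m1 e1 h1 h2; apply: le_trans l2; exact: d4.
  - by move=> i /d11 h; apply: le_trans h _; rewrite ler_pM2r.
  by apply: le_trans d12 _; rewrite ler_pM2r.
have conf := (Hf (lev k) (lev0 k)).2 C CZ C0 _ _ _ _ _ _ _ HDf.
have [zC|zC] := boolP (z \in C).
  by left; apply: le_trans th'1; have [h _] := conf n hn; exact: h.
have zD : z \in Z :\: C by rewrite inE zC.
have bb : (b.-1 < b)%N by nlia.
have conf1 : confined Z C X X0 a b.-1 th' by move=> i hi; apply: conf; nlia.
have HF : run (Z :\: C) (freeze C X) a b by exact: run_freeze.
have inb i : (a <= i < b)%N -> (a <= i <= b.-1)%N by nlia.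
have Q1 : forall i j, (a <= i < b)%N -> (a <= j < b)%N -> Q * \sum_(x in Z) `|tx X i x - tx X j x| <= 5 * B * Nn * th'.
  move=> i j hi hj.
  apply: le_trans (ler_wpM2l (cr_Q HR) (conf_sum CZ HD bb th'0 th'2 conf1 (inb _ hi) (inb _ hj))) _.
  rewrite (_ : Q * (Nn * (5 * th' * X0)) = (Q * X0) * (5 * Nn * th')); last by ring.
  rewrite (_ : 5 * B * Nn * th' = B * (5 * Nn * th')); last by ring.
  by rewrite ler_wpM2r ?(cr_QB HR) // !mulr_ge0 // ltW.
have R3 i x : (a <= i < b)%N -> x \in C -> `|ty X i x - ln (tx X i x)| <= th'.
  move=> hi xC; have e3 : lev k.+1 < kap th' * (lev k / 2).
    apply: le_lt_trans l3 _; rewrite ltr_pM2l ?kap0 // ltr_pM2l // ltf_pV2 ?posrE // ltr_nat //.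
  by have [] := conf_R3 kap0 CZ HD bb th'2 conf1 th'0 e3 (inb _ hi) xC.
have Y1 : forall i j x, (a <= i < b)%N -> (a <= j < b)%N -> x \in C -> `|ty X i x - ty X j x| <= 4 * th'.
  move=> i j x hi hj xC.
  have y1 := R3 i x hi xC; have y2 := R3 j x hj xC.
  have [/(_ x xC) x1 _] := conf1 i (inb _ hi); have [/(_ x xC) x2 _] := conf1 j (inb _ hj).
  rewrite (_ : ty X i x - ty X j x = ((ty X i x - ln (tx X i x)) + (ln (tx X i x) - ln (tx X a x)) -
     (ln (tx X j x) - ln (tx X a x))) + 0 - (ty X j x - ln (tx X j x))); last by ring.
  have := abs_tri3 (abs_tri3 y1 x1 x2) (_ : `|0| <= 0) y2; rewrite normr0 => /(_ (lexx _)).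
  by rewrite (_ : th' + th' + th' + 0 + th' = 4 * th'); last ring.
have th4 : 0 <= 4 * th' by rewrite mulr_ge0 // ltW.
have ab1 : (b <= b.-1.+1)%N by nlia.
have Ho := osc_frozen CZ HD bb (leqnn a) ab1 th4 Q1 Y1.
have Hoe : osc (freeze C X) a b em.
  apply: osc_sub Ho => //.
  have e1 : lev k.+1 <= em / 2 by apply: le_trans l1 _; exact: le_trans (levm 0%N k) lev0e.
  have -> : Nn * (5 * B * Nn * th' + 4 * th') * Msup = th' * (Nn * Msup * (5 * B * Nn + 4)) by ring.
  move: th'3 (ltW th'0) e1; rewrite mulrDr mulr1; set u := th' * _; set v := lev _.
  by clear -kap0 r Nn; lra.
have [h|h] := Hem C CZ C0 _ a b HF Hoe n z hn zD; first by left.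
right; apply: le_trans h; rewrite ler_pM2r ?pos //; apply: le_trans eps_em _.
by rewrite ler_pdivrMr // mulr_natr mulr2n lerDl ltW.
Qed.

(** Strong induction on the number of components. *)
Lemma all_sets Z : N_disp Z /\ N_moveQ Z.
Proof.
have [k] := ubnP #|Z|; elim: k Z => // k IH Z; rewrite ltnS => cZ.
have HQ : N_moveQ Z.
  apply: moveQ_step => C CZ /finset.set0Pn[z zC].
  have [|h1 h2] := IH (Z :\: C); last by split=> //; exact: N_moveQ_move.
  apply: leq_trans cZ; apply: proper_card; rewrite properE subsetDl /=.
  by apply/negP => /fintype.subsetP /(_ z (fintype.subsetP CZ z zC)); rewrite inE zC.
split=> //; have [->|Z0] := eqVneq Z finset.set0; first exact: N_disp0.
apply: (disp_step kap0 Z0) => [|z zZ]; first exact: N_moveQ_move.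
have [|h1 h2] := IH (Z :\ z) => //.
by apply: leq_trans cZ; rewrite [X in (_ < X)%N](cardsD1 z) zZ.
Qed.

(** In the tail of the sequence the cost is as small as desired.  A component that moves
    logarithmically has an amount bounded by a multiple of the cost, and it stays small by
    [growth_core]; otherwise it moves little.  Hence the amounts form a Cauchy sequence. *)
Lemma run_cvg X (bt : nat -> E -> R) (q : nat -> L -> R) (Q Bx K : R) :
  (forall b, run finset.setT X 0 b) -> (forall b, cost X 0 b <= K) ->
  (forall n z, tx X n z <= Bx) ->
  (forall n e, tg X n e = bt n e + \sum_z q n z * r z e) ->
  (forall eps, 0 < eps -> exists n0, forall n m e, (n0 <= n)%N -> (n0 <= m)%N -> `|bt n e - bt m e| <= eps) ->
  0 <= Q ->
  (forall n m z, `|q n z - q m z| <= Q * \sum_i `|tx X n i - tx X m i|) ->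
  (forall n m, 0 <= \sum_z (q n z - q m z) * (tx X n z - tx X m z)) ->
  forall z, cvgn (fun n => tx X n z).
Proof.
move=> HX HK HB Hdec Hosc Q0 Hlip Hmono z.
have pos n i : 0 < tx X n i by apply: (run_pos (HX n.+1)) => //; rewrite ?finset.in_setT //=.
have Bx0 : 0 < Bx by exact: lt_le_trans (pos 0%N z) (HB _ _).
apply: cauchy_cvg; apply: cauchy_exP => tau tau0.
pose th := Num.min 2^-1 (tau / (8 * Bx)).
have th0 : 0 < th by rewrite lt_min invr_gt0 ltr0n divr_gt0 // mulr_gt0.
have [th2 thB] : th <= 2^-1 /\ th * (8 * Bx) <= tau.
  split; first by rewrite /th ge_min lexx.
  by rewrite -ler_pdivlMr ?mulr_gt0 // /th ge_min lexx orbT.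
have QB0 : 0 <= Q * Bx by rewrite mulr_ge0 // ltW.
have [eps eps0 /(_ eps eps0 (lexx _)) H] := (all_sets finset.setT).2 (Q * Bx) th QB0 th0.
pose Cg := growth_cst kap eps.
have Cg1 : 1 <= Cg.
  have k10 : 0 < kap 1 by exact: kap0.
  have e1 : 1 <= expR 1 :> R by rewrite -[X in X <= _]expR0 ler_expR.
  have p1 : 0 < eps^-1 by rewrite invr_gt0.
  have p2 : 0 < expR 1 / kap 1 by rewrite divr_gt0 // expR_gt0.
  have p3 : 0 < expR 1 * expR 1 / eps by rewrite divr_gt0 // mulr_gt0 // expR_gt0.
  by rewrite /Cg /growth_cst; lra.
have Cg0 : 0 < Cg by exact: lt_le_trans Cg1.
have ie0 : 0 < eps^-1 + 1 by rewrite addr_gt0 // invr_gt0.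
pose eta := tau / (4 * Cg * (eps^-1 + 1)).
have eta0 : 0 < eta by rewrite divr_gt0 // !mulr_gt0.
have [norm1 tail] : exists norm1, forall n, (norm1 <= n)%N -> cost X norm1 n <= eta.
  have nd : nondecreasing_seq (fun n => cost X 0 n).
    by move=> m n mn; apply: (cost_mono (HX n)).
  have ub : has_ubound (range (fun n => cost X 0 n)) by exists K => _ [n _ <-].
  have cv := nondecreasing_is_cvgn nd ub.
  have := cv => /cvgrPdist_le /(_ eta eta0) [norm1 _ Hn1]; exists norm1 => n hn.
  have := Hn1 norm1 (leqnn _); have := nondecreasing_cvgn_le nd cv n.
  rewrite (cost_cat X (a := 0%N) (m := norm1) (b := n)) //= => h1 /ler_normlP[_ h2]; lra.
have [n2 Ho] := Hosc eps eps0.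
pose n0 := maxn norm1 n2.
have tail0 n : (n0 <= n)%N -> cost X n0 n <= eta.
  move=> hn; apply: le_trans (tail n _); last by nlia.
  by apply: (cost_mono (HX n)) => //; nlia.
have HR m n : (n0 <= m)%N -> coupled_run finset.setT (Q * Bx) eps X m n bt q Q.
  move=> hm; split=> //.
  - by apply: run_sub (HX n).
  - by move=> k e _; rewrite Hdec; congr (_ + _); apply: eq_bigl => i; rewrite finset.in_setT.
  - by move=> k k' e h1 h2; apply: Ho; nlia.
  - by move=> i _; rewrite ler_wpM2l.
  - move=> k k' i _ _ _; apply: le_trans (Hlip k k' i) _.
    by rewrite (eq_bigl (fun i => i \in finset.setT)) // => j; rewrite finset.in_setT.
  move=> k k' _ _; rewrite (eq_bigl predT) //.
  by move=> j; rewrite finset.in_setT.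
have HM m n : (n0 <= m <= n)%N -> `|ln (tx X n z) - ln (tx X m z)| <= th \/ eps * tx X m z <= cost X m n.
  by move=> /andP[h1 h2]; apply: (H _ _ _ _ _ _ (HR m n h1)); rewrite ?finset.in_setT // h2 leqnn.
exists (tx X n0 z); exists n0 => // n /= hn; rewrite /ball /= distrC.
have [|h|h] := HM n0 n; first by rewrite leqnn.
  apply: le_lt_trans (close_of_ln (pos _ _) (pos _ _) th2 h) _.
  have : 2 * th * tx X n0 z <= 2 * th * Bx by rewrite ler_pM2l // mulr_gt0.
  by lra.
have [->|nn0] := eqVneq n n0; first by rewrite subrr normr0.
have ab : (n0 < n)%N by nlia.
have HX0 : run finset.setT X n0 n by apply: run_sub (HX n).
have xe : tx X n0 z <= eta / eps.
  by rewrite ler_pdivlMr // mulrC; apply: le_trans h _; exact: tail0.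
have g m : (n0 <= m <= n)%N -> tx X m z <= Cg * (tx X n0 z + cost X n0 n).
  move=> hm; apply: (growth_core kap0 eps0 HX0 ab hm); rewrite ?finset.in_setT // => k hk.
  have [|h'|h'] := HM k m; [nlia | by left; apply: le_trans h' _; lra |].
  by right; apply: le_trans h' _; apply: (cost_mono HX0); nlia.
have b : Cg * (tx X n0 z + cost X n0 n) <= tau / 4.
  have e1 : tx X n0 z + cost X n0 n <= eta * (eps^-1 + 1).
    by rewrite mulrDr mulr1; apply: lerD => //; exact: tail0.
  apply: le_trans (ler_wpM2l (ltW Cg0) e1) _; rewrite le_eqVlt; apply/orP; left; apply/eqP.
  by rewrite /eta; field; rewrite !lt0r_neq0 //; rewrite addr_gt0.
apply: le_lt_trans (abs_sub_le (pos n z) (pos n0 z) (le_trans (g n _) b) (le_trans (g n0 _) b)) _.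
- by rewrite hn leqnn.
- by rewrite leqnn hn.
lra.
Qed.

End Main.

(** * Depletion of a species is impossible *)

Definition eventually_n (P : nat -> Prop) := exists n0, forall n, (n0 <= n)%N -> P n.

Lemma eventually_and (P Q : nat -> Prop) : eventually_n P -> eventually_n Q -> eventually_n (fun n => P n /\ Q n).
Proof.
move=> [p Hp] [q Hq]; exists (maxn p q) => n; rewrite geq_max => /andP[pn qn].
by split; [exact: Hp | exact: Hq].
Qed.

Lemma eventually_imp (P Q : nat -> Prop) : (forall n, P n -> Q n) -> eventually_n P -> eventually_n Q.
Proof. by move=> PQ [p Hp]; exists p => n /Hp /PQ. Qed.

Lemma eventually_all (I : finType) (P : I -> nat -> Prop) :
  (forall i, eventually_n (P i)) -> eventually_n (fun n => forall i, P i n).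
Proof.
move=> H; suff : forall s : seq I, eventually_n (fun n => forall i, i \in s -> P i n).
  by move=> /(_ (enum I)); apply: eventually_imp => n h i; apply: h; rewrite mem_enum.
elim=> [|i s IH]; first by exists 0%N.
apply: eventually_imp (eventually_and (H i) IH) => n [h1 h2] j; rewrite inE => /predU1P[->|] //; exact: h2.
Qed.

Section Limits.
Variable R : realType.
Implicit Types (s : nat -> R) (l : R).
Local Open Scope classical_set_scope.

Lemma cvg_eventually s l : s @ \oo --> l -> forall eta, 0 < eta -> eventually_n (fun n => `|s n - l| <= eta).
Proof.
move=> /cvgrPdist_le H eta /H [n0 _ Hn]; exists n0 => n /Hn /=.
by rewrite distrC.
Qed.

Lemma eventually_cvg s l : (forall eta, 0 < eta -> eventually_n (fun n => `|s n - l| <= eta)) -> s @ \oo --> l.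
Proof.
move=> H; apply/cvgrPdist_le => eta /H [n0 Hn]; exists n0 => // n /Hn /=.
by rewrite distrC.
Qed.

Lemma cvgR_unique s l l' : s @ \oo --> l -> s @ \oo --> l' -> l = l'.
Proof. by move=> /cvg_lim <- // /cvg_lim <-. Qed.

Lemma cvg_sumR (I : finType) (F : I -> nat -> R) (L : I -> R) : (forall i, F i n @[n --> \oo] --> L i) ->
  \sum_i F i n @[n --> \oo] --> \sum_i L i.
Proof. by move=> H; apply: cvg_big => //; exact: add_continuous. Qed.

End Limits.

Section Spread.
Variables (R : realType) (N : nat) (v : 'I_N -> R) (c u nu : nat -> 'I_N -> R) (K : nat -> 'I_N -> 'I_N -> R).
Hypotheses (v0 : forall i, 0 < v i) (c0 : forall n i, 0 < c n i) (K0 : forall n i j, 0 <= K n i j)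
  (KC : forall n i j, K n i j = K n j i).
Hypothesis step : forall n i, v i * (c n.+1 i - c n i) = \sum_j K n i j * (nu n j - nu n i).
Implicit Types (Z : {set 'I_N}).

Definition mass n Z : R := \sum_(i in Z) v i * c n i.

Lemma mass_gain n Z : mass n.+1 Z - mass n Z = \sum_(i in Z) \sum_(j in ~: Z) K n i j * (nu n j - nu n i).
Proof.
rewrite /mass -sumrB.
have -> : \sum_(i in Z) (v i * c n.+1 i - v i * c n i) = \sum_(i in Z) \sum_j K n i j * (nu n j - nu n i).
  by apply: eq_bigr => i _; rewrite -mulrBr step.
pose S := \sum_(i in Z) \sum_(j in Z) K n i j * (nu n j - nu n i).
have S0 : S = 0.
  have : S = - S.
    rewrite {1}/S exchange_big /= -sumrN; apply: eq_bigr => i _; rewrite -sumrN; apply: eq_bigr => j _.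
    by rewrite KC; ring.
  by lra.
transitivity (S + \sum_(i in Z) \sum_(j in ~: Z) K n i j * (nu n j - nu n i)); last by rewrite S0 add0r.
rewrite /S -big_split /=; apply: eq_bigr => i _.
by rewrite (bigID (mem Z)) /=; congr (_ + _); apply: eq_bigl => j; rewrite inE.
Qed.

(** All fluxes across the boundary of a sublevel set of the potential enter it. *)
Lemma lower_gain n Z i j : (forall i j, i \in Z -> j \notin Z -> nu n i <= nu n j) -> i \in Z -> j \notin Z ->
  K n i j * (nu n j - nu n i) <= mass n.+1 Z - mass n Z.
Proof.
move=> low iZ jZ; rewrite mass_gain (bigD1 i) //= (bigD1 j) /=; last by rewrite inE.
have t i' j' : i' \in Z -> j' \in ~: Z -> 0 <= K n i' j' * (nu n j' - nu n i').
  by move=> h1; rewrite inE => h2; rewrite mulr_ge0 // subr_ge0 low.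
rewrite -addrA lerDl addr_ge0 //; first by apply: sumr_ge0 => j' /andP[h _]; exact: t.
by apply: sumr_ge0 => i' /andP[h _]; apply: sumr_ge0 => j' h'; exact: t.
Qed.

Lemma lower_ge0 n Z : (forall i j, i \in Z -> j \notin Z -> nu n i <= nu n j) -> mass n Z <= mass n.+1 Z.
Proof.
move=> low; rewrite -subr_ge0 mass_gain; apply: sumr_ge0 => i iZ; apply: sumr_ge0 => j; rewrite inE => jZ.
by rewrite mulr_ge0 // subr_ge0 low.
Qed.

Lemma mass_gt0 n Z i : i \in Z -> 0 < mass n Z.
Proof.
move=> iZ; rewrite /mass (bigD1 i) //= ltr_pwDl ?mulr_gt0 // sumr_ge0 // => j _.
by rewrite mulr_ge0 // ltW.
Qed.

Variables (Fr : {set 'I_N}) (o p : 'I_N) (D rho kp dl : R).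
Hypotheses (oF : o \in Fr) (D0 : 0 <= D) (kp0 : 0 < kp) (dl0 : 0 < dl) (rho0 : 0 <= rho).
Let vt : R := \sum_i v i.
Hypothesis rho_small : forall i, rho * vt <= v i / 2.
Hypothesis grow_free : eventually_n (fun n => forall i s, s \in Fr -> c n i <= c n.+1 i -> nu n i <= nu n s ->
  c n.+1 i <= D * c n.+1 s).
Hypothesis grow_crowded : eventually_n (fun n => forall i s, i \notin Fr -> s \in Fr -> c n i <= c n.+1 i -> nu n i <= nu n s ->
  c n.+1 i <= rho * c n.+1 s).
(** Every set of free cells containing [o] has mass at least [theta ^+ #|Z| * t].  The factor
    [theta] per cell absorbs the spreading of the mass to further cells. *)
Definition persist theta n (t : R) := forall Z, o \in Z -> Z \subset Fr -> theta ^+ #|Z| * t <= mass n Z.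

(** Take a largest set [Z] violating the bound at time [n.+1] and the sublevel set of the potential
    at its highest cell [s].  The sublevel set gains mass.  Its free cells outside [Z] lose mass: a
    growing one would be comparable with [s] and could be added to [Z], against maximality.  Its
    growing crowded cells end with at most half of the mass of [Z] in total.  So [Z] had a mass below the
    bound already at time [n]. *)
Lemma persist_step : exists theta : R, 1 <= theta /\ eventually_n (fun n => forall t, 0 < t ->
  persist theta n t -> persist theta n.+1 (2 / 3 * t)).
Proof.
have vt0 : 0 <= vt by apply: sumr_ge0 => i _; exact/ltW.
have [vm vm0 Hvm] : small (fun t => forall i, t <= v i) by apply: small_all => i; exists (v i).
have {Hvm} Hvm := Hvm vm vm0 (lexx _).
pose theta : R := 1 + D * (vt / vm).
have th1 : 1 <= theta by rewrite lerDl mulr_ge0 // divr_ge0 // ltW.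
exists theta; split=> //.
apply: eventually_imp (eventually_and grow_free grow_crowded) => n [gf gc] t t0 Hn Z1 oZ1 Z1F.
apply: contrapT => /negP; rewrite -ltNge => bad1.
pose bad (Z : {set 'I_N}) := [&& o \in Z, Z \subset Fr & mass n.+1 Z < theta ^+ #|Z| * (2 / 3 * t)].
have bZ1 : bad Z1 by rewrite /bad oZ1 Z1F bad1.
case: (@arg_maxnP _ Z1 bad (fun Z => #|Z|) bZ1) => Z /and3P[oZ ZF badZ] Zmax.
have [s sZ smax] : exists2 s, s \in Z & forall i, i \in Z -> nu n i <= nu n s.
  by case: (@arg_maxP _ _ _ o (mem Z) (nu n) oZ) => s sZ sm; exists s.
have sF := fintype.subsetP ZF s sZ.
pose Zh := [set i | nu n i <= nu n s].
have ZZh : Z \subset Zh by apply/fintype.subsetP => i iZ; rewrite inE smax.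
have lowZh : forall i j, i \in Zh -> j \notin Zh -> nu n i <= nu n j.
  by move=> i j; rewrite !inE -ltNge => h1 h2; exact/ltW/(le_lt_trans h1).
have m0 : 0 < mass n.+1 Z by exact: mass_gt0 oZ.
have cs i : i \in Z -> v i * c n.+1 i <= mass n.+1 Z.
  move=> iZ; rewrite /mass (bigD1 i) //= lerDl sumr_ge0 // => j _; by rewrite mulr_ge0 // ltW.
(* no free cell of the sublevel set grows outside [Z] *)
have noG i : i \in Zh -> i \notin Z -> i \in Fr -> c n.+1 i < c n i.
  move=> iZh iZ iF; rewrite ltNge; apply/negP => gr.
  have ci : c n.+1 i <= D * c n.+1 s by apply: gf => //; move: iZh; rewrite inE.
  have /Zmax : bad (i |: Z).
    rewrite /bad finset.inE oZ orbT /= finset.subUset finset.sub1set iF ZF /=.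
    rewrite cardsU1 iZ add1n exprS /mass big_setU1 //= -/(mass n.+1 Z).
    have vi : v i <= vt by rewrite /vt (bigD1 i) //= lerDl sumr_ge0 // => j _; exact/ltW.
    have h1 : v i * c n.+1 i <= D * (vt / vm) * mass n.+1 Z.
      apply: le_trans (_ : vt * (D * c n.+1 s) <= _).
        by apply: ler_pM => //; exact: ltW.
      have h2 : c n.+1 s <= mass n.+1 Z / vm.
        rewrite ler_pdivlMr // mulrC; apply: le_trans (cs s sZ); by rewrite ler_pM2r.
      rewrite (_ : D * (vt / vm) * mass n.+1 Z = vt * (D * (mass n.+1 Z / vm))); last by ring.
      by rewrite ler_wpM2l // ler_wpM2l.
    apply: le_lt_trans (_ : theta * mass n.+1 Z < _).
      by rewrite /theta mulrDl mul1r addrC lerD2l.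
    by rewrite -mulrA ltr_pM2l // (lt_le_trans ltr01).
  by rewrite cardsU1 iZ /= add1n ltnn.
have gain := lower_ge0 lowZh.
have split_mass k : mass k Zh = mass k Z + \sum_(i in Zh :\: Z) v i * c k i.
  rewrite /mass (bigID (mem Z)) /=; congr (_ + _); apply: eq_bigl => i; last by rewrite !inE andbC.
  by rewrite andb_idl // => /(fintype.subsetP ZZh).
have rest : \sum_(i in Zh :\: Z) v i * c n.+1 i <= \sum_(i in Zh :\: Z) v i * c n i + \sum_(i in Zh :\: Z) v i * (rho * c n.+1 s).
  rewrite -big_split /=; apply: ler_sum => i; rewrite inE => /andP[iZ iZh].
  have cs0 : 0 <= rho * c n.+1 s by rewrite mulr_ge0 // ltW.
  rewrite -mulrDr ler_pM2l //; have [gr|dr] := leP (c n i) (c n.+1 i); last first.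
    by apply: le_trans (ltW dr) _; rewrite lerDl.
  have iF : i \notin Fr by apply/negP => iF; have := noG i iZh iZ iF; rewrite ltNge gr.
  apply: le_trans (gc i s iF sF gr _) _; first by move: iZh; rewrite inE.
  by rewrite lerDr ltW.
have rest2 : \sum_(i in Zh :\: Z) v i * (rho * c n.+1 s) <= mass n.+1 Z / 2.
  apply: (@le_trans _ _ (vt * (rho * c n.+1 s))).
    rewrite mulr_suml big_mkcond /=; apply: ler_sum => i _; case: ifP => // _.
    by rewrite mulr_ge0 ?(ltW (v0 i)) // mulr_ge0 // ltW.
  rewrite mulrCA mulrA; apply: (@le_trans _ _ (v s / 2 * c n.+1 s)); first by rewrite ler_pM2r.
  by rewrite mulrAC ler_pM2r ?invr_gt0 // cs.
have := Hn Z oZ ZF; move: gain badZ; rewrite !split_mass.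
set t1 := theta ^+ _; rewrite (_ : t1 * (2 / 3 * t) = 2 / 3 * (t1 * t)); last by ring.
by move: rest rest2; set s1 := \sum_(i in _) _; set s2 := \sum_(i in _) _; set s3 := \sum_(i in _) _; lra.
Qed.

Hypothesis low_u : eventually_n (fun n => dl <= u n p).
Hypothesis lowK : forall n, kp * Num.min (u n p) (u n o) <= K n p o.
Hypothesis gap : forall T, eventually_n (fun n => T <= nu n p - nu n o).
Hypothesis c_to0 : forall eta, 0 < eta -> eventually_n (fun n => c n o <= eta).
Hypothesis u_incr : forall n, c n o <= c n.+1 o -> c n.+1 o <= u n.+1 o.
Hypothesis u_small : forall n, u n.+1 o <= c n.+1 o / 4 -> c n.+1 o <= 2 / 5 * c n o.

(** [Fr] are the cells in which the solvent stays.  A growing cell is bounded by [D] times any cell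
    of [Fr] with higher potential ([grow_free]), and by a small multiple of it if the growing cell
    is crowded, that is, outside [Fr] ([grow_crowded]).  The flux from [p] into the sublevel set of [o] is at least
    [kp * Num.min (u n p) (u n o)] times a potential difference that tends to infinity, and at most
    a multiple of the new concentration at [o]; hence [u n o] is eventually small compared with it.
    Since [u] follows the concentration, this excludes growth at [o] and forces a decay by 2/5 per
    step, which [persist_step] excludes. *)
Lemma no_depletion : False.
Proof.
have vt0 : 0 <= vt by apply: sumr_ge0 => i _; exact/ltW.
pose D1 := D * vt + 1; have D10 : 0 < D1 by rewrite ltr_wpDl // mulr_ge0.
have dlD : 0 < dl by [].
(* the nodal value at [o] is far below the new concentration *)
have key : eventually_n (fun n => u n o <= c n.+1 o / 4).
  have [nc Hc] := c_to0 dl0.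
  have g4 := gap (4 * D1 / kp).
  have gpos := gap 1.
  have c1 : eventually_n (fun n => c n.+1 o <= dl) by exists nc => n hn; apply: Hc; apply: leq_trans hn _.
  apply: eventually_imp (eventually_and (eventually_and low_u c1) (eventually_and (eventually_and g4 gpos) grow_free)) => n [[up co] [[T4 T1] gf]].
  pose Zo := [set i | nu n i <= nu n o].
  have oZ : o \in Zo by rewrite inE.
  have pZ : p \notin Zo by rewrite inE -ltNge; move: T1; lra.
  have low : forall i j, i \in Zo -> j \notin Zo -> nu n i <= nu n j.
    by move=> i j; rewrite !inE -ltNge => h1 h2; exact/ltW/(le_lt_trans h1).
  have := lower_gain low oZ pZ.
  have up_mass : mass n.+1 Zo - mass n Zo <= D1 * c n.+1 o.
    rewrite /mass -sumrB; apply: (@le_trans _ _ (\sum_(i in Zo) v i * (D * c n.+1 o))).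
      apply: ler_sum => i; rewrite inE => iZ; rewrite -mulrBr ler_pM2l //.
      have [gr|dr] := leP (c n i) (c n.+1 i).
        apply: le_trans (_ : _ <= c n.+1 i) _; first by rewrite gerBl ltW.
        exact: gf.
      by apply: le_trans (ltW _) (mulr_ge0 D0 (ltW (c0 n.+1 o))); rewrite subr_lt0.
    rewrite -mulr_suml /D1 mulrDl mul1r; apply: le_trans (_ : D * vt * c n.+1 o <= _); last by rewrite lerDl ltW.
    rewrite mulrA ler_pM2r // mulrC; apply: ler_wpM2l => //.
    by rewrite /vt big_mkcond /=; apply: ler_sum => i _; case: ifP => // _; exact/ltW.
  move=> h; have {h up_mass} h := le_trans h up_mass.
  have gn0 : 0 <= nu n p - nu n o by apply: le_trans T1.
  have h2 : kp * Num.min (u n p) (u n o) * (4 * D1 / kp) <= D1 * c n.+1 o.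
    apply: le_trans h; rewrite [K n o p]KC.
    have [mneg|mpos] := leP 0 (Num.min (u n p) (u n o)).
      apply: ler_pM => //; first by rewrite mulr_ge0 // ltW.
      by rewrite divr_ge0 ?mulr_ge0 // ltW.
    apply: le_trans (_ : 0 <= _); last by rewrite mulr_ge0.
    by rewrite mulr_le0_ge0 ?divr_ge0 ?mulr_ge0 ?(ltW D10) ?(ltW kp0) // mulr_ge0_le0 // ltW.
  have h3 : Num.min (u n p) (u n o) <= c n.+1 o / 4.
    rewrite ler_pdivlMr // -(ler_pM2l D10); apply: le_trans h2.
    by rewrite le_eqVlt; apply/orP; left; apply/eqP; field; exact: lt0r_neq0.
  have [uu|uu] := leP (u n o) (u n p); first by rewrite (min_idPr uu) in h3.
  rewrite (min_idPl (ltW uu)) in h3; exfalso.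
  have := c0 n.+1 o; lra.
have [n1 key'] := key.
have [theta [th1 [n2 pst]]] := persist_step.
pose n0 := maxn n1 n2.
have kn n : (n0 <= n)%N -> u n o <= c n.+1 o / 4 by move=> hn; apply: key'; apply: leq_trans hn; exact: leq_maxl.
have pn n t : (n0 <= n)%N -> 0 < t -> persist theta n t -> persist theta n.+1 (2 / 3 * t).
  by move=> hn; apply: pst; apply: leq_trans hn; exact: leq_maxr.
(* one increase would be followed by further increases, against the limit 0 *)
have [[n [hn inc]]|dec] := pselect (exists n, (n0 <= n)%N /\ c n o <= c n.+1 o).
  have up k : c n.+1 o <= c (n + k).+1 o /\ c (n + k)%N o <= c (n + k).+1 o.
    elim: k => [|k [IH1 IH2]]; first by rewrite addn0.
    have h1 := u_incr IH2.
    have h2 : u (n + k).+1 o <= c (n + k).+2 o / 4 by apply: kn; exact: leq_trans hn (leqW (leq_addr _ _)).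
    have := c0 (n + k).+2 o; rewrite addnS => h3; split; lra.
  have cn0 : 0 < c n.+1 o / 2 by rewrite divr_gt0.
  have [n3 H3] := c_to0 cn0.
  have := H3 (n + n3).+1; rewrite -addSn leq_addl // => /(_ isT).
  have [h _] := up n3; rewrite addSn; have := c0 n.+1 o; lra.
have drop n : (n0 <= n)%N -> c n.+2 o <= 2 / 5 * c n.+1 o.
  move=> hn; apply: u_small; apply: le_trans (kn n.+2 (leqW (leqW hn))) _.
  rewrite ler_pM2r ?invr_gt0 // ltW // ltNge; apply/negP => h; apply: dec; exists n.+2.
  by split=> //; exact: leqW (leqW hn).
have geo k : c (n0.+1 + k)%N o <= (2 / 5) ^+ k * c n0.+1 o.
  elim: k => [|k IH]; first by rewrite addn0 mul1r.
  rewrite addnS addSn; apply: le_trans (drop _ _) _; first by rewrite leq_addr.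
  have h25 : (0 : R) <= 2 / 5 by rewrite divr_ge0.
  by apply: le_trans (ler_wpM2l h25 IH) _; rewrite exprS mulrA.
pose t0 := v o * c n0.+1 o / theta ^+ N.
have th0 : 0 < theta by exact: lt_le_trans th1.
have t00 : 0 < t0 by rewrite divr_gt0 ?mulr_gt0 // exprn_gt0.
have base : persist theta n0.+1 t0.
  move=> Z oZ ZF; apply: (@le_trans _ _ (v o * c n0.+1 o)).
    rewrite /t0 mulrCA ger_pMr ?mulr_gt0 // ler_pdivrMr ?exprn_gt0 // mul1r ler_weXn2l //.
    by rewrite (leq_trans (max_card _)) // card_ord.
  rewrite /mass (bigD1 o) //= lerDl sumr_ge0 // => j _; by rewrite mulr_ge0 // ltW.
have all_k k : persist theta (n0.+1 + k)%N ((2 / 3) ^+ k * t0).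
  elim: k => [|k IH]; first by rewrite addn0 mul1r.
  rewrite addnS exprS -mulrA; apply: pn => //; first by rewrite addSn leqW // leq_addr.
  by rewrite mulr_gt0 // exprn_gt0.
have lowc k : (2 / 3) ^+ k * t0 <= v o * c (n0.+1 + k)%N o.
  have := all_k k [set o]; rewrite finset.set11 finset.sub1set oF /mass big_set1 cards1 expr1 => /(_ isT isT).
  apply: le_trans; rewrite ler_peMl //; apply: mulr_ge0; [exact: exprn_ge0 | exact: ltW].
(* a decay by 2/5 per step is faster than one by 2/3 *)
have fin k : t0 <= v o * c n0.+1 o * (3 / 5) ^+ k.
  have h1 := le_trans (lowc k) (ler_wpM2l (ltW (v0 o)) (geo k)).
  have e : (2 / 5 : R) ^+ k = (2 / 3) ^+ k * (3 / 5) ^+ k by rewrite -exprMn; congr (_ ^+ _); field.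
  rewrite -(ler_pM2l (_ : 0 < (2 / 3) ^+ k)) ?exprn_gt0 //; apply: le_trans h1 _.
  by rewrite e le_eqVlt; apply/orP; left; apply/eqP; ring.
have q1 : `|3 / 5 : R| < 1 by rewrite ger0_norm //; lra.
have := cvg_expr q1; move/cvgrPdist_lt => /(_ (t0 / (v o * c n0.+1 o))).
have vc0 : 0 < v o * c n0.+1 o by rewrite mulr_gt0.
rewrite (divr_gt0 t00 vc0) => /(_ isT) [k _ /(_ k (leqnn _))] /=.
rewrite sub0r normrN ger0_norm ?exprn_ge0 // ltr_pdivlMr ?mulr_gt0 //.
by rewrite ltNge mulrC fin.
Qed.

End Spread.

(** * Entropy produced by the time discretization *)

Section Entropy.
Variable R : realType.
Implicit Types (u s t th : R) (h : R -> R).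

(** For c and c' the old and new concentration, [c' * dissip h (c / c')] is what the convex entropy
    loses beyond the work of the implicit log-activity [ln c' + h (c / c')]. *)
Definition dissip h u := u * ln u - (u - 1) - (u - 1) * h u.

(** What the convergence proof needs from the correction [h] to the logarithm in a time-implicit
    scheme: bounds from above and, for growing concentrations, from below; consistency; and a
    dissipation that controls every logarithmic jump. *)
Record implicit_entropy h : Prop := ImplicitEntropy {
  ie_up : forall u, 0 < u -> h u <= 3 / 8;
  ie_low : forall u, 0 < u <= 1 -> - (2 / 3) <= h u;
  ie_cont : forall th, 0 < th -> exists2 th2, 0 < th2 & forall u, 0 < u -> `|ln u| <= th2 -> `|h u| <= th;
  ie_ge0 : forall u, 0 < u -> 0 <= dissip h u;
  ie_coer : forall th, 0 < th -> exists2 k : R, 0 < k & forall u, 0 < u -> th <= `|ln u| -> k * Num.max u 1 <= dissip h u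
}.

Lemma ln_ge_inv t : 0 < t -> 1 - t^-1 <= ln t.
Proof.
move=> t0; have := @ln_sub_le R 1 t ltr01 t0; rewrite ln1 mulrBl mul1r divff ?gt_eqF //; lra.
Qed.

Lemma ln_cases u th : 0 < u -> 0 < th -> th <= `|ln u| -> expR th <= u \/ u <= expR (- th).
Proof.
move=> u0 th0; rewrite ler_normr => /orP[h|h]; [left|right].
  by rewrite -[u]lnK ?posrE // ler_expR.
by rewrite -[u]lnK ?posrE // ler_expR; lra.
Qed.

(** The fully implicit scheme: the log-activity is the logarithm of the new concentration. *)
Definition corr1 u : R := 0.

(** By [ln_ge_inv] at the square root of u, the dissipation u ln u - u + 1 is at least
    (sqrt u - 1)^2. *)
Lemma implicit_entropy1 : implicit_entropy corr1.
Proof.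
have low u : 0 < u -> (Num.sqrt u - 1) ^+ 2 <= dissip corr1 u.
  move=> u0; rewrite /dissip /corr1 mulr0 subr0; set s := Num.sqrt u.
  have s0 : 0 < s by rewrite sqrtr_gt0.
  have us : u = s ^+ 2 by rewrite sqr_sqrtr // ltW.
  have lu : ln u = 2 * ln s by rewrite us lnXn // mulr_natl.
  have := ln_ge_inv s0 => h; rewrite lu.
  have : u * (2 * (1 - s^-1)) <= u * (2 * ln s) by rewrite ler_pM2l // ler_pM2l.
  have -> : u * (2 * (1 - s^-1)) = 2 * s ^+ 2 - 2 * s by rewrite us; field; exact: lt0r_neq0.
  by rewrite {2}us; have : u = s ^+ 2 by []; move=> -> ; nra.
split.
- by move=> u _; rewrite /corr1; lra.
- by move=> u _; rewrite /corr1; lra.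
- by move=> th th0; exists 1 => // u _ _; rewrite normr0 ltW.
- by move=> u u0; apply: le_trans (low u u0); exact: sqr_ge0.
move=> th th0; set q := expR (th / 2).
have q0 : 0 < q by exact: expR_gt0.
have q1 : 1 < q by rewrite -expR0 ltr_expR divr_gt0.
have iq : q^-1 < 1 by rewrite invf_lt1.
exists ((1 - q^-1) ^+ 2); first by rewrite exprn_gt0 // subr_gt0.
move=> u u0 hu; apply: le_trans (low u u0).
set s := Num.sqrt u; have s0 : 0 < s by rewrite sqrtr_gt0.
have us : u = s ^+ 2 by rewrite sqr_sqrtr // ltW.
have eq2 : expR th = q ^+ 2 by rewrite -expRM_natl mulrC; congr expR; field.
have iq0 : 0 < q^-1 by rewrite invr_gt0.
case: (ln_cases u0 th0 hu); rewrite ?expRN eq2 us.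
  rewrite ler_pXn2r ?nnegrE ?(ltW q0) ?(ltW s0) // => qs.
  rewrite (max_idPl _); last by rewrite -[X in X <= _](expr1n _ 2) ler_pXn2r ?nnegrE ?(ltW s0) ?ler01 //; exact: le_trans (ltW q1) qs.
  have g1 : 0 <= (1 - q^-1) * s by rewrite mulr_ge0 ?(ltW s0) // subr_ge0 ltW.
  have g2 : 0 <= s - 1 by rewrite subr_ge0; exact: le_trans (ltW q1) qs.
  rewrite -exprMn ler_pXn2r ?nnegrE //.
  by rewrite mulrBl mul1r lerD2l lerN2 mulrC ler_pdivlMr ?mul1r.
rewrite -exprVn ler_pXn2r ?nnegrE ?(ltW iq0) ?(ltW s0) // => sq.
rewrite (max_idPr _); last by rewrite expr_le1 ?ltW // (le_lt_trans sq).
have -> : (s - 1) ^+ 2 = (1 - s) ^+ 2 by ring.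
have g1 : 0 <= 1 - q^-1 by rewrite subr_ge0 ltW.
have g2 : 0 <= 1 - s by rewrite subr_ge0 (le_trans sq) // ltW.
by rewrite mulr1 ler_pXn2r ?nnegrE // lerD2l lerN2.
Qed.

(** The second-order correction: the first Taylor terms of the mean of the logarithm between the two
    concentrations. *)
Definition corr2 u : R := (u - 1) / 2 - (u - 1) ^+ 2 / 6.

(** The dissipation of [corr2] divided by its argument; its derivative (u - 1)^3 / (3 u^2) has the
    sign of u - 1. *)
Definition dissip_ratio u : R := ln u + u ^+ 2 / 6 - u + 2^-1 + u^-1 / 3.

Lemma dissip_ratioE u : 0 < u -> dissip corr2 u = u * dissip_ratio u.
Proof. by move=> u0; rewrite /dissip /dissip_ratio /corr2; field; exact: lt0r_neq0. Qed.

Lemma dissip_ratio_derive u : 0 < u -> is_derive u 1 dissip_ratio ((u - 1) ^+ 3 / (3 * u ^+ 2)).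
Proof.
move=> u0; have un : u != 0 by exact: lt0r_neq0.
have d1 := is_derive1_ln u0.
have di : is_derive u 1 (id : R -> R) 1 by exact: is_derive_id.
have d2 : is_derive u 1 (fun t : R => t^-1) (- u ^- 2 *: 1) by exact: (is_deriveV un di).
have d3 := is_deriveX 2 di.
have d4 := is_deriveD (is_deriveB (is_deriveD d1 (is_deriveZ (6^-1) d3)) di) (is_deriveZ (3^-1) d2).
have d5 := is_deriveD d4 (is_derive_cst (2^-1 : R) u 1).
have e : dissip_ratio = (fun t : R => ln t + 6^-1 * t ^+ 2 - t + 3^-1 * t^-1 + 2^-1).
  by apply/funext => t; rewrite /dissip_ratio; ring.
rewrite e; apply: (is_derive_eq d5).
rewrite /GRing.scale /= /GRing.scale /=; field; exact: un.
Qed.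

Lemma dissip_ratio_cont u : 0 < u -> {for u, continuous dissip_ratio}.
Proof.
move=> u0; apply/differentiable_continuous/derivable1_diffP.
by have [] := dissip_ratio_derive u0.
Qed.

Lemma dissip_ratio_mvt a b : 0 < a -> a < b -> exists2 c, a < c < b & dissip_ratio b - dissip_ratio a = (c - 1) ^+ 3 / (3 * c ^+ 2) * (b - a).
Proof.
move=> a0 ab; have [|c|c cab e] := MVT (f := dissip_ratio) (df := fun x => (x - 1) ^+ 3 / (3 * x ^+ 2)) ab.
- by move=> x; rewrite in_itv /= => /andP[ax _]; apply: dissip_ratio_derive; exact: lt_trans ax.
- apply/continuous_in_subspaceT => x; rewrite inE /= in_itv /= => /andP[ax _].
  by apply: dissip_ratio_cont; exact: lt_le_trans ax.
by exists c => //; move: cab; rewrite in_itv.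
Qed.

Lemma dissip_ratio1 : dissip_ratio 1 = 0.
Proof. by rewrite /dissip_ratio ln1 expr1n invr1; field. Qed.

Lemma dissip_ratio_incr a b : 1 <= a -> a < b -> dissip_ratio a < dissip_ratio b.
Proof.
move=> a1 ab; have a0 : 0 < a by exact: lt_le_trans a1.
have [c /andP[ac cb] e] := dissip_ratio_mvt a0 ab.
rewrite -subr_gt0 e mulr_gt0 ?subr_gt0 // divr_gt0 //.
  by rewrite exprn_gt0 // subr_gt0 (le_lt_trans a1).
by rewrite mulr_gt0 // exprn_gt0 // (lt_trans a0).
Qed.

Lemma dissip_ratio_decr a b : 0 < a -> b <= 1 -> a < b -> dissip_ratio b < dissip_ratio a.
Proof.
move=> a0 b1 ab; have [c /andP[ac cb] e] := dissip_ratio_mvt a0 ab.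
have c0 : 0 < c by exact: lt_trans ac.
rewrite -subr_lt0 e pmulr_llt0 ?subr_gt0 // pmulr_llt0 ?invr_gt0 ?mulr_gt0 ?exprn_gt0 //.
have c1 : c - 1 < 0 by rewrite subr_lt0 (lt_le_trans cb).
by rewrite exprS pmulr_llt0 // exprn_even_gt0 //= lt_eqF.
Qed.

Lemma dissip_ratio_ge0 u : 0 < u -> 0 <= dissip_ratio u.
Proof.
move=> u0; have [u1|u1|->] := ltgtP u 1; last by rewrite dissip_ratio1.
  by rewrite -dissip_ratio1 ltW // dissip_ratio_decr.
by rewrite -dissip_ratio1 ltW // dissip_ratio_incr.
Qed.

(** The dissipation is u times [dissip_ratio], which is minimal at 1.  Near u = 0, where the factor u
    is lost, it is bounded below by a direct estimate: it tends to 1/3. *)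
Lemma implicit_entropy2 : implicit_entropy corr2.
Proof.
split.
- move=> u _; rewrite -subr_ge0 (_ : _ - _ = (u - 5 / 2) ^+ 2 / 6); last by rewrite /corr2; field.
  by rewrite divr_ge0 // sqr_ge0.
- move=> u /andP[u0 u1]; rewrite -subr_ge0 (_ : _ - _ = (u * (1 - u) + 4 * u) / 6); last by rewrite /corr2; field.
  by rewrite divr_ge0 // addr_ge0 // mulr_ge0 ?subr_ge0 // ltW.
- move=> th th0; exists (Num.min 2^-1 (th / 4)); first by rewrite lt_min invr_gt0 ltr0n divr_gt0.
  move=> u u0; rewrite le_min => /andP[h1' h2'].
  have := @close_of_ln R u 1 `|ln u| u0 ltr01 h1'; rewrite ln1 subr0 mulr1 => /(_ (lexx _)) h.
  rewrite /corr2; set s := u - 1 in h *.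
  apply: le_trans (ler_normB _ _) _; rewrite [`|s / 2|]normrM [`|s ^+ 2 / 6|]normrM normrX !(gtr0_norm (x := _^-1)) ?invr_gt0 //.
  have s1 : `|s| <= 1 by apply: le_trans h _; rewrite mulrC -ler_pdivlMr // mul1r.
  have s2 : `|s| ^+ 2 <= `|s| by rewrite expr2 ler_piMl.
  have s3 : `|s| <= th / 2 by apply: le_trans h _; lra.
  have : `|s| / 2 + `|s| ^+ 2 / 6 <= `|s| by have := normr_ge0 s; lra.
  by lra.
- by move=> u u0; rewrite dissip_ratioE // mulr_ge0 ?(ltW u0) // dissip_ratio_ge0.
move=> th th0; set q := expR th.
have q0 : 0 < q by exact: expR_gt0.
have q1 : 1 < q by rewrite -expR0 ltr_expR.
have iq : q^-1 < 1 by rewrite invf_lt1.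
have iq0 : 0 < q^-1 by rewrite invr_gt0.
have k1 : 0 < dissip_ratio q by rewrite -dissip_ratio1 dissip_ratio_incr.
have k2 : 0 < dissip_ratio q^-1 by rewrite -dissip_ratio1 dissip_ratio_decr.
exists (Num.min (dissip_ratio q) (Num.min (dissip_ratio q^-1 / 100) (100^-1))).
  by rewrite !lt_min k1 divr_gt0 //= invr_gt0.
move=> u u0 hu; rewrite dissip_ratioE //; set k := Num.min _ _.
have [c1 c2 c3] : [/\ k <= dissip_ratio q, k <= dissip_ratio q^-1 / 100 & k <= 100^-1] by split; rewrite /k !ge_min lexx ?orbT.
case: (ln_cases u0 th0 hu); rewrite -/q ?expRN -/q => hq.
  have u1 : 1 <= u by exact: le_trans (ltW q1) hq.
  rewrite (max_idPl u1) mulrC ler_pM2l //; apply: le_trans c1 _.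
  move: hq; rewrite le_eqVlt => /predU1P[->//|hq]; apply/ltW/dissip_ratio_incr => //; exact: ltW.
have u1 : u <= 1 by apply: le_trans hq _; exact: ltW.
rewrite (max_idPr u1) mulr1.
have pu : dissip_ratio q^-1 <= dissip_ratio u.
  by move: hq; rewrite le_eqVlt => /predU1P[->//|hq]; apply/ltW/dissip_ratio_decr => //; exact: ltW.
have [h|h] := leP 100^-1 u.
  apply: le_trans c2 _; rewrite mulrC; apply: ler_pM => //; first by rewrite ltW.
have : - u * ln u <= 2 * Num.sqrt u.
  set s := Num.sqrt u; have s0 : 0 < s by rewrite sqrtr_gt0.
  have us : u = s ^+ 2 by rewrite sqr_sqrtr // ltW.
  have lu : ln u = 2 * ln s by rewrite us lnXn // mulr_natl.
  have := ln_ge_inv s0 => hs; rewrite lu.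
  have : u * (2 * (1 - s^-1)) <= u * (2 * ln s) by rewrite ler_pM2l // ler_pM2l.
  have -> : u * (2 * (1 - s^-1)) = 2 * s ^+ 2 - 2 * s by rewrite us; field; exact: lt0r_neq0.
  nra.
have s10 : Num.sqrt u <= 10^-1.
  have -> : (10^-1 : R) = Num.sqrt (100^-1).
    by rewrite (_ : 100^-1 = (10^-1) ^+ 2) ?sqrtr_sqr ?ger0_norm //; field.
  by rewrite ler_wsqrtr // ltW.
move=> hs; apply: le_trans c3 _.
have -> : u * dissip_ratio u = u * ln u + u ^+ 3 / 6 - u ^+ 2 + u / 2 + 3^-1.
  by rewrite /dissip_ratio; field; exact: lt0r_neq0.
have : 0 < u ^+ 3 by exact: exprn_gt0.
have : u ^+ 2 <= u / 100 by rewrite expr2 ler_pM2l // ltW.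
lra.
Qed.

End Entropy.

(** * The discrete Poisson operator *)

Section Poisson.
Variables (R : realType) (N : nat) (w : 'I_N -> 'I_N -> R) (d : 'I_N -> R).
Implicit Types (psi phi : 'I_N -> R).

(** The weights [w] of the edges are diffusive conductances; [d] collects the Dirichlet edges. *)
Definition lap psi i : R := \sum_j w i j * (psi i - psi j) + d i * psi i.

Lemma lap_lin a psi phi i : lap (fun k => a * psi k + phi k) i = a * lap psi i + lap phi i.
Proof.
rewrite /lap [a * (_ + _)]mulrDr mulr_sumr addrACA -big_split /=; congr (_ + _); last by ring.
by apply: eq_bigr => j _; ring.
Qed.

Lemma lapB psi phi i : lap (fun k => psi k - phi k) i = lap psi i - lap phi i.
Proof.
rewrite /lap opprD addrACA -sumrB; congr (_ + _); last by ring.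
by apply: eq_bigr => j _; ring.
Qed.

Hypotheses (wC : forall i j, w i j = w j i) (w0 : forall i j, 0 <= w i j) (d0 : forall i, 0 <= d i).

Lemma lap_form psi phi : \sum_i lap psi i * phi i =
  2^-1 * \sum_i \sum_j w i j * (psi i - psi j) * (phi i - phi j) + \sum_i d i * psi i * phi i.
Proof.
rewrite /lap; under eq_bigr do rewrite mulrDl; rewrite big_split /=; congr (_ + _).
pose S := \sum_i \sum_j w i j * (psi i - psi j) * phi i.
have -> : \sum_i (\sum_j w i j * (psi i - psi j)) * phi i = S by apply: eq_bigr => i _; rewrite mulr_suml.
have S' : S = - \sum_i \sum_j w i j * (psi i - psi j) * phi j.
  rewrite /S exchange_big /= -sumrN; apply: eq_bigr => i _; rewrite -sumrN; apply: eq_bigr => j _.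
  by rewrite wC; ring.
have -> : \sum_i \sum_j w i j * (psi i - psi j) * (phi i - phi j) = S + S.
  rewrite {2}S' -sumrB; apply: eq_bigr => i _; rewrite -sumrB; apply: eq_bigr => j _; ring.
by field.
Qed.

Lemma lap_sym psi phi : \sum_i lap psi i * phi i = \sum_i lap phi i * psi i.
Proof.
rewrite !lap_form; congr (_ * _ + _); last by apply: eq_bigr => i _; ring.
by apply: eq_bigr => i _; apply: eq_bigr => j _; ring.
Qed.

Lemma lap_ge0 psi : 0 <= \sum_i lap psi i * psi i.
Proof.
rewrite lap_form addr_ge0 //.
  rewrite mulr_ge0 // ?invr_ge0 // sumr_ge0 // => i _; rewrite sumr_ge0 // => j _.
  by rewrite -mulrA -expr2 mulr_ge0 // sqr_ge0.
by apply: sumr_ge0 => i _; rewrite -mulrA -expr2 mulr_ge0 // sqr_ge0.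
Qed.

Hypothesis conn : forall A : {set 'I_N}, A != finset.set0 -> A != finset.setT ->
  exists i j, [/\ i \in A, j \notin A & 0 < w i j].
Hypothesis dpos : exists i, 0 < d i.

(** The energy vanishes, so the set where [psi] is 0 contains a Dirichlet cell and is closed under
    neighbours. *)
Lemma lap_eq0 psi : (forall i, lap psi i = 0) -> forall i, psi i = 0.
Proof.
move=> H; have [i0 di0] := dpos.
have : \sum_i lap psi i * psi i = 0 by rewrite big1 // => i _; rewrite H mul0r.
rewrite lap_form => E.
have p1 i j : 0 <= w i j * (psi i - psi j) * (psi i - psi j) by rewrite -mulrA -expr2 mulr_ge0 // sqr_ge0.
have p2 i : 0 <= d i * psi i * psi i by rewrite -mulrA -expr2 mulr_ge0 // sqr_ge0.
have s1 : 0 <= \sum_i \sum_j w i j * (psi i - psi j) * (psi i - psi j) by do 2! apply: sumr_ge0 => ? _.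
have s2 : 0 <= \sum_i d i * psi i * psi i by apply: sumr_ge0.
have e1 : \sum_i \sum_j w i j * (psi i - psi j) * (psi i - psi j) = 0 by lra.
have e2 : \sum_i d i * psi i * psi i = 0 by lra.
have psi0 : psi i0 = 0.
  move/eqP: e2; rewrite psumr_eq0 // => /allP /(_ i0); rewrite mem_index_enum => /(_ isT) /=.
  by rewrite -mulrA !mulf_eq0 (gt_eqF di0) /= orbb => /eqP.
pose A := [set i | psi i == 0].
have [AT|AT] := eqVneq A finset.setT.
  by move=> i; apply/eqP; have := finset.in_setT i; rewrite -AT inE.
have [|i [j [iA jA wij]]] := conn _ AT; first by apply/finset.set0Pn; exists i0; rewrite inE psi0.
move/eqP: e1; rewrite psumr_eq0; last by move=> i' _; apply: sumr_ge0.
move=> /allP /(_ i); rewrite mem_index_enum => /(_ isT) /=; rewrite psumr_eq0 //.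
move=> /allP /(_ j); rewrite mem_index_enum => /(_ isT) /=.
rewrite -mulrA !mulf_eq0 (gt_eqF wij) /= orbb subr_eq0; move: iA jA; rewrite !inE => /eqP -> h.
by rewrite eq_sym (negbTE h).
Qed.

(** The matrix of the operator is injective, hence invertible. *)
Lemma lap_inverse : exists B : 'I_N -> 'I_N -> R, forall psi i, psi i = \sum_j lap psi j * B j i.
Proof.
pose de (i k : 'I_N) : R := (i == k)%:R.
pose A : 'M[R]_N := \matrix_(i, j) lap (de i) j.
have AE (v : 'rV[R]_N) j : (v *m A) 0 j = lap (fun k => v 0 k) j.
  rewrite mxE.
  have -> : lap (fun k => v 0 k) j = lap (fun k => \sum_i v 0 i * de i k) j.
    congr lap; apply/funext => k; rewrite (bigD1 k) //= /de eqxx mulr1 big1 ?addr0 // => i /negbTE ->.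
    by rewrite mulr0.
  elim: (index_enum _) => [|i s IH].
    by rewrite !big_nil /lap big1 => [|k _]; rewrite !big_nil ?subrr ?mulr0 ?addr0.
  rewrite big_cons mxE IH -lap_lin; congr lap; apply/funext => k.
  by rewrite [RHS]big_cons.
have uA : A \in unitmx.
  rewrite -row_free_unit; apply: inj_row_free => v vA; apply/rowP => i; rewrite mxE.
  by apply: (@lap_eq0 (fun k => v 0 k)) => j; rewrite -AE vA mxE.
exists (fun j i => invmx A j i) => psi i.
pose v : 'rV[R]_N := \row_k psi k.
have : v 0 i = (v *m A *m invmx A) 0 i by rewrite mulmxK.
rewrite [in RHS]mxE mxE => ->; apply: eq_bigr => j _; congr (_ * _).
by rewrite AE; congr lap; apply/funext => k; rewrite mxE.
Qed.

End Poisson.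

(** * Convergence of abstract implicit evolutions *)

Lemma sum_option (R : realType) (T : finType) (F : option T -> R) :
  \sum_o F o = F None + \sum_t F (Some t).
Proof.
rewrite (bigD1 None) //=; congr (_ + _).
rewrite (reindex_omap Some id) /=; last by case.
by apply: eq_bigl => t; rewrite eqxx.
Qed.

Lemma max_ratio (R : realType) (x y : R) : 0 < y -> Num.max x y = y * Num.max (x / y) 1.
Proof. by move=> y0; rewrite maxr_pMr ?ltW // mulr1 mulrC divfK // gt_eqF. Qed.

Section Model.
Variables (R : realType) (N M : nat).
Variables (v : 'I_N -> R) (tau : 'I_N -> 'I_N -> R) (a : 'I_M -> R) (b : R) (z : 'I_M -> R)
  (e0 : 'I_M -> 'I_N -> R) (g : 'I_M -> R) (w : 'I_N -> 'I_N -> R) (d f : 'I_N -> R).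
Local Notation conc := (option 'I_M -> 'I_N -> R).
Local Notation lap := (lap w d).
Implicit Types (C : conc) (h : R -> R).

Definition act h C C' o i : R := ln (C' o i) + h (C o i / C' o i).

Definition drive h C C' (psit : 'I_N -> R) l i : R :=
  act h C C' (Some l) i - a l / b * act h C C' None i + z l * psit i + e0 l i.

Definition blend (alpha : R) (psi psi' : 'I_N -> R) i : R := psi i + alpha * (psi' i - psi i).

(** Both schemes in one form.  [C n None] is the concentration of the solvent, [h] the correction of
    the logarithm, [alpha] the implicitness of the electric potential, [m] the mobility on the edges
    and [u] the nodal values from which it is built.  Of [u] it only matters that it follows a
    growing concentration ([ev_u_incr]), and that it is small only after a decay ([ev_u_small]). *)
Record evolution h (alpha : R) (C : nat -> conc) (psi : nat -> 'I_N -> R)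
    (u : nat -> 'I_M -> 'I_N -> R) (m : nat -> 'I_M -> 'I_N -> 'I_N -> R) : Prop := Evolution {
  ev_pos : forall n o i, 0 < C n o i;
  ev_vol : forall n i, \sum_l a l * C n (Some l) i + b * C n None i = 1;
  ev_poisson : forall n i, lap (psi n) i = v i * (\sum_l z l * C n (Some l) i) + f i;
  ev_step : forall n l i, v i * (C n.+1 (Some l) i - C n (Some l) i) =
     \sum_j g l * tau i j * m n l i j *
       (drive h (C n) (C n.+1) (blend alpha (psi n) (psi n.+1)) l j -
        drive h (C n) (C n.+1) (blend alpha (psi n) (psi n.+1)) l i);
  ev_sym : forall n l i j, m n l i j = m n l j i;
  ev_low : forall n l i j, Num.min (u n l i) (u n l j) <= m n l i j;
  ev_u0 : forall n l i, 0 < u n l i;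
  ev_u_incr : forall n l i, C n (Some l) i <= C n.+1 (Some l) i -> C n.+1 (Some l) i <= u n.+1 l i;
  ev_u_small : forall n l i, u n.+1 l i <= C n.+1 (Some l) i / 4 -> C n.+1 (Some l) i <= 2 / 5 * C n (Some l) i
}.

Hypotheses (v0 : forall i, 0 < v i) (tauC : forall i j, tau i j = tau j i) (tau0 : forall i j, 0 <= tau i j).
Hypotheses (a0 : forall l, 0 < a l) (b0 : 0 < b) (g0 : forall l, 0 < g l).
Hypotheses (wC : forall i j, w i j = w j i) (w0 : forall i j, 0 <= w i j) (d0 : forall i, 0 <= d i).
Hypothesis wtau : forall i j, 0 < tau i j -> 0 < w i j.
Hypothesis conn : forall A : {set 'I_N}, A != finset.set0 -> A != finset.setT ->
  exists i j, [/\ i \in A, j \notin A & 0 < tau i j].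
Hypothesis dpos : exists i, 0 < d i.

Lemma conn_w (A : {set 'I_N}) : A != finset.set0 -> A != finset.setT -> exists i j, [/\ i \in A, j \notin A & 0 < w i j].
Proof. by move=> A0 AT; have [i [j [iA jA t]]] := conn A0 AT; exists i, j; split=> //; exact: wtau. Qed.

(** The linear part of the electric energy coming from the fixed charge and the boundary data is
    contained in the last term, because [lap psi] includes them. *)
Definition energy C psi : R := \sum_i v i * (\sum_o (C o i * ln (C o i) - C o i)) +
  \sum_l \sum_i v i * C (Some l) i * e0 l i + 2^-1 * \sum_i lap psi i * psi i.

Lemma entropy_step h (c c' : R) : 0 < c -> 0 < c' ->
  (c' * ln c' - c') - (c * ln c - c) = (c' - c) * (ln c' + h (c / c')) - c' * dissip h (c / c').
Proof.
move=> c0 c'0; rewrite /dissip ln_div ?posrE //; set H := h _; field; exact: lt0r_neq0.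
Qed.

Section Run.
Variables (h : R -> R) (alpha : R) (C : nat -> conc) (psi : nat -> 'I_N -> R)
    (u : nat -> 'I_M -> 'I_N -> R) (m : nat -> 'I_M -> 'I_N -> 'I_N -> R).
Hypotheses (hH : implicit_entropy h) (al : 2^-1 <= alpha <= 1) (HE : evolution h alpha C psi u m).

Definition nu n l i := drive h (C n) (C n.+1) (blend alpha (psi n) (psi n.+1)) l i.
Definition fluxK n l i j := g l * tau i j * m n l i j.
Definition dissipation n : R := 2^-1 * \sum_l \sum_i \sum_j fluxK n l i j * (nu n l j - nu n l i) ^+ 2.
Definition time_loss n : R := \sum_i v i * \sum_o C n.+1 o i * dissip h (C n o i / C n.+1 o i).

Lemma m_ge0 n l i j : 0 < m n l i j.
Proof. by apply: lt_le_trans (ev_low HE n l i j); rewrite lt_min !(ev_u0 HE). Qed.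

Lemma fluxK_ge0 n l i j : 0 <= fluxK n l i j.
Proof. by rewrite /fluxK mulr_ge0 ?mulr_ge0 // ltW // m_ge0. Qed.

Lemma fluxKC n l i j : fluxK n l i j = fluxK n l j i.
Proof. by rewrite /fluxK tauC (ev_sym HE). Qed.

Lemma dissipation_flux n l : \sum_i (v i * (C n.+1 (Some l) i - C n (Some l) i)) * nu n l i =
  - (2^-1 * \sum_i \sum_j fluxK n l i j * (nu n l j - nu n l i) ^+ 2).
Proof.
pose S := \sum_i \sum_j fluxK n l i j * (nu n l j - nu n l i) * nu n l i.
have -> : \sum_i (v i * (C n.+1 (Some l) i - C n (Some l) i)) * nu n l i = S.
  by apply: eq_bigr => i _; rewrite (ev_step HE) mulr_suml.
have S' : S = - \sum_i \sum_j fluxK n l i j * (nu n l j - nu n l i) * nu n l j.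
  rewrite /S exchange_big /= -sumrN; apply: eq_bigr => i _; rewrite -sumrN; apply: eq_bigr => j _.
  by rewrite fluxKC; ring.
have -> : \sum_i \sum_j fluxK n l i j * (nu n l j - nu n l i) ^+ 2 = - (S + S).
  rewrite {2}S' -sumrB -sumrN; apply: eq_bigr => i _; rewrite -sumrB -sumrN; apply: eq_bigr => j _; ring.
by field.
Qed.

Lemma dC_None n i : C n.+1 None i - C n None i = - \sum_l a l / b * (C n.+1 (Some l) i - C n (Some l) i).
Proof.
have e1 := ev_vol HE n i; have e2 := ev_vol HE n.+1 i.
have bn : b != 0 by exact: lt0r_neq0.
apply: (mulfI bn); rewrite mulrN mulr_sumr.
have -> : \sum_l b * (a l / b * (C n.+1 (Some l) i - C n (Some l) i)) =
   \sum_l a l * C n.+1 (Some l) i - \sum_l a l * C n (Some l) i.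
  by rewrite -sumrB; apply: eq_bigr => l _; field.
have e3 : b * C n.+1 None i - b * C n None i = - (\sum_l a l * C n.+1 (Some l) i - \sum_l a l * C n (Some l) i).
  by set s1 := \sum_l _ in e1 *; set s2 := \sum_l _ in e2 *; lra.
by rewrite -e3; ring.
Qed.

Lemma lap_step n i : lap (fun k => psi n.+1 k - psi n k) i = v i * \sum_l z l * (C n.+1 (Some l) i - C n (Some l) i).
Proof.
rewrite lapB !(ev_poisson HE); under [in RHS]eq_bigr do rewrite mulrBr.
by rewrite sumrB; ring.
Qed.

(** Test the equations with the potentials and sum by parts.  The electric energy is quadratic; its
    increment is the work of the blended potential minus a multiple of [alpha - 1/2]. *)
Lemma energy_step n : dissipation n + time_loss n <= energy (C n) (psi n) - energy (C n.+1) (psi n.+1).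
Proof.
pose de k := psi n.+1 k - psi n k.
have elec : \sum_i lap (psi n.+1) i * psi n.+1 i - \sum_i lap (psi n) i * psi n i =
   2 * (\sum_i lap de i * blend alpha (psi n) (psi n.+1) i - (alpha - 2^-1) * \sum_i lap de i * de i).
  have -> : \sum_i lap de i * blend alpha (psi n) (psi n.+1) i = \sum_i lap de i * psi n i + alpha * \sum_i lap de i * de i.
    rewrite mulr_sumr -big_split /=; apply: eq_bigr => i _; rewrite /blend -/(de i); ring.
  have -> : \sum_i lap (psi n.+1) i * psi n.+1 i = \sum_i lap (psi n) i * psi n i + 2 * (\sum_i lap de i * psi n i) + \sum_i lap de i * de i.
    have e i : lap (psi n.+1) i = lap (psi n) i + lap de i by rewrite /de lapB; ring.
    have -> : \sum_i lap (psi n.+1) i * psi n.+1 i = \sum_i lap (psi n) i * psi n i + \sum_i lap (psi n) i * de i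
        + \sum_i lap de i * psi n i + \sum_i lap de i * de i.
      by rewrite -!big_split /=; apply: eq_bigr => i _; rewrite e /de; ring.
    by rewrite (lap_sym d wC (psi n) de); ring.
  by field.
have ent : \sum_i v i * (\sum_o (C n.+1 o i * ln (C n.+1 o i) - C n.+1 o i)) - \sum_i v i * (\sum_o (C n o i * ln (C n o i) - C n o i)) =
   \sum_l \sum_i v i * (C n.+1 (Some l) i - C n (Some l) i) * (act h (C n) (C n.+1) (Some l) i - a l / b * act h (C n) (C n.+1) None i) - time_loss n.
  have e1 i : v i * (\sum_o (C n.+1 o i * ln (C n.+1 o i) - C n.+1 o i)) - v i * (\sum_o (C n o i * ln (C n o i) - C n o i)) =
     v i * (\sum_o (C n.+1 o i - C n o i) * act h (C n) (C n.+1) o i) - v i * \sum_o C n.+1 o i * dissip h (C n o i / C n.+1 o i).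
    rewrite -!mulrBr -!sumrB; congr (_ * _); apply: eq_bigr => o _.
    by apply: entropy_step; exact: (ev_pos HE).
  have e2 i : v i * (\sum_o (C n.+1 o i - C n o i) * act h (C n) (C n.+1) o i) =
     \sum_l v i * (C n.+1 (Some l) i - C n (Some l) i) * (act h (C n) (C n.+1) (Some l) i - a l / b * act h (C n) (C n.+1) None i).
    under [RHS]eq_bigr do rewrite -mulrA.
    rewrite -mulr_sumr; congr (_ * _).
    by rewrite sum_option dC_None mulNr mulr_suml addrC -sumrB; apply: eq_bigr => l _; ring.
  by rewrite exchange_big /= /time_loss -!sumrB; apply: eq_bigr => i _; rewrite e1 e2.
have -> : dissipation n = - \sum_l \sum_i (v i * (C n.+1 (Some l) i - C n (Some l) i)) * nu n l i.
  by rewrite /dissipation; under [in RHS]eq_bigr do rewrite dissipation_flux; rewrite sumrN opprK mulr_sumr.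
have fl : \sum_l \sum_i (v i * (C n.+1 (Some l) i - C n (Some l) i)) * nu n l i =
   \sum_l \sum_i v i * (C n.+1 (Some l) i - C n (Some l) i) * (act h (C n) (C n.+1) (Some l) i - a l / b * act h (C n) (C n.+1) None i)
   + (\sum_l \sum_i v i * C n.+1 (Some l) i * e0 l i - \sum_l \sum_i v i * C n (Some l) i * e0 l i)
   + \sum_i lap de i * blend alpha (psi n) (psi n.+1) i.
  have -> : \sum_i lap de i * blend alpha (psi n) (psi n.+1) i =
     \sum_l \sum_i v i * (C n.+1 (Some l) i - C n (Some l) i) * (z l * blend alpha (psi n) (psi n.+1) i).
    rewrite exchange_big /=; apply: eq_bigr => i _; rewrite lap_step mulr_sumr mulr_suml; apply: eq_bigr => l _; ring.
  rewrite -sumrB -!big_split /=; apply: eq_bigr => l _; rewrite -sumrB -!big_split /=; apply: eq_bigr => i _.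
  by rewrite /nu /drive; ring.
have l0 := lap_ge0 wC w0 d0 de.
have /andP[al1 _] := al.
have : 0 <= (alpha - 2^-1) * \sum_i lap de i * de i by rewrite mulr_ge0 // subr_ge0.
rewrite fl /energy; move: elec ent.
set A1 := \sum_i lap (psi n.+1) i * _; set A2 := \sum_i lap (psi n) i * _; set A3 := \sum_i lap de i * blend _ _ _ _.
set A4 := (alpha - _) * _; set B1 := \sum_i v i * (\sum_o (C n.+1 o i * _ - _)); set B2 := \sum_i v i * (\sum_o (C n o i * _ - _)).
set B3 := \sum_l \sum_i _ * (act _ _ _ _ _ - _); set B4 := \sum_l \sum_i v i * C n.+1 _ _ * _; set B5 := \sum_l \sum_i v i * C n _ _ * _.
by lra.
Qed.

Lemma dissipation_ge0 n : 0 <= dissipation n.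
Proof.
rewrite /dissipation mulr_ge0 // ?invr_ge0 //; do 3! apply: sumr_ge0 => ? _.
by rewrite mulr_ge0 ?fluxK_ge0 // sqr_ge0.
Qed.

Lemma ratio_gt0 n o i : 0 < C n o i / C n.+1 o i.
Proof. by rewrite divr_gt0 // (ev_pos HE). Qed.

Lemma time_loss_term_ge0 n o i : 0 <= C n.+1 o i * dissip h (C n o i / C n.+1 o i).
Proof. apply: mulr_ge0; [exact/ltW/(ev_pos HE) | exact/(ie_ge0 hH)/ratio_gt0]. Qed.

Lemma time_loss_ge0 n : 0 <= time_loss n.
Proof.
apply: sumr_ge0 => i _; rewrite mulr_ge0 ?(ltW (v0 i)) //; apply: sumr_ge0 => o _; exact: time_loss_term_ge0.
Qed.

Definition drop n := energy (C n) (psi n) - energy (C n.+1) (psi n.+1).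

Lemma drop_dissipation n : dissipation n <= drop n.
Proof. by have := energy_step n; have := time_loss_ge0 n; rewrite /drop; lra. Qed.

Lemma drop_time_loss n o i : v i * (C n.+1 o i * dissip h (C n o i / C n.+1 o i)) <= drop n.
Proof.
apply: (@le_trans _ _ (time_loss n)); last by have := energy_step n; have := dissipation_ge0 n; rewrite /drop; lra.
rewrite /time_loss (bigD1 i) //=; apply: le_trans (_ : v i * \sum_o C n.+1 o i * dissip h (C n o i / C n.+1 o i) <= _).
  rewrite ler_pM2l // (bigD1 o) //= lerDl; apply: sumr_ge0 => o' _; exact: time_loss_term_ge0.
rewrite lerDl; apply: sumr_ge0 => i' _; rewrite mulr_ge0 ?(ltW (v0 i')) //; apply: sumr_ge0 => o' _; exact: time_loss_term_ge0.
Qed.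

Lemma drop_ge0 n : 0 <= drop n.
Proof. by apply: le_trans (drop_dissipation n); exact: dissipation_ge0. Qed.

Definition cmax : R := b^-1 + \sum_l (a l)^-1.

Lemma C_bound n o i : C n o i <= cmax.
Proof.
have p l : 0 <= a l * C n (Some l) i by apply: mulr_ge0; apply: ltW; rewrite // (ev_pos HE).
have q : 0 <= b * C n None i by apply: mulr_ge0; apply: ltW; rewrite // (ev_pos HE).
have e := ev_vol HE n i; have s0 : 0 <= \sum_l (a l)^-1 by apply: sumr_ge0 => l _; rewrite invr_ge0 ltW.
have s1 : 0 <= \sum_l a l * C n (Some l) i by apply: sumr_ge0.
case: o => [l|].
  apply: (@le_trans _ _ (a l)^-1).
    rewrite -[(a l)^-1]mul1r ler_pdivlMr // mulrC -e (bigD1 l) //= -addrA lerDl addr_ge0 //.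
    by apply: sumr_ge0.
  rewrite /cmax (bigD1 l) //= addrCA lerDl addr_ge0 ?invr_ge0 ?(ltW b0) //.
  by apply: sumr_ge0 => l' _; rewrite invr_ge0 ltW.
apply: (@le_trans _ _ b^-1); last by rewrite lerDl.
by rewrite -[b^-1]mul1r ler_pdivlMr // mulrC -e lerDr.
Qed.

Lemma cmax_gt0 : 0 < cmax.
Proof. by rewrite ltr_pwDl ?invr_gt0 // sumr_ge0 // => l _; rewrite invr_ge0 ltW. Qed.

(** [c ln c - c] is at least -1, and the concentrations are bounded by the volume constraint. *)
Lemma energy_low : exists B, forall n, B <= energy (C n) (psi n).
Proof.
exists (\sum_i v i * (\sum_(o : option 'I_M) -1) + \sum_l \sum_i - (v i * cmax * `|e0 l i|)) => n.
rewrite /energy -[leLHS]addr0; apply: lerD; first apply: lerD.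
- apply: ler_sum => i _; rewrite ler_pM2l //; apply: ler_sum => o _.
  have c0 := ev_pos HE n o i; set c := C n o i in c0 *.
  have : c * (1 - c^-1) <= c * ln c by rewrite ler_pM2l // ln_ge_inv.
  by rewrite mulrBr divff ?gt_eqF //; lra.
- apply: ler_sum => l _; apply: ler_sum => i _; rewrite lerNl -mulrN.
  apply: le_trans (ler_norm _) _; rewrite normrM normrN ler_wpM2r // normrM.
  rewrite (gtr0_norm (v0 i)) (gtr0_norm (ev_pos HE n _ i)) ler_pM2l //; exact: C_bound.
by rewrite mulr_ge0 ?invr_ge0 // lap_ge0.
Qed.

(** Coefficients of the volume constraint: an ion of type [l] entering a cell displaces [a l / b]
    units of solvent. *)
Definition weight (o : option 'I_M) (l : 'I_M) : R := if o is Some l' then (l' == l)%:R else - (a l / b).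
(** Each unordered edge occurs with both orientations as a channel; hence the factor 1/2. *)
Definition stoich (x : option 'I_M * 'I_N) (e : 'I_M * 'I_N * 'I_N) : R :=
  weight x.1 e.1.1 * (2^-1 * ((x.2 == e.1.2)%:R - (x.2 == e.2)%:R)).

Lemma sum_weight (y : option 'I_M -> R) l : \sum_o weight o l * y o = y (Some l) - a l / b * y None.
Proof.
rewrite sum_option /= (bigD1 l) //= eqxx mul1r big1 ?addr0; first by rewrite addrC mulNr.
by move=> l' /negbTE ->; rewrite mul0r.
Qed.

Lemma sum_delta (y : 'I_N -> R) i : \sum_k y k * (k == i)%:R = y i.
Proof.
by rewrite (bigD1 i) //= eqxx mulr1 big1 ?addr0 // => k /negbTE ->; rewrite mulr0.
Qed.

Lemma sum_stoich (y : option 'I_M -> 'I_N -> R) l i j :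
  \sum_x y x.1 x.2 * stoich x (l, i, j) = 2^-1 * ((y (Some l) i - a l / b * y None i) - (y (Some l) j - a l / b * y None j)).
Proof.
rewrite -(pair_bigA _ (fun o k => y o k * stoich (o, k) (l, i, j))) /=.
transitivity (\sum_o weight o l * (2^-1 * (y o i - y o j))).
  apply: eq_bigr => o _; rewrite -[in RHS](sum_delta (y o) i) -[in RHS](sum_delta (y o) j) -sumrB !mulr_sumr.
  by apply: eq_bigr => k _; rewrite /stoich /=; ring.
by rewrite (sum_weight (fun o => 2^-1 * (y o i - y o j))); ring.
Qed.

Lemma sum_flux_stoich (J : 'I_M -> 'I_N -> 'I_N -> R) o k : (forall l i j, J l j i = - J l i j) ->
  dot (fun e => J e.1.1 e.1.2 e.2) (stoich (o, k)) = \sum_l weight o l * \sum_j J l k j.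
Proof.
move=> JN; rewrite /dot -(pair_bigA _ (fun li j => J li.1 li.2 j * stoich (o, k) (li, j))) /=.
rewrite -(pair_bigA _ (fun l i => \sum_j J l i j * stoich (o, k) ((l, i), j))) /=.
apply: eq_bigr => l _.
have e1 : \sum_i \sum_j J l i j * (k == i)%:R = \sum_j J l k j.
  rewrite (bigD1 k) //= [X in _ + X]big1 ?addr0 => [|i /negbTE ki].
    by apply: eq_bigr => j _; rewrite eqxx mulr1.
  by rewrite big1 // => j _; rewrite eq_sym ki mulr0.
have e2 : \sum_i \sum_j J l i j * (k == j)%:R = - \sum_j J l k j.
  rewrite exchange_big /= -e1 -sumrN; apply: eq_bigr => j _; rewrite -sumrN; apply: eq_bigr => i _.
  by rewrite JN mulNr.
transitivity (weight o l * 2^-1 * (\sum_i \sum_j J l i j * (k == i)%:R - \sum_i \sum_j J l i j * (k == j)%:R)).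
  rewrite -sumrB mulr_sumr; apply: eq_bigr => i _; rewrite -sumrB mulr_sumr; apply: eq_bigr => j _.
  by rewrite /stoich /=; ring.
by rewrite e1 e2; field.
Qed.

(** The alternative required by [step_ok], in terms of the ratio of two successive concentrations. *)
Lemma entropy_alternative : exists kap : R -> R, (forall th, 0 < th -> 0 < kap th) /\
  forall th s, 0 < th -> 0 < s -> kap th * Num.max s 1 <= dissip h s \/ `|ln s| + `|h s| <= th.
Proof.
suff /choice[kap H] : forall th : R, exists k : R, 0 < th -> 0 < k /\
    forall s, 0 < s -> k * Num.max s 1 <= dissip h s \/ `|ln s| + `|h s| <= th.
  by exists kap; split=> th => [/H[]//|s /H[_ h'] /h'].
move=> th; have [th0|th0] := ltP 0 th; last by exists 1 => ?; exfalso; lra.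
have th20 : 0 < th / 2 by rewrite divr_gt0.
have [t t0 ht] := ie_cont hH th20.
have m0 : 0 < Num.min (th / 2) t by rewrite lt_min th20.
have [k k0 hk] := ie_coer hH m0; exists k => _; split=> // s s0.
have [h1|h1] := leP (Num.min (th / 2) t) `|ln s|; first by left; exact: hk.
right; move: h1; rewrite lt_min => /andP[h1 h2].
by have := ht s s0 (ltW h2); lra.
Qed.

Lemma drop_small eta : 0 < eta -> exists n0, forall n, (n0 <= n)%N -> drop n <= eta.
Proof.
move=> eta0; have [B HB] := energy_low.
have ni : nonincreasing_seq (fun n => energy (C n) (psi n)).
  by apply/nonincreasing_seqP => n; have := drop_ge0 n; rewrite /drop; lra.
have lb : has_lbound (range (fun n => energy (C n) (psi n))) by exists B => _ [n _ <-].
have cv := nonincreasing_is_cvgn ni lb.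
have := cv => /cvgrPdist_le /(_ eta eta0) [n0 _ Hn]; exists n0 => n hn.
have := Hn n hn; have := nonincreasing_cvgn_ge ni cv n.+1.
by rewrite /drop /= => h1 /ler_normlP[h2 h3]; lra.
Qed.

Lemma C_step_small eta : 0 < eta -> exists n0, forall n o i, (n0 <= n)%N -> `|C n.+1 o i - C n o i| <= eta.
Proof.
move=> eta0; have [kap [kap0 Hkap]] := entropy_alternative.
have c0 := cmax_gt0.
pose th := Num.min 2^-1 (eta / (2 * cmax)).
have th0 : 0 < th by rewrite lt_min invr_gt0 ltr0n divr_gt0 // mulr_gt0.
have [th1 th2] : th <= 2^-1 /\ th * (2 * cmax) <= eta.
  split; first by rewrite /th ge_min lexx.
  by rewrite -ler_pdivlMr ?mulr_gt0 // /th ge_min lexx orbT.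
have [vm vm0 Hvm] : small (fun t => forall i, t <= v i).
  by apply: small_all => i; exists (v i).
have {Hvm} Hvm := Hvm vm vm0 (lexx _).
have [|n0 H] := @drop_small (kap th * vm * eta); first by rewrite !mulr_gt0 // kap0.
exists n0 => n o i hn.
have x0 := ev_pos HE n o i; have x1 := ev_pos HE n.+1 o i.
have [h1|h1] := Hkap th _ th0 (ratio_gt0 n o i).
  have h2 : kap th * vm * Num.max (C n o i) (C n.+1 o i) <= kap th * vm * eta.
    apply: le_trans (H n hn); apply: le_trans (drop_time_loss n o i).
    rewrite (_ : kap th * vm * _ = vm * (C n.+1 o i * (kap th * Num.max (C n o i / C n.+1 o i) 1))); last first.
      have -> : Num.max (C n o i) (C n.+1 o i) = C n.+1 o i * Num.max (C n o i / C n.+1 o i) 1.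
        by rewrite maxr_pMr ?ltW // mulr1 mulrC divfK // gt_eqF.
      by ring.
    apply: ler_pM; rewrite ?(ltW vm0) //; last by rewrite ler_pM2l.
    by rewrite mulr_ge0 ?(ltW x1) // mulr_ge0 ?(ltW (kap0 _ th0)) // le_max ler01 orbT.
  rewrite ler_pM2l ?mulr_gt0 ?kap0 // ge_max in h2; case/andP: h2 => h2 h3.
  exact: abs_sub_le.
apply: le_trans (close_of_ln (th := th) x1 x0 th1 _) _.
  rewrite distrC -ln_div ?posrE //; apply: le_trans h1; by rewrite lerDl.
apply: le_trans th2; rewrite [2 * th]mulrC -mulrA ler_pM2l // ler_pM2l //; exact: C_bound.
Qed.

Section Potential.
Variable Bm : 'I_N -> 'I_N -> R.
Hypothesis HBm : forall psi i, psi i = \sum_j lap psi j * Bm j i.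

Definition amount n (p : option 'I_M * 'I_N) : R := v p.2 * C n p.1 p.2.

Definition Qpsi : R := (\sum_l `|z l|) * \sum_i \sum_j `|Bm j i|.

(** The potential is the image of the charges under the inverse of the Poisson operator. *)
Lemma psi_lip n k i : `|psi n i - psi k i| <= Qpsi * \sum_p `|amount n p - amount k p|.
Proof.
set D := \sum_p _; have D0 : 0 <= D by apply: sumr_ge0.
have lapd j : `|lap (psi n) j - lap (psi k) j| <= (\sum_l `|z l|) * D.
  rewrite !(ev_poisson HE) (_ : _ - _ = \sum_l z l * (amount n (Some l, j) - amount k (Some l, j))); last first.
    rewrite /amount /= [LHS](_ : _ = v j * (\sum_l z l * C n (Some l) j) - v j * (\sum_l z l * C k (Some l) j)); last by ring.
    by rewrite -mulrBr -sumrB mulr_sumr; apply: eq_bigr => l _; ring.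
  apply: le_trans (ler_norm_sum _ _ _) _; rewrite mulr_suml; apply: ler_sum => l _.
  rewrite normrM ler_wpM2l // /D (bigD1 (Some l, j)) //= lerDl; exact: sumr_ge0.
rewrite (HBm (psi n)) (HBm (psi k)) -sumrB.
apply: le_trans (ler_norm_sum _ _ _) _.
apply: (@le_trans _ _ (\sum_j (\sum_l `|z l|) * D * `|Bm j i|)).
  by apply: ler_sum => j _; rewrite -mulrBl normrM ler_wpM2r.
rewrite -mulr_sumr /Qpsi mulrAC ler_wpM2r //.
have s0 : 0 <= \sum_l `|z l| by apply: sumr_ge0.
apply: ler_wpM2l => //.
rewrite [leRHS](bigD1 i) //= lerDl; apply: sumr_ge0 => i' _; exact: sumr_ge0.
Qed.

Lemma psi_step_small eta : 0 < eta -> exists n0, forall n i, (n0 <= n)%N -> `|psi n.+1 i - psi n i| <= eta.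
Proof.
move=> eta0.
have Q0 : 0 <= Qpsi by rewrite mulr_ge0 ?sumr_ge0 // => i _; rewrite sumr_ge0.
pose W := Qpsi * \sum_(p : option 'I_M * 'I_N) v p.2.
have W0 : 0 <= W by rewrite mulr_ge0 // sumr_ge0 // => p _; exact/ltW.
have [|n0 H] := @C_step_small (eta / (W + 1)); first by rewrite divr_gt0 // ltr_wpDl.
exists n0 => n i hn; apply: le_trans (psi_lip _ _ _) _.
apply: (@le_trans _ _ (W * (eta / (W + 1)))).
  rewrite /W -mulrA; apply: ler_wpM2l => //; rewrite mulr_suml; apply: ler_sum => p _.
  by rewrite /amount -mulrBr normrM gtr0_norm // ler_pM2l // H.
by rewrite mulrCA ger_pMr // ler_pdivrMr ?ltr_wpDl // mul1r lerDl.
Qed.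

(** The coupling of the abstract trajectories: the electric part of the log-activity. *)
Definition electric n (p : option 'I_M * 'I_N) : R := if p.1 is Some l then z l * psi n p.2 else 0.
Definition log_act n (p : option 'I_M * 'I_N) : R := ln (v p.2) + act h (C n) (C n.+1) p.1 p.2.
Definition base n l i : R := e0 l i - (ln (v i) - a l / b * ln (v i)) + z l * (blend alpha (psi n) (psi n.+1) i - psi n i).
Definition bias n (e : 'I_M * 'I_N * 'I_N) : R := 2^-1 * (base n e.1.1 e.1.2 - base n e.1.1 e.2).
Definition flux n l i j : R := fluxK n l i j * (nu n l j - nu n l i).

Definition scheme_traj : traj R (option 'I_M * 'I_N)%type ('I_M * 'I_N * 'I_N)%type :=
  Traj amount log_act (fun n e => flux n e.1.1 e.1.2 e.2) (fun n e => bias n e + \sum_p electric n p * stoich p e) drop.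

Lemma drive_split n l i j :
  bias n (l, i, j) + \sum_p electric n p * stoich p (l, i, j) + \sum_p log_act n p * stoich p (l, i, j) = 2^-1 * (nu n l i - nu n l j).
Proof.
rewrite (sum_stoich (fun o k => electric n (o, k))) (sum_stoich (fun o k => log_act n (o, k))) /bias /base /nu /drive /electric /log_act /=.
ring.
Qed.

Lemma electric_mono n k : 0 <= \sum_p (electric n p - electric k p) * (amount n p - amount k p).
Proof.
have -> : \sum_p (electric n p - electric k p) * (amount n p - amount k p) =
   \sum_i lap (fun j => psi n j - psi k j) i * (psi n i - psi k i); last exact: (lap_ge0 wC w0 d0).
rewrite -(pair_bigA _ (fun o i => (electric n (o, i) - electric k (o, i)) * (amount n (o, i) - amount k (o, i)))) /= exchange_big /=.
apply: eq_bigr => i _; rewrite sum_option /electric /= subrr mul0r add0r lapB !(ev_poisson HE).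
rewrite [X in X * _](_ : _ = v i * (\sum_l z l * C n (Some l) i) - v i * (\sum_l z l * C k (Some l) i)); last by ring.
by rewrite -mulrBr -sumrB mulr_sumr mulr_suml; apply: eq_bigr => l _; rewrite /amount /=; ring.
Qed.

(** The amounts of all species in all cells form a trajectory to which [run_cvg] applies. *)
Lemma C_cvg o i : cvgn (fun n => C n o i).
Proof.
have [kap [kap0 Hkap]] := entropy_alternative.
have inT (T : finType) (F : T -> R) : \sum_(t in finset.setT) F t = \sum_t F t.
  by apply: eq_bigl => t; rewrite finset.in_setT.
have HX n : step_ok stoich kap finset.setT (amount n) (amount n.+1) (log_act n) (fun e => flux n e.1.1 e.1.2 e.2)
    (fun e => bias n e + \sum_p electric n p * stoich p e) (drop n).
  split; first exact: drop_ge0.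
  - move=> [sp k] _; split; rewrite /amount /= ?mulr_gt0 ?(ev_pos HE) //.
    have anti l i' j : flux n l j i' = - flux n l i' j by rewrite /flux fluxKC; ring.
    rewrite (sum_flux_stoich sp k anti) addrC; apply/eqP; rewrite -subr_eq; apply/eqP.
    rewrite -mulrBr; case: sp => [l|].
      rewrite (ev_step HE) [RHS](bigD1 l) //= eqxx mul1r [X in _ + X]big1 ?addr0 // => l' /negbTE h'.
      by rewrite eq_sym h' mul0r.
    rewrite dC_None mulrN mulr_sumr -sumrN; apply: eq_bigr => l _.
    by rewrite /flux /fluxK -(ev_step HE) /=; ring.
  - move=> [[l i'] j]; rewrite inT drive_split /flux /=; set k0 := fluxK n l i' j.
    have k00 : 0 <= k0 by exact: fluxK_ge0.
    rewrite -normrM (_ : _ * _ = - (2^-1 * (k0 * (nu n l j - nu n l i') ^+ 2))); last by ring.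
    rewrite normrN ger0_norm; last by rewrite mulr_ge0 ?invr_ge0 // mulr_ge0 // sqr_ge0.
    apply: le_trans (drop_dissipation n).
    rewrite /dissipation ler_pM2l ?invr_gt0 // (bigD1 l) //= (bigD1 i') //= (bigD1 j) //= -!addrA lerDl.
    have t0 l' i2 j2 : 0 <= fluxK n l' i2 j2 * (nu n l' j2 - nu n l' i2) ^+ 2 by rewrite mulr_ge0 ?fluxK_ge0 // sqr_ge0.
    by rewrite !addr_ge0 //; do ?[apply: sumr_ge0 => ? _] => //.
  move=> [sp k] th _ th0.
  have x0 := ev_pos HE n sp k; have x1 := ev_pos HE n.+1 sp k.
  have lnr : ln (C n sp k / C n.+1 sp k) = ln (C n sp k) - ln (C n.+1 sp k) by rewrite ln_div ?posrE.
  have [h1|h1] := Hkap th _ th0 (ratio_gt0 n sp k); [left|right].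
    apply: le_trans (drop_time_loss n sp k).
    rewrite /amount /= -maxr_pMr ?(ltW (v0 k)) // max_ratio //.
    rewrite mulrCA ler_pM2l // mulrCA ler_pM2l //.
  rewrite /amount /log_act /act /= !lnM ?posrE //.
  move: h1; set Hs := h _; rewrite lnr => h1.
  have n1' := ler_norm Hs; have n2' := normr_ge0 Hs; have n3' := normr_ge0 (ln (C n sp k) - ln (C n.+1 sp k)).
  split.
    rewrite (_ : _ - _ = - (ln (C n sp k) - ln (C n.+1 sp k))); last by ring.
    by rewrite normrN; lra.
  rewrite (_ : _ - _ = Hs - (ln (C n sp k) - ln (C n.+1 sp k))); last by ring.
  by apply: le_trans (ler_normB _ _) _; lra.
have HR n : run stoich kap finset.setT scheme_traj 0 n by move=> k _; exact: HX.
have [B HB] := energy_low.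
have Hcost n : cost scheme_traj 0 n <= energy (C 0%N) (psi 0%N) - B.
  have -> : cost scheme_traj 0 n = energy (C 0%N) (psi 0%N) - energy (C n) (psi n).
    elim: n => [|n IH]; first by rewrite /cost big_geq // subrr.
    by rewrite /cost big_nat_recr //= -/(cost scheme_traj 0 n) IH /drop; ring.
  by rewrite lerD2l lerN2.
have Q0 : 0 <= Qpsi by rewrite mulr_ge0 ?sumr_ge0 // => i' _; rewrite sumr_ge0.
have z0 : 0 <= \sum_l `|z l| by apply: sumr_ge0.
have cvx : cvgn (fun n => tx scheme_traj n (o, i)).
  apply: (@run_cvg _ _ _ stoich kap kap0 scheme_traj bias electric ((\sum_l `|z l|) * Qpsi) ((\sum_i v i) * cmax) _ HR Hcost) => //.
  - move=> n [sp k] /=; rewrite /amount /=; apply: ler_pM; rewrite ?(ltW (ev_pos HE _ _ _)) ?(ltW (v0 _)) ?C_bound //.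
    by rewrite (bigD1 k) //= lerDl; apply: sumr_ge0 => k' _; exact/ltW.
  - move=> eta eta0.
    have [|n0 H] := @psi_step_small (eta / (2 * (\sum_l `|z l|) + 1)).
      by rewrite divr_gt0 // ltr_wpDl // mulr_ge0.
    exists n0 => n k [[l i'] j] hn hk; rewrite /bias /base /=.
    pose D n' i2 := psi n'.+1 i2 - psi n' i2.
    have be n' i2 : blend alpha (psi n') (psi n'.+1) i2 - psi n' i2 = alpha * D n' i2 by rewrite /blend /D; ring.
    rewrite !be.
    rewrite (_ : _ - _ = 2^-1 * alpha * z l * (D n i' + D k j - D n j - D k i')); last by ring.
    have /andP[al1 al2] := al.
    have hD n' i2 : (n0 <= n')%N -> `|D n' i2| <= eta / (2 * (\sum_l `|z l|) + 1) by move=> h'; exact: H.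
    set eps := eta / _ in hD.
    have s4 : `|D n i' + D k j - D n j - D k i'| <= 4 * eps.
      have := abs_tri3 (abs_tri3 (hD n i' hn) (hD k j hk) (hD n j hn)) (_ : `|0| <= 0) (hD k i' hk).
      by rewrite normr0 addr0 addr0 => /(_ (lexx _)); rewrite (_ : eps + eps + eps + eps = 4 * eps); last ring.
    rewrite normrM !normrM (gtr0_norm (_ : 0 < 2^-1)) ?invr_gt0 // (ger0_norm (_ : 0 <= alpha)); last by apply: le_trans al1; rewrite invr_ge0.
    have zl : `|z l| <= \sum_l `|z l| by rewrite (bigD1 l) //= lerDl sumr_ge0.
    apply: (@le_trans _ _ ((2^-1 * 1 * \sum_l `|z l|) * (4 * eps))).
      apply: ler_pM => //; first by rewrite !mulr_ge0 ?invr_ge0 // (le_trans _ al1) // invr_ge0.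
      apply: ler_pM => //; first by rewrite mulr_ge0 ?invr_ge0 // (le_trans _ al1) // invr_ge0.
      by rewrite ler_pM2l ?invr_gt0.
    rewrite (_ : 2^-1 * 1 * _ * _ = 2 * (\sum_l `|z l|) * eps); last by field.
    by rewrite /eps mulrCA ger_pMr // ler_pdivrMr ?mul1r ?lerDl // ltr_wpDl // mulr_ge0.
  - by rewrite mulr_ge0.
  - move=> n k [[l|] i']; rewrite /electric /=; last by rewrite subrr normr0; apply: mulr_ge0; [exact: mulr_ge0 | exact: sumr_ge0].
    rewrite -mulrBr normrM -mulrA; apply: ler_pM => //; last exact: psi_lip.
    by rewrite (bigD1 l) //= lerDl sumr_ge0.
  exact: electric_mono.
have -> : (fun n => C n o i) = (fun n => (v i)^-1 * tx scheme_traj n (o, i)).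
  by apply/funext => n; rewrite /= /amount /= mulKf // gt_eqF.
by apply: is_cvgM => //; exact: is_cvg_cst.
Qed.

(** The limit is only known to be nonnegative at this stage. *)
Definition Cinf o i : R := limn (fun n => C n o i).

Lemma cvg_Cinf o i : (C n o i @[n --> \oo] --> Cinf o i)%classic.
Proof. exact: C_cvg. Qed.

Lemma Cinf_ge0 o i : 0 <= Cinf o i.
Proof. by apply: limr_ge; [exact: C_cvg | apply: nearW => n; exact/ltW/(ev_pos HE)]. Qed.

(** The limit of the potentials, through the inverse [Bm] of the Poisson operator. *)
Definition psinf i : R := \sum_j (v j * (\sum_l z l * Cinf (Some l) j) + f j) * Bm j i.

Lemma cvg_rhs i : (v i * (\sum_l z l * C n (Some l) i) + f i @[n --> \oo] --> v i * (\sum_l z l * Cinf (Some l) i) + f i)%classic.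
Proof.
apply: cvgD; last exact: cvg_cst.
by apply: cvgMr; apply: cvg_sumR => l; apply: cvgMr; exact: cvg_Cinf.
Qed.

Lemma cvg_psinf i : (psi n i @[n --> \oo] --> psinf i)%classic.
Proof.
have -> : (fun n => psi n i) = (fun n => \sum_j (v j * (\sum_l z l * C n (Some l) j) + f j) * Bm j i).
  by apply/funext => n; rewrite [LHS](HBm (psi n)); apply: eq_bigr => j _; rewrite (ev_poisson HE).
by apply: cvg_sumR => j; apply: cvgMl; exact: cvg_rhs.
Qed.

Lemma Cinf_vol i : \sum_l a l * Cinf (Some l) i + b * Cinf None i = 1.
Proof.
apply: (cvgR_unique (s := fun n => \sum_l a l * C n (Some l) i + b * C n None i)).
  by apply: cvgD; [apply: cvg_sumR => l | ]; apply: cvgMr; exact: cvg_Cinf.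
by under eq_fun do rewrite (ev_vol HE); exact: cvg_cst.
Qed.

Lemma Cinf_poisson i : lap psinf i = v i * (\sum_l z l * Cinf (Some l) i) + f i.
Proof.
apply: (cvgR_unique (s := fun n => lap (psi n) i)); last first.
  by under eq_fun do rewrite (ev_poisson HE); exact: cvg_rhs.
apply: cvgD; last by apply: cvgMr; exact: cvg_psinf.
by apply: cvg_sumR => j; apply: cvgMr; apply: cvgB; exact: cvg_psinf.
Qed.
Lemma amount_step n o : \sum_i v i * C n.+1 o i = \sum_i v i * C n o i.
Proof.
have ion l : \sum_i v i * C n.+1 (Some l) i = \sum_i v i * C n (Some l) i.
  apply/eqP; rewrite -subr_eq0 -sumrB; apply/eqP.
  under eq_bigr do rewrite -mulrBr (ev_step HE) -/(nu n _ _).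
  pose S := \sum_i \sum_j fluxK n l i j * (nu n l j - nu n l i).
  suff : S = - S by rewrite /S /fluxK /nu; lra.
  rewrite {1}/S exchange_big /= -sumrN; apply: eq_bigr => i _; rewrite -sumrN; apply: eq_bigr => j _.
  by rewrite fluxKC; ring.
case: o => [l|]; first exact: ion.
apply/eqP; rewrite -subr_eq0 -sumrB; apply/eqP.
under eq_bigr do rewrite -mulrBr dC_None mulrN mulr_sumr -sumrN.
rewrite exchange_big /= big1 // => l _.
transitivity (- (a l / b) * (\sum_i v i * C n.+1 (Some l) i - \sum_i v i * C n (Some l) i)).
  by rewrite -sumrB mulr_sumr; apply: eq_bigr => i _; ring.
by rewrite ion subrr mulr0.
Qed.

Lemma Cinf_amount o : \sum_i v i * Cinf o i = \sum_i v i * C 0%N o i.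
Proof.
apply: (cvgR_unique (s := fun n => \sum_i v i * C n o i)).
  by apply: cvg_sumR => i; apply: cvgMr; exact: cvg_Cinf.
have -> : (fun n => \sum_i v i * C n o i) = fun=> \sum_i v i * C 0%N o i.
  by apply/funext; elim=> // n IH; rewrite amount_step.
exact: cvg_cst.
Qed.

(** The total amount of each species, including the solvent, is conserved. *)
Lemma Cinf_somewhere o : exists i, 0 < Cinf o i.
Proof.
apply: contrapT => H.
have [i0 _] := dpos.
have : 0 < \sum_i v i * C 0%N o i.
  rewrite (bigD1 i0) //= ltr_pwDl ?mulr_gt0 ?(ev_pos HE) // sumr_ge0 // => j _.
  by rewrite mulr_ge0 // ltW ?(ev_pos HE).
rewrite -Cinf_amount big1 ?ltxx // => i _.
have := Cinf_ge0 o i; rewrite le_eqVlt => /predU1P[<-|h']; first by rewrite mulr0.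
by case: H; exists i.
Qed.
Lemma act_up n o i : act h (C n) (C n.+1) o i <= ln (C n.+1 o i) + 3 / 8.
Proof. by rewrite /act lerD2l; apply: (ie_up hH); exact: ratio_gt0. Qed.

Lemma cmax_ln n o i : ln (C n o i) <= ln cmax.
Proof. by rewrite ler_ln ?posrE ?cmax_gt0 ?(ev_pos HE) // C_bound. Qed.

Lemma act_cvg o i : 0 < Cinf o i -> (act h (C n) (C n.+1) o i @[n --> \oo] --> ln (Cinf o i))%classic.
Proof.
move=> c0.
have cl : (ln (C n o i) @[n --> \oo] --> ln (Cinf o i))%classic.
  by apply: continuous_cvg; [exact: continuous_ln | exact: cvg_Cinf].
have cl1 : (ln (C n.+1 o i) @[n --> \oo] --> ln (Cinf o i))%classic by rewrite (cvg_shiftS (fun n => ln (C n o i))).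
rewrite -[ln _]addr0; apply: cvgD => //.
apply: eventually_cvg => eta eta0; have [t t0 ht] := ie_cont hH eta0.
have dl : (ln (C n o i) - ln (C n.+1 o i) @[n --> \oo] --> 0)%classic by rewrite -(subrr (ln (Cinf o i))); exact: cvgB.
apply: eventually_imp (cvg_eventually dl t0) => n; rewrite !subr0 => hn.
by apply: ht; [exact: ratio_gt0 | rewrite ln_div ?posrE ?(ev_pos HE)].
Qed.

Lemma act_low o i : 0 < Cinf o i -> exists B, eventually_n (fun n => `|act h (C n) (C n.+1) o i| <= B).
Proof.
move=> c0; exists (`|ln (Cinf o i)| + 1).
apply: eventually_imp (cvg_eventually (act_cvg c0) ltr01) => n hn.
rewrite -lerBlDl; apply: le_trans hn; exact: lerB_dist.
Qed.

Lemma act_infty o i T : Cinf o i = 0 -> eventually_n (fun n => act h (C n) (C n.+1) o i <= - T).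
Proof.
move=> c0; have := @cvg_Cinf o i; rewrite c0 -(cvg_shiftS (fun n => C n o i)) => cv.
have e0' := expR_gt0 (- T - 3 / 8).
apply: eventually_imp (cvg_eventually cv e0') => n; rewrite subr0 gtr0_norm ?(ev_pos HE) // => hn.
apply: le_trans (act_up _ _ _) _.
by have : ln (C n.+1 o i) <= - T - 3 / 8; [rewrite -[leRHS]expRK ler_ln ?posrE ?(ev_pos HE) | lra].
Qed.

Definition drift n l i : R := z l * blend alpha (psi n) (psi n.+1) i + e0 l i.

Lemma cvg_drift l i : (drift n l i @[n --> \oo] --> z l * psinf i + e0 l i)%classic.
Proof.
apply: cvgD; last exact: cvg_cst.
apply: cvgMr; rewrite -[psinf i]addr0; apply: cvgD; first exact: cvg_psinf.
have -> : (0 : R) = alpha * (psinf i - psinf i) by rewrite subrr mulr0.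
by apply: cvgMr; apply: cvgB; [rewrite (cvg_shiftS (fun n => psi n i)) |]; exact: cvg_psinf.
Qed.

Lemma drift_bound : exists2 B, 0 <= B & eventually_n (fun n => forall l i, `|drift n l i| <= B).
Proof.
exists (\sum_l \sum_i (`|z l * psinf i + e0 l i| + 1)).
  by do 2! apply: sumr_ge0 => ? _; rewrite addr_ge0.
apply: eventually_all => l; apply: eventually_all => i.
apply: eventually_imp (cvg_eventually (@cvg_drift l i) ltr01) => n hn.
apply: (@le_trans _ _ (`|z l * psinf i + e0 l i| + 1)).
  by rewrite -lerBlDl; apply: le_trans hn; exact: lerB_dist.
rewrite (bigD1 l) //= (bigD1 i) //= -addrA lerDl addr_ge0 //; first by apply: sumr_ge0 => ? _; rewrite addr_ge0.
by do 2! apply: sumr_ge0 => ? _; rewrite addr_ge0.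
Qed.

Lemma nuE n l i : nu n l i = act h (C n) (C n.+1) (Some l) i - a l / b * act h (C n) (C n.+1) None i + drift n l i.
Proof. by rewrite /nu /drive /drift addrA. Qed.

Lemma ab_gt0 l : 0 < a l / b.
Proof. exact: divr_gt0. Qed.

(** The logarithm of the vanishing concentration, either of the solvent in [p] or of the ion in [o],
    is the only unbounded term, and it has the right sign. *)
Lemma gap_infty l p o : 0 < Cinf (Some l) p -> 0 < Cinf None o -> Cinf None p = 0 \/ Cinf (Some l) o = 0 ->
  forall T, eventually_n (fun n => T <= nu n l p - nu n l o).
Proof.
move=> cp co alt T.
have [B1 H1] := act_low cp; have [B2 H2] := act_low co; have [B3 B30 H3] := drift_bound.
have ab := ab_gt0 l; set r := a l / b in ab.
pose L := ln cmax + 3 / 8.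
have upL n o' i : act h (C n) (C n.+1) o' i <= L by apply: le_trans (act_up _ _ _) _; rewrite lerD2r cmax_ln.
have rup n i : r * act h (C n) (C n.+1) None i <= r * L by rewrite ler_pM2l.
case: alt => alt.
  pose T' := (T + B1 + L + r * B2 + 2 * B3) / r.
  apply: eventually_imp (eventually_and (eventually_and H1 H2) (eventually_and H3 (act_infty T' alt))) => n [[h1 h2] [h3 h4]].
  rewrite !nuE -/r.
  have := h3 l p; have := h3 l o; move=> /ler_normlP[_ f1] /ler_normlP[f2 _].
  move: h1 h2 => /ler_normlP[g1 _] /ler_normlP[g2 _].
  have h5 : r * act h (C n) (C n.+1) None p <= r * - T' by rewrite ler_pM2l.
  have e1 : r * - T' = - (T + B1 + L + r * B2 + 2 * B3) by rewrite /T'; field; rewrite gt_eqF.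
  have h6 : r * - act h (C n) (C n.+1) None o <= r * B2 by rewrite ler_pM2l.
  have := upL n (Some l) o; move: h5 h6 f1 f2 g1; rewrite e1 mulrN; lra.
pose T' := T + B1 + r * L + r * B2 + 2 * B3.
apply: eventually_imp (eventually_and (eventually_and H1 H2) (eventually_and H3 (act_infty T' alt))) => n [[h1 h2] [h3 h4]].
rewrite !nuE -/r.
have := h3 l p; have := h3 l o; move=> /ler_normlP[_ f1] /ler_normlP[f2 _].
move: h1 h2 => /ler_normlP[g1 _] /ler_normlP[g2 _].
have h6 : r * - act h (C n) (C n.+1) None o <= r * B2 by rewrite ler_pM2l.
have := rup n p; move: h4 h6 f1 f2 g1; rewrite /T' mulrN; lra.
Qed.

(** By [ev_u_small], a nodal value far below the concentration would require a decay. *)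
Lemma u_low l i : 0 < Cinf (Some l) i -> exists2 dl : R, 0 < dl & eventually_n (fun n => dl <= u n l i).
Proof.
move=> c0; exists (Cinf (Some l) i / 5); first by rewrite divr_gt0.
have c50 : 0 < Cinf (Some l) i / 10 by rewrite divr_gt0.
have [n0 H] := cvg_eventually (@cvg_Cinf (Some l) i) c50.
exists n0.+1; case=> // n; rewrite ltnS => hn.
have /ler_normlP[h1 h2] := H n hn; have /ler_normlP[h3 h4] := H n.+1 (leqW hn).
rewrite leNgt; apply/negP => hu.
have hs := ev_u_small HE (n := n) (l := l) (i := i); have hc : u n.+1 l i <= C n.+1 (Some l) i / 4 by lra.
by have := hs hc; lra.
Qed.

Lemma drop_flux n l i j : fluxK n l i j * (nu n l j - nu n l i) ^+ 2 <= 2 * drop n.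
Proof.
suff : 2^-1 * (fluxK n l i j * (nu n l j - nu n l i) ^+ 2) <= drop n by lra.
apply: le_trans (drop_dissipation n).
have t0 l' i2 j2 : 0 <= fluxK n l' i2 j2 * (nu n l' j2 - nu n l' i2) ^+ 2 by rewrite mulr_ge0 ?fluxK_ge0 // sqr_ge0.
rewrite /dissipation ler_pM2l ?invr_gt0 // (bigD1 l) //= (bigD1 i) //= (bigD1 j) //= -!addrA lerDl.
by rewrite !addr_ge0 //; do ?[apply: sumr_ge0 => ? _] => //.
Qed.

(** With the mobility bounded below, the dissipation controls the difference of the potentials. *)
Lemma flux_gap l i j : 0 < tau i j -> 0 < Cinf (Some l) i -> 0 < Cinf (Some l) j ->
  forall eta, 0 < eta -> eventually_n (fun n => `|nu n l j - nu n l i| <= eta).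
Proof.
move=> t0 ci cj eta eta0.
have [d1 d10 H1] := u_low ci; have [d2 d20 H2] := u_low cj.
pose k0 := g l * tau i j * Num.min d1 d2.
have k00 : 0 < k0 by rewrite !mulr_gt0 // lt_min d10.
have [|n0 H] := @drop_small (k0 * eta ^+ 2 / 2); first by rewrite divr_gt0 // mulr_gt0 // exprn_gt0.
apply: eventually_imp (eventually_and (eventually_and H1 H2) (ex_intro _ n0 H : eventually_n _)) => n [[h1 h2] hk].
have Kk : k0 <= fluxK n l i j.
  rewrite /fluxK /k0 ler_pM2l ?mulr_gt0 //; apply: le_trans (ev_low HE n l i j).
  by rewrite le_min !ge_min h1 h2 /= orbT.
rewrite -ler_sqr ?nnegrE ?(ltW eta0) // -normrX ger0_norm ?sqr_ge0 // -(ler_pM2l k00).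
apply: le_trans (_ : fluxK n l i j * (nu n l j - nu n l i) ^+ 2 <= _); first by rewrite ler_wpM2r // sqr_ge0.
by apply: le_trans (drop_flux _ _ _ _) _; lra.
Qed.

(** Lower bound of the potential in a growing cell, where the correction [h] is bounded below, and
    upper bound in a cell where the solvent stays. *)
Lemma grow_bound l : exists B, eventually_n (fun n => forall i, C n (Some l) i <= C n.+1 (Some l) i ->
  ln (C n.+1 (Some l) i) - a l / b * act h (C n) (C n.+1) None i - B <= nu n l i) /\
  eventually_n (fun n => forall s, 0 < Cinf None s -> nu n l s <= ln (C n.+1 (Some l) s) + B).
Proof.
have [B3 B30 H3] := drift_bound; have ab := ab_gt0 l; set r := a l / b in ab *.
have Hs s : exists B2, eventually_n (fun n => 0 < Cinf None s -> `|act h (C n) (C n.+1) None s| <= B2).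
  have [c0|c0] := ltP 0 (Cinf None s).
    by have [B2 H2] := act_low c0; exists B2; apply: eventually_imp H2.
  by exists 0; exists 0%N => n _ c0'; exfalso; lra.
have /choice[B2 H2] := Hs.
pose B := 2 / 3 + B3 + r * \sum_s `|B2 s|.
have s0 : 0 <= \sum_s `|B2 s| by apply: sumr_ge0.
exists B; split.
  apply: eventually_imp H3 => n h3 i gr; rewrite nuE -/r.
  have /ler_normlP[f1 _] := h3 l i.
  have : - (2 / 3) <= h (C n (Some l) i / C n.+1 (Some l) i).
    by apply: (ie_low hH); rewrite ratio_gt0 ler_pdivrMr ?mul1r ?(ev_pos HE).
  have : 0 <= r * \sum_s `|B2 s| by rewrite mulr_ge0 // ltW.
  rewrite /B /(act _ _ _ (Some l)); move: f1; lra.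
apply: eventually_imp (eventually_and H3 (eventually_all H2)) => n [h3 h2] s cs; rewrite nuE -/r.
have /ler_normlP[_ f1] := h3 l s; have /ler_normlP[g1 _] := h2 s cs.
have g2 : - act h (C n) (C n.+1) None s <= \sum_s `|B2 s|.
  apply: le_trans g1 _; apply: le_trans (ler_norm _) _; rewrite (bigD1 s) //= lerDl; exact: sumr_ge0.
have g3 : r * - act h (C n) (C n.+1) None s <= r * \sum_s `|B2 s| by rewrite ler_pM2l.
have := act_up n (Some l) s; move: f1 g3; rewrite /B mulrN; lra.
Qed.

(** Otherwise the potential difference tends to infinity by [gap_infty].  If the ion stays in [o],
    this contradicts [flux_gap]; if it disappears there, it contradicts [no_depletion]. *)
Lemma neighbours_positive l p o : 0 < tau p o -> 0 < Cinf (Some l) p -> 0 < Cinf None o ->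
  0 < Cinf (Some l) o /\ 0 < Cinf None p.
Proof.
move=> t0 cp co; apply: contrapT => H.
(* one of the two limits vanishes *)
have alt : Cinf None p = 0 \/ Cinf (Some l) o = 0.
  apply: contrapT => H'; apply: H; split; rewrite lt_neqAle Cinf_ge0 andbT eq_sym; apply/eqP => h'; apply: H'; [by right | by left].
have gap := gap_infty cp co alt.
have [clo|clo] := ltP 0 (Cinf (Some l) o).
  have [n0 Hn] := eventually_and (flux_gap t0 cp clo ltr01) (gap 2).
  have [/ler_normlP[h1 h2] h3] := Hn n0 (leqnn _); lra.
have {clo}clo : Cinf (Some l) o = 0 by apply/eqP; rewrite eq_le clo Cinf_ge0.
have [dl dl0 Hdl] := u_low cp.
have [B [HB1 HB2]] := grow_bound l.
have ab := ab_gt0 l; set r := a l / b in ab HB1.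
pose L := ln cmax + 3 / 8.
have upL n o' i : act h (C n) (C n.+1) o' i <= L by apply: le_trans (act_up _ _ _) _; rewrite lerD2r cmax_ln.
have [vm vm0 Hvm] : small (fun t => forall i, t * (\sum_i v i) <= v i / 2).
  apply: small_all => i; have hv : 0 < v i / 2 by rewrite divr_gt0.
  have [t t1 Ht] := small_le (\sum_i v i) hv; exists t => // t' h1' h2'; rewrite mulrC; exact: Ht.
pose Fr := [set i | 0 < Cinf None i].
have oF : o \in Fr by rewrite inE.
have crowd i : i \notin Fr -> Cinf None i = 0.
  by rewrite inE -leNgt => h'; apply/eqP; rewrite eq_le h' Cinf_ge0.
apply: (@no_depletion R N v (fun n => C n (Some l)) (fun n => u n l) (fun n => nu n l) (fun n => fluxK n l) v0 _ _ _ _ Fr o p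
   (expR (2 * B + r * L)) vm (g l * tau p o) dl oF) => //.
- by move=> n i; exact: (ev_pos HE).
- by move=> n i j; exact: fluxK_ge0.
- by move=> n i j; exact: fluxKC.
- by move=> n i; rewrite (ev_step HE).
- by rewrite mulr_gt0.
- exact: ltW.
- by move=> i; apply: Hvm.
- apply: eventually_imp (eventually_and HB1 HB2) => n [h1 h2] i s sF gr le.
  rewrite inE in sF; have := h1 i gr; have := h2 s sF => h3 h4.
  apply: ln_le_exp; rewrite ?(ev_pos HE) //.
  have : r * act h (C n) (C n.+1) None i <= r * L by rewrite ler_pM2l.
  move: h3 h4 le; lra.
- have Hc : eventually_n (fun n => forall i, i \notin Fr -> act h (C n) (C n.+1) None i <= (ln vm - 2 * B) / r).
    apply: eventually_all => i; have [iF|iF] := boolP (i \in Fr); first by exists 0%N.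
    by apply: eventually_imp (act_infty (- ((ln vm - 2 * B) / r)) (crowd i iF)) => n; rewrite opprK.
  apply: eventually_imp (eventually_and Hc (eventually_and HB1 HB2)) => n [hc [h1 h2]] i s iF sF gr le.
  rewrite inE in sF; have := h1 i gr; have := h2 s sF => h3 h4.
  rewrite -[vm]lnK ?posrE //; apply: ln_le_exp; rewrite ?(ev_pos HE) //.
  have : r * act h (C n) (C n.+1) None i <= r * ((ln vm - 2 * B) / r) by rewrite ler_pM2l // hc.
  rewrite [r * (_ / r)]mulrC divfK ?gt_eqF //.
  move: h3 h4 le; lra.
- by move=> n; rewrite /fluxK ler_pM2l ?mulr_gt0 //; exact: (ev_low HE).
- move=> eta eta0; have := @cvg_Cinf (Some l) o; rewrite clo => cv.
  by apply: eventually_imp (cvg_eventually cv eta0) => n; rewrite subr0 gtr0_norm ?(ev_pos HE).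
- by move=> n; exact: (ev_u_incr HE).
- by move=> n; exact: (ev_u_small HE).
Qed.

(** Where the solvent disappears some ion remains, by the volume constraint.  Apply
    [neighbours_positive] to an edge between a cell with and a cell without solvent. *)
Lemma solvent_positive i : 0 < Cinf None i.
Proof.
pose A := [set i | 0 < Cinf None i].
suff /eqP AT : A == finset.setT by have := finset.in_setT i; rewrite -AT inE.
apply/negPn/negP => AT.
have [|q [p [oA pA t]]] := conn _ AT.
  by have [j cj] := Cinf_somewhere None; apply/finset.set0Pn; exists j; rewrite inE.
rewrite inE in oA; move: pA; rewrite inE => pA.
have pz : Cinf None p = 0 by apply/eqP; rewrite eq_le Cinf_ge0 leNgt pA.
have [l cl] : exists l, 0 < Cinf (Some l) p.
  apply: contrapT => H; have := Cinf_vol p; rewrite pz mulr0 addr0 big1 => [/eqP|l _]; first by rewrite eq_sym oner_eq0.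
  have := Cinf_ge0 (Some l) p; rewrite le_eqVlt => /predU1P[<-|h']; first by rewrite mulr0.
  by case: H; exists l.
by have [|_] := neighbours_positive _ cl oA; [rewrite tauC | rewrite (negbTE pA)].
Qed.

Lemma Cinf_positive o i : 0 < Cinf o i.
Proof.
case: o => [l|]; last exact: solvent_positive.
pose A := [set i | 0 < Cinf (Some l) i].
suff /eqP AT : A == finset.setT by have := finset.in_setT i; rewrite -AT inE.
apply/negPn/negP => AT.
have [|p [q [pA oA t]]] := conn _ AT.
  by have [j cj] := Cinf_somewhere (Some l); apply/finset.set0Pn; exists j; rewrite inE.
rewrite inE in pA; move: oA; rewrite inE => /negP[].
by have [] := neighbours_positive t pA (solvent_positive q).
Qed.

Definition potential (Cs : conc) (ps : 'I_N -> R) l i : R :=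
  ln (Cs (Some l) i) - a l / b * ln (Cs None i) + z l * ps i + e0 l i.

Lemma Cinf_potential l i j : potential Cinf psinf l i = potential Cinf psinf l j.
Proof.
have cv k : (nu n l k @[n --> \oo] --> potential Cinf psinf l k)%classic.
  under eq_fun do rewrite nuE; rewrite /potential -addrA; apply: cvgD; last exact: cvg_drift.
  apply: cvgB; first by apply: act_cvg; exact: Cinf_positive.
  by apply: cvgMr; apply: act_cvg; exact: Cinf_positive.
have edge k k' : 0 < tau k k' -> potential Cinf psinf l k' = potential Cinf psinf l k.
  move=> t; apply/eqP; rewrite -subr_eq0; apply/eqP.
  apply: (cvgR_unique (s := fun n => nu n l k' - nu n l k)); first exact: cvgB.
  apply: eventually_cvg => eta eta0; apply: eventually_imp (flux_gap (l := l) t (Cinf_positive _ _) (Cinf_positive _ _) eta0) => n.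
  by rewrite subr0.
pose A := [set k | potential Cinf psinf l k == potential Cinf psinf l j].
suff /eqP AT : A == finset.setT by have := finset.in_setT i; rewrite -AT inE => /eqP.
apply/negPn/negP => AT.
have [|p [q [pA oA t]]] := conn _ AT; first by apply/finset.set0Pn; exists j; rewrite inE.
by move: pA oA; rewrite !inE (edge _ _ t) => ->.
Qed.

End Potential.
End Run.
Section Uniqueness.
Implicit Types (Cs : conc) (ps : 'I_N -> R).

(** The Poisson-Boltzmann system, without the constraint on the total amounts. *)
Record equilibrium Cs ps : Prop := Equilibrium {
  eq_pos : forall o i, 0 < Cs o i;
  eq_vol : forall i, \sum_l a l * Cs (Some l) i + b * Cs None i = 1;
  eq_poisson : forall i, lap ps i = v i * (\sum_l z l * Cs (Some l) i) + f i;
  eq_const : forall l i j, potential Cs ps l i = potential Cs ps l j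
}.

Lemma ln_mono (s t : R) : 0 < s -> 0 < t -> 0 <= (ln s - ln t) * (s - t) ?= iff (s == t).
Proof.
move=> s0 t0; split; last first.
  by apply/idP/eqP => [|->]; rewrite ?subrr ?mul0r // eq_sym mulf_eq0 !subr_eq0 => /orP[/eqP/ln_inj->|/eqP]; rewrite ?posrE.
have [h|h] := leP s t.
  by rewrite mulr_le0 // subr_le0 // ler_ln ?posrE.
by rewrite mulr_ge0 // subr_ge0 ?ler_ln ?posrE // ltW.
Qed.

(** Test the difference of the potentials, which is constant for each ion, with the difference of
    the concentrations, whose total amounts agree.  The result is 0, and it is a sum of nonnegative
    terms: the monotonicity of [ln] for each species and the electric energy of the difference. *)
Lemma equilibrium_unique C1 p1 C2 p2 : equilibrium C1 p1 -> equilibrium C2 p2 ->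
  (forall l, \sum_i v i * C1 (Some l) i = \sum_i v i * C2 (Some l) i) ->
  (forall o i, C1 o i = C2 o i) /\ (forall i, p1 i = p2 i).
Proof.
move=> E1 E2 am.
pose X o i := (ln (C1 o i) - ln (C2 o i)) * (C1 o i - C2 o i).
have X0 o i : 0 <= X o i by apply: (ln_mono (eq_pos E1 o i) (eq_pos E2 o i)).1.
pose dp i := p1 i - p2 i.
have lapd i : lap dp i = v i * \sum_l z l * (C1 (Some l) i - C2 (Some l) i).
  rewrite /dp lapB (eq_poisson E1) (eq_poisson E2); under [in RHS]eq_bigr do rewrite mulrBr.
  by rewrite sumrB; ring.
have dS i : C1 None i - C2 None i = - \sum_l a l / b * (C1 (Some l) i - C2 (Some l) i).
  have bn : b != 0 by exact: lt0r_neq0.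
  apply: (mulfI bn); rewrite mulrN mulr_sumr.
  have -> : \sum_l b * (a l / b * (C1 (Some l) i - C2 (Some l) i)) =
     \sum_l a l * C1 (Some l) i - \sum_l a l * C2 (Some l) i.
    by rewrite -sumrB; apply: eq_bigr => l _; field.
  have := eq_vol E1 i; have := eq_vol E2 i; lra.
have bal : \sum_l \sum_i (potential C1 p1 l i - potential C2 p2 l i) * (v i * (C1 (Some l) i - C2 (Some l) i)) =
   \sum_i v i * (\sum_o X o i) + \sum_i lap dp i * dp i.
  rewrite exchange_big -big_split /=; apply: eq_bigr => i _.
  rewrite sum_option lapd {1}/X dS mulrDr -addrA mulrN mulrN !mulr_sumr -sumrN mulr_suml -!big_split /=.
  by apply: eq_bigr => l _; rewrite /X /potential /dp; ring.
have bal0 : \sum_l \sum_i (potential C1 p1 l i - potential C2 p2 l i) * (v i * (C1 (Some l) i - C2 (Some l) i)) = 0.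
  apply: big1 => l _; have [i0 _] := dpos.
  transitivity (\sum_i (potential C1 p1 l i0 - potential C2 p2 l i0) * (v i * (C1 (Some l) i - C2 (Some l) i))).
    by apply: eq_bigr => i _; rewrite (eq_const E1 l i i0) (eq_const E2 l i i0).
  rewrite -mulr_sumr; under eq_bigr do rewrite mulrBr.
  by rewrite sumrB am subrr mulr0.
have L0 := lap_ge0 wC w0 d0 dp.
have S0 i : 0 <= v i * \sum_o X o i by rewrite mulr_ge0 ?(ltW (v0 i)) // sumr_ge0.
have z0 : \sum_i v i * (\sum_o X o i) = 0.
  by apply/eqP; rewrite eq_le sumr_ge0 // andbT; move: bal; rewrite bal0; move: L0; lra.
have CE o i : C1 o i = C2 o i.
  move/eqP: z0; rewrite psumr_eq0 // => /allP /(_ i); rewrite mem_index_enum => /(_ isT) /=.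
  rewrite mulf_eq0 gt_eqF //= psumr_eq0 // => /allP /(_ o); rewrite mem_index_enum => /(_ isT) /=.
  by rewrite eq_sym (ln_mono (eq_pos E1 o i) (eq_pos E2 o i)).2 => /eqP.
split=> // i; apply/eqP; rewrite -subr_eq0; apply/eqP.
apply: (@lap_eq0 _ _ w d wC w0 d0 conn_w dpos (fun k => p1 k - p2 k)) => j; rewrite -/(dp).
by rewrite lapd big1 ?mulr0 // => l _; rewrite CE subrr mulr0.
Qed.

End Uniqueness.

Theorem evolution_cvg h alpha (C : nat -> conc) psi u m : implicit_entropy h -> 2^-1 <= alpha <= 1 ->
  evolution h alpha C psi u m ->
  exists (Cs : conc) (ps : 'I_N -> R), [/\ equilibrium Cs ps,
    forall o, \sum_i v i * Cs o i = \sum_i v i * C 0%N o i,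
    forall o i, (C n o i @[n --> \oo] --> Cs o i)%classic & forall i, (psi n i @[n --> \oo] --> ps i)%classic].
Proof.
move=> hH al HE; have [Bm HBm] := lap_inverse wC w0 d0 conn_w dpos.
exists (Cinf C), (psinf C Bm); split.
- split.
  + exact: (Cinf_positive hH al HE HBm).
  + exact: (Cinf_vol hH al HE HBm).
  + exact: (Cinf_poisson hH al HE HBm).
  + exact: (Cinf_potential hH al HE HBm).
- exact: (Cinf_amount hH al HE HBm).
- exact: (cvg_Cinf hH al HE HBm).
- exact: (cvg_psinf hH al HE HBm).
Qed.

End Model.

(** * Lower bounds on the mobilities *)

Section Extrapolation.
Variables (R : realType).
Implicit Types (p q r s t x y : R).

(** The limited slope has the sign of the first argument and does not exceed it. *)
Lemma minmod_pos p q r : 0 <= p -> 0 <= minmod p q r <= p.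
Proof.
move=> p0; rewrite /minmod; case: ifP => [/andP[/eqP e1 _]|_]; last by rewrite lexx.
move: p0; rewrite le_eqVlt => /predU1P[<-|p0]; first by rewrite sgr0 mul0r lexx.
rewrite gtr0_sg // mul1r ge_min (gtr0_norm p0) lexx andbT.
by rewrite !le_min !normr_ge0 ltW.
Qed.

Lemma minmod_neg p q r : p <= 0 -> p <= minmod p q r <= 0.
Proof.
move=> p0; rewrite /minmod; case: ifP => [/andP[/eqP e1 _]|_]; last by rewrite lexx p0.
move: p0; rewrite le_eqVlt => /predU1P[->|p0]; first by rewrite sgr0 mul0r lexx.
rewrite ltr0_sg // mulN1r lerNr oppr_le0 ge_min (ltr0_norm p0) lexx /=.
by rewrite !le_min !normr_ge0 oppr_ge0 ltW.
Qed.
(** The extrapolation of a single nodal value. *)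
Definition hat1 (p c : R) : R := if 3 * c > p then (3 * c - p) / 2 else c `^ (3 / 2) / p `^ (1 / 2).

Lemma hat_gt0 p c : 0 < p -> 0 < c -> 0 < hat1 p c.
Proof.
move=> p0 c0; rewrite /hat1; case: ifP => h.
  by rewrite divr_gt0 // subr_gt0.
by rewrite divr_gt0 // powR_gt0.
Qed.

Lemma hat_incr p c : 0 < p -> p <= c -> c <= hat1 p c.
Proof. move=> p0 pc; rewrite /hat1 ifT; lra. Qed.

(** In the first branch this is linear; the second branch itself requires [3 * c <= p]. *)
Lemma hat_small p c : 0 < p -> 0 < c -> hat1 p c <= c / 4 -> c <= 2 / 5 * p.
Proof. by move=> p0 c0; rewrite /hat1; case: ifP => [_|/negbT]; [lra | rewrite -leNgt; lra]. Qed.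

End Extrapolation.

Section Mobility.
Variables (R : realType) (d N : nat) (G : mesh R d N) (K : recon R N).
Hypothesis HK : admissible_recon G K.
Implicit Types (u mu : 'I_N -> R).

(** The limiter bounds the increment by [beta / 2] times [u j - u i], and [beta / 2] is at most 1, so
    the reconstructed value stays between [u i] and [u j]. *)
Lemma reconstruct_ge u i j : 0 < eudist (vtx G i) (vtx G j) -> Num.min (u i) (u j) <= reconstruct G K u i j.
Proof.
move=> D0; have [/andP[b1 b2] _ _] := HK.
rewrite /reconstruct; set s := splus _ _ _ _; set D := eudist _ _ in D0 *.
have sE : D * s = u j - u i by rewrite /s /splus -/D mulrC divfK // gt_eqF.
have [uu|uu] := leP (u i) (u j).
  have s0 : 0 <= s by rewrite /s /splus divr_ge0 ?subr_ge0 // ltW.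
  have p0 : 0 <= beta K * s by rewrite mulr_ge0 // (le_trans ler01).
  have /andP[m0 _] := minmod_pos (beta K * sminus G K u i j) ((s + sminus G K u i j) / 2) p0.
  by rewrite lerDl mulr_ge0 // divr_ge0 // ltW.
have s0 : s <= 0 by rewrite /s /splus pmulr_lle0 ?invr_gt0 // subr_le0 ltW.
have p0 : beta K * s <= 0 by rewrite mulr_ge0_le0 // (le_trans ler01).
have /andP[m0 _] := minmod_neg (beta K * sminus G K u i j) ((s + sminus G K u i j) / 2) p0.
have h : D / 2 * (beta K * s) <= D / 2 * minmod (beta K * s) (beta K * sminus G K u i j) ((s + sminus G K u i j) / 2).
  by rewrite ler_pM2l ?divr_gt0.
have e : D / 2 * (beta K * s) = beta K / 2 * (u j - u i) by rewrite -sE; ring.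
have : (2 - beta K) * (u j - u i) <= 0 by apply: mulr_ge0_le0; [rewrite subr_ge0 | rewrite subr_le0 ltW].
rewrite e in h; move: h; set X := D / 2 * minmod _ _ _; lra.
Qed.

Hypothesis vtx_dist : forall i j, i != j -> 0 < eudist (vtx G i) (vtx G j).

Lemma mobility_ge u mu i j : i != j -> Num.min (u i) (u j) <= mobility G K u mu i j.
Proof.
move=> ij; have ji : j != i by rewrite eq_sym.
rewrite /mobility /mobility_ord; case: ifP => _; case: ifP => _;
  first [exact: reconstruct_ge (vtx_dist ij) | rewrite minC; exact: reconstruct_ge (vtx_dist ji)].
Qed.

Lemma mobility_sym u mu i j : i != j -> mobility G K u mu i j = mobility G K u mu j i.
Proof.
move=> ij; have [_ _ /(_ i j ij) o] := HK.
by rewrite /mobility o; case: (oriented K j i).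
Qed.

End Mobility.

(** * The two schemes as implicit evolutions *)

(** All that the convergence proof uses from the mesh. *)
Record mesh_geometry (R : realType) (d N : nat) (G : mesh R d N) : Prop := MeshGeometry {
  mg_vol : forall i, 0 < mV G i;
  mg_dist : forall i j, i != j -> 0 < eudist (vtx G i) (vtx G j);
  mg_sym : forall i j, tauI G i j = tauI G j i;
  mg_tauI : forall i j, 0 <= tauI G i j;
  mg_tauD : forall i, 0 <= tauD G i;
  mg_conn : forall A : {set 'I_N}, A != finset.set0 -> A != finset.setT ->
    exists i j, [/\ i \in A, j \notin A & 0 < tauI G i j];
  mg_dirichlet : exists i, 0 < tauD G i
}.

Section Bridge.
Variables (R : realType) (d N M : nat) (G : mesh R d N) (P : model R d N M) (K : recon R N).
Hypotheses (HG : mesh_geometry G) (HK : admissible_recon G K) (HP : admissible_model P).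
Local Notation conc := ('I_M -> 'I_N -> R).
Local Notation pot := ('I_N -> R).
Implicit Types (c : conc) (psi u mu : pot).

Definition ia l : R := ionsize P l ^+ 3.
Definition sb : R := solsize P ^+ 3.
(** The constants of the chemical potential once the logarithms are taken of the concentrations
    themselves instead of the volume fractions. *)
Definition ref_pot l i : R := ln (ia l) - ia l / sb * ln sb + born P l i.
Definition step_mob l : R := dt P * gamma P l.
Definition cond i j : R := kappa P * tauI G i j * epsI P i j.
Definition cond_bd i : R := kappa P * tauD G i * epsD P i.
Definition source i : R := mV G i * vol_avg (voronoi G i) (rhof P) +
  kappa P * (tauD G i * epsD P i * surf_avg (sigmaD G i) (psiD P) + tauN G i * epsN P i * DpsiN G P i).

(** The ions together with the solvent, whose index is [None]. *)
Definition full c (o : option 'I_M) i : R := if o is Some l then c l i else sb^-1 * solvent P c i.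

Lemma ia_gt0 l : 0 < ia l.
Proof. by have [[h _ _ _ _] _ _ _] := HP; rewrite exprn_gt0. Qed.

Lemma sb_gt0 : 0 < sb.
Proof. by have [[_ h _ _ _] _ _ _] := HP; rewrite exprn_gt0. Qed.

Lemma step_mob_gt0 l : 0 < step_mob l.
Proof. by have [[_ _ h _ _] h' _ _] := HP; rewrite mulr_gt0. Qed.

Lemma kappa_gt0 : 0 < kappa P.
Proof. by have [[]]  := HP. Qed.

Lemma eps_gt0 : (forall i j, 0 < epsI P i j) /\ (forall i, 0 < epsD P i).
Proof.
have [_ _ [emin [emax [e0 [_ h1 h2 _]]]] _] := HP.
by split=> [i j|i]; [have /andP[h _] := h1 i j | have /andP[h _] := h2 i]; exact: lt_le_trans h.
Qed.

Lemma condC i j : cond i j = cond j i.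
Proof. by have [_ _ _ h] := HP; rewrite /cond (mg_sym HG) h. Qed.

Lemma cond_ge0 i j : 0 <= cond i j.
Proof. by have [e _] := eps_gt0; exact: mulr_ge0 (mulr_ge0 (ltW kappa_gt0) (mg_tauI HG i j)) (ltW (e i j)). Qed.

Lemma cond_bd_ge0 i : 0 <= cond_bd i.
Proof. by have [_ e] := eps_gt0; exact: mulr_ge0 (mulr_ge0 (ltW kappa_gt0) (mg_tauD HG i)) (ltW (e i)). Qed.

Lemma cond_gt0 i j : 0 < tauI G i j -> 0 < cond i j.
Proof. by have [e _] := eps_gt0; move=> t; exact: mulr_gt0 (mulr_gt0 kappa_gt0 t) (e i j). Qed.

Lemma cond_bd_pos : exists i, 0 < cond_bd i.
Proof.
by have [_ e] := eps_gt0; have [i t] := mg_dirichlet HG; exists i; exact: mulr_gt0 (mulr_gt0 kappa_gt0 t) (e i).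
Qed.

Lemma full_vol c i : \sum_l ia l * full c (Some l) i + sb * full c None i = 1.
Proof. by rewrite /= mulrA divff ?gt_eqF ?sb_gt0 // mul1r /solvent addrC subrK. Qed.

Lemma full_pos c : positive_conc P c -> forall o i, 0 < full c o i.
Proof. by move=> [h1 h2] [l|] i; [exact: h1 | exact: h2]. Qed.

Lemma solvent_gt0 c i : positive_conc P c -> 0 < solvent P c i.
Proof. by move=> [_ /(_ i)]; rewrite pmulr_rgt0 // invr_gt0 sb_gt0. Qed.

Lemma poisson_lap c psi : poisson G P c psi <->
  forall i, lap cond cond_bd psi i = mV G i * (\sum_l valence P l * c l i) + source i.
Proof.
have e i : lap cond cond_bd psi i - source i = - kappa P * (\sum_(j | j != i) tauI G i j * epsI P i j * (psi j - psi i)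
                 + tauD G i * epsD P i * DpsiD G P psi i
                 + tauN G i * epsN P i * DpsiN G P i) - mV G i * vol_avg (voronoi G i) (rhof P).
  rewrite /lap (bigD1 i) //= subrr mulr0 add0r.
  have -> : \sum_(j | j != i) cond i j * (psi i - psi j) = - kappa P * \sum_(j | j != i) tauI G i j * epsI P i j * (psi j - psi i).
    by rewrite mulr_sumr; apply: eq_bigr => j _; rewrite /cond; ring.
  by rewrite /source /cond_bd /DpsiD; ring.
split=> H i; have := e i; have := H i.
  by move=> -> h; rewrite -[LHS](subrK (source i)) h; ring.
by move=> -> h; rewrite -[LHS](subrK (mV G i * vol_avg (voronoi G i) (rhof P))) -h; ring.
Qed.

(** The value on the diagonal only makes [ev_low] hold there: the diagonal terms of the flux vanish. *)
Definition mob u mu i j : R := if i == j then u i else mobility G K u mu i j.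

Lemma mobC u mu i j : mob u mu i j = mob u mu j i.
Proof. by rewrite /mob eq_sym; case: eqVneq => [->//|ij]; apply: (mobility_sym HK); rewrite eq_sym. Qed.

Lemma mob_low u mu i j : Num.min (u i) (u j) <= mob u mu i j.
Proof.
rewrite /mob; case: eqVneq => [->|ij]; first by rewrite minxx.
exact: mobility_ge HK (mg_dist HG) _ _ _ _ ij.
Qed.

Lemma sum_without_diag (T m m' : 'I_N -> 'I_N -> R) (nu : pot) g i : (forall j, j != i -> m' i j = m i j) ->
  g * \sum_(j | j != i) T i j * m i j * (nu j - nu i) = \sum_j g * T i j * m' i j * (nu j - nu i).
Proof.
move=> e; rewrite [RHS](bigD1 i) //= subrr mulr0 add0r mulr_sumr; apply: eq_bigr => j /e ->.
by ring.
Qed.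

Lemma transport_flux l (cl cl' : pot) u mu nu : transport_step G P K l cl cl' u mu nu ->
  forall i, mV G i * (cl' i - cl i) = \sum_j step_mob l * tauI G i j * mob u mu i j * (nu j - nu i).
Proof.
move=> H i; have [_ dt0 _ _] := HP.
have -> : mV G i * (cl' i - cl i) = dt P * (mV G i * ((cl' i - cl i) / dt P)) by field; rewrite gt_eqF.
rewrite (H i) [LHS]mulrA -/(step_mob l); apply: sum_without_diag => j ji.
by rewrite /mob eq_sym (negbTE ji).
Qed.

Lemma transport_amount l (cl cl' : pot) u mu nu : transport_step G P K l cl cl' u mu nu ->
  \sum_i mV G i * cl' i = \sum_i mV G i * cl i.
Proof.
move=> H; apply/eqP; rewrite -subr_eq0 -sumrB; apply/eqP.
under eq_bigr do rewrite -mulrBr (transport_flux H).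
set S := \sum_i _; suff : S = - S by lra.
rewrite {1}/S exchange_big /= -sumrN; apply: eq_bigr => i _; rewrite -sumrN; apply: eq_bigr => j _.
by rewrite mobC (mg_sym HG); ring.
Qed.

Local Notation evolution h alpha := (evolution (mV G) (tauI G) ia sb (valence P) ref_pot step_mob cond cond_bd source h alpha).
Local Notation drive := (drive ia sb (valence P) ref_pot).

Lemma ln_solvent c i : positive_conc P c -> ln (full c None i) = ln (solvent P c i) - ln sb.
Proof. by move=> hc; rewrite /= lnM ?posrE ?invr_gt0 ?sb_gt0 ?solvent_gt0 // lnV ?posrE ?sb_gt0 // addrC. Qed.

Lemma ln_ion c l i : positive_conc P c -> ln (ionsize P l ^+ 3 * c l i) = ln (ia l) + ln (c l i).
Proof. by move=> [hc _]; rewrite lnM ?posrE ?ia_gt0. Qed.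

Lemma chem_pot_potential c psi l i : positive_conc P c ->
  chem_pot P c psi l i = potential ia sb (valence P) ref_pot (full c) psi l i.
Proof.
move=> hc; rewrite /chem_pot /potential ln_solvent // ln_ion // /ref_pot -/(ia l) -/sb /=; ring.
Qed.

Lemma drive1 c c' psi psi' l i : positive_conc P c' ->
  chem_pot P c' psi' l i = drive (@corr1 R) (full c) (full c') (blend 1 psi psi') l i.
Proof.
by move=> hc; rewrite chem_pot_potential // /potential /drive /act /corr1 /blend; ring.
Qed.

Lemma drive2 c c' psi psi' l i : positive_conc P c -> positive_conc P c' ->
  mu_half P c c' psi psi' l i = drive (@corr2 R) (full c) (full c') (blend 2^-1 psi psi') l i.
Proof.
move=> hc hc'; have s0 := solvent_gt0 i hc; have s0' := solvent_gt0 i hc'.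
have [/(_ l i) k0 _] := hc; have [/(_ l i) k0' _] := hc'.
rewrite /mu_half /mu_e1 /mu_e2 /drive /act ln_solvent // ln_ion // -!/(ia l) -!/sb /ref_pot /blend /=.
have -> : \sum_(k < M) ionsize P k ^+ 3 * (c' k i - c k i) = solvent P c i - solvent P c' i.
  rewrite /solvent; under eq_bigr do rewrite mulrBr.
  by rewrite sumrB; ring.
have -> : sb^-1 * solvent P c i / (sb^-1 * solvent P c' i) = solvent P c i / solvent P c' i.
  by field; rewrite !gt_eqF // sb_gt0.
by rewrite /corr2; field; rewrite !gt_eqF // sb_gt0.
Qed.

Lemma evolution1 (c : nat -> conc) (psi : nat -> pot) : solutionI G P K c psi ->
  evolution (@corr1 R) 1 (fun n => full (c n)) psi c (fun n l => mob (c n l) (chem_pot P (c n) (psi n) l)).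
Proof.
move=> [hp hpo hs]; split.
- by move=> n; apply: full_pos.
- by move=> n i; apply: full_vol.
- by move=> n; apply/poisson_lap; apply: hpo.
- move=> n l i; rewrite -(drive1 (c n) (psi n) (psi n.+1) l i (hp n.+1)).
  rewrite (transport_flux (hs n l)); apply: eq_bigr => j _.
  by rewrite -(drive1 (c n) (psi n) (psi n.+1) l j (hp n.+1)).
- by move=> n l i j; apply: mobC.
- by move=> n l i j; apply: mob_low.
- by move=> n l i; have [h _] := hp n; apply: h.
- by move=> n l i _; apply: lexx.
- move=> n l i /= h; have [/(_ l i) h' _] := hp n.+1; exfalso; lra.
Qed.

(** The sequence starts at step 1, because the array prescribed at step -1 is arbitrary and so the
    extrapolated values used at step 0 are not controlled. *)
Lemma evolution2 cm1 (c : nat -> conc) (psi : nat -> pot) : solutionII G P K cm1 c psi ->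
  evolution (@corr2 R) 2^-1 (fun n => full (c n.+1)) (fun n => psi n.+1) (fun n => c_hat (c n) (c n.+1))
    (fun n l => mob (c_hat (c n) (c n.+1) l) (chem_pot P (c n.+1) (psi n.+1) l)).
Proof.
move=> [hp hpo hs].
have c0 n l i : 0 < c n l i by have [] := hp n.
split.
- by move=> n; apply: full_pos.
- by move=> n i; apply: full_vol.
- by move=> n; apply/poisson_lap; apply: hpo.
- move=> n l i; rewrite -(drive2 (psi n.+1) (psi n.+2) l i (hp n.+1) (hp n.+2)).
  rewrite (transport_flux (hs n.+1 l)); apply: eq_bigr => j _.
  by rewrite -(drive2 (psi n.+1) (psi n.+2) l j (hp n.+1) (hp n.+2)).
- by move=> n l i j; apply: mobC.
- by move=> n l i j; apply: mob_low.
- by move=> n l i; apply: hat_gt0; apply: c0.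
- by move=> n l i; apply: hat_incr; apply: c0.
- by move=> n l i; apply: hat_small; apply: c0.
Qed.

Lemma steady_state_limit h alpha (c0 : conc) (C : nat -> conc) (psi : nat -> pot) (u : nat -> conc) m : implicit_entropy h -> 2^-1 <= alpha <= 1 ->
  evolution h alpha (fun n => full (C n)) psi u m ->
  (forall l, \sum_i mV G i * C 0%N l i = \sum_i mV G i * c0 l i) ->
  exists s, [/\ unique (poisson_boltzmann G P c0) s,
    forall l i, (C n l i @[n --> \oo] --> s.1 l i)%classic & forall i, (psi n i @[n --> \oo] --> s.2 i)%classic].
Proof.
move=> hh al HE am.
have [Cs [ps [Heq Ham HC Hpsi]]] := evolution_cvg (mg_vol HG) (mg_sym HG) (mg_tauI HG) ia_gt0 sb_gt0 step_mob_gt0 condC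
  cond_ge0 cond_bd_ge0 cond_gt0 (mg_conn HG) cond_bd_pos hh al HE.
pose cs : conc := fun l => Cs (Some l).
have fE : full cs = Cs.
  apply/funext => -[l|]; apply/funext => i //=; have b0 := sb_gt0.
  have e : solvent P cs i = sb * Cs None i by rewrite /solvent -(eq_vol Heq i) addrC addKr.
  by rewrite e mulKf // gt_eqF.
have pcs : positive_conc P cs.
  by split=> [l i|i]; [exact: (eq_pos Heq) | have := eq_pos Heq None i; rewrite -fE].
exists (cs, ps); split=> //=; last by move=> l i; exact: HC.
split=> [|[c' psi'] [/= pc po [mu Hmu] mass]].
  split=> //=.
  - by apply/poisson_lap => i; rewrite (eq_poisson Heq).
  - have [i0 _] := mg_dirichlet HG; exists (fun l => chem_pot P cs ps l i0) => l i.
    by rewrite !chem_pot_potential // fE; exact: (eq_const Heq).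
  - by move=> l; rewrite -am; have := Ham (Some l).
have Heq' : equilibrium (mV G) ia sb (valence P) ref_pot cond cond_bd source (full c') psi'.
  split.
  - exact: full_pos.
  - exact: full_vol.
  - exact/poisson_lap.
  - by move=> l i j; rewrite -!chem_pot_potential // -!Hmu.
have [|E1 E2] := equilibrium_unique (mg_vol HG) sb_gt0 condC cond_ge0 cond_bd_ge0 cond_gt0 (mg_conn HG) cond_bd_pos Heq Heq'.
  by move=> l /=; rewrite mass -am; have := Ham (Some l).
congr pair; last by apply/funext => i.
by apply/funext => l; apply/funext => i; have := E1 (Some l) i.
Qed.

Lemma convergenceI (c : nat -> conc) (psi : nat -> pot) : solutionI G P K c psi -> converges_to_steady_state G P c psi.
Proof.
move=> H; have al : 2^-1 <= (1 : R) <= 1 by lra.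
exact: (steady_state_limit (@implicit_entropy1 R) al (evolution1 H)).
Qed.

Lemma convergenceII cm1 (c : nat -> conc) (psi : nat -> pot) : solutionII G P K cm1 c psi -> converges_to_steady_state G P c psi.
Proof.
move=> H; have al : 2^-1 <= (2^-1 : R) <= 1 by lra.
have [|s [hs hc hpsi]] := steady_state_limit (c0 := c 0%N) (@implicit_entropy2 R) al (evolution2 H).
  by have [_ _ hs] := H; move=> l; exact: (transport_amount (hs 0%N l)).
exists s; split=> [//|l i|i].
- by rewrite -(cvg_shiftS (fun n => c n l i)); exact: hc.
- by rewrite -(cvg_shiftS (fun n => psi n i)); exact: hpsi.
Qed.

End Bridge.

(** * Voronoi cells *)

Local Open Scope classical_set_scope.
Local Open Scope ring_scope.

Lemma cvg_sumRf (R : realType) (T : Type) (F : set_system T) (FF : Filter F) (I : finType) (f : I -> T -> R) (L : I -> R) :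
  (forall i, f i t @[t --> F] --> L i) -> \sum_i f i t @[t --> F] --> \sum_i L i.
Proof. by move=> H; apply: cvg_big => //; exact: add_continuous. Qed.

Section Euclid.
Variables (R : realType) (d : nat).
Local Notation E := 'rV[R]_d.
Implicit Types (x y z u v : E) (A B : set E).

Lemma eudot_ge0 u : 0 <= eudot u u.
Proof. by apply: sumr_ge0 => k _; rewrite -expr2 sqr_ge0. Qed.

Lemma eudot_gt0 u : u != 0 -> 0 < eudot u u.
Proof.
move=> u0; rewrite lt_neqAle eudot_ge0 andbT eq_sym; apply: contra u0 => /eqP h; apply/eqP/rowP => k.
rewrite mxE; apply/eqP; move/eqP: h; rewrite psumr_eq0 => [/allP /(_ k)|k' _]; last by rewrite -expr2 sqr_ge0.
by rewrite mem_index_enum => /(_ isT) /=; rewrite mulf_eq0 orbb.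
Qed.

Lemma eunorm_ge0 u : 0 <= eunorm u.
Proof. exact: sqrtr_ge0. Qed.

Lemma eudist_ge0 x y : 0 <= eudist x y.
Proof. exact: eunorm_ge0. Qed.

Lemma eudist_gt0 x y : x != y -> 0 < eudist x y.
Proof. by move=> xy; rewrite /eudist /eunorm sqrtr_gt0 eudot_gt0 // subr_eq0. Qed.

Lemma eudistC x y : eudist x y = eudist y x.
Proof. by rewrite /eudist /eunorm; congr Num.sqrt; apply: eq_bigr => k _; rewrite !mxE; ring. Qed.

Lemma coord_le u k : `|u 0 k| <= eunorm u.
Proof.
rewrite -sqrtr_sqr ler_wsqrtr // /eudot (bigD1 k) //= expr2 lerDl; apply: sumr_ge0 => j _.
by rewrite -expr2 sqr_ge0.
Qed.

Lemma eunorm_le u (e : R) : 0 <= e -> (forall k, `|u 0 k| <= e) -> eunorm u <= d%:R * e.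
Proof.
move=> e0 H; have de0 : 0 <= d%:R * e by rewrite mulr_ge0.
rewrite -(ger0_norm de0) -sqrtr_sqr ler_wsqrtr //.
apply: (@le_trans _ _ (\sum_(k < d) e ^+ 2)).
  by apply: ler_sum => k _; rewrite -expr2 -[leLHS]ger0_norm ?sqr_ge0 // normrX ler_pXn2r ?nnegrE.
rewrite sumr_const card_ord -[leLHS]mulr_natl exprMn ler_wpM2r ?sqr_ge0 //.
by rewrite -natrX ler_nat; case: (d) => // n; rewrite -[leqLHS]muln1 expnS leq_mul2l expn1 /=.
Qed.

(** Squared distances avoid square roots; differences of two of them are affine functions ([sqd_seg]). *)
Definition sqd x y : R := eudot (x - y) (x - y).

Lemma lt_sqd x x' y : (eudist x y < eudist x' y) = (sqd x y < sqd x' y).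
Proof. by rewrite /eudist /eunorm !ltNge ler_psqrt // nnegrE eudot_ge0. Qed.
Definition box y (e : R) z := forall k, `|y 0 k - z 0 k| < e.

Lemma box_ball y (e : R) z : 0 < e -> ball y e z <-> box y e z.
Proof.
move=> e0; split=> [[_ h] k|h]; first exact: h.
by split=> // i k; rewrite !ord1; exact: h.
Qed.

Lemma nbhs_box y A : nbhs y A <-> exists2 e : R, 0 < e & forall z, box y e z -> A z.
Proof.
rewrite nbhs_ballP; split=> [[e e0 H]|[e e0 H]]; exists e => // z h; apply: H; exact/box_ball.
Qed.

Lemma closure_box A y : closure A y <-> forall e : R, 0 < e -> exists2 z, A z & box y e z.
Proof.
split=> [H e e0|H B /nbhs_box[e e0 He]].
  have /H[z [Az hz]] : nbhs y (box y e) by apply/nbhs_box; exists e.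
  by exists z.
by have [z Az hz] := H e e0; exists z; split=> //; exact: He.
Qed.

Lemma sqd_continuous x : continuous (sqd x).
Proof.
move=> y; have FF : Filter (nbhs y) by exact: nbhs_filter.
apply: cvg_sumRf => k.
have cv : ((x - z) 0 k @[z --> y] --> (x - y) 0 k).
  under eq_fun do rewrite !mxE; rewrite !mxE; apply: cvgB; [exact: cvg_cst | exact: coord_continuous].
exact: cvgM.
Qed.

Lemma sqd_seg x x' y z (t : R) : sqd x' (y + t *: (z - y)) - sqd x (y + t *: (z - y)) =
  (1 - t) * (sqd x' y - sqd x y) + t * (sqd x' z - sqd x z).
Proof.
rewrite /sqd /eudot -!sumrB !mulr_sumr -big_split /=; apply: eq_bigr => k _; rewrite !mxE; ring.
Qed.

End Euclid.

Section Voronoi.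
Variables (R : realType) (d N : nat) (G : mesh R d N).
Local Notation E := 'rV[R]_d.
Local Notation x := (vtx G).
Local Notation Om := (Omega G).
Hypothesis xinj : injective x.
Hypothesis Omo : open Om.
Hypothesis xOm : forall i, closure Om (x i).

(** The closed Voronoi cell, without the restriction to the domain. *)
Definition cell i : set E := [set y | forall j, sqd (x i) y <= sqd (x j) y].

Lemma voronoiE i y : voronoi G i y <-> Om y /\ forall j, j != i -> sqd (x i) y < sqd (x j) y.
Proof. by split=> -[h1 h2]; split=> // j ji; have := h2 j ji; rewrite lt_sqd. Qed.

Lemma closed_le_sqd i j : closed [set y | sqd (x i) y <= sqd (x j) y].
Proof.
have -> : [set y | sqd (x i) y <= sqd (x j) y] = (fun y => sqd (x j) y - sqd (x i) y) @^-1` [set t : R | 0 <= t].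
  by apply/seteqP; split=> y /=; rewrite subr_ge0.
apply: closed_comp; last exact: closed_ge.
by move=> y _; apply: continuousB; exact: sqd_continuous.
Qed.

Lemma voronoi_open i : open (voronoi G i).
Proof.
have -> : voronoi G i = Om `&` ~` \bigcup_(j in [set j | j != i]) [set y | sqd (x j) y <= sqd (x i) y].
  apply/seteqP; split=> y.
    move=> /voronoiE[h1 h2]; split=> // -[j /= ji hj].
    by have := h2 j ji; rewrite ltNge hj.
  move=> [h1 h2]; apply/voronoiE; split=> // j ji; rewrite ltNge; apply/negP => hj.
  by apply: h2; exists j.
apply: openI => //; apply: closed_openC; apply: closed_bigcup => [|j _]; first exact: finite_finset.
exact: closed_le_sqd.
Qed.

Lemma sqd_self (y : E) : sqd y y = 0.
Proof. by rewrite /sqd subrr /eudot big1 // => k _; rewrite !mxE mul0r. Qed.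

Lemma sqd_vtx i j : j != i -> 0 < sqd (x j) (x i).
Proof. by move=> ji; rewrite /sqd eudot_gt0 // subr_eq0; apply: contra ji => /eqP/xinj ->. Qed.
(** Moving from [y] towards the vertex makes all the inequalities strict, since they are affine along
    the segment and strict at the vertex. *)
Lemma cell_closure i y : Om y -> cell i y -> closure (voronoi G i) y.
Proof.
move=> Oy Ky; apply/closure_box => e e0.
have /nbhs_box[r r0 Hr] : nbhs y Om by move: Omo; rewrite openE => /(_ y Oy).
pose m := Num.min e r; have m0 : 0 < m by rewrite lt_min e0.
pose B : R := 1 + \sum_k `|(x i - y) 0 k|.
have B0 : 0 < B by rewrite ltr_wpDr // sumr_ge0.
pose t := Num.min 1 (m / (2 * B)).
have t0 : 0 < t by rewrite lt_min ltr01 divr_gt0 // mulr_gt0.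
have t1 : t <= 1 by rewrite ge_min lexx.
have tB : t * B <= m / 2.
  have : t <= m / (2 * B) by rewrite ge_min lexx orbT.
  by rewrite ler_pdivlMr ?mulr_gt0 // => h; lra.
have bx : box y m (y + t *: (x i - y)).
  move=> k; rewrite !mxE opprD addNKr normrN normrM (gtr0_norm t0).
  apply: (@le_lt_trans _ _ (m / 2)); last by move: m0; lra.
  apply: le_trans tB; rewrite ler_pM2l //.
  have -> : x i 0 k - y 0 k = (x i - y) 0 k by rewrite !mxE.
  by rewrite /B (bigD1 k) //= addrCA lerDl addr_ge0 // sumr_ge0.
exists (y + t *: (x i - y)); last by move=> k; apply: lt_le_trans (bx k) _; rewrite /m ge_min lexx.
apply/voronoiE; split.
  by apply: Hr => k; apply: lt_le_trans (bx k) _; rewrite /m ge_min lexx orbT.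
move=> j ji; rewrite -subr_gt0 sqd_seg sqd_self subr0 ltr_wpDl //.
  by rewrite mulr_ge0 // subr_ge0.
by rewrite mulr_gt0 // sqd_vtx.
Qed.

(** The strict inequalities hold near the vertex, which lies in the closure of the domain. *)
Lemma voronoi_nonempty i : voronoi G i !=set0.
Proof.
pose W := ~` \bigcup_(j in [set j | j != i]) [set y | sqd (x j) y <= sqd (x i) y].
have Wo : open W.
  apply: closed_openC; apply: closed_bigcup => [|j _]; first exact: finite_finset.
  exact: closed_le_sqd.
have Wx : W (x i) by move=> [j /= ji]; rewrite sqd_self leNgt sqd_vtx.
have /(@xOm i W) [y [Oy Wy]] : nbhs (x i) W by move: Wo; rewrite openE => /(_ _ Wx).
exists y; apply/voronoiE; split=> // j ji; rewrite ltNge; apply/negP => h.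
by apply: Wy; exists j.
Qed.

Lemma tie_boundary i j y : i != j -> Om y -> cell i y -> cell j y -> boundary (voronoi G i) y.
Proof.
move=> ij Oy Ki Kj; split; first exact: cell_closure.
move=> /interior_subset /voronoiE[_ /(_ j)]; rewrite eq_sym => /(_ ij).
by rewrite ltNge Kj.
Qed.

(** Where two closed cells meet inside the domain, both open cells are adherent and neither contains
    the point. *)
Lemma tie_sigma i j y : i != j -> Om y -> cell i y -> cell j y -> sigmaI G i j y.
Proof.
move=> ij Oy Ki Kj; split; first exact: tie_boundary Kj.
by apply: tie_boundary Ki => //; rewrite eq_sym.
Qed.

Lemma closed_cell i : closed (cell i).
Proof.
have -> : cell i = \bigcap_(j in setT) [set y | sqd (x i) y <= sqd (x j) y].
  by apply/seteqP; split=> y H j; [move=> _; exact: H | exact: H].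
by apply: closed_bigI => j _; exact: closed_le_sqd.
Qed.

Lemma cell_cover (i0 : 'I_N) y : exists i, cell i y.
Proof.
have [i _ Hi] := @arg_minP _ _ _ i0 xpredT (fun i => sqd (x i) y) isT.
by exists i => j; exact: Hi.
Qed.

Lemma voronoi_cell i j y : voronoi G i y -> cell j y -> i = j.
Proof.
move=> /voronoiE[_ H] K; apply/eqP/negPn/negP => ij.
by have := H j; rewrite eq_sym => /(_ ij); rewrite ltNge K.
Qed.

Lemma voronoi_sub_cell i y : voronoi G i y -> cell i y.
Proof. by move=> /voronoiE[_ H] j; have [->//|ji] := eqVneq j i; exact/ltW/H. Qed.
(** The closed cells on the two sides of the partition cover [S]; if they did not meet in [S], it
    would split into two closed parts. *)
Lemma connected_tie (S : set E) (A : {set 'I_N}) p q i j : connected S -> S p -> S q -> voronoi G i p -> voronoi G j q ->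
  i \in A -> j \notin A -> exists i' j' y, [/\ i' \in A, j' \notin A, S y, cell i' y & cell j' y].
Proof.
move=> Sc Sp Sq pi qj iA jA; apply: contrapT => no.
pose KA := \bigcup_(k in [set k | k \in A]) cell k.
pose KB := \bigcup_(k in [set k | k \notin A]) cell k.
have KAc : closed KA by apply: closed_bigcup => [|k _]; [exact: finite_finset | exact: closed_cell].
have KBc : closed KB by apply: closed_bigcup => [|k _]; [exact: finite_finset | exact: closed_cell].
have eS : S `&` KA = S.
  apply: Sc; first by exists p; split=> //; exists i => //; exact: voronoi_sub_cell.
    exists (~` KB); first exact: closed_openC.
    apply/seteqP; split=> y [Sy]; last first.
      move=> nB; split=> //; have [k Hk] := cell_cover i y; exists k => //=.
      by apply/negPn/negP => kA; apply: nB; exists k.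
    by move=> [k kA Hk]; split=> // -[k' kA' Hk']; apply: no; exists k, k', y.
  by exists KA.
have : S q by []; rewrite -eS => -[_ [k kA Hk]].
by have e := voronoi_cell qj Hk; move: jA; rewrite e => /negP[].
Qed.

End Voronoi.

(** * Volumes *)

Section Volume.
Variables (R : realType).
Local Notation TR := (measurableTypeR R).

(** An open set is a countable union of boxes with rational data. *)
Lemma open_preimage_measurable (disp : measure_display) (T : measurableType disp) (d : nat) (f : T -> 'rV[R]_d) (A : set 'rV[R]_d) :
  open A -> (forall k, measurable_fun [set: T] ((fun p => f p 0 k) : T -> TR)) -> measurable (f @^-1` A).
Proof.
move=> Ao mf.
pose good (q : {ffun 'I_d -> rat} * rat) := forall z : 'rV[R]_d, (forall k, `|ratr (q.1 k) - z 0 k| < ratr q.2) -> A z.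
pose F (q : {ffun 'I_d -> rat} * rat) : set T := if `[< good q >] then \bigcap_(k in [set: 'I_d]) [set p | `|ratr (q.1 k) - f p 0 k| < ratr q.2] else set0.
have -> : f @^-1` A = \bigcup_q F q.
  apply/seteqP; split=> p /=; last first.
    by move=> [q _]; rewrite /F; case: asboolP => // gq Hp; apply: gq => k; exact: Hp.
  move=> Ap; have /nbhs_box[r r0 Hr] : nbhs (f p) A by move: Ao; rewrite openE => /(_ _ Ap).
  have [e /itvP He] := @rat_in_itvoo R 0 (r / 2) (divr_gt0 r0 (ltr0Sn _ _)).
  have e0 : 0 < (ratr e : R) by rewrite He.
  have Hq k : exists q : rat, `|ratr q - f p 0 k| < (ratr e : R).
    have [|q /itvP Hq] := @rat_in_itvoo R (f p 0 k - ratr e) (f p 0 k + ratr e); first by lra.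
    exists q; rewrite ltr_norml; apply/andP; split; [have : f p 0 k - ratr e < ratr q by rewrite Hq | have : ratr q < f p 0 k + ratr e by rewrite Hq]; lra.
  have /choice[q {}Hq] := Hq.
  exists (finfun q, e) => //; rewrite /F asboolT /=; first by move=> k _ /=; rewrite ffunE.
  move=> z /= Hz; apply: Hr => k; have := Hz k; rewrite ffunE => h1; have h2 := Hq k.
  have h3 : ratr e < r / 2 by rewrite He.
  rewrite (_ : f p 0 k - z 0 k = - (ratr (q k) - f p 0 k) + (ratr (q k) - z 0 k)); last by ring.
  by apply: le_lt_trans (ler_normD _ _) _; rewrite normrN; lra.
apply: countable_bigcupT_measurable => [|q]; first exact: countableP.
rewrite /F; case: asboolP => _ //.
apply: fin_bigcap_measurable => [|k _]; first exact: finite_finset.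
have -> : [set p | `|ratr (q.1 k) - f p 0 k| < (ratr q.2 : R)] =
  (fun p => f p 0 k) @^-1` `]ratr (q.1 k) - ratr q.2, ratr (q.1 k) + ratr q.2[.
  by apply/seteqP; split=> p /=; rewrite in_itv /= ltr_norml => /andP[h1 h2]; apply/andP; split; lra.
rewrite -[X in measurable X]setTI; apply: mf => //; exact: measurable_itv.
Qed.

Lemma fine_measure_gt0 (disp : measure_display) (T : measurableType disp) (mu : {measure set T -> \bar R}) (L X H : set T) (l h : \bar R) :
  measurable L -> measurable X -> measurable H -> L `<=` X -> X `<=` H -> mu L = l -> mu H = h -> (0 < l)%E -> (h < +oo)%E -> 0 < fine (mu X).
Proof.
move=> mL mX mH LX XH <- <- L0 Hoo; apply: fine_gt0.
rewrite (lt_le_trans L0) ?le_measure ?inE //=.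
by apply: le_lt_trans Hoo; rewrite le_measure ?inE.
Qed.

Lemma lebesgue_itvoo (a b : R) : a <= b -> lebesgue_measure (`]a, b[%classic : set TR) = (b - a)%:E.
Proof.
move=> ab; rewrite lebesgue_measure_itv /= lte_fin; case: ltP => // h.
by have -> : a = b; [lra | rewrite subrr].
Qed.

Lemma leb2_rect (I J : set TR) : measurable I -> measurable J ->
  (@lebesgue_measure R \x @lebesgue_measure R)%E (I `*` J) = (lebesgue_measure I * lebesgue_measure J)%E.
Proof. by move=> mI mJ; exact: product_measure1E. Qed.

Lemma leb3_rect (I J K : set TR) : measurable I -> measurable J -> measurable K ->
  ((@lebesgue_measure R \x @lebesgue_measure R) \x @lebesgue_measure R)%E (I `*` J `*` K) =
  (lebesgue_measure I * lebesgue_measure J * lebesgue_measure K)%E.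
Proof.
move=> mI mJ mK; rewrite -leb2_rect //; apply: product_measure1E => //; exact: measurableX.
Qed.

(** Squeeze the set between a box contained in it and a box containing it. *)
Lemma vol_gt0 (d : nat) (A : set 'rV[R]_d) (B : R) y : d = 2%N \/ d = 3%N -> open A -> A y -> (forall z, A z -> forall k, `|z 0 k| <= B) ->
  0 < vol A.
Proof.
move=> d23 Ao Ay AB.
have /nbhs_box[e e0 He] : nbhs y A by move: Ao; rewrite openE => /(_ _ Ay).
have inB z k : A z -> - (B + 1) < z 0 k < B + 1 by move=> /AB /(_ k); rewrite ler_norml => /andP[h1 h2]; apply/andP; split; lra.
have ye k : y 0 k - e <= y 0 k + e by lra.
have pe k : (0 < ((y 0 k + e) - (y 0 k - e))%:E)%E by rewrite lte_fin; lra.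
have nrm k z : y 0 k - e < z < y 0 k + e -> `|y 0 k - z| < e.
  by move=> /andP[h1 h2]; rewrite ltr_norml; apply/andP; split; lra.
case: d23 => dE; subst d; rewrite /vol /=.
  pose k0 : 'I_2 := ord0; pose k1 : 'I_2 := lift ord0 ord0.
  have B0 : - (B + 1) <= B + 1 by have := AB y Ay k0; have := normr_ge0 (y 0 k0); lra.
  apply: (@fine_measure_gt0 _ _ (@lebesgue_measure R \x @lebesgue_measure R)%E
    (`]y 0 k0 - e, y 0 k0 + e[ `*` `]y 0 k1 - e, y 0 k1 + e[) _ (`]- (B + 1), B + 1[ `*` `]- (B + 1), B + 1[)).
  - by apply: measurableX; exact: measurable_itv.
  - apply: open_preimage_measurable => // k.
    case: k => -[|[|//]] hk.
      by under eq_fun do rewrite mxE /=; exact: measurable_fst.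
    by under eq_fun do rewrite mxE /=; exact: measurable_snd.
  - by apply: measurableX; exact: measurable_itv.
  - move=> [p1 p2] [/=]; rewrite !in_itv /= => h1 h2; apply: He => k; rewrite mxE.
    have [->|->] : k = k0 \/ k = k1 by case: k => -[|[|//]] hk; [left|right]; exact/val_inj.
      exact: nrm.
    exact: nrm.
  - move=> [p1 p2] /= Ap; split; rewrite /= in_itv /=.
      by have := inB _ k0 Ap; rewrite mxE.
    by have := inB _ k1 Ap; rewrite mxE.
  - by apply: leb2_rect; exact: measurable_itv.
  - by apply: leb2_rect; exact: measurable_itv.
  - by rewrite !lebesgue_itvoo // mule_gt0.
  - by rewrite !lebesgue_itvoo // -EFinM ltry.
pose k0 : 'I_3 := ord0; pose k1 : 'I_3 := lift ord0 ord0; pose k2 : 'I_3 := lift ord0 (lift ord0 ord0).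
have B0 : - (B + 1) <= B + 1 by have := AB y Ay k0; have := normr_ge0 (y 0 k0); lra.
apply: (@fine_measure_gt0 _ _ ((@lebesgue_measure R \x @lebesgue_measure R) \x @lebesgue_measure R)%E
    (`]y 0 k0 - e, y 0 k0 + e[ `*` `]y 0 k1 - e, y 0 k1 + e[ `*` `]y 0 k2 - e, y 0 k2 + e[) _
    (`]- (B + 1), B + 1[ `*` `]- (B + 1), B + 1[ `*` `]- (B + 1), B + 1[)).
- by do 2? apply: measurableX; exact: measurable_itv.
- apply: open_preimage_measurable => // k.
  case: k => -[|[|[|//]]] hk; under eq_fun do rewrite mxE /=.
  + by apply: (measurableT_comp (f := fst)); exact: measurable_fst.
  + by apply: (measurableT_comp (f := snd)); [exact: measurable_snd | exact: measurable_fst].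
  + exact: measurable_snd.
- by do 2? apply: measurableX; exact: measurable_itv.
- move=> [[p1 p2] p3] [[/=]]; rewrite !in_itv /= => h1 h2 h3; apply: He => k; rewrite mxE.
  have [->|[->|->]] : k = k0 \/ k = k1 \/ k = k2.
    by case: k => -[|[|[|//]]] hk; [left|right;left|right;right]; exact/val_inj.
  + exact: nrm.
  + exact: nrm.
  + exact: nrm.
- move=> [[p1 p2] p3] /= Ap; split; [split|]; rewrite /= in_itv /=.
  + by have := inB _ k0 Ap; rewrite mxE.
  + by have := inB _ k1 Ap; rewrite mxE.
  + by have := inB _ k2 Ap; rewrite mxE.
- by apply: leb3_rect; exact: measurable_itv.
- by apply: leb3_rect; exact: measurable_itv.
- by rewrite !lebesgue_itvoo // !mule_gt0.
- by rewrite !lebesgue_itvoo // -!EFinM ltry.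
Qed.

Lemma polytopal_bounded (d : nat) (A : set 'rV[R]_d) : polytopal_domain A -> open A /\ exists B, forall y, A y -> forall k, `|y 0 k| <= B.
Proof.
move=> [_ _ [n [p ->]]]; split; first exact: open_interior.
exists (\sum_(t < n) \sum_k \sum_(c < d) `|p t k 0 c|) => y /interior_subset [t _ [w [w0 w1 ->]]] c.
have s0 k : 0 <= \sum_(c < d) `|p t k 0 c| by apply: sumr_ge0.
apply: (@le_trans _ _ (\sum_k \sum_(c < d) `|p t k 0 c|)); last first.
  by rewrite [leRHS](bigD1 t) //= lerDl; apply: sumr_ge0 => t' _; apply: sumr_ge0 => k _; exact: sumr_ge0.
rewrite summxE; apply: le_trans (ler_norm_sum _ _ _) _; apply: ler_sum => k _.
rewrite mxE normrM (ger0_norm (w0 k)); apply: (@le_trans _ _ `|p t k 0 c|).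
  apply: ler_piMl => //; rewrite -w1 (bigD1 k) //= lerDl; exact: sumr_ge0.
by rewrite (bigD1 c) //= lerDl; exact: sumr_ge0.
Qed.

End Volume.

(** * Hausdorff measure of edges *)

Section Diameter.
Variables (R : realType) (d : nat).
Local Notation E := 'rV[R]_d.
Implicit Types (y z : E) (A B : set E) (D : R).

Lemma eudiam_le A D : 0 <= D -> (forall y z, A y -> A z -> eudist y z <= D) -> eudiam A <= D.
Proof.
move=> D0 H; rewrite /eudiam; set S := [set _ | _ in _].
have [->|/set0P S0] := eqVneq S set0; first by rewrite sup0.
by apply: ge_sup => // _ [[y z] [/= Ay Az] <-]; exact: H.
Qed.

Lemma eudist_le_diam A D y z : (forall y z, A y -> A z -> eudist y z <= D) -> A y -> A z -> eudist y z <= eudiam A.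
Proof.
move=> H Ay Az; apply: ub_le_sup; last by exists (y, z).
by exists D => _ [[y' z'] [/= Ay' Az'] <-]; exact: H.
Qed.

Lemma eudiam_ge0 A : 0 <= eudiam A.
Proof.
rewrite /eudiam; set S := [set _ | _ in _]; have [hS|/sup_out->//] := pselect (has_sup S).
have [[e Se] ub] := hS; apply: (@le_trans _ _ e); last exact: ub_le_sup.
by have [p _ <-] := Se; exact: eudist_ge0.
Qed.

Lemma eudiam0 : eudiam (set0 : set E) = 0.
Proof.
rewrite /eudiam (_ : [set _ | _ in _] = set0) ?sup0 //.
by apply/seteqP; split=> // _ [[y z] [/= []]].
Qed.

Lemma hausdorff_const_gt0 k : 0 < hausdorff_const R k.
Proof. by rewrite /hausdorff_const; case: ifP => // _; rewrite divr_gt0 // pi_gt0. Qed.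

Lemma cover_term_ge0 k (A : set E) : (0 <= (hausdorff_const R k * eudiam A ^+ k)%:E)%E.
Proof. by rewrite lee_fin mulr_ge0 ?(ltW (hausdorff_const_gt0 _)) // exprn_ge0 // eudiam_ge0. Qed.

Lemma hausdorff_pre_ge0 k D A : (0 <= hausdorff_pre k D A)%E.
Proof.
apply: le_ereal_inf_tmp => _ [B _ <-]; apply: nneseries_ge0 => j _ _; exact: cover_term_ge0.
Qed.

Lemma hausdorff_pre_le k D A : 0 < D -> (hausdorff_pre k D A <= hausdorff k A)%E.
Proof. by move=> D0; apply: ereal_sup_ubound; exists D. Qed.

Lemma hausdorff_ge0 k A : (0 <= hausdorff k A)%E.
Proof. exact: le_trans (hausdorff_pre_ge0 k 1 A) (hausdorff_pre_le _ _ ltr01). Qed.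

Lemma area_ge0 A : 0 <= area A.
Proof. exact/fine_ge0/hausdorff_ge0. Qed.

Lemma eudist_set_ge0 y A : 0 <= eudist_set y A.
Proof.
rewrite /eudist_set; set S := [set _ | _ in _]; have [->|/set0P S0] := eqVneq S set0; first by rewrite inf0.
by apply: lb_le_inf => // _ [z _ <-]; exact: eudist_ge0.
Qed.

(** Extend the finite family by empty sets, which have diameter 0; this needs [0 < k]. *)
Lemma finite_cover (T : finType) (F : T -> set E) k D A : (0 < k)%N ->
  (forall y, A y -> exists t, F t y) -> (forall t y z, F t y -> F t z -> eudist y z <= D) ->
  (hausdorff_pre k D A <= (\sum_t hausdorff_const R k * eudiam (F t) ^+ k)%:E)%E.
Proof.
move=> k0 AF FD.
pose B j : set E := if insub j is Some t then F (enum_val (t : 'I_#|T|)) else set0.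
have BD j y z : B j y -> B j z -> eudist y z <= D by rewrite /B; case: insubP => [t _ _|_ []]; exact: FD.
apply: le_trans (ereal_inf_lbound _) _.
  exists B => //; split=> // y /AF [t Ft]; exists (enum_rank t) => //.
  by rewrite /B valK enum_rankK.
rewrite (nneseries_split 0%N #|T|); last by move=> j _; exact: cover_term_ge0.
rewrite add0n eseries0 ?adde0; last first.
  move=> j Tj _; rewrite /B insubN ?eudiam0 -?leqNgt // expr0n eqn0Ngt k0 mulr0 //.
rewrite big_mkord sumEFin lee_fin (reindex (@enum_val T predT)) /=; last first.
  by exists enum_rank => ? _; [exact: enum_valK | exact: enum_rankK].
by rewrite le_eqVlt; apply/orP; left; apply/eqP; apply: eq_bigr => t _; rewrite /B valK.
Qed.

End Diameter.

(** The last subdivision point that does not exceed [s]. *)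
Lemma grid_cell (R : realType) (n : nat) (B s : R) : 0 <= B -> `|s| <= B ->
  exists t : 'I_n.+1, - B + 2 * B * (t%:R / n.+1%:R) <= s <= - B + 2 * B * (t.+1%:R / n.+1%:R).
Proof.
move=> B0; rewrite ler_norml => /andP[s1 s2].
have [|t Pt tmax] := @arg_maxnP _ ord0 (fun t : 'I_n.+1 => - B + 2 * B * (t%:R / n.+1%:R) <= s) (fun t : 'I_n.+1 => nat_of_ord t).
  by rewrite mul0r mulr0 addr0.
exists t; rewrite Pt /=; have [tn|tn] := ltnP t.+1 n.+1.
  rewrite leNgt; apply/negP => h; have := tmax (Ordinal tn) (ltW h).
  by rewrite /= ltnn.
have -> : t.+1 = n.+1 by apply/eqP; rewrite eqn_leq tn ltn_ord.
by rewrite divff ?pnatr_eq0 // mulr1; lra.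
Qed.

Section Plane.
Variables (R : realType) (k : nat).
Hypothesis k0 : (0 < k)%N.
Local Notation E := 'rV[R]_k.+1.

(** Divide by the largest coordinate of the normal vector: on the hyperplane that coordinate is a
    Lipschitz function of the others.  A grid with [n ^ k] cells in the other coordinates gives
    pieces of diameter of order 1 / n, so the sums in the definition of the measure are bounded
    independently of [n]. *)
Lemma plane_hausdorff_fin (nv : E) (s B : R) (A : set E) : nv != 0 -> 0 <= B ->
  (forall y, A y -> eudot nv y = s) -> (forall y, A y -> forall c, `|y 0 c| <= B) ->
  (hausdorff k A < +oo)%E.
Proof.
move=> nv0 B0 As AB.
have [m nm nmax] : exists2 m, nv 0 m != 0 & forall c, `|nv 0 c| <= `|nv 0 m|.
  have [m _ Hm] := @arg_maxP _ _ _ ord0 xpredT (fun c => `|nv 0 c|) isT.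
  exists m => [|c]; last exact: Hm.
  apply: contra nv0 => /eqP e; apply/eqP/rowP => c; rewrite mxE; apply/eqP.
  by rewrite -normr_le0; have := Hm c isT; rewrite /= e normr0.
have steep (e : R) y z : 0 <= e -> A y -> A z -> (forall c, `|y 0 (lift m c) - z 0 (lift m c)| <= e) ->
    eudist y z <= k.+1%:R * (k.+1%:R * e).
  move=> e0 Ay Az H; apply: eunorm_le => [|c]; first by rewrite mulr_ge0.
  rewrite !mxE; have [->|cm] := eqVneq c m; last first.
    have [c' ->] : exists c', c = lift m c' by case: (unliftP m c) cm => [c' ->|->]; [exists c' | rewrite eqxx].
    by apply: le_trans (H c') _; rewrite ler_peMl // ler1n.
  have : eudot nv y - eudot nv z = 0 by rewrite (As y) // (As z) // subrr.
  rewrite /eudot -sumrB (bigD1_ord m) //= -mulrBr => /eqP; rewrite addr_eq0 => /eqP e1.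
  have n0 : 0 < `|nv 0 m| by rewrite normr_gt0.
  rewrite -(ler_pM2l n0) -normrM e1 normrN; apply: le_trans (ler_norm_sum _ _ _) _.
  apply: (@le_trans _ _ (\sum_(c' < k) `|nv 0 m| * e)).
    by apply: ler_sum => c' _; rewrite -mulrBr normrM ler_pM.
  by rewrite sumr_const card_ord -[leLHS]mulr_natl mulrCA ler_pM2l // ler_wpM2r // ler_nat.
pose L := k.+1%:R * (k.+1%:R * (2 * B)); have L0 : 0 <= L by rewrite !mulr_ge0.
suff H : (hausdorff k A <= (hausdorff_const R k * L ^+ k)%:E)%E by apply: le_lt_trans H _; rewrite ltry.
apply: ge_ereal_sup => _ [D /= D0 <-].
have [n Hn] : exists n, L / n.+1%:R <= D.
  exists (Num.truncn (L / D)); rewrite ler_pdivrMr // mulrC -ler_pdivrMr //.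
  by apply: ltW; apply: truncnS_gt.
pose F (t : {ffun 'I_k -> 'I_n.+1}) := [set y | A y /\ forall c, - B + 2 * B * ((t c)%:R / n.+1%:R) <= y 0 (lift m c) <= - B + 2 * B * ((t c).+1%:R / n.+1%:R)].
have FL t y z : F t y -> F t z -> eudist y z <= L / n.+1%:R.
  move=> [Ay Hy] [Az Hz]; have e0 : 0 <= 2 * B / n.+1%:R by rewrite divr_ge0 // mulr_ge0.
  apply: le_trans (steep _ _ _ e0 Ay Az _) _; last by rewrite /L !mulrA.
  move=> c; have e1 : 2 * B * ((t c).+1%:R / n.+1%:R) = 2 * B * ((t c)%:R / n.+1%:R) + 2 * B / n.+1%:R.
    by rewrite -natr1; ring.
  move: (Hy c) (Hz c); rewrite e1; set p := 2 * B * _; set q := 2 * B / _ => /andP[h1 h2] /andP[h3 h4].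
  by move: h1 h2 h3 h4; clear; set u := y 0 _; set v := z 0 _ => *; rewrite ler_norml; apply/andP; split; lra.
apply: le_trans (finite_cover (F := F) k0 _ _) _.
- move=> y Ay; have /choice[t Ht] := fun c : 'I_k => @grid_cell R n B (y 0 (lift m c)) B0 (AB y Ay _).
  by exists (finfun t); split=> // c; rewrite ffunE; exact: Ht.
- by move=> t y z Fy Fz; apply: le_trans (FL t y z Fy Fz) Hn.
rewrite lee_fin -mulr_sumr ler_pM2l ?hausdorff_const_gt0 //.
have Ln : 0 <= L / n.+1%:R by rewrite divr_ge0.
apply: (@le_trans _ _ (\sum_(t : {ffun 'I_k -> 'I_n.+1}) (L / n.+1%:R) ^+ k)).
  apply: ler_sum => t _; rewrite ler_pXn2r ?nnegrE ?eudiam_ge0 //; apply: eudiam_le => //; exact: FL.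
rewrite sumr_const card_ffun !card_ord -[leLHS]mulr_natl natrX -exprMn mulrC divfK ?pnatr_eq0 //.
Qed.

End Plane.

(** * Projections of null sets *)

Lemma thin_negligible (R : realType) (disp : measure_display) (T : measurableType disp) (mu : {measure set T -> \bar R}) (X : set T) :
  (forall e : R, 0 < e -> exists U, [/\ measurable U, X `<=` U & (mu U <= e%:E)%E]) -> mu.-negligible X.
Proof.
move=> H.
have /choice[U HU] : forall n : nat, exists U, [/\ measurable U, X `<=` U & (mu U <= (n.+1%:R^-1)%:E)%E].
  by move=> n; apply: H; rewrite invr_gt0.
have mI : measurable (\bigcap_n U n) by apply: bigcapT_measurable => n; have [] := HU n.
exists (\bigcap_n U n); split=> //; last by move=> p Xp n _; have [_ + _] := HU n; apply.
apply/eqP; rewrite eq_le measure_ge0 andbT; apply/lee_addgt0Pr => e e0; rewrite add0e.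
have [n Hn] : exists n : nat, n.+1%:R^-1 <= e.
  exists (Num.truncn e^-1); rewrite -[leRHS]invrK lef_pV2 ?posrE ?invr_gt0 //; exact/ltW/truncnS_gt.
apply: (@le_trans _ _ (mu (U n))); first by apply: le_measure; rewrite ?inE //; [have [] := HU n | exact: bigcap_inf].
by have [_ _ h] := HU n; apply: le_trans h _; rewrite lee_fin.
Qed.

Section Shadow.
Variables (R : realType) (k : nat).
Local Notation E := 'rV[R]_k.+1.
Local Notation TR := (measurableTypeR R).
Local Notation leb2' := (@lebesgue_measure R \x @lebesgue_measure R)%E.
Hypothesis k12 : k = 1%N \/ k = 2%N.
Variables (f1 f2 : E -> R) (L : R).
Hypotheses (L0 : 0 < L) (lip1 : forall y z, `|f1 y - f1 z| <= L * eudist y z) (lip2 : forall y z, `|f2 y - f2 z| <= L * eudist y z).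
(** The image under [f1], or under the pair [f1], [f2] when [k = 2].  When [k = 1] it is thickened by
    the unit interval, so that plane Lebesgue measure serves in both cases. *)
Definition shadow (S : set E) : set (TR * TR) :=
  [set p | exists y, [/\ S y, p.1 = f1 y & if k == 2%N then p.2 = f2 y else 0 <= p.2 <= 1]].

Lemma lebesgue_itvcc (a b : R) : a <= b -> lebesgue_measure (`[a, b]%classic : set TR) = (b - a)%:E.
Proof.
move=> ab; rewrite lebesgue_measure_itv /= lte_fin; case: ltP => // h.
by have -> : a = b; [lra | rewrite subrr].
Qed.

(** Lipschitz images of a set lie in intervals of length [2 * L] times its diameter. *)
Lemma shadow_rect (B : set E) (D : R) : (forall y z, B y -> B z -> eudist y z <= D) ->
  exists I J : interval R, shadow B `<=` [set` I] `*` [set` J] /\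
    leb2' ([set` I] `*` [set` J]) = ((2 * L * eudiam B) ^+ k)%:E.
Proof.
move=> BD; pose r := L * eudiam B.
have r0 : 0 <= r by rewrite mulr_ge0 ?(ltW L0) // eudiam_ge0.
have near f y z : (forall y z, `|f y - f z| <= L * eudist y z) -> B y -> B z -> f z - r <= f y <= f z + r.
  move=> lip By Bz; have := lip y z; have : L * eudist y z <= r by rewrite ler_pM2l // (eudist_le_diam BD).
  by move=> h1 h2; have := le_trans h2 h1; rewrite ler_norml => /andP[h3 h4]; apply/andP; split; lra.
have [[z Bz]|nB] := pselect (B !=set0); last first.
  have -> : B = set0 by apply/seteqP; split=> // y By; case: nB; exists y.
  exists `]0, 0[, `]0, 0[; split; first by move=> p [y []].
  rewrite eudiam0 mulr0 expr0n gtn_eqF; last by case: k12 => ->.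
  by rewrite leb2_rect; [rewrite !lebesgue_itvoo // subrr mule0 | exact: measurable_itv..].
exists `[f1 z - r, f1 z + r], (if k == 2%N then `[f2 z - r, f2 z + r] else `[0, 1]); split.
  move=> p [y [By e1 e2]]; split=> /=; first by rewrite in_itv /= e1; exact: near.
  by case: ifP e2 => _ e2; rewrite in_itv /= ?e2 //; exact: near.
rewrite leb2_rect; [|exact: measurable_itv..].
have e : f1 z - r <= f1 z + r by lra.
have e' : f2 z - r <= f2 z + r by lra.
move: e e'; rewrite /r; move: (f1 z) (f2 z) (eudiam B) => s t D' e e'.
case: k12 => -> /=; rewrite lebesgue_itvcc // lebesgue_itvcc // -EFinM; congr EFin; ring.
Qed.

(** Coverings with small [k]-dimensional content become coverings by rectangles of small area. *)
Lemma shadow_negligible S : hausdorff k S = 0 -> leb2'.-negligible (shadow S).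
Proof.
move=> S0; apply: thin_negligible => e e0.
have hc0 := hausdorff_const_gt0 R k; set hc := hausdorff_const R k in hc0.
pose c := (2 * L) ^+ k / hc; have c0 : 0 < c by rewrite divr_gt0 // exprn_gt0 // mulr_gt0.
have : (hausdorff_pre k 1 S < (e / c)%:E)%E.
  by apply: le_lt_trans (hausdorff_pre_le _ _ ltr01) _; rewrite S0 lte_fin divr_gt0.
move=> /ereal_inf_lt [_ [B [SB BD] <-] lt].
have /choice[IJ HIJ] : forall j, exists IJ : interval R * interval R, shadow (B j) `<=` [set` IJ.1] `*` [set` IJ.2] /\
    leb2' ([set` IJ.1] `*` [set` IJ.2]) = ((2 * L * eudiam (B j)) ^+ k)%:E.
  by move=> j; have [I [J H]] := shadow_rect (BD j); exists (I, J).
have mR j : measurable ([set` (IJ j).1] `*` [set` (IJ j).2] : set (TR * TR)).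
  by apply: measurableX; exact: measurable_itv.
exists (\bigcup_j ([set` (IJ j).1] `*` [set` (IJ j).2])); split.
- exact: bigcupT_measurable.
- move=> p [y [/SB[j _ Bjy] h1 h2]]; exists j => //; have [h _] := HIJ j; apply: h; exists y; split=> //.
apply: le_trans (measure_sigma_subadditive leb2' mR _ (@subset_refl _ _)) _; first exact: bigcupT_measurable.
have -> : (\sum_(0 <= j <oo) leb2' ([set` (IJ j).1] `*` [set` (IJ j).2]) = c%:E * \sum_(0 <= j <oo) (hc * eudiam (B j) ^+ k)%:E)%E.
  rewrite -nneseriesZl; last by move=> j _; exact: cover_term_ge0.
  apply: eq_eseriesr => j _; have [_ ->] := HIJ j; rewrite -EFinM; congr EFin.
  by rewrite exprMn /c mulrA divfK ?gt_eqF.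
by rewrite -lee_pdivlMl // -EFinM mulrC; exact: ltW.
Qed.

End Shadow.

(** * Connectivity of Voronoi meshes *)

Lemma negligible_fin (R : realType) (disp : measure_display) (T : measurableType disp) (mu : {measure set T -> \bar R})
  (I : finType) (F : I -> set T) : (forall t, mu.-negligible (F t)) -> mu.-negligible [set p | exists t, F t p].
Proof.
move=> H; suff : forall s : seq I, mu.-negligible [set p | exists2 t, t \in s & F t p].
  by move=> /(_ (enum I)); apply: negligibleS => p [t Ft]; exists t; rewrite ?mem_enum.
elim=> [|t s IH]; first by apply: negligibleS (negligible_set0 mu) => p [].
apply: negligibleS (negligibleU (H t) IH) => p [t']; rewrite inE => /predU1P[->|ts] Ft'; first by left.
by right; exists t'.
Qed.

Section Geometry.
Variables (R : realType) (k N : nat) (G : mesh R k.+2 N).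
Hypothesis k01 : k = 0%N \/ k = 1%N.
Hypothesis HG : admissible_mesh G.
Local Notation E := 'rV[R]_k.+2.
Local Notation x := (vtx G).
Local Notation Om := (Omega G).
Local Notation V := (voronoi G).

Lemma vtx_inj : injective x.
Proof. by have [_ _ []] := HG. Qed.

Lemma vtx_closure i : closure Om (x i).
Proof. by have [_ _ [_ /(_ i)]] := HG. Qed.

Lemma Om_open : open Om.
Proof. by have [/polytopal_bounded[]] := HG. Qed.

Lemma Om_bounded : exists B : R, forall y, Om y -> forall c, `|y 0 c| <= B.
Proof. by have [/polytopal_bounded[_]] := HG. Qed.

Lemma Om_connected : connected Om.
Proof. by have [[_]] := HG. Qed.

Let Vo i : open (V i) := @voronoi_open _ _ _ G Om_open i.
Let V0 i : V i !=set0 := @voronoi_nonempty _ _ _ G vtx_inj vtx_closure i.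

Lemma voronoi_vol i : 0 < mV G i.
Proof.
have [B HB] := Om_bounded; have [y Vy] := V0 i.
apply: (@vol_gt0 R k.+2 (V i) B y) => //; first by case: k01 => ->; [left|right].
by move=> z [Oz _]; exact: HB.
Qed.

Lemma vtx_dist i j : i != j -> 0 < eudist (x i) (x j).
Proof. by move=> ij; apply: eudist_gt0; apply: contra ij => /eqP/vtx_inj ->. Qed.

Lemma tauI_sym i j : tauI G i j = tauI G j i.
Proof. by rewrite /tauI /sigmaI setIC eudistC. Qed.

Lemma tauI_ge0 i j : 0 <= tauI G i j.
Proof. by rewrite /tauI divr_ge0 ?area_ge0 // eudist_ge0. Qed.

Lemma tauD_ge0 i : 0 <= tauD G i.
Proof. by rewrite /tauD divr_ge0 ?area_ge0 // eudist_set_ge0. Qed.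

Lemma voronoi_diam i : 0 < eudiam (V i).
Proof.
have [B HB] := Om_bounded; have [y Vy] := V0 i.
have /nbhs_box[e e0 He] : nbhs y (V i) by move: (@Vo i); rewrite openE => /(_ _ Vy).
pose z := y + const_mx (e / 2).
have Vz : V i z by apply: He => c; rewrite !mxE opprD addNKr normrN gtr0_norm; lra.
have B0 : 0 <= B by apply: le_trans (normr_ge0 _) (HB y Vy.1 ord0).
apply: lt_le_trans (_ : eudist y z <= _).
  apply: eudist_gt0; apply/eqP => /rowP /(_ ord0); rewrite !mxE => h; move: e0 h; lra.
apply: (@eudist_le_diam R k.+2 (V i) (k.+2%:R * (B + B))) => // y' z' [Oy _] [Oz _].
apply: eunorm_le => [|c]; first by rewrite addr_ge0.
by rewrite !mxE; apply: le_trans (ler_normB _ _) _; rewrite lerD ?HB.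
Qed.

(** An edge of positive measure keeps a positive distance from its vertex by shape regularity. *)
Lemma tauD_somewhere : exists i, 0 < tauD G i.
Proof.
have [_ _ _ _ [[xi xi0 Hxi] [i ai]]] := HG; exists i; rewrite /tauD divr_gt0 //.
have := Hxi i (sigmaD G i) (or_intror (or_introl erefl)) ai; apply: lt_le_trans.
by rewrite mulr_gt0 // voronoi_diam.
Qed.

Lemma closure_cell i y : closure (V i) y -> cell G i y.
Proof.
move=> cy; apply: (@closed_cell R _ _ G i); move: y cy; apply: closureS => y; exact: voronoi_sub_cell.
Qed.

(** The edge lies in the bisecting hyperplane of two vertices and in the bounded closure of the
    domain.  Finiteness matters because [area] would be 0 for an edge of infinite measure. *)
Lemma sigma_finite_area i j : i != j -> (hausdorff k.+1 (sigmaI G i j) < +oo)%E.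
Proof.
move=> ij; have [B HB] := Om_bounded.
have [y0 [Oy0 _]] := V0 i.
have B0 : 0 <= B by apply: le_trans (normr_ge0 _) (HB y0 Oy0 ord0).
apply: (@plane_hausdorff_fin R k.+1 (ltn0Sn _) (x j - x i) ((eudot (x j) (x j) - eudot (x i) (x i)) / 2) B) => //.
- by rewrite subr_eq0 eq_sym; apply: contra ij => /eqP/vtx_inj ->.
- move=> y [[/closure_cell Ki _] [/closure_cell Kj _]].
  have e : sqd (x j) y - sqd (x i) y = 0 by apply/eqP; rewrite subr_eq0 eq_le Ki Kj.
  have : sqd (x j) y - sqd (x i) y = eudot (x j) (x j) - eudot (x i) (x i) - 2 * eudot (x j - x i) y.
    rewrite /sqd /eudot mulr_sumr -!sumrB; apply: eq_bigr => c _; rewrite !mxE; ring.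
  by rewrite e; lra.
move=> y [[cy _] _] c; apply/ler_addgt0Pr => e e0.
have [z [Oz _] hz] := (closure_box (V i) y).1 cy e e0.
rewrite -(subrK (z 0 c) (y 0 c)); apply: le_trans (ler_normD _ _) _.
by rewrite addrC lerD ?HB // ltW // hz.
Qed.

Section Shadows.
Variables (p v : E) (m : 'I_k.+2).
Hypothesis vm : v 0 m != 0.
(** The coordinates, in the hyperplane through [p] where coordinate [m] is constant, of the
    projection along [v]. *)
Definition proj (c : 'I_k.+1) (y : E) : R := (y - p) 0 (lift m c) - (y - p) 0 m / v 0 m * v 0 (lift m c).

Definition lip : R := 1 + \sum_c `|v 0 c / v 0 m|.

Lemma lip_gt0 : 0 < lip.
Proof. by rewrite ltr_wpDr // sumr_ge0. Qed.

Lemma proj_lip c y z : `|proj c y - proj c z| <= lip * eudist y z.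
Proof.
have -> : proj c y - proj c z = (y - z) 0 (lift m c) - v 0 (lift m c) / v 0 m * (y - z) 0 m.
  by rewrite /proj !mxE; field.
apply: le_trans (ler_normB _ _) _; rewrite normrM /lip mulrDl mul1r lerD ?coord_le //.
apply: ler_pM => //; last exact: coord_le.
by rewrite (bigD1 (lift m c)) //= lerDl sumr_ge0.
Qed.

Lemma proj_seg c (w : E) (t : R) : w 0 m = 0 -> proj c (p + w + t *: v) = w 0 (lift m c).
Proof. by move=> w0; rewrite /proj !mxE w0; field. Qed.

End Shadows.

Lemma segment_set_connected (y v : E) : connected [set y + t *: v | t in `[0, 1]%classic].
Proof.
apply: connected_continuous_connected; first exact: segment_connected.
apply: continuous_subspaceT => t; apply: cvgD; first exact: cvg_cst.
by apply: cvgZr_tmp.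
Qed.

(** Suppose that all edges between [A] and its complement are null.  The domain is connected, so two
    closed cells on different sides meet at some [y0] in it.  Near [y0] choose small boxes around
    points [p], [q] of the two open cells.  All segments from [p + w] to [q + w] with small [w] stay in the
    domain and meet an edge between [A] and its complement ([connected_tie]).  So the projections of
    these edges along [q - p] cover a small cube, although they are null sets. *)
Lemma voronoi_connected (A : {set 'I_N}) : A != finset.set0 -> A != finset.setT ->
  exists i j, [/\ i \in A, j \notin A & 0 < tauI G i j].
Proof.
move=> /finset.set0Pn[i0 i0A] AT; apply: contrapT => no.
have [j0 j0A] : exists j, j \notin A.
  apply: contrapT => H; case/negP: AT; apply/eqP/setP => j; rewrite finset.in_setT.
  by apply/negPn/negP => h; apply: H; exists j.
have null i j : i \in A -> j \notin A -> hausdorff k.+1 (sigmaI G i j) = 0%E.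
  move=> iA jA; have ij : i != j by apply: contraNneq jA => <-.
  have h0 := hausdorff_ge0 k.+1 (sigmaI G i j); have hoo := sigma_finite_area ij.
  have hf : hausdorff k.+1 (sigmaI G i j) \is a fin_num by rewrite ge0_fin_numE.
  rewrite -(fineK hf); congr EFin; apply/eqP; rewrite eq_le fine_ge0 // andbT leNgt; apply/negP => a0.
  by apply: no; exists i, j; split=> //; apply: divr_gt0 => //; exact: vtx_dist.
have [p0 Vp0] := V0 i0; have [q0 Vq0] := V0 j0.
have [i1 [j1 [y0 [i1A j1A Oy0 Ki Kj]]]] := connected_tie Om_connected Vp0.1 Vq0.1 Vp0 Vq0 i0A j0A.
have /nbhs_box[rho rho0 Hrho] : nbhs y0 Om by move: Om_open; rewrite openE => /(_ _ Oy0).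
have rho2 : 0 < rho / 2 by rewrite divr_gt0.
have [p Vp hp] := (closure_box (V i1) y0).1 (cell_closure vtx_inj Om_open Oy0 Ki) _ rho2.
have [q Vq hq] := (closure_box (V j1) y0).1 (cell_closure vtx_inj Om_open Oy0 Kj) _ rho2.
have /nbhs_box[r1 r10 Hr1] : nbhs p (V i1) by move: (@Vo i1); rewrite openE => /(_ _ Vp).
have /nbhs_box[r2 r20 Hr2] : nbhs q (V j1) by move: (@Vo j1); rewrite openE => /(_ _ Vq).
pose r := Num.min (rho / 2) (Num.min r1 r2).
have r0 : 0 < r by rewrite !lt_min rho2 r10.
have [ra rb rc] : [/\ r <= rho / 2, r <= r1 & r <= r2] by split; rewrite /r !ge_min lexx ?orbT.
pose v : E := q - p.
have [m vm] : exists m, v 0 m != 0.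
  apply: contrapT => H; have e : q = p.
    apply/eqP; rewrite -subr_eq0; apply/eqP/rowP => c; rewrite [RHS]mxE; apply/eqP/negPn/negP => h; apply: H; by exists c.
  have := voronoi_cell Vp (voronoi_sub_cell (eq_ind _ (V j1) Vq _ e)) => e1.
  by move: j1A; rewrite -e1 i1A.
pose c1 : 'I_k.+1 := ord0; pose c2 : 'I_k.+1 := ord_max.
have k12 : k.+1 = 1%N \/ k.+1 = 2%N by case: k01 => ->; [left|right].
pose Sh (ij : 'I_N * 'I_N) := if (ij.1 \in A) && (ij.2 \notin A) then
  shadow (proj p v m c1) (proj p v m c2) (sigmaI G ij.1 ij.2) else set0.
have nSh ij : (@lebesgue_measure R \x @lebesgue_measure R)%E.-negligible (Sh ij).
  rewrite /Sh; case: ifP => [/andP[iA jA]|_]; last exact: negligible_set0.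
  apply: (@shadow_negligible R k.+1 k12 _ _ (lip v m) (lip_gt0 v m)) => [y z|y z|]; [exact: proj_lip | exact: proj_lip | exact: null].
pose J : interval R := if k.+1 == 2%N then `]- r, r[ else `]0, 1[.
have mQ : measurable ([set` `]- r, r[] `*` [set` J] : set (measurableTypeR R * measurableTypeR R)).
  by apply: measurableX; exact: measurable_itv.
have cover : [set` `]- r, r[] `*` [set` J] `<=` [set s | exists ij, Sh ij s].
  move=> [s t] [/=]; rewrite in_itv /= => hs ht.
  (* the point of the cross-section with coordinates [s] and, when [k = 1], [t] *)
  pose w : E := \row_c (if unlift m c is Some c' then if c' == c1 then s else t else 0).
  have wm : w 0 m = 0 by rewrite mxE unlift_none.
  have w1 : w 0 (lift m c1) = s by rewrite mxE liftK eqxx.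
  have w2 : k.+1 == 2%N -> w 0 (lift m c2) = t.
    by move=> /eqP k2; rewrite mxE liftK ifN // -val_eqE /=; case: k k2.
  have wr c : `|w 0 c| < r.
    rewrite mxE; case: unliftP => [c' _|_]; last by rewrite normr0.
    case: eqVneq => [_|c'1]; first by rewrite ltr_norml.
    move: ht; rewrite /J ifT; first by rewrite in_itv /= ltr_norml.
    case: k01 => k0; last by rewrite k0.
    have h := ltn_ord c'; move: h c'1; rewrite -val_eqE /=; move: (nat_of_ord c') => n.
    by rewrite k0; case: n.
  clearbody w.
  pose S : set E := [set p + w + u *: v | u in `[0, 1]%classic].
  have Sc : connected S by exact: segment_set_connected.
  have Sp : S (p + w) by exists 0; rewrite /= ?in_itv /= ?lexx ?ler01 // scale0r addr0.
  have Sq : S (q + w).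
    by exists 1; [rewrite /= in_itv /= lexx ler01 | apply/rowP => c; rewrite !mxE; ring].
  have Vpw : V i1 (p + w) by apply: Hr1 => c; rewrite !mxE opprD addNKr normrN; apply: lt_le_trans (wr c) rb.
  have Vqw : V j1 (q + w) by apply: Hr2 => c; rewrite !mxE opprD addNKr normrN; apply: lt_le_trans (wr c) rc.
  have [i2 [j2 [y [i2A j2A [u /= hu ey] Ki2 Kj2]]]] := connected_tie Sc Sp Sq Vpw Vqw i1A j1A.
  have Oy : Om y.
    apply: Hrho => c; move: hu; rewrite in_itv /= => /andP[u0 u1].
    have e : y0 0 c - y 0 c = (1 - u) * (y0 0 c - p 0 c) + u * (y0 0 c - q 0 c) - w 0 c.
      by rewrite -ey /v !mxE; ring.
    rewrite e; apply: le_lt_trans (ler_normB _ _) _.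
    have h1 := wr c; have h2 : `|(1 - u) * (y0 0 c - p 0 c) + u * (y0 0 c - q 0 c)| <= rho / 2.
      apply: le_trans (ler_normD _ _) _; rewrite !normrM (ger0_norm u0) ger0_norm ?subr_ge0 //.
      rewrite (_ : rho / 2 = (1 - u) * (rho / 2) + u * (rho / 2)); last by ring.
      by apply: lerD; apply: ler_wpM2l; rewrite ?subr_ge0 // ltW ?hp ?hq.
    by move: ra h1 h2; lra.
  have i2j2 : i2 != j2 by apply: contraNneq j2A => <-.
  exists (i2, j2); rewrite /Sh /= i2A j2A /=; exists y; split => /=.
  - exact: tie_sigma (vtx_inj) Om_open _ _ _ i2j2 Oy Ki2 Kj2.
  - by rewrite -ey proj_seg.
  - case: ifP => k2; first by rewrite -ey proj_seg // w2.
    by move: ht; rewrite /J k2 in_itv /= => /andP[/ltW -> /ltW ->].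
have nU : (@lebesgue_measure R \x @lebesgue_measure R)%E.-negligible [set s | exists ij, Sh ij s].
  exact: (negligible_fin nSh).
have [X [mX X0 QX]] := nU.
pose I : interval R := `]- r, r[.
have : (lebesgue_measure ([set` I] : set (measurableTypeR R)) * lebesgue_measure ([set` J] : set (measurableTypeR R)) = 0)%E.
  rewrite -leb2_rect; [|exact: measurable_itv..].
  by apply: measure_negligible => //; exists X; split=> //; exact: subset_trans cover QX.
have rr : - r <= r by lra.
have r2' : r - - r != 0 by lra.
move=> /eqP; rewrite /I /J; case: ifP => _; rewrite !lebesgue_itvoo // -EFinM eqe mulf_eq0 (negbTE r2') //.
by rewrite subr0 oner_eq0.
Qed.

Lemma admissible_geometry : mesh_geometry G.
Proof.
split.
- exact: voronoi_vol.
- exact: vtx_dist.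
- exact: tauI_sym.
- exact: tauI_ge0.
- exact: tauD_ge0.
- exact: voronoi_connected.
- exact: tauD_somewhere.
Qed.

End Geometry.

Close Scope classical_set_scope.
Close Scope ring_scope.

Theorem theorem4p6 (R : realType) (d N M : nat)
    (G : mesh R d N) (P : model R d N M) (K : recon R N)
    (hd : d = 2 \/ d = 3)
    (hG : admissible_mesh G)
    (hK : admissible_recon G K)
    (hP : admissible_model P)
    (hdata : smooth_bounded_data G P) :
  (forall (c : nat -> 'I_M -> 'I_N -> R) (psi : nat -> 'I_N -> R),
     solutionI G P K c psi -> converges_to_steady_state G P c psi) /\
  (forall (cm1 : 'I_M -> 'I_N -> R)
     (c : nat -> 'I_M -> 'I_N -> R) (psi : nat -> 'I_N -> R),
     solutionII G P K cm1 c psi -> converges_to_steady_state G P c psi).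
Proof.
have [k [dE k01]] : exists k, d = k.+2 /\ (k = 0 \/ k = 1).
  by case: hd => ->; [exists 0; split=> //; left | exists 1; split=> //; right].
subst d; have HG := admissible_geometry k01 hG.
split=> [c psi|cm1 c psi]; [exact: convergenceI | exact: convergenceII].
Qed.
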